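(* Let $G$ be a planar graph and let $S\subseteq V(G)$ be a collinear set of $G$. Then $S$ is a free collinear set: for every set $X$ of $|S|$ collinear points in the plane, $G$ has a plane straight-line drawing in which the vertices of $S$ are mapped to the points of $X$.
   Context: All graphs are finite and simple. A plane straight-line (Fáry) drawing of a graph maps vertices to distinct points and edges to straight-line segments between their endpoints so that no two edges intersect except at a common endpoint. A set $S\subseteq V(G)$ of a planar graph $G$ is a collinear set if $G$ has a plane straight-line drawing in which all vertices of $S$ lie on a single line. A collinear set $S$ is a free collinear set if for every set $X$ of $|S|$ collinear points in the plane, $G$ has a plane straight-line drawing in which the vertices of $S$ are mapped to the points of $X$. *)

(* Defs.v *)
From HB Require Import structures.
From mathcomp Require Import all_boot all_order all_algebra.
From mathcomp Require Import reals.
Set Implicit Arguments. Unset Strict Implicit. Unset Printing Implicit Defensive.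
Import Order.TTheory GRing.Theory Num.Theory.
Local Open Scope ring_scope.

Definition point (R : realType) := (R * R)%type.

Definition on_seg (R : realType) (a b x : point R) : Prop :=
  exists t : R, 0 <= t <= 1 /\
    x = ((1 - t) * a.1 + t * b.1, (1 - t) * a.2 + t * b.2).

Definition simple_graph (V : finType) (e : rel V) : Prop :=
  symmetric e /\ irreflexive e.

Definition plane_sl_drawing (R : realType) (V : finType) (e : rel V)
    (p : V -> point R) : Prop :=
  injective p /\
  (forall u v w, e u v -> w != u -> w != v -> ~ on_seg (p u) (p v) (p w)) /\
  (forall u v x y, e u v -> e x y -> [set u; v] != [set x; y] ->
     forall z, on_seg (p u) (p v) z -> on_seg (p x) (p y) z ->
       exists2 w, w \in [set u; v] :&: [set x; y] & z = p w).

Definition planar (R : realType) (V : finType) (e : rel V) : Prop :=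
  exists p : V -> point R, plane_sl_drawing e p.

Definition on_one_line (R : realType) (P : point R -> Prop) : Prop :=
  exists a b c : R, (a != 0 \/ b != 0) /\
    forall q, P q -> a * q.1 + b * q.2 = c.

Definition collinear_set (R : realType) (V : finType) (e : rel V)
    (S : {set V}) : Prop :=
  exists p : V -> point R, plane_sl_drawing e p /\
    on_one_line (fun q => exists2 s, s \in S & q = p s).

(* For every set X of |S| collinear points (a duplicate-free list), there is a
   drawing mapping S into X; by injectivity and |X| = |S| this maps S onto X. *)
Definition free_collinear_set (R : realType) (V : finType) (e : rel V)
    (S : {set V}) : Prop :=
  forall X : seq (point R), uniq X -> size X = #|S| ->
    on_one_line (fun q => q \in X) ->
    exists p : V -> point R, plane_sl_drawing e p /\
      (forall s, s \in S -> p s \in X).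

(* Main.v *)
(* Normalise the line to the axis x = 0 and add the axis crossings of the edges
   and four auxiliary points as vertices; saturate this plane graph to a plane
   triangulation. On either side of the axis, the edges reaching the axis form a
   walk. In the projective coordinates (h, Y) = (y / |x|, 1 / |x|) an axis
   point (0, t) becomes the linear form h - t Y, so moving the axis points to
   prescribed heights while keeping every crossing edge straight is a linear
   problem for the walk vertices: an M-matrix system, whose column sums are
   controlled by the original drawing. The remaining vertices are placed
   harmonically in (h, Y). Then every inner vertex lies in the relative interior
   of the hull of its neighbours, and a Tutte-Floater counting argument shows
   that all triangles stay positively oriented, so the new drawing is plane.
   An increasing interpolation and an affine map finish the proof. *)

Require Import Defs.
From HB Require Import structures.
From mathcomp Require Import all_boot all_order all_algebra.
From mathcomp Require Import reals.
From mathcomp Require Import boolp ring lra zify.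
Set Implicit Arguments. Unset Strict Implicit. Unset Printing Implicit Defensive.
Import Order.TTheory GRing.Theory Num.Theory.
Local Open Scope ring_scope.

(** * Determinants and angles *)

Section Vectors.
Variable R : realType.
Implicit Types (u v w z : point R).

(** Each open half-plane is sent by its own projective map to a half-plane with the axis at
    infinity: an edge to the axis point of height [t] becomes a ray of slope [t], so prescribed
    heights are prescribed slopes. The two sides interact only at crossing edges, which are straight
    when the two values of [h - t Y] cancel. The obstacle is that a walk may return to a vertex,
    whose [(h, Y)] must be the same at every visit. Returns do not cross, so they form a laminar
    family of blocks, with one unknown and one closing condition per block. Weak dominance of the
    system holds for any data; strictness comes from the values of the same forms in the given
    straight drawing. A first positive solution may leave a vertex aligned with its two walk
    neighbours, so a small multiple of a second one is added to bend the walk. The Tutte-Floater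
    step has no convexity or nondegeneracy to start from: vertices are ranked by a linear form of
    the new positions with ties broken by the old drawing, and the number of corners with middle key
    does not depend on the ranking. *)

Definition crossp u v : R := u.1 * v.2 - u.2 * v.1.
Definition vec (a b : point R) : point R := (b.1 - a.1, b.2 - a.2).
Definition det (a b c : point R) : R := crossp (vec a b) (vec a c).

Lemma detE (a b c : point R) : det a b c = (b.1 - a.1) * (c.2 - a.2) - (b.2 - a.2) * (c.1 - a.1).
Proof. by []. Qed.

Lemma det_rot (a b c : point R) : det b c a = det a b c.
Proof. by rewrite !detE; ring. Qed.

Lemma det_swap (a b c : point R) : det a c b = - det a b c.
Proof. by rewrite !detE; ring. Qed.

Lemma crosspC u v : crossp u v = - crossp v u.
Proof. by rewrite /crossp; ring. Qed.

Lemma crossp_plucker u v w z :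
  crossp u w * crossp v z = crossp v w * crossp u z + crossp u v * crossp w z.
Proof. by rewrite /crossp; ring. Qed.

Lemma pair_ext u v : u.1 = v.1 -> u.2 = v.2 -> u = v.
Proof. by case: u v => [? ?] [? ?] /= -> ->. Qed.

Lemma sqnorm_gt0 u : u.1 != 0 \/ u.2 != 0 -> 0 < u.1 ^+ 2 + u.2 ^+ 2.
Proof.
case=> h; rewrite -?exprnP.
  by rewrite ltr_wpDr ?sqr_ge0 // lt0r sqrf_eq0 h sqr_ge0.
by rewrite ltr_wpDl ?sqr_ge0 // lt0r sqrf_eq0 h sqr_ge0.
Qed.

Lemma crossp_neq0 u v : crossp u v != 0 -> u.1 != 0 \/ u.2 != 0.
Proof.
rewrite /crossp; case: (eqVneq u.1 0) => [->|]; last by left.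
by case: (eqVneq u.2 0) => [->|]; [rewrite !mul0r subrr eqxx | right].
Qed.

Section Angles.
Variables (I : finType) (q : I -> point R) (D : point R).

(** [k] is the cotangent of the angle from [D] to [q i], decreasing on the open half-plane to the
    left of [D]; its minimum sits at the largest angle. *)
Lemma angle_last (A : {set I}) : A != set0 ->
  (forall a, a \in A -> 0 < crossp D (q a)) ->
  exists2 a, a \in A & forall b, b \in A -> crossp (q a) (q b) <= 0.
Proof.
case/set0Pn=> a0 Aa0 hA.
pose k i := (D.1 * (q i).1 + D.2 * (q i).2) / crossp D (q i).
case: (@Order.TotalTheory.arg_minP _ _ I a0 (mem A) k Aa0) => a Aa hmin.
exists a => // b Ab; have := hmin b Ab; rewrite /k.
have da := hA _ Aa; have db := hA _ Ab.
rewrite ler_pdivrMr // mulrAC ler_pdivlMr //.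
have nD : 0 < D.1 ^+ 2 + D.2 ^+ 2 by apply: sqnorm_gt0; apply: (@crossp_neq0 _ (q a)); rewrite gt_eqF.
move=> h; rewrite -(pmulr_rle0 _ nD); move: h; rewrite /crossp; lra.
Qed.

End Angles.

Lemma angle_first (I : finType) (q : I -> point R) D (A : {set I}) : A != set0 ->
  (forall a, a \in A -> 0 < crossp D (q a)) ->
  exists2 a, a \in A & forall b, b \in A -> 0 <= crossp (q a) (q b).
Proof.
move=> A0 hA.
have [|a Aa ha] := @angle_last I (fun i => ((q i).1, - (q i).2)) (- D.1, D.2) A A0.
  by move=> a /hA; rewrite /crossp /=; lra.
by exists a => // b /ha; rewrite /crossp /=; lra.
Qed.

Section Cyclic.
Variables (I : finType) (q : I -> point R) (nx : I -> I) (A : {set I}).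
Hypothesis A0 : A != set0.
Hypothesis nxA : forall a, a \in A -> nx a \in A.
Hypothesis nx_pos : forall a, a \in A -> 0 < crossp (q a) (q (nx a)).

Lemma cycle_next_neq0 D : D.1 != 0 \/ D.2 != 0 ->
  exists2 a, a \in A & crossp D (q a) != 0.
Proof.
move=> D0; have [a Aa] := set0Pn _ A0.
case: (eqVneq (crossp D (q a)) 0) => [ha|]; last by exists a.
exists (nx a); first exact: nxA.
apply/eqP => hn; have := nx_pos Aa.
rewrite -(pmulr_rgt0 _ (sqnorm_gt0 D0)).
have -> : (D.1 ^+ 2 + D.2 ^+ 2) * crossp (q a) (q (nx a)) =
  (D.1 * (q a).1 + D.2 * (q a).2) * crossp D (q (nx a)) -
  crossp D (q a) * (D.1 * (q (nx a)).1 + D.2 * (q (nx a)).2) by rewrite /crossp; ring.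
by rewrite ha hn mulr0 mul0r subrr ltxx.
Qed.

(** Every [nx] turns left by less than a half-turn. If all vectors stayed in the opposite closed
    half-plane, [nx] would preserve those strictly inside it, and the angularly last of them could
    not turn further. *)
Lemma cycle_meets_halfplane D : D.1 != 0 \/ D.2 != 0 ->
  exists2 a, a \in A & 0 < crossp D (q a).
Proof.
move=> D0; have [a0 Aa0 da0] := cycle_next_neq0 D0.
apply/exists_inP; apply: contraNT (da0) => /exists_inPn /= hle.
have {}hle a : a \in A -> crossp D (q a) <= 0 by move=> /hle; rewrite -leNgt.
pose B := [set a in A | crossp D (q a) < 0].
have nD := sqnorm_gt0 D0.
have key u v : (D.1 ^+ 2 + D.2 ^+ 2) * crossp u v =
  (D.1 * u.1 + D.2 * u.2) * crossp D v - crossp D u * (D.1 * v.1 + D.2 * v.2).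
  by rewrite /crossp; ring.
(* If [q (nx a)] were on the line of [D], it would point along [D] itself, and one more left turn
   would leave the half-plane. *)
have nB a : a \in B -> nx a \in B.
  rewrite !inE => /andP[Aa da]; rewrite nxA //= lt_neqAle hle ?nxA // andbT.
  apply/eqP => hc.
  have := nx_pos Aa; have := nx_pos (nxA Aa); have := hle _ (nxA (nxA Aa)).
  move=> h2; rewrite -(pmulr_rgt0 _ nD) key hc mul0r subr0 => h1.
  rewrite -(pmulr_rgt0 _ nD) key hc mulr0 sub0r => h3.
  have h4 : 0 < D.1 * (q (nx a)).1 + D.2 * (q (nx a)).2.
    by rewrite -(nmulr_rlt0 _ da) -oppr_gt0.
  by move: h1; rewrite pmulr_rgt0 // ltNge h2.
have B0 : B != set0.
  by apply/set0Pn; exists a0; rewrite inE Aa0 lt_neqAle da0 hle.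
have [a|a] := @angle_last I q (- D.1, - D.2) B B0.
  by rewrite inE /crossp /= => /andP[_]; lra.
move=> Ba /(_ _ (nB _ Ba)); move: Ba; rewrite inE => /andP[/nx_pos + _].
by rewrite ltNge => /negbTE ->.
Qed.
End Cyclic.

(** Otherwise [nx] preserves the half-plane [crossp D _ <= 0], and the vectors in it contradict
    [cycle_meets_halfplane]. The cone is closed at [q a] and open at the next vector, as in
    [tg_cone]. *)
Lemma cycle_covers (I : finType) (q : I -> point R) (nx : I -> I) (A : {set I}) D :
  A != set0 -> (forall a, a \in A -> nx a \in A) ->
  (forall a, a \in A -> 0 < crossp (q a) (q (nx a))) ->
  D.1 != 0 \/ D.2 != 0 ->
  exists2 a, a \in A & (0 <= crossp (q a) D) && (0 < crossp D (q (nx a))).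
Proof.
move=> A0 nxA nx_pos D0; apply/exists_inP; apply: contraT => /exists_inPn /= hn.
have {}hn a : a \in A -> crossp D (q a) <= 0 -> crossp D (q (nx a)) <= 0.
  move=> /hn; rewrite negb_and -!ltNge -leNgt (crosspC (q a)) oppr_lt0.
  by case/orP => [h|//]; rewrite leNgt h.
have D0' : (- D.1, - D.2).1 != 0 \/ (- D.1, - D.2).2 != 0 by rewrite /= !oppr_eq0.
have [b Ab hb] := cycle_meets_halfplane A0 nxA nx_pos D0'.
pose C := [set a in A | crossp D (q a) <= 0].
have [|c|c|c] := @cycle_meets_halfplane I q nx C _ _ _ D D0.
- by apply/set0Pn; exists b; rewrite inE Ab; move: hb; rewrite /crossp /=; lra.
- by rewrite !inE => /andP[Ac hc]; rewrite nxA // hn.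
- by rewrite inE => /andP[/nx_pos].
- by rewrite inE => /andP[_]; rewrite leNgt => /negbTE ->.
Qed.
End Vectors.

(** * A Tutte-Floater theorem for triangulations *)

Section LexKey.
Variables (R : realType) (P : finType).

(** The rank of a point is its number of predecessors in the lexicographic order of [f], [g] and
    [enum_rank]. Corner counting needs injective keys, and [g] controls how ties of [f] are
    broken. *)
Lemma lex_key (f g : P -> R) : exists k : P -> nat,
  [/\ injective k, forall u v, f u < f v -> (k u < k v)%N &
      forall u v, f u = f v -> g u < g v -> (k u < k v)%N].
Proof.
pose r u v := (f u < f v) || ((f u == f v) && ((g u < g v) ||
  ((g u == g v) && (enum_rank u < enum_rank v)%N))).
have rirr u : r u u = false by rewrite /r !ltxx ltnn !andbF.
have rtr v u w : r u v -> r v w -> r u w.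
  rewrite /r => /orP[h1|/andP[/eqP -> h1]] /orP[h2|/andP[/eqP <- h2]].
  - by rewrite (lt_trans h1 h2).
  - by rewrite h1.
  - by rewrite h2.
  rewrite ltxx eqxx /=; move: h1 h2 => /orP[h1|/andP[/eqP -> h1]] /orP[h2|/andP[/eqP <- h2]].
  - by rewrite (lt_trans h1 h2).
  - by rewrite h1.
  - by rewrite h2.
  by rewrite ltxx eqxx /= (ltn_trans h1 h2).
have rtot u v : u != v -> r u v || r v u.
  move=> uv; rewrite /r; case: (ltgtP (f u) (f v)) => //= _.
  case: (ltgtP (g u) (g v)) => //= _.
  by rewrite -neq_ltn; apply: contraNneq uv => h; apply/eqP/enum_rank_inj/val_inj.
have kr u v : r u v -> (#|[set w | r w u]| < #|[set w | r w v]|)%N.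
  move=> ruv; apply: proper_card; apply/properP; split.
    by apply/subsetP => w; rewrite !inE => /rtr; apply.
  by exists u; rewrite inE ?rirr.
exists (fun u => #|[set w | r w u]|); split.
- move=> u v huv; apply/eqP; apply: contraT => /rtot /orP[] /kr; by rewrite huv ltnn.
- by move=> u v huv; apply: kr; rewrite /r huv.
by move=> u v e huv; apply: kr; rewrite /r e eqxx huv orbT.
Qed.

(** A slope exceeding the absolute slope of every segment between two of the points leaves no such
    segment level. *)
Lemma generic_slope (p : P -> point R) : injective p ->
  exists s : R, injective (fun v => (p v).2 - s * (p v).1).
Proof.
move=> pI; pose sl (uv : P * P) := `|((p uv.1).2 - (p uv.2).2) / ((p uv.1).1 - (p uv.2).1)|.
exists (1 + \sum_uv sl uv) => u v /= h; apply: pI.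
have hs : sl (u, v) < 1 + \sum_uv sl uv.
  rewrite (bigD1 (u, v)) //=; have : 0 <= \sum_(i | i != (u, v)) sl i by apply: sumr_ge0 => i _;
      apply: normr_ge0.
  lra.
have [e|ne] := eqVneq (p u).1 (p v).1.
  by apply: pair_ext => //; move: h; rewrite e; lra.
exfalso; move: hs; set s := 1 + _ in h *; rewrite /sl /=.
have -> : (p u).2 - (p v).2 = s * ((p u).1 - (p v).1) by lra.
have ne' : (p u).1 - (p v).1 != 0 by rewrite subr_eq0.
rewrite mulfK //; have := ler_norm s; lra.
Qed.
End LexKey.

Section Count.
Variables (P : finType) (tri : P -> P -> P -> bool).
Hypothesis tri_rot : forall a b c, tri a b c -> tri b c a.
Hypothesis tri_neq : forall a b c, tri a b c -> a != b.

(* Corners at which [v] has the median key, split by orientation. Each triangle has exactly one, so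
   their total number does not depend on the injective key [k]. *)
Definition rising (k : P -> nat) v := #|[set uw : P * P | [&& tri v uw.1 uw.2, k uw.1 < k v &
    k v < k uw.2]]|%N.
Definition falling (k : P -> nat) v := #|[set uw : P * P | [&& tri v uw.1 uw.2, k v < k uw.1 &
    k uw.2 < k v]]|%N.

Lemma sum_corners_rot (f : P -> P -> P -> nat) :
  (\sum_v \sum_u \sum_w f v u w = \sum_v \sum_u \sum_w f u w v)%N.
Proof.
rewrite [RHS]exchange_big; apply: eq_bigr => u _ /=.
by rewrite [RHS]exchange_big.
Qed.

(** Each face occurs in three rotations, of which exactly one starts at the vertex with the middle
    key, as a rising or a falling corner. The factor 3 avoids choosing a representative rotation. *)
Lemma count_middle_corners k : injective k ->
  (3 * \sum_v (rising k v + falling k v) = \sum_v \sum_u \sum_w tri v u w)%N.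
Proof.
move=> kI.
pose m v u w : nat := tri v u w && ((k u < k v < k w) || (k w < k v < k u))%N.
have -> : (\sum_v (rising k v + falling k v) = \sum_v \sum_u \sum_w m v u w)%N.
  apply: eq_bigr => v _; rewrite pair_bigA /= /rising /falling -!sum1_card [in LHS]big_mkcond.
  rewrite [X in (_ + X)%N]big_mkcond -big_split /=; apply: eq_bigr => -[u w] _.
  rewrite !inE /m /=; case: (tri v u w) => //=.
  rewrite andbC [(k w < _ < _)%N]andbC.
  by case: (ltngtP (k u) (k v)); case: (ltngtP (k w) (k v)).
rewrite !mulSn mul0n addn0 {2}sum_corners_rot [X in (_ + (_ + X))%N]sum_corners_rot.
rewrite [X in (_ + (_ + X))%N]sum_corners_rot -!big_split; apply: eq_bigr => a _ /=.
rewrite -!big_split; apply: eq_bigr => b _ /=; rewrite -!big_split; apply: eq_bigr => c _ /=.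
have e1 : tri b c a = tri a b c by apply/idP/idP => [/tri_rot/tri_rot|/tri_rot].
have e2 : tri c a b = tri a b c by apply/idP/idP => [/tri_rot|/tri_rot/tri_rot].
rewrite /m e1 e2; case h : (tri a b c) => //=.
have ab := tri_neq h; have bc := tri_neq (tri_rot h); have ca := tri_neq (tri_rot (tri_rot h)).
have {}ab : k a != k b by rewrite (inj_eq kI).
have {}bc : k b != k c by rewrite (inj_eq kI).
have {}ca : k c != k a by rewrite (inj_eq kI).
move: ab bc ca; case: (ltngtP (k a) (k b)) => // h1 _; case: (ltngtP (k b) (k c)) => // h2 _;
 case: (ltngtP (k c) (k a)) => // h3 _; lia.
Qed.
End Count.

(* [tri] holds the bounded faces, each in its three positively oriented rotations; [tg_cone]: the
   corners at a vertex do not overlap. *)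
Record triangulation (R : realType) (P : finType) (E : rel P)
    (tri : P -> P -> P -> bool) (x y z : P) (p : P -> point R) : Prop := Triangulation {
  tg_rot : forall a b c, tri a b c -> tri b c a;
  tg_uniq : forall a b c c', tri a b c -> tri a b c' -> c = c';
  tg_edge : forall a b c, tri a b c -> E a b;
  tg_sym : symmetric E;
  tg_pos : forall a b c, tri a b c -> 0 < det (p a) (p b) (p c);
  tg_out : 0 < det (p x) (p y) (p z);
  tg_in : forall v, [&& v != x, v != y & v != z] ->
    [/\ 0 < det (p x) (p y) (p v), 0 < det (p y) (p z) (p v) & 0 < det (p z) (p x) (p v)];
  tg_next : forall a b, E a b -> (a, b) != (y, x) -> (a, b) != (z, y) -> (a, b) != (x, z) ->
    exists c, tri a b c;
  tg_deg : forall v, [&& v != x, v != y & v != z] -> exists u, E v u;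
  tg_outE : [/\ E x y, E y z & E z x];
  tg_cone : forall v u w u' w' d, tri v u w -> tri v u' w' ->
    0 <= crossp (vec (p v) (p u)) d -> 0 < crossp d (vec (p v) (p w)) ->
    0 <= crossp (vec (p v) (p u')) d -> 0 < crossp d (vec (p v) (p w')) -> u = u';
  tg_inj : injective p
}.

Section Rot.
Variables (R : realType) (P : finType) (E : rel P) (tri : P -> P -> P -> bool)
  (x y z : P) (p : P -> point R).
Lemma tg_turn : triangulation E tri x y z p -> triangulation E tri y z x p.
Proof.
case=> h1 h2 h3 h4 h5 h6 h7 h8 h9 [h10 h11 h12] h13 h14; split => //.
- by rewrite det_rot.
- by move=> v /and3P[a b c]; case: (h7 v); rewrite ?a ?b ?c.
- by move=> a b ab n1 n2 n3; apply: h8.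
- by move=> v /and3P[a b c]; apply: h9; rewrite a b c.
Qed.
End Rot.

(** * Links of vertices and bounds on their corner counts *)

Section TF.
Variables (R : realType) (P : finType) (E : rel P) (tri : P -> P -> P -> bool)
  (x y z : P) (p : P -> point R).
Hypothesis T : triangulation E tri x y z p.

Definition inner_vertex v := [&& v != x, v != y & v != z].
(** The third vertex of the face to the left of the dart from [v] to [u]; the default [u] stands for
    a dart with no face on its left. *)
Definition next_nbr v u := odflt u [pick w | tri v u w].
Definition nbrs v := [set u | E v u].

Lemma tri_neq a b c : tri a b c -> a != b.
Proof.
by move=> /(tg_pos T); apply: contraTneq => ->; rewrite detE !subrr !mul0r subrr ltxx.
Qed.

Lemma tg_edge_neq a b : E a b -> a != b.
Proof.
suff h c d : (c, d) != (y, x) -> (c, d) != (z, y) -> (c, d) != (x, z) -> E c d -> c != d.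
  have out_neq : [/\ x != y, y != z & z != x].
    by split; apply: contraTneq (tg_out T) => ->; rewrite detE -leNgt le_eqVlt;
      apply/orP; left; apply/eqP; ring.
  case: out_neq => xy yz zx eab.
  case: (eqVneq (a, b) (y, x)) => [[-> ->]|n1]; first by rewrite eq_sym.
  case: (eqVneq (a, b) (z, y)) => [[-> ->]|n2]; first by rewrite eq_sym.
  case: (eqVneq (a, b) (x, z)) => [[-> ->]|n3]; first by rewrite eq_sym.
  exact: h.
by move=> n1 n2 n3 /(tg_next T) h; case: h => // w /tri_neq.
Qed.

Lemma next_nbrP v u w : tri v u w -> next_nbr v u = w.
Proof.
by rewrite /next_nbr => h; case: pickP => [w' /(tg_uniq T h)|/(_ w)]; rewrite ?h.
Qed.

Lemma next_nbr_tri v u : inner_vertex v -> E v u -> tri v u (next_nbr v u).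
Proof.
move=> /and3P[vx vy vz] e.
have [||| w h] := tg_next T e; rewrite ?xpair_eqE ?(negbTE vx) ?(negbTE vy) ?(negbTE vz) //.
by rewrite (next_nbrP h).
Qed.

Lemma tri_edge2 a b c : tri a b c -> E a c.
Proof. by move=> h; rewrite (tg_sym T); apply: tg_edge T _ _ _ (tg_rot T (tg_rot T h)). Qed.

Lemma next_nbr_in v u : inner_vertex v -> u \in nbrs v -> next_nbr v u \in nbrs v.
Proof. by rewrite !inE => iv /(next_nbr_tri iv)/tri_edge2. Qed.

Lemma tri_crossp v u w : tri v u w -> 0 < crossp (vec (p v) (p u)) (vec (p v) (p w)).
Proof. by move/(tg_pos T). Qed.

Lemma next_nbr_inj v u u' : inner_vertex v -> E v u -> E v u' -> next_nbr v u = next_nbr v u' -> u = u'.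
Proof.
move=> iv e e' h; have := next_nbr_tri iv e; have := next_nbr_tri iv e'; rewrite -h.
move=> /(tg_rot T)/(tg_rot T) h1 /(tg_rot T)/(tg_rot T) h2; exact: tg_uniq T _ _ _ _ h2 h1.
Qed.

Lemma nbrs0 v : inner_vertex v -> nbrs v != set0.
Proof. by move=> /(tg_deg T)[u e]; apply/set0Pn; exists u; rewrite inE. Qed.

(** A set of neighbours closed under [next_nbr] winds around [v], so one of its faces contains the
    direction [(1, 0)]. If [A] were proper, its complement would be closed too, by injectivity, and
    give a second such face, against [tg_cone]. *)
Lemma link_conn v (A : {set P}) : inner_vertex v -> A \subset nbrs v -> A != set0 ->
  (forall u, u \in A -> next_nbr v u \in A) -> A = nbrs v.
Proof.
move=> iv sA A0 nA; apply/eqP; rewrite eqEsubset sA /=; apply/subsetP => b.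
apply: contraTT => bA; apply/negP => bN.
have AN u : u \in A -> E v u by move=> /(subsetP sA); rewrite inE.
have im : [set next_nbr v u | u in A] = A.
  apply/eqP; rewrite eqEcard card_in_imset ?leqnn ?andbT.
    by apply/subsetP => ? /imsetP[u uA ->]; apply: nA.
  by move=> u u' /AN e /AN e' /next_nbr_inj; apply.
pose B := nbrs v :\: A.
have nB u : u \in B -> next_nbr v u \in B.
  rewrite !inE => /andP[uA e]; move: (next_nbr_tri iv e) => h; rewrite (tri_edge2 h) andbT.
  apply: contra uA; rewrite -{1}im => /imsetP[u' u'A] /next_nbr_inj -> //; exact: AN.
have pos u : E v u -> 0 < crossp (vec (p v) (p u)) (vec (p v) (p (next_nbr v u))).
  by move=> /(next_nbr_tri iv)/tri_crossp.
pose D : point R := (1, 0).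
have D0 : D.1 != 0 \/ D.2 != 0 by left; rewrite oner_eq0.
have [a aA /andP[a1 a2]] := @cycle_covers R P (fun u => vec (p v) (p u)) (next_nbr v) A _ A0 nA
  (fun u uA => pos u (AN u uA)) D0.
have [|u|b' b'B /andP[b1 b2]] := @cycle_covers R P (fun u => vec (p v) (p u)) (next_nbr v) B _ _ nB _ D0.
- by apply/set0Pn; exists b; rewrite !inE bA /=; move: bN; rewrite inE.
- by rewrite !inE => /andP[_ /pos].
have e' : E v b' by move: b'B; rewrite !inE => /andP[].
have := tg_cone T (next_nbr_tri iv (AN _ aA)) (next_nbr_tri iv e') a1 a2 b1 b2 => ab.
by move: b'B; rewrite -ab inE aA.
Qed.

Definition linform al be (v : point R) : R := al * v.1 + be * v.2.

Lemma tri_span v al be : inner_vertex v -> al != 0 \/ be != 0 ->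
  exists2 u, E v u & linform al be (p v) < linform al be (p u).
Proof.
move=> iv ab; pose D : point R := (be, - al).
have D0 : D.1 != 0 \/ D.2 != 0 by rewrite /= oppr_eq0; case: ab; [right|left].
have [u|u|u uN h] := @cycle_meets_halfplane R P (fun u =>
    vec (p v) (p u)) (next_nbr v) (nbrs v) (nbrs0 iv) _ _ D D0.
- exact: next_nbr_in.
- by rewrite inE => /(next_nbr_tri iv)/tri_crossp.
by exists u; [move: uN; rewrite inE | move: h; rewrite /crossp /linform /=; lra].
Qed.

(** By [link_conn] the link is one cycle; between a lower and a higher neighbour it must pass from
    below the key of [v] to above it. *)
Lemma rising_ge1 (k : P -> nat) v : injective k -> inner_vertex v ->
  (exists2 u, E v u & (k u < k v)%N) -> (exists2 u, E v u & (k v < k u)%N) ->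
  (0 < rising tri k v)%N.
Proof.
move=> kI iv [u eu ku] [w ew kw].
pose A := [set u in nbrs v | (k u < k v)%N].
have : ~~ [forall u in A, next_nbr v u \in A].
  apply/negP => /forall_inP nA.
  have : A = nbrs v.
    apply: link_conn => //; first by apply/subsetP => t; rewrite inE => /andP[].
    by apply/set0Pn; exists u; rewrite !inE eu.
  by move/setP/(_ w); rewrite !inE ew /= ltnNge (ltnW kw).
rewrite negb_forall_in => /exists_inP[t]; rewrite !inE => /andP[et kt].
have h := next_nbr_tri iv et; rewrite (tri_edge2 h) /= -leqNgt leq_eqVlt => /orP[/eqP/kI e|kn].
  by move: (tri_edge2 h); rewrite -e => /tg_edge_neq; rewrite eqxx.
by apply/card_gt0P; exists (t, next_nbr v t); rewrite inE /= h kt kn.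
Qed.

Lemma falling_ge1 (k : P -> nat) v : injective k -> inner_vertex v ->
  (exists2 u, E v u & (k u < k v)%N) -> (exists2 u, E v u & (k v < k u)%N) ->
  (0 < falling tri k v)%N.
Proof.
move=> kI iv [u eu ku] [w ew kw].
pose A := [set u in nbrs v | (k v < k u)%N].
have : ~~ [forall u in A, next_nbr v u \in A].
  apply/negP => /forall_inP nA.
  have : A = nbrs v.
    apply: link_conn => //; first by apply/subsetP => t; rewrite inE => /andP[].
    by apply/set0Pn; exists w; rewrite !inE ew.
  by move/setP/(_ u); rewrite !inE eu /= ltnNge (ltnW ku).
rewrite negb_forall_in => /exists_inP[t]; rewrite !inE => /andP[et kt].
have h := next_nbr_tri iv et; rewrite (tri_edge2 h) /= -leqNgt leq_eqVlt => /orP[/eqP/kI e|kn].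
  by move: (tri_edge2 h); rewrite e => /tg_edge_neq; rewrite eqxx.
by apply/card_gt0P; exists (t, next_nbr v t); rewrite inE /= h kt kn.
Qed.

Lemma outer_neq : [/\ x != y, y != z & z != x].
Proof.
by split; apply: contraTneq (tg_out T) => ->; rewrite detE -leNgt le_eqVlt;
  apply/orP; left; apply/eqP; ring.
Qed.

(** All other points are strictly on one side of the line through [p y] parallel to the opposite
    outer edge, so the neighbours of [y] are linearly ordered by angle, from [z] to [x]. *)
Lemma outer_first v : v != y -> 0 < crossp (vec (p x) (p z)) (vec (p y) (p v)).
Proof.
move=> vy.
have -> : crossp (vec (p x) (p z)) (vec (p y) (p v)) = det (p x) (p y) (p v) + det (p y) (p z) (p v).
  by rewrite /det /crossp /=; ring.
case: (eqVneq v z) => [->|vz].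
  by have := tg_out T; rewrite /det /crossp /=; lra.
case: (eqVneq v x) => [->|vx].
  by have := tg_out T; rewrite /det /crossp /=; lra.
by have [|h1 h2 _] := @tg_in _ _ _ _ _ _ _ _ T v; [apply/and3P | lra].
Qed.

Lemma outer_last_nbr (A : {set P}) : A != set0 -> A \subset nbrs y ->
  exists2 a, a \in A & forall b, b \in A -> crossp (vec (p y) (p a)) (vec (p y) (p b)) <= 0.
Proof.
move=> A0 sA; apply: (@angle_last R P (fun u => vec (p y) (p u)) (vec (p x) (p z)) A A0).
by move=> a /(subsetP sA); rewrite inE => /tg_edge_neq; rewrite eq_sym; apply: outer_first.
Qed.

Lemma outer_first_nbr (A : {set P}) : A != set0 -> A \subset nbrs y ->
  exists2 a, a \in A & forall b, b \in A -> 0 <= crossp (vec (p y) (p a)) (vec (p y) (p b)).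
Proof.
move=> A0 sA; apply: (@angle_first R P (fun u => vec (p y) (p u)) (vec (p x) (p z)) A A0).
by move=> a /(subsetP sA); rewrite inE => /tg_edge_neq; rewrite eq_sym; apply: outer_first.
Qed.

Lemma next_nbr_tri_outer u : E y u -> u != x -> tri y u (next_nbr y u).
Proof.
have [xy yz zx] := outer_neq => e ux.
have [||| w h] := tg_next T e;
    rewrite ?xpair_eqE ?(negbTE ux) ?andbF ?(negbTE yz) ?(eq_sym y) ?(negbTE xy) //.
by rewrite (next_nbrP h).
Qed.

(** Take the angularly last neighbour whose key is on the same side of the key of [y] as that of
    [z]. It is not [x], so it has a face on its left, and the third vertex of that face has its key
    on the other side. *)
Lemma outer_middle (k : P -> nat) : injective k ->
  ((k z < k y)%N && (k y < k x)%N || (k x < k y)%N && (k y < k z)%N) ->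
  (0 < rising tri k y + falling tri k y)%N.
Proof.
have [xy yz zx] := outer_neq; have [exy eyz ezx] := tg_outE T.
move=> kI /orP[/andP[kz kx]|/andP[kx kz]].
  pose A := [set u in nbrs y | (k u < k y)%N].
  have [||a] := @outer_last_nbr A; first by apply/set0Pn; exists z; rewrite !inE eyz kz.
    by apply/subsetP => u; rewrite inE => /andP[].
  rewrite !inE => /andP[ea ka] la.
  have ax : a != x by apply: contraTneq ka => ->; rewrite -leqNgt ltnW.
  have t := next_nbr_tri_outer ea ax; set w := next_nbr y a in t.
  rewrite addn_gt0; apply/orP; left; apply/card_gt0P; exists (a, w).
  rewrite inE /= t ka ltn_neqAle (inj_eq kI) (tg_edge_neq (tri_edge2 t)) /= leqNgt.
  apply/negP => kw; have := la w; rewrite !inE (tri_edge2 t) kw => /(_ isT).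
  by rewrite leNgt (tri_crossp t).
pose A := [set u in nbrs y | (k y < k u)%N].
have [||a] := @outer_last_nbr A; first by apply/set0Pn; exists z; rewrite !inE eyz kz.
  by apply/subsetP => u; rewrite inE => /andP[].
rewrite !inE => /andP[ea ka] la.
have ax : a != x by apply: contraTneq ka => ->; rewrite -leqNgt ltnW.
have t := next_nbr_tri_outer ea ax; set w := next_nbr y a in t.
rewrite addn_gt0; apply/orP; right; apply/card_gt0P; exists (a, w).
rewrite inE /= t ka ltn_neqAle (inj_eq kI) eq_sym (tg_edge_neq (tri_edge2 t)) /= leqNgt.
apply/negP => kw; have := la w; rewrite !inE (tri_edge2 t) kw => /(_ isT).
by rewrite leNgt (tri_crossp t).
Qed.

Variable s : R.
Definition height v : R := (p v).2 - s * (p v).1.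
Hypothesis height_inj : injective height.
Variable hkey : P -> nat.
Hypothesis hkey_inj : injective hkey.
Hypothesis hkeyP : forall u v, height u < height v -> (hkey u < hkey v)%N.

Lemma hkey_lt u v : (hkey u < hkey v)%N = (height u < height v).
Proof.
apply/idP/idP => [|/hkeyP//]; case: (ltgtP (height u) (height v)) => // [/hkeyP|/height_inj ->];
    last by rewrite ltnn.
by move=> h /(ltn_trans h); rewrite ltnn.
Qed.

(** For a linear key, a rising corner contains the direction [(1, s)] of the level lines, and by
    [tg_cone] only one corner at [v] does. *)
Lemma rising_le1 v : (rising tri hkey v <= 1)%N.
Proof.
apply/card_le1P => -[u w]; rewrite inE /= !hkey_lt => /and3P[t gu gw] [u' w'].
rewrite !inE /= !hkey_lt; apply/idP/eqP => [/and3P[t' gu' gw']|[-> ->]]; last by rewrite t gu gw.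
have e : u = u'.
  apply: (tg_cone T t t' (d := (1, s))); move: gu gw gu' gw'; rewrite /height /crossp /=; lra.
by rewrite -e in t' *; rewrite (tg_uniq T t t').
Qed.

Lemma falling_le1 v : (falling tri hkey v <= 1)%N.
Proof.
apply/card_le1P => -[u w]; rewrite inE /= !hkey_lt => /and3P[t gu gw] [u' w'].
rewrite !inE /= !hkey_lt; apply/idP/eqP => [/and3P[t' gu' gw']|[-> ->]]; last by rewrite t gu gw.
have e : u = u'.
  apply: (tg_cone T t t' (d := (-1, - s))); move: gu gw gu' gw'; rewrite /height /crossp /=; lra.
by rewrite -e in t' *; rewrite (tg_uniq T t t').
Qed.

Lemma height_barycentric v : det (p x) (p y) (p z) * height v =
  det (p y) (p z) (p v) * height x + det (p z) (p x) (p v) * height y + det (p x) (p y) (p v) * height z.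
Proof. by rewrite /height /det /crossp /=; ring. Qed.

Lemma outer_low v : height y < height x -> height y < height z -> height y <= height v.
Proof.
move=> h1 h2; case: (eqVneq v x) => [->|vx]; first exact: ltW.
case: (eqVneq v y) => [->//|vy]; case: (eqVneq v z) => [->|vz]; first exact: ltW.
have [|d1 d2 d3] := @tg_in _ _ _ _ _ _ _ _ T v; first exact/and3P.
rewrite -(ler_pM2l (tg_out T)) [leRHS]height_barycentric.
have := tg_out T.
have -> : det (p x) (p y) (p z) = det (p x) (p y) (p v) + det (p y) (p z) (p v) + det (p z) (p x) (p v).
  by rewrite /det /crossp /=; ring.
move=> _; move: (det (p x) (p y) (p v)) (det (p y) (p z) (p v)) (det (p z) (p x) (p v)) d1 d2 d3 =>
    a b c d1 d2 d3.
move: (height x) (height y) (height z) h1 h2 => gx gy gz h1 h2.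
have e1 : 0 < b * (gx - gy) by rewrite mulr_gt0 // subr_gt0.
have e2 : 0 < a * (gz - gy) by rewrite mulr_gt0 // subr_gt0.
lra.
Qed.

Lemma outer_high v : height x < height y -> height z < height y -> height v <= height y.
Proof.
move=> h1 h2; case: (eqVneq v x) => [->|vx]; first exact: ltW.
case: (eqVneq v y) => [->//|vy]; case: (eqVneq v z) => [->|vz]; first exact: ltW.
have [|d1 d2 d3] := @tg_in _ _ _ _ _ _ _ _ T v; first exact/and3P.
rewrite -(ler_pM2l (tg_out T)) [leLHS]height_barycentric.
have -> : det (p x) (p y) (p z) = det (p x) (p y) (p v) + det (p y) (p z) (p v) + det (p z) (p x) (p v).
  by rewrite /det /crossp /=; ring.
move: (det (p x) (p y) (p v)) (det (p y) (p z) (p v)) (det (p z) (p x) (p v)) d1 d2 d3 => a b c d1 d2 d3.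
move: (height x) (height y) (height z) h1 h2 => gx gy gz h1 h2.
have e1 : 0 < b * (gy - gx) by rewrite mulr_gt0 // subr_gt0.
have e2 : 0 < a * (gy - gz) by rewrite mulr_gt0 // subr_gt0.
lra.
Qed.

Lemma outer_extreme : (height y < height x /\ height y < height z) \/ (height x < height y /\
    height z < height y) ->
  (rising tri hkey y + falling tri hkey y = 0)%N.
Proof.
move=> h; apply/eqP; rewrite addn_eq0 !cards_eq0; apply/andP; split; apply/eqP/setP => -[u w];
  rewrite !inE /= !hkey_lt; apply/negP => /and3P[t h1 h2]; case: h => -[a b];
  [have := outer_low u a b; have := outer_low w a b|have := outer_high u a b; have := outer_high w a b|
   have := outer_low u a b; have := outer_low w a b|have := outer_high u a b;
       have := outer_high w a b]; lra.
Qed.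

Lemma outer_le1 : (rising tri hkey y + falling tri hkey y <= 1)%N.
Proof.
rewrite leqNgt; apply/negP => h.
have := rising_le1 y; have := falling_le1 y => d1 u1.
have /card_gt0P[[u w]] : (0 < rising tri hkey y)%N by lia.
have /card_gt0P[[u' w']] : (0 < falling tri hkey y)%N by lia.
rewrite !inE /= !hkey_lt => /and3P[t' h1' h2'] /and3P[t h1 h2].
have := tri_crossp t'; have := tri_crossp t.
have uy := tg_edge_neq (tg_edge T t); have wy := tg_edge_neq (tri_edge2 t).
have uy' := tg_edge_neq (tg_edge T t'); have wy' := tg_edge_neq (tri_edge2 t').
move: uy wy uy' wy'; rewrite ![y == _]eq_sym.
move=> /outer_first + /outer_first + /outer_first + /outer_first.
move: h1 h2 h1' h2'; rewrite /height /crossp /=.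
set X := p x; set Y := p y; set Z := p z; set U := p u; set W := p w; set U' := p u'; set W' := p w'.
move=> h1 h2 h1' h2' L1 L2 L1' L2' c c'.
(* the level line through y leaves a triangle on both sides *)
pose l := (Z.1 - X.1) * s - (Z.2 - X.2).
have e1 : 0 < l * ((U.1 - Y.1) * (W.2 - Y.2) - (U.2 - Y.2) * (W.1 - Y.1)).
  have -> : l * ((U.1 - Y.1) * (W.2 - Y.2) - (U.2 - Y.2) * (W.1 - Y.1)) =
   ((W.2 - s * W.1) - (Y.2 - s * Y.1)) * ((Z.1 - X.1) * (U.2 - Y.2) - (Z.2 - X.2) * (U.1 - Y.1)) +
   ((Y.2 - s * Y.1) - (U.2 - s * U.1)) * ((Z.1 - X.1) * (W.2 - Y.2) - (Z.2 - X.2) * (W.1 - Y.1)).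
    by rewrite /l; ring.
  by rewrite addr_gt0 // mulr_gt0 // subr_gt0.
have e2 : 0 < - l * ((U'.1 - Y.1) * (W'.2 - Y.2) - (U'.2 - Y.2) * (W'.1 - Y.1)).
  have -> : - l * ((U'.1 - Y.1) * (W'.2 - Y.2) - (U'.2 - Y.2) * (W'.1 - Y.1)) =
   ((Y.2 - s * Y.1) - (W'.2 - s * W'.1)) * ((Z.1 - X.1) * (U'.2 - Y.2) - (Z.2 - X.2) * (U'.1 - Y.1)) +
   ((U'.2 - s * U'.1) - (Y.2 - s * Y.1)) * ((Z.1 - X.1) * (W'.2 - Y.2) - (Z.2 - X.2) * (W'.1 - Y.1)).
    by rewrite /l; ring.
  by rewrite addr_gt0 // mulr_gt0 // subr_gt0.
have l1 : 0 < l by rewrite -(pmulr_lgt0 _ c).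
have l2 : 0 < - l by rewrite -(pmulr_lgt0 _ c').
lra.
Qed.
End TF.

(** * Exact corner counts at inner vertices *)

Section Exact.
Variables (R : realType) (P : finType) (E : rel P) (tri : P -> P -> P -> bool)
  (x y z : P) (p : P -> point R).
Hypothesis T : triangulation E tri x y z p.
Let T1 := tg_turn T.
Let T2 := tg_turn T1.
Local Notation inner := (inner_vertex x y z).
Local Notation nx := (next_nbr tri).

Lemma outer_some k : injective k ->
  exists2 m, ~~ inner m & (0 < rising tri k m + falling tri k m)%N.
Proof.
move=> kI; have [xy yz zx] := outer_neq T.
have hx := outer_middle T2 kI; have hy := outer_middle T kI; have hz := outer_middle T1 kI.
have {}xy : k x != k y by rewrite (inj_eq kI).
have {}yz : k y != k z by rewrite (inj_eq kI).
have {}zx : k z != k x by rewrite (inj_eq kI).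
have nx' : ~~ inner x by rewrite /inner_vertex eqxx.
have ny : ~~ inner y by rewrite /inner_vertex eqxx andbF.
have nz : ~~ inner z by rewrite /inner_vertex eqxx !andbF.
move: xy yz zx hx hy hz; case: (ltngtP (k x) (k y)) => // h1 _; case: (ltngtP (k y) (k z)) => // h2 _;
 case: (ltngtP (k z) (k x)) => // h3 _ /= hx hy hz;
 solve [by exists x => //; apply: hx | by exists y => //; apply: hy | by exists z => //; apply: hz | lia].
Qed.

Lemma outer_cases m : ~~ inner m -> [\/ m = x, m = y | m = z].
Proof.
rewrite /inner_vertex !negb_and !negbK => /or3P[/eqP->|/eqP->|/eqP->];
 by [constructor 1 | constructor 2 | constructor 3].
Qed.

Lemma lt_cycle_false (a b c : R) : a < b -> b < c -> c < a -> False.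
Proof. lra. Qed.

Lemma gt_cycle_false (a b c : R) : b < a -> c < b -> a < c -> False.
Proof. lra. Qed.

(** An upper bound from a linear key: inner vertices have at most one corner of each kind, the
    lowest and the highest outer vertex have none, and the third one, [m], has at most one. *)
Lemma generic_bound : exists2 k : P -> nat, injective k &
  exists m, forall v, (rising tri k v + falling tri k v <= 2 * inner v + (v == m))%N.
Proof.
have [s gI] := generic_slope (tg_inj T).
have [k [kI kP _]] := lex_key (height p s) (height p s).
exists k => //.
have [xy yz zx] := outer_neq T.
have ex := @outer_extreme _ _ _ _ _ _ _ _ T2 s gI _ kP; have ey :=
    @outer_extreme _ _ _ _ _ _ _ _ T s gI _ kP.
have ez := @outer_extreme _ _ _ _ _ _ _ _ T1 s gI _ kP.
have ox := @outer_le1 _ _ _ _ _ _ _ _ T2 s gI _ kP; have oy := @outer_le1 _ _ _ _ _ _ _ _ T s gI _ kP.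
have oz := @outer_le1 _ _ _ _ _ _ _ _ T1 s gI _ kP.
have main m : (m = x \/ (height p s x < height p s z /\ height p s x < height p s y \/
    height p s z < height p s x /\ height p s y < height p s x)) ->
  (m = y \/ (height p s y < height p s x /\ height p s y < height p s z \/
      height p s x < height p s y /\ height p s z < height p s y)) ->
  (m = z \/ (height p s z < height p s y /\ height p s z < height p s x \/
      height p s y < height p s z /\ height p s x < height p s z)) ->
  forall v, (rising tri k v + falling tri k v <= 2 * inner v + (v == m))%N.
  move=> hx hy hz v; case: (boolP (inner v)) => [_|/outer_cases].
    by have := @rising_le1 _ _ _ _ _ _ _ _ T s gI _ kP v; have :=
        @falling_le1 _ _ _ _ _ _ _ _ T s gI _ kP v; lia.
  rewrite muln0 add0n; case=> ->.
  - by case: hx => [->|h]; [rewrite eqxx ox | rewrite (ex h)].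
  - by case: hy => [->|h]; [rewrite eqxx oy | rewrite (ey h)].
  - by case: hz => [->|h]; [rewrite eqxx oz | rewrite (ez h)].
have nxy : height p s x != height p s y by rewrite (inj_eq gI).
have nyz : height p s y != height p s z by rewrite (inj_eq gI).
have nzx : height p s z != height p s x by rewrite (inj_eq gI).
move: (height p s x) (height p s y) (height p s z) nxy nyz nzx main => a b c.
case: (ltgtP a b) => // h1 _; case: (ltgtP b c) => // h2 _; case: (ltgtP c a) => // h3 _ main;
 solve [by exists x; apply: main; solve [by left | by right; left | by right; right] | by exists y;
     apply: main; solve [by left | by right; left | by right; right] | by exists z; apply: main;
     solve [by left | by right; left | by right; right] | by case: (lt_cycle_false h1 h2 h3) |
     by case: (gt_cycle_false h1 h2 h3)].
Qed.

(** The total is the same for all keys. [generic_bound] makes it at most twice the number of inner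
    vertices plus one, while for [k] each inner vertex contributes at least two and some outer
    vertex at least one; so nothing is left over. *)
Lemma exact_count k : injective k ->
  (forall v, inner v -> 0 < rising tri k v)%N -> (forall v, inner v -> 0 < falling tri k v)%N ->
  forall v, inner v -> rising tri k v = 1%N /\ falling tri k v = 1%N.
Proof.
move=> kI up dn v0 iv0.
have [kg kgI [mg hg]] := generic_bound.
have [m om hm] := outer_some kI.
have eS : (\sum_v (rising tri k v + falling tri k v) = \sum_v (rising tri kg v + falling tri kg v))%N.
  apply/eqP; rewrite -(eqn_pmul2l (isT : 0 < 3)%N) !count_middle_corners //; first exact: (tg_rot T).
  - exact: (tri_neq T).
  - exact: (tg_rot T).
  exact: (tri_neq T).
have sum1 (w : P) : (\sum_(v : P) (v == w : nat) = 1)%N.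
  by rewrite (bigD1 w) //= eqxx big1 ?addn0 // => i /negbTE ->.
have le1 : (\sum_v (rising tri k v + falling tri k v) <= \sum_v 2 * inner v + 1)%N.
  rewrite eS; have -> : (\sum_v 2 * inner v + 1 = \sum_v (2 * inner v + (v == mg)))%N.
    by rewrite [RHS]big_split /= sum1.
  by apply: leq_sum => v _; apply: hg.
have := up _ iv0; have := dn _ iv0.
suff : (rising tri k v0 + falling tri k v0 < 3)%N by lia.
rewrite ltnNge; apply/negP => h3.
suff : (\sum_v 2 * inner v + 2 <= \sum_v (rising tri k v + falling tri k v))%N by lia.
have -> : (\sum_v 2 * inner v + 2 = \sum_v (2 * inner v + (v == v0) + (v == m)))%N.
  by rewrite [RHS]big_split [in RHS]big_split /= !sum1 -addnA.
apply: leq_sum => v _ /=.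
case: (boolP (inner v)) => iv; last first.
  rewrite muln0 add0n (_ : v == v0 = false) ?add0n; last by apply: contraNF iv => /eqP ->.
  by case: eqP => // ->.
rewrite (_ : v == m = false); last by apply: contraTF iv => /eqP ->.
by case: eqP => [->|_]; [lia | have := up _ iv; have := dn _ iv; lia].
Qed.
End Exact.

(** * Sign changes of a linear form around a vertex *)

Section TF.
Variables (R : realType) (P : finType) (E : rel P) (tri : P -> P -> P -> bool)
  (x y z : P) (p q : P -> point R).
Hypothesis T : triangulation E tri x y z p.
Hypothesis q_out : 0 < det (q x) (q y) (q z).
Local Notation inner := (inner_vertex x y z).
Local Notation nx := (next_nbr tri).
(** [q v] is in the relative interior of the convex hull of its neighbours' images, phrased so that
    coincident and collinear images are allowed. *)
Hypothesis hull : forall v, inner v -> forall al be,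
  (forall u, E v u -> linform al be (q v) <= linform al be (q u)) ->
  forall u, E v u -> linform al be (q u) = linform al be (q v).

Lemma hull_lt v al be w : inner v -> E v w -> linform al be (q w) != linform al be (q v) ->
  exists2 u, E v u & linform al be (q u) < linform al be (q v).
Proof.
move=> iv ew nw; apply/exists_inP; apply: contraNT nw => /exists_inPn h.
by apply/eqP/hull => // u e; rewrite leNgt; apply: h.
Qed.

Lemma linform_opp al be (v : point R) : linform (- al) (- be) v = - linform al be v.
Proof. by rewrite /linform; ring. Qed.

Lemma hull_gt v al be w : inner v -> E v w -> linform al be (q w) != linform al be (q v) ->
  exists2 u, E v u & linform al be (q v) < linform al be (q u).
Proof.
move=> iv ew nw; have [|u e h] := @hull_lt v (- al) (- be) w iv ew.
  by rewrite !linform_opp eqr_opp.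
by exists u => //; move: h; rewrite !linform_opp ltrN2.
Qed.

(** A form of [q] alone leaves a vertex without lower and higher neighbours when all of them are
    level with it. Breaking ties by a form of the old drawing repairs this through [tri_span], so
    that [exact_count] applies. *)
Lemma two_key al be ga de : ga != 0 \/ de != 0 -> exists k : P -> nat,
  [/\ injective k,
   forall u v, linform al be (q u) < linform al be (q v) -> (k u < k v)%N,
   forall u v, linform al be (q u) = linform al be (q v) ->
       linform ga de (p u) < linform ga de (p v) -> (k u < k v)%N &
   forall v, inner v -> rising tri k v = 1%N /\ falling tri k v = 1%N].
Proof.
move=> gd; have [k [kI k1 k2]] := lex_key (fun v => linform al be (q v)) (fun v => linform ga de (p v)).
exists k; split => //.
have lo v : inner v -> exists2 u, E v u & (k u < k v)%N.
  move=> iv; case: (boolP [exists u, E v u && (linform al be (q u) != linform al be (q v))]).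
    by case/existsP=> w /andP[ew /(hull_lt iv ew)[u e /k1]]; exists u.
  rewrite negb_exists => /forallP fl.
  have [|u e h] := @tri_span _ _ _ _ _ _ _ _ T v (- ga) (- de) iv; first by rewrite !oppr_eq0.
  exists u => //; apply: k2; last by move: h; rewrite !linform_opp ltrN2.
  by have := fl u; rewrite e /= negbK => /eqP.
have hi v : inner v -> exists2 u, E v u & (k v < k u)%N.
  move=> iv; case: (boolP [exists u, E v u && (linform al be (q u) != linform al be (q v))]).
    by case/existsP=> w /andP[ew /(hull_gt iv ew)[u e /k1]]; exists u.
  rewrite negb_exists => /forallP fl.
  have [u e h] := @tri_span _ _ _ _ _ _ _ _ T v ga de iv gd.
  exists u => //; apply: k2 => //.
  by have := fl u; rewrite e /= negbK => /eqP.
apply: (exact_count T) => // v iv.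
  by apply: (rising_ge1 T) => //; [apply: lo|apply: hi].
by apply: (falling_ge1 T) => //; [apply: lo|apply: hi].
Qed.

Definition nonflat al be v := exists2 w, E v w & linform al be (q w) != linform al be (q v).

Lemma rise_uniq k v u u' : rising tri k v = 1%N -> inner v ->
  E v u -> (k u < k v)%N -> (k v < k (nx v u))%N ->
  E v u' -> (k u' < k v)%N -> (k v < k (nx v u'))%N -> u = u'.
Proof.
move=> c iv e1 a1 b1 e2 a2 b2.
have /card_le1P/(_ (u, nx v u)) h : (rising tri k v <= 1)%N by rewrite c.
have := h _ (u', nx v u'); rewrite !inE /= (next_nbr_tri T iv e1) (next_nbr_tri T iv e2) a1 b1 a2 b2.
by move=> /(_ isT)/esym/eqP[].
Qed.

Lemma drop_uniq k v u u' : falling tri k v = 1%N -> inner v ->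
  E v u -> (k v < k u)%N -> (k (nx v u) < k v)%N ->
  E v u' -> (k v < k u')%N -> (k (nx v u') < k v)%N -> u = u'.
Proof.
move=> c iv e1 a1 b1 e2 a2 b2.
have /card_le1P/(_ (u, nx v u)) h : (falling tri k v <= 1)%N by rewrite c.
have := h _ (u', nx v u'); rewrite !inE /= (next_nbr_tri T iv e1) (next_nbr_tri T iv e2) a1 b1 a2 b2.
by move=> /(_ isT)/esym/eqP[].
Qed.

Lemma vec_neq0 u v : u != v -> (vec (p u) (p v)).1 != 0 \/ (vec (p u) (p v)).2 != 0.
Proof.
move=> uv; rewrite /= !subr_eq0.
case: (eqVneq (p v).1 (p u).1) => [e1|]; last by left.
right; apply: contra uv => /eqP e2; apply/eqP/(tg_inj T); exact: pair_ext.
Qed.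

(* Around v the link reaches u before closing up. *)
Lemma link_reach v a u : inner v -> E v a -> E v u ->
  exists2 i, iter i (nx v) a = u & forall j, (j < i)%N -> iter j (nx v) a != u.
Proof.
move=> iv ea eu.
have ex : exists i, iter i (nx v) a == u.
  have nA w : fconnect (nx v) a w -> w \in nbrs E v.
    move=> /iter_findex <-; elim: (findex _ _ _) => [|n IH]; first by rewrite inE.
    exact: (next_nbr_in T).
  have h : [set w | fconnect (nx v) a w] = nbrs E v.
    apply: (link_conn T) => //.
    - by apply/subsetP => w; rewrite inE => /nA.
    - by apply/set0Pn; exists a; rewrite inE.
    - by move=> w; rewrite !inE => h; apply: connect_trans h _; exact: fconnect1.
  have : u \in nbrs E v by rewrite inE.
  by rewrite -h inE => /iter_findex <-; exists (findex (nx v) a u).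
case: (ex_minnP ex) => i /eqP hi hm; exists i => // j ji.
by apply: contraTneq ji => h; rewrite -leqNgt; apply: hm; rewrite h.
Qed.

(** Opposite tie-breaks make the corner [(u, w)] the only falling one for [k1] and the only rising
    one for [k2]. Going around [v] to [u], the neighbours from [a] on stay above for [k1] and those
    from [b] on stay below for [k2]. The longer path passes through the start of the shorter one,
    which is strictly on the wrong side. *)
Lemma zero_pair al be v u : inner v -> nonflat al be v -> E v u ->
  linform al be (q u) = linform al be (q v) -> linform al be (q (nx v u)) = linform al be (q v) -> False.
Proof.
move=> iv [c ec nc] eu zu zw; set w := nx v u in zw.
have [a ea ha] := hull_gt iv ec nc; have [b eb hb] := hull_lt iv ec nc.
have tv := next_nbr_tri T iv eu; have ew := tri_edge2 T tv.
have cr := tri_crossp T tv; rewrite -/w in tv ew cr.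
(* [s] is the sum of the vectors from [p v] to [p u] and [p w]; a form vanishing on [s] takes
   opposite nonzero values on the two. *)
pose s := ((p u).1 + (p w).1 - 2 * (p v).1, (p u).2 + (p w).2 - 2 * (p v).2) : point R.
have gd : s.2 != 0 \/ - s.1 != 0.
  rewrite oppr_eq0; case: (eqVneq s.2 0) => [e2|]; last by left.
  right; apply/eqP => e1; move: e1 e2 cr; rewrite /s /crossp /= => e1 e2.
  have -> : (p w).1 = 2 * (p v).1 - (p u).1 by lra.
  have -> : (p w).2 = 2 * (p v).2 - (p u).2 by lra.
  lra.
have gd' : - s.2 != 0 \/ - - s.1 != 0 by rewrite !oppr_eq0; move: gd; rewrite oppr_eq0.
have [k1 [k1I k1f k1g k1c]] := @two_key al be _ _ gd.
have [k2 [k2I k2f k2g k2c]] := @two_key al be _ _ gd'.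
have [c1 d1] := k1c _ iv; have [c2 d2] := k2c _ iv.
have u1 : (k1 v < k1 u)%N by apply: k1g => //; move: cr; rewrite /s /linform /crossp /=; lra.
have w1 : (k1 w < k1 v)%N by apply: k1g => //; move: cr; rewrite /s /linform /crossp /=; lra.
have u2 : (k2 u < k2 v)%N by apply: k2g => //; move: cr; rewrite /s /linform /crossp /=; lra.
have w2 : (k2 v < k2 w)%N by apply: k2g => //; move: cr; rewrite /s /linform /crossp /=; lra.
have a1 := k1f _ _ ha; have a2 := k2f _ _ ha; have b1 := k1f _ _ hb; have b2 := k2f _ _ hb.
have [i ai imin] := link_reach iv ea eu; have [j bj jmin] := link_reach iv eb eu.
have nEn n t : E v t -> E v (iter n (nx v) t).
  by move=> et; elim: n => // n IH; have := next_nbr_in T iv (u := iter n (nx v) t); rewrite !inE /=; apply.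
have strict (k : P -> nat) t : injective k -> E v t -> ~~ (k v < k t)%N -> (k t < k v)%N.
  by move=> kI et; rewrite -leqNgt leq_eqVlt (inj_eq kI) eq_sym (negbTE (tg_edge_neq T et)).
have hi1 n : (n <= i)%N -> (k1 v < k1 (iter n (nx v) a))%N.
  elim: n => // n IH ni; have := IH (ltnW ni); have en := nEn n _ ea => kn.
  apply: contraT => h; have := strict _ _ k1I (nEn n.+1 _ ea) h => kn'.
  by have := imin _ ni; rewrite (drop_uniq d1 iv en kn kn' eu u1 w1) eqxx.
have lo2 n : (n <= j)%N -> (k2 (iter n (nx v) b) < k2 v)%N.
  elim: n => // n IH nj; have := IH (ltnW nj); have en := nEn n _ eb => kn.
  rewrite ltnNge leq_eqVlt (inj_eq k2I) (negbTE (tg_edge_neq T (nEn n.+1 _ eb))) /=; apply/negP => kn'.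
  by have := jmin _ nj; rewrite (rise_uniq c2 iv en kn kn' eu u2 w2) eqxx.
have back m n t t' : E v t -> E v t' -> iter (m + n) (nx v) t = iter m (nx v) t' -> iter n (nx v) t = t'.
  move=> et et1; elim: m => // m IH /= h; apply: IH.
  by apply: (next_nbr_inj T iv _ _ h); apply: nEn.
have [ij|ji] := leqP j i.
  have := back j (i - j)%N _ _ ea eb; rewrite subnKC // ai bj => /(_ erefl) e.
  by have := hi1 (i - j)%N (leq_subr _ _); rewrite e ltnNge (ltnW b1).
have := back i (j - i)%N _ _ eb ea; rewrite subnKC ?(ltnW ji) // ai bj => /(_ erefl) e.
by have := lo2 (j - i)%N (leq_subr _ _); rewrite e ltnNge (ltnW a2).
Qed.

(** The tie-break along [p v - p u] ranks [u] just below [v]. If the neighbour after [u] were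
    strictly above, the corner at [u] would be the only rising one; the other lower neighbours could
    then be left only by a second rise or through [u], whose predecessor [w] is above. *)
Lemma zero_pos al be v w u : inner v -> nonflat al be v -> E v w -> nx v w = u ->
  linform al be (q u) = linform al be (q v) ->
  linform al be (q v) < linform al be (q w) -> linform al be (q (nx v u)) <= linform al be (q v).
Proof.
move=> iv [c ec nc] ew wu zu hw; rewrite leNgt; apply/negP => hn.
have tw := next_nbr_tri T iv ew; have eu : E v u by rewrite -wu; exact: (tri_edge2 T tw).
have [b eb hb] := hull_lt iv ec nc.
pose s := vec (p u) (p v).
have gd : s.1 != 0 \/ s.2 != 0 by apply: vec_neq0; rewrite eq_sym (tg_edge_neq T eu).
have [k [kI kf kg /(_ _ iv)[cu cd]]] := @two_key al be _ _ gd.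
have ku : (k u < k v)%N.
  by apply: kg => //; have := sqnorm_gt0 gd; rewrite /s /linform /=; lra.
have kw := kf _ _ hw; have kn := kf _ _ hn; have kb := kf _ _ hb.
pose A := [set t in nbrs E v | (k t < k v)%N && (t != u)].
have : ~~ [forall t in A, nx v t \in A].
  apply/negP => /forall_inP nA.
  have : A = nbrs E v.
    apply: (link_conn T) => //; first by apply/subsetP => t; rewrite inE => /andP[].
    apply/set0Pn; exists b; rewrite !inE eb kb; apply: contraTneq hb => ->.
    by rewrite zu ltxx.
  by move/setP/(_ u); rewrite !inE eqxx !andbF eu.
rewrite negb_forall_in => /exists_inP[t]; rewrite !inE => /and3P[et kt tu].
have h := next_nbr_tri T iv et; rewrite (tri_edge2 T h) /= negb_and negbK => /orP[|/eqP e].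
  rewrite -leqNgt leq_eqVlt (inj_eq kI) (negbTE (tg_edge_neq T (tri_edge2 T h))) /= => kt'.
  by move: tu; rewrite (rise_uniq cu iv et kt kt' eu ku kn) eqxx.
have tw' : t = w by apply: (next_nbr_inj T iv et ew); rewrite wu.
by move: kt; rewrite tw' ltnNge ltnW.
Qed.

Lemma zero_neg al be v w u : inner v -> nonflat al be v -> E v w -> nx v w = u ->
  linform al be (q u) = linform al be (q v) ->
  linform al be (q w) < linform al be (q v) -> linform al be (q v) <= linform al be (q (nx v u)).
Proof.
move=> iv [c ec nc] ew wu zu hw.
have := @zero_pos (- al) (- be) v w u iv _ ew wu; rewrite !linform_opp lerN2 ltrN2.
apply => //; last by rewrite zu.
by exists c => //; rewrite !linform_opp eqr_opp.
Qed.
End TF.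

(** * Closed sets of inner vertices reach the outer triangle *)

Section Ends.
Variables (R : realType) (P : finType) (E : rel P) (tri : P -> P -> P -> bool)
  (x y z : P) (p : P -> point R).
Hypothesis T : triangulation E tri x y z p.
Local Notation inner := (inner_vertex x y z).
Local Notation nx := (next_nbr tri).
Variable F : {set P}.
Hypothesis F_in : forall v, v \in F -> inner v.
Hypothesis F_cl : forall v u, v \in F -> E v u -> inner u -> u \in F.

(** Order the neighbours of [y] in [F] by angle. The last one is followed by a neighbour outside
    [F], which is outer by closure and hence [x]; the first one is likewise preceded by [z]. *)
Lemma outer_ends v : v \in F -> E y v ->
  (exists2 a, a \in F & tri y a x) /\ (exists2 a, a \in F & tri y z a).
Proof.
move=> vF eyv; pose A := F :&: nbrs E y.
have A0 : A != set0 by apply/set0Pn; exists v; rewrite !inE vF.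
have sA : A \subset nbrs E y by apply: subsetIr.
have nA w a : a \in F -> E y w -> E a w -> w \notin A -> w = x \/ w = z.
  move=> aF ey ea wA; have [iw|/outer_cases[->|e|->]] := boolP (inner w); try by [left|right].
    by case/negP: wA; rewrite !inE ey andbT; apply: F_cl ea iw.
  by have := tg_edge_neq T ey; rewrite e eqxx.
split.
  have [a] := outer_last_nbr T A0 sA; rewrite !inE => /andP[aF ea] la; exists a => //.
  have ia := F_in aF; have [h1 h2 h3] := tg_in T ia.
  have ax : a != x by case/and3P: ia.
  have t := next_nbr_tri_outer T ea ax; case: (nA _ _ aF (tri_edge2 T t) (tg_edge T (tg_rot T t))).
  - apply/negP => wA; have := la _ wA; rewrite leNgt => /negP[]; exact: (tri_crossp T t).
  - by move=> <-.
  by move=> e; have := tg_pos T t; rewrite e det_swap; lra.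
have [a] := outer_first_nbr T A0 sA; rewrite !inE => /andP[aF ea] la; exists a => //.
have ia := F_in aF; have [h1 h2 h3] := tg_in T ia.
have eay : E a y by rewrite (tg_sym T).
have [ax ay az] := and3P ia.
have [||| w t] := tg_next T eay; rewrite ?xpair_eqE ?(negbTE ax) ?(negbTE ay) ?(negbTE az) //.
have t' := tg_rot T t; case: (nA w _ aF (tg_edge T t') (tri_edge2 T t)) => [|e|e].
- apply/negP => wA; have := la _ wA; rewrite crosspC oppr_ge0 leNgt => /negP[]; exact: (tri_crossp T t').
- by have := tg_pos T t'; rewrite e; move: h1; rewrite /det /crossp /=; lra.
by rewrite -e.
Qed.

(** A highest vertex of [F] has a strictly higher neighbour, which by closure cannot be inner. *)
Lemma outer_reached : F != set0 -> exists v u, [/\ v \in F, ~~ inner u & E v u].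
Proof.
case/set0Pn=> v0 v0F.
have [v vF vm] := @Order.TotalTheory.arg_maxP _ _ _ v0 (mem F) (fun v => linform 0 1 (p v)) v0F.
have [|u e h] := @tri_span _ _ _ _ _ _ _ _ T v 0 1 (F_in vF); first by right; rewrite oner_eq0.
exists v, u; split => //; apply/negP => iu.
have : linform 0 1 (p u) <= linform 0 1 (p v) := vm u (F_cl vF e iu).
by rewrite leNgt h.
Qed.
End Ends.

(** * Faces keep their orientation *)

Section TF.
Variables (R : realType) (P : finType) (E : rel P) (tri : P -> P -> P -> bool)
  (x y z : P) (p q : P -> point R).
Hypothesis T : triangulation E tri x y z p.
Hypothesis q_out : 0 < det (q x) (q y) (q z).
Local Notation inner := (inner_vertex x y z).
Local Notation nx := (next_nbr tri).
Hypothesis hull : forall v, inner v -> forall al be,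
  (forall u, E v u -> linform al be (q v) <= linform al be (q u)) ->
  forall u, E v u -> linform al be (q u) = linform al be (q v).
Let T1 := tg_turn T.
Let T2 := tg_turn T1.

Lemma inner_turn v : inner_vertex y z x v = inner v.
Proof. by rewrite /inner_vertex; case: (v != x); case: (v != y); case: (v != z). Qed.

Lemma inner_turn2 v : inner_vertex z x y v = inner v.
Proof. by rewrite /inner_vertex; case: (v != x); case: (v != y); case: (v != z). Qed.

Lemma linform_det (a b c : point R) al be : 0 < det a b c -> linform al be a = linform al be b ->
  linform al be b = linform al be c -> al != 0 \/ be != 0 -> False.
Proof.
rewrite /det /crossp /linform /= => h0 h1 h2.
have ha : al * (b.1 - a.1) + be * (b.2 - a.2) = 0 by lra.
have hb : al * (c.1 - a.1) + be * (c.2 - a.2) = 0 by lra.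
move: (b.1 - a.1) (b.2 - a.2) (c.1 - a.1) (c.2 - a.2) h0 ha hb => r s t u h0 ha hb.
have e1 : al * (r * u - s * t) = 0.
  transitivity ((al * r + be * s) * u - (al * t + be * u) * s); first ring.
  by rewrite ha hb !mul0r subrr.
have e2 : be * (r * u - s * t) = 0.
  transitivity ((al * t + be * u) * r - (al * r + be * s) * t); first ring.
  by rewrite ha hb !mul0r subrr.
move/eqP: e1; move/eqP: e2; rewrite !mulf_eq0 (gt_eqF h0) !orbF => /eqP -> /eqP ->.
by rewrite eqxx; case.
Qed.

(** Flatness spreads to inner neighbours: a nonflat one would have two consecutive neighbours at its
    own level, against [zero_pair]. It therefore reaches the outer triangle, whose three corners
    would be on one line. *)
Lemma no_flat al be v : al != 0 \/ be != 0 -> inner v -> nonflat E q al be v.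
Proof.
move=> ab iv.
pose fl v := [forall u, E v u ==> (linform al be (q u) == linform al be (q v))].
have flP v' u : fl v' -> E v' u -> linform al be (q u) = linform al be (q v').
  by move/forallP/(_ u)/implyP => h /h/eqP.
have nflP v' : ~~ fl v' -> nonflat E q al be v'.
  by rewrite negb_forall => /existsP[u]; rewrite negb_imply => /andP[]; exists u.
apply: (nflP v); apply/negP => flv.
pose F := [set v | inner v && fl v].
have F_in v' : v' \in F -> inner v' by rewrite inE => /andP[].
have F_cl v' u : v' \in F -> E v' u -> inner u -> u \in F.
  rewrite !inE => /andP[iv' fv] e iu; rewrite iu /=; apply: contraT => /nflP nu.
  have e' : E u v' by rewrite (tg_sym T).
  have t := next_nbr_tri T iu e'; have e2 := tg_edge T (tg_rot T t).
  exfalso; apply: (zero_pair T hull iu nu e'); first by rewrite -(flP _ _ fv e).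
  by rewrite (flP _ _ fv e2) -(flP _ _ fv e).
have [|v' [u [vF ou e]]] := outer_reached T F_in F_cl.
  by apply/set0Pn; exists v; rewrite inE iv.
have Ffl v1 u1 : v1 \in F -> E v1 u1 -> linform al be (q u1) = linform al be (q v1).
  by rewrite inE => /andP[_ /flP]; apply.
have e' : E u v' by rewrite (tg_sym T).
suff [h1 h2] : linform al be (q x) = linform al be (q y) /\ linform al be (q y) = linform al be (q z).
  exact: (@linform_det (q x) (q y) (q z) al be q_out h1 h2 ab).
have use a b c : triangulation E tri a b c p -> (forall v, inner_vertex a b c v = inner v) ->
    E b v' -> linform al be (q a) = linform al be (q b) /\ linform al be (q c) = linform al be (q b).
  move=> T' hi ebv.
  have [||[c1 c1F t1] [c2 c2F t2]] := @outer_ends _ _ _ _ _ _ _ _ T' F _ _ v' vF ebv.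
  - by move=> w /F_in; rewrite hi.
  - by move=> w w'; rewrite hi; apply: F_cl.
  have h1 := Ffl _ _ c1F (tg_edge T' (tg_rot T' t1)).
  have h2 : linform al be (q b) = linform al be (q c1).
    by apply: Ffl => //; rewrite (tg_sym T); exact: tg_edge T' _ _ _ t1.
  have h3 : linform al be (q c) = linform al be (q c2).
    by apply: Ffl => //; rewrite (tg_sym T); exact: tg_edge T' _ _ _ (tg_rot T' t2).
  have h4 := Ffl _ _ c2F (tg_edge T' (tg_rot T' (tg_rot T' t2))).
  by split; congruence.
case/outer_cases: ou e' => -> e1.
- by have [h1 h2] := use z x y T2 inner_turn2 e1; split; congruence.
- by have [h1 h2] := use x y z T (fun _ => erefl) e1; split; congruence.
by have [h1 h2] := use y z x T1 inner_turn e1; split; congruence.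
Qed.

(** In a degenerate face at [v], two consecutive neighbours are on a line through [q v]; a form
    constant along it contradicts [zero_pair]. *)
Lemma nondeg v u w : inner v -> tri v u w -> det (q v) (q u) (q w) != 0.
Proof.
move=> iv t; apply/eqP => d0.
have [D Dn [D1 D2]] : exists2 D : point R, D.1 != 0 \/ D.2 != 0 &
    crossp D (vec (q v) (q u)) = 0 /\ crossp D (vec (q v) (q w)) = 0.
  have self (d : point R) : crossp d d = 0 by rewrite /crossp; ring.
  have [e1|] := eqVneq (vec (q v) (q u)).1 0; last first.
    by exists (vec (q v) (q u)); [left | rewrite self].
  have [e2|] := eqVneq (vec (q v) (q u)).2 0; last first.
    by exists (vec (q v) (q u)); [right | rewrite self].
  have hu d : crossp d (vec (q v) (q u)) = 0 by rewrite /crossp e1 e2 !mulr0 subrr.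
  have [e3|] := eqVneq (vec (q v) (q w)).1 0; last first.
    by exists (vec (q v) (q w)); [left | rewrite self].
  have [e4|] := eqVneq (vec (q v) (q w)).2 0; last first.
    by exists (vec (q v) (q w)); [right | rewrite self].
  exists (1, 0); first by left; rewrite oner_eq0.
  by rewrite hu /crossp e3 e4 !mulr0 subrr.
have ab : - D.2 != 0 \/ D.1 != 0 by rewrite oppr_eq0; case: Dn; [right|left].
apply: (zero_pair T hull iv (no_flat ab iv) (tg_edge T t)).
  by move: D1; rewrite /crossp /linform /=; lra.
by rewrite (next_nbrP T t); move: D2; rewrite /crossp /linform /=; lra.
Qed.

(** The form constant along the common edge is level at [w]; by [zero_pos] and [zero_neg] the
    neighbours before and after [w] are on opposite sides, so both faces turn the same way. *)
Lemma turn_sign v u w t : inner v -> tri v u w -> tri v w t ->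
  (0 < det (q v) (q u) (q w)) = (0 < det (q v) (q w) (q t)).
Proof.
move=> iv t1 t2; have n1 := nondeg iv t1; have n2 := nondeg iv t2.
pose D := vec (q v) (q w).
have Dn : D.1 != 0 \/ D.2 != 0.
  case: (eqVneq D.1 0) => [e1|]; last by left.
  by right; apply: contra n2 => /eqP e2; rewrite /det -/D /crossp e1 e2 !mul0r subrr.
have ab : - D.2 != 0 \/ D.1 != 0 by rewrite oppr_eq0; case: Dn; [right|left].
have fu : linform (- D.2) D.1 (q u) - linform (- D.2) D.1 (q v) = - det (q v) (q u) (q w).
  by rewrite /D /det /crossp /linform /=; ring.
have ft : linform (- D.2) D.1 (q t) - linform (- D.2) D.1 (q v) = det (q v) (q w) (q t).
  by rewrite /D /det /crossp /linform /=; ring.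
have fw : linform (- D.2) D.1 (q w) = linform (- D.2) D.1 (q v) by rewrite /D /linform /=; ring.
have eu := tg_edge T t1; have nf := no_flat ab iv.
have hp := @zero_pos _ _ _ _ _ _ _ _ q T hull (- D.2) D.1 v u w iv nf eu (next_nbrP T t1) fw.
have hn := @zero_neg _ _ _ _ _ _ _ _ q T hull (- D.2) D.1 v u w iv nf eu (next_nbrP T t1) fw.
rewrite (next_nbrP T t2) in hp hn.
move: n1 n2 fu ft; case: (ltgtP (det (q v) (q u) (q w)) 0) => // h _;
    case: (ltgtP (det (q v) (q w) (q t)) 0) => // h' _ fu ft.
  by have := hp ltac:(lra); lra.
by have := hn ltac:(lra); lra.
Qed.

Lemma sign_all v u w u' w' : inner v -> tri v u w -> tri v u' w' ->
  0 < det (q v) (q u) (q w) -> 0 < det (q v) (q u') (q w').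
Proof.
move=> iv t t' h.
pose A := [set u in nbrs E v | 0 < det (q v) (q u) (q (nx v u))].
have : A = nbrs E v.
  apply: (link_conn T) => //; first by apply/subsetP => b; rewrite inE => /andP[].
    by apply/set0Pn; exists u; rewrite !inE (next_nbrP T t) h (tg_edge T t).
  move=> b; rewrite !inE => /andP[eb hb]; have tb := next_nbr_tri T iv eb; have eb' := tri_edge2 T tb.
  by rewrite eb' -(turn_sign iv tb (next_nbr_tri T iv eb')).
by move/setP/(_ u'); rewrite !inE (tg_edge T t') (next_nbrP T t') /=.
Qed.

(** Minimum principle for the signed distance to an outer edge: a lowest inner vertex has a strictly
    lower neighbour, which must be outer and hence not below the edge. *)
Lemma outer_edge_det a b c : triangulation E tri a b c p -> (forall v, inner_vertex a b c v = inner v) ->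
  0 < det (q a) (q b) (q c) -> forall v, inner v -> 0 <= det (q a) (q b) (q v).
Proof.
move=> T' hi qo v0 iv0; rewrite leNgt; apply/negP => h0.
pose D := vec (q a) (q b).
have fE v : linform (- D.2) D.1 (q v) - linform (- D.2) D.1 (q a) = det (q a) (q b) (q v).
  by rewrite /D /det /crossp /linform /=; ring.
have [v iv vm] := @Order.TotalTheory.arg_minP _ _ _ v0 inner (fun v => linform (- D.2) D.1 (q v)) iv0.
have ab : - D.2 != 0 \/ D.1 != 0.
  rewrite oppr_eq0; case: (eqVneq D.2 0) => [e1|]; last by left.
  by right; apply: contraTneq qo => e2; rewrite /det -/D /crossp e1 e2 !mul0r subrr ltxx.
have [w ew nw] := no_flat ab iv.
have [u eu hu] := hull_lt hull iv ew nw.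
have /= := vm v0 iv0; rewrite -(lerD2r (- linform (- D.2) D.1 (q a))) !fE => h1.
move: hu; rewrite -(ltrD2r (- linform (- D.2) D.1 (q a))) !fE => h2.
have [iu|] := boolP (inner u).
  by have /= := vm u iu; rewrite -(lerD2r (- linform (- D.2) D.1 (q a))) !fE; lra.
rewrite -hi => /outer_cases[] e; move: h2; rewrite e; first 1 last.
- by rewrite {1}/det /crossp /=; lra.
- lra.
- by rewrite {1}/det /crossp /=; lra.
Qed.

(** By [sign_all] the faces around an inner vertex are all positive or all negative, and adjacent
    inner vertices share a face. Negativity would thus spread to a face on an outer edge, where
    [outer_edge_det] forbids it. *)
Theorem tutte_floater a b c : tri a b c -> 0 < det (q a) (q b) (q c).
Proof.
pose F := [set v | inner v && [forall u, E v u ==> (det (q v) (q u) (q (nx v u)) < 0)]].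
have F_in v : v \in F -> inner v by rewrite inE => /andP[].
have toF v u w : inner v -> tri v u w -> det (q v) (q u) (q w) <= 0 -> v \in F.
  move=> iv t h; rewrite inE iv; apply/forallP => u'; apply/implyP => e'.
  have t' := next_nbr_tri T iv e'; rewrite lt_neqAle nondeg // leNgt; apply/negP => h'.
  by have := sign_all iv t' t h'; rewrite ltNge h.
have F_cl v u : v \in F -> E v u -> inner u -> u \in F.
  rewrite inE => /andP[iv /forallP/(_ u)/implyP h] e iu; have t := next_nbr_tri T iv e.
  by apply: toF iu (tg_rot T t) _; rewrite det_rot ltW // h.
have F0 : F = set0.
  apply/eqP; apply: contraT => /(outer_reached T F_in F_cl)[v [u [vF ou e]]]; exfalso.
  have e' : E u v by rewrite (tg_sym T).
  have use x' y' z' : triangulation E tri x' y' z' p -> (forall v, inner_vertex x' y' z' v = inner v) ->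
      0 < det (q x') (q y') (q z') -> E y' v -> False.
    move=> T' hi qo ebv.
    have [||[a' aF t'] _] := @outer_ends _ _ _ _ _ _ _ _ T' F _ _ v vF ebv.
    - by move=> w /F_in; rewrite hi.
    - by move=> w w'; rewrite hi; apply: F_cl.
    have ia := F_in _ aF; have := outer_edge_det T' hi qo ia.
    move: aF; rewrite inE => /andP[_ /forallP/(_ x')/implyP].
    have t2 := tg_rot T t'; rewrite (next_nbrP T t2) => /(_ (tg_edge T t2)).
    by rewrite (det_rot (q a') (q x') (q y')); lra.
  case/outer_cases: ou e' => ->; first by apply: (use z x y T2 inner_turn2); rewrite -det_rot.
    exact: (use x y z T (fun _ => erefl) q_out).
  by apply: (use y z x T1 inner_turn); rewrite det_rot.
have pos v u w : inner v -> tri v u w -> 0 < det (q v) (q u) (q w).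
  by move=> iv t; rewrite ltNge; apply/negP => /(toF _ _ _ iv t); rewrite F0 inE.
move=> t; have [ia|oa] := boolP (inner a); first exact: pos.
have [ib|ob] := boolP (inner b); first by rewrite -det_rot; apply: pos ib (tg_rot T t).
have [ic|oc] := boolP (inner c); first by rewrite det_rot; apply: pos ic (tg_rot T (tg_rot T t)).
have := tri_neq T t; have := tri_neq T (tg_rot T t); have := tri_neq T (tg_rot T (tg_rot T t)).
have := tg_pos T t; have := tg_out T.
have q1 := q_out; have q2 := q_out; rewrite -det_rot in q1; rewrite -det_rot -det_rot in q2.
case/outer_cases: oa => ->; case/outer_cases: ob => ->; case/outer_cases: oc => -> //; rewrite ?eqxx //.
all: rewrite ?(det_swap (p x) (p y)) /det /crossp /=; lra.
Qed.
End TF.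

(** * Saturated plane graphs are triangulations *)

Section Segments.
Variable R : realType.
Implicit Types (a b c d x y z : point R) (s t : R).

Definition interp a b s : point R := ((1 - s) * a.1 + s * b.1, (1 - s) * a.2 + s * b.2).
Definition open_seg a b x := exists2 s, 0 < s < 1 & x = interp a b s.

Lemma ratio_in01 (a b : R) : 0 < a -> a < b -> 0 < a / b < 1.
Proof.
by move=> a0 ab; rewrite divr_gt0 ?ltr_pdivrMr ?mul1r ?(lt_trans a0 ab).
Qed.

Lemma det_interp a b c d s : det a b (interp c d s) = (1 - s) * det a b c + s * det a b d.
Proof. by rewrite /det /crossp /=; ring. Qed.

Lemma interp_sym a b s : interp a b s = interp b a (1 - s).
Proof. by apply: pair_ext => /=; ring. Qed.

Lemma interp0 a b : interp a b 0 = a. Proof. by apply: pair_ext => /=; ring. Qed.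
Lemma interp1 a b : interp a b 1 = b. Proof. by apply: pair_ext => /=; ring. Qed.

Lemma interp_interp a b s s' t : interp (interp a b s) (interp a b s') t = interp a b ((1 - t) * s
    + t * s').
Proof. by apply: pair_ext => /=; ring. Qed.

Lemma interp_interpl a b s t : interp (interp a b s) b t = interp a b (s + t * (1 - s)).
Proof. by apply: pair_ext => /=; ring. Qed.

Lemma open_seg_sym a b x : open_seg a b x -> open_seg b a x.
Proof. by case=> s h ->; exists (1 - s); [lra | rewrite -interp_sym]. Qed.

Lemma detaa a b : det a a b = 0. Proof. by rewrite /det /crossp /=; ring. Qed.
Lemma detaba a b : det a b a = 0. Proof. by rewrite /det /crossp /=; ring. Qed.
Lemma detabb a b : det a b b = 0. Proof. by rewrite /det /crossp /=; ring. Qed.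

Lemma det0_line a b c : a != b -> det a b c = 0 -> exists s, c = interp a b s.
Proof.
move=> ab h; have {}ab : (vec a b).1 != 0 \/ (vec a b).2 != 0.
  have [e1|e1] := eqVneq (vec a b).1 0; last by left.
  right; apply: contraNneq ab => e2; apply/eqP/pair_ext; move: e1 e2; rewrite /vec /=; lra.
have p := sqnorm_gt0 ab; rewrite /vec /= in p.
pose D := (b.1 - a.1) ^+ 2 + (b.2 - a.2) ^+ 2.
have D0 : D != 0 by rewrite gt_eqF.
pose s := ((b.1 - a.1) * (c.1 - a.1) + (b.2 - a.2) * (c.2 - a.2)) / D.
exists s; have eD : s * D = (b.1 - a.1) * (c.1 - a.1) + (b.2 - a.2) * (c.2 - a.2) by rewrite divfK.
rewrite detE in h; apply: pair_ext => /=; apply: (mulIf D0).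
  rewrite mulrDl [s * _ * D]mulrAC [(1 - s) * _ * D]mulrAC mulrBl eD mul1r /D.
  have -> : c.1 * ((b.1 - a.1) ^+ 2 + (b.2 - a.2) ^+ 2) =
     a.1 * ((b.1 - a.1) ^+ 2 + (b.2 - a.2) ^+ 2) + (c.1 - a.1) * ((b.1 - a.1) ^+ 2) + (b.2 - a.2) *
         ((b.2 - a.2) * (c.1 - a.1)) by ring.
  by rewrite (_ : (b.2 - a.2) * (c.1 - a.1) = (b.1 - a.1) * (c.2 - a.2)); [ring | lra].
rewrite mulrDl [s * _ * D]mulrAC [(1 - s) * _ * D]mulrAC mulrBl eD mul1r /D.
have -> : c.2 * ((b.1 - a.1) ^+ 2 + (b.2 - a.2) ^+ 2) =
     a.2 * ((b.1 - a.1) ^+ 2 + (b.2 - a.2) ^+ 2) + (c.2 - a.2) * ((b.2 - a.2) ^+ 2) + (b.1 - a.1) *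
         ((b.1 - a.1) * (c.2 - a.2)) by ring.
by rewrite (_ : (b.1 - a.1) * (c.2 - a.2) = (b.2 - a.2) * (c.1 - a.1)); [ring | lra].
Qed.

Lemma interp_inj a b s t : a != b -> interp a b s = interp a b t -> s = t.
Proof.
move=> ab [e1 e2]; apply/eqP; rewrite -subr_eq0; apply: contraNT ab => st; apply/eqP/pair_ext.
  by apply: (mulIf st); move: e1; lra.
by apply: (mulIf st); move: e2; lra.
Qed.

(** Oblique coordinates with origin [v] and basis vectors towards [z] and [a], by Cramer's rule. *)
Definition cone_x v z a x := det v x a / det v z a.
Definition cone_y v z a x := det v z x / det v z a.

Lemma cone_coord_affine v z a x : det v z a != 0 ->
  x = (v.1 + cone_x v z a x * (z.1 - v.1) + cone_y v z a x * (a.1 - v.1),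
       v.2 + cone_x v z a x * (z.2 - v.2) + cone_y v z a x * (a.2 - v.2)).
Proof. by rewrite /cone_x /cone_y detE => D; apply: pair_ext => /=; rewrite /det /crossp /=; field. Qed.

Lemma cone_x_interp v z a x y s : cone_x v z a (interp x y s) = (1 - s) * cone_x v z a x + s *
    cone_x v z a y.
Proof. by rewrite /cone_x /det /crossp /=; ring. Qed.
Lemma cone_y_interp v z a x y s : cone_y v z a (interp x y s) = (1 - s) * cone_y v z a x + s *
    cone_y v z a y.
Proof. by rewrite /cone_y /det /crossp /=; ring. Qed.

Lemma cone_coordE v z a : det v z a != 0 ->
  [/\ cone_x v z a v = 0, cone_y v z a v = 0, cone_x v z a z = 1, cone_y v z a z = 0 &
      (cone_x v z a a = 0 /\ cone_y v z a a = 1)].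
Proof. by move=> D; rewrite /cone_x /cone_y detaba detaa !detabb !mul0r divff. Qed.

Lemma cone_coord_inj v z a x y : det v z a != 0 -> cone_x v z a x = cone_x v z a y ->
    cone_y v z a x = cone_y v z a y -> x = y.
Proof. by move=> D e1 e2; rewrite (cone_coord_affine x D) (cone_coord_affine y D) e1 e2. Qed.
End Segments.

(** Edges are compared as open segments, so common ends are allowed; the alternatives in [pl_cr] are
    the two orientations of one edge. *)
Record plane_graph (R : realType) (P : finType) (p : P -> point R) (E : rel P) : Prop := Plane {
  pl_sym : symmetric E;
  pl_irr : irreflexive E;
  pl_pt : forall a b w, E a b -> ~ open_seg (p a) (p b) (p w);
  pl_cr : forall a b c d x, E a b -> E c d -> open_seg (p a) (p b) x -> open_seg (p c) (p d) x ->
    (a, b) = (c, d) \/ (a, b) = (d, c)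
}.

Definition saturated (R : realType) (P : finType) (p : P -> point R) (E : rel P) :=
  forall a b, a != b -> (forall w, ~ open_seg (p a) (p b) (p w)) ->
    (forall c d x, E c d -> open_seg (p a) (p b) x -> ~ open_seg (p c) (p d) x) -> E a b.

(** A plane edge set of maximal cardinality is saturated: adding an admissible segment in both
    orientations would keep it plane. *)
Lemma saturate (R : realType) (P : finType) (p : P -> point R) (E0 : rel P) : plane_graph p E0 ->
  exists E : rel P, [/\ plane_graph p E, saturated p E & subrel E0 E].
Proof.
move=> pl0; pose rl (A : {set P * P}) : rel P := fun a b => (a, b) \in A.
pose Q (A : {set P * P}) := `[< plane_graph p (rl A) /\ subrel E0 (rl A) >].
have Q0 : Q [set ab | E0 ab.1 ab.2].
  apply/asboolP; split; last by move=> a b; rewrite /rl inE.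
  case: pl0 => h1 h2 h3 h4; split; rewrite /rl.
  - by move=> a b; rewrite !inE /= h1.
  - by move=> a; rewrite !inE /= h2.
  - by move=> a b w; rewrite inE; apply: h3.
  - by move=> a b c d x; rewrite !inE; apply: h4.
case: (@arg_maxnP _ _ Q (fun A => #|A|) Q0) => A /asboolP[plA subA] mx.
exists (rl A); split => // a b ab nP nE; apply: contraT => nAb; exfalso.
pose A' := (a, b) |: ((b, a) |: A).
have sA : A \subset A' by apply/subsetP => x xA; rewrite !inE xA !orbT.
have : Q A'.
  apply/asboolP; split; last by move=> x y /subA xy; apply: (subsetP sA).
  have inA' c d : rl A' c d -> [\/ (c, d) = (a, b), (c, d) = (b, a) | rl A c d].
    by rewrite /rl !inE => /or3P[/eqP|/eqP|]; [constructor 1|constructor 2|constructor 3].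
  have os c d x : (c, d) = (a, b) \/ (c, d) = (b, a) -> open_seg (p c) (p d) x -> open_seg (p a) (p b) x.
    by case=> -[-> ->] // /open_seg_sym.
  split.
  - move=> c d; rewrite /rl !inE !xpair_eqE (pl_sym plA c d : ((c, d) \in A) = ((d, c) \in A)).
    by rewrite [(d == a) && _]andbC [(d == b) && _]andbC; do 2 case: (_ && _).
  - move=> c; rewrite /rl !inE !xpair_eqE (pl_irr plA c : ((c, c) \in A) = false) orbF.
    by apply/negbTE; apply: contra ab => /orP[] /andP[/eqP <- /eqP <-].
  - move=> c d w /inA'[h|h|h]; last exact: (pl_pt plA h).
      by move=> /(os _ _ _ (or_introl h)); apply: nP.
    by move=> /(os _ _ _ (or_intror h)); apply: nP.
  have key c d c' d' x : (c, d) = (a, b) \/ (c, d) = (b, a) -> rl A' c' d' ->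
      open_seg (p c) (p d) x -> open_seg (p c') (p d') x -> (c, d) = (c', d') \/ (c, d) = (d', c').
    move=> h h' o o'; have oab := os _ _ _ h o.
    by case/inA': h' => [[-> ->]|[-> ->]|h']; [case: h => -[-> ->]; tauto..|case: (nE _ _ _ h' oab o')].
  move=> c d c' d' x h h' o o'.
  case/inA': (h) => [e|e|e]; [by apply: key h' o o'; left|by apply: key h' o o'; right|].
  case/inA': (h') => [e'|e'|e'].
  - by have [[-> ->]|[-> ->]] := key _ _ _ _ _ (or_introl e') h o' o; tauto.
  - by have [[-> ->]|[-> ->]] := key _ _ _ _ _ (or_intror e') h o' o; tauto.
  exact: (pl_cr plA e e' o o').
move/mx => /=; rewrite leqNgt => /negP[]; apply: proper_card; apply/properP; split => //.
by exists (a, b); rewrite ?inE ?eqxx.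
Qed.

(** * Angles without further neighbours close up to empty triangles *)

Section Saturated.
Variables (R : realType) (P : finType) (p : P -> point R) (E : rel P).
Hypothesis pI : injective p.
Hypothesis pl : plane_graph p E.
Hypothesis sat : saturated p E.

Let Esym a b : E a b -> E b a. Proof. by rewrite (pl_sym pl). Qed.

Lemma plane_edge_neq a b : E a b -> a != b.
Proof. by apply: contraTneq => ->; rewrite (pl_irr pl). Qed.

Lemma p_ne a b : a != b -> p a != p b.
Proof. by move=> ab; apply: contraNneq ab => /pI ->. Qed.

(** An end of one segment may not be strictly inside the other; around the common point [x] this
    leaves only equal ends. *)
Lemma collinear_same a b c d x : a != b -> c != d -> (forall w, ~ open_seg (p a) (p b) (p w)) ->
  (forall w, ~ open_seg (p c) (p d) (p w)) ->
  open_seg (p a) (p b) x -> open_seg (p c) (p d) x -> det (p a) (p b) (p c) = 0 ->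
      (a, b) = (c, d) \/ (a, b) = (d, c).
Proof.
move=> ab cd nP nP' [xi xi01 ex] [s s01 ex'] dc.
have pab := p_ne ab.
have dd : det (p a) (p b) (p d) = 0.
  have : det (p a) (p b) x = 0 by rewrite ex det_interp detaba detabb; ring.
  rewrite ex' det_interp dc mulr0 add0r => /eqP; rewrite mulf_eq0 => /orP[/eqP|/eqP//]; lra.
have [ga eg] := det0_line pab dc; have [de ed] := det0_line pab dd.
have exi : xi = (1 - s) * ga + s * de.
  by apply: (interp_inj pab); rewrite -ex ex' eg ed interp_interp.
have out (w : P) t : p w = interp (p a) (p b) t -> 0 < t -> t < 1 -> False.
  by move=> e h1 h2; apply: (nP w); exists t; rewrite ?h1.
suff key c' d' ga' de' : (forall w, ~ open_seg (p c') (p d') (p w)) ->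
    p c' = interp (p a) (p b) ga' -> p d' = interp (p a) (p b) de' ->
    ga' < xi -> xi < de' -> (a, b) = (c', d').
  have [l|l|e] := ltgtP ga de.
  - by left; apply: (key c d ga de) => //; nra.
  - by right; apply: (key d c de ga) => //; [move=> w /open_seg_sym; apply: nP' | nra | nra].
  by move: cd; rewrite (_ : c = d) ?eqxx //; apply: pI; rewrite eg ed e.
move=> e' ec' ed' l1 l2.
have g0 : ga' <= 0 by rewrite leNgt; apply/negP => h; apply: (out c' ga') => //; lra.
have d1 : 1 <= de' by rewrite leNgt; apply/negP => h; apply: (out d' de') => //; lra.
have mm t : interp (p c') (p d') t = interp (p a) (p b) ((1 - t) * ga' + t * de') by rewrite ec'
    ed' interp_interp.
have gap : 0 < de' - ga' by lra.
have [h|h] := eqVneq ga' 0; last first.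
  case: (e' a); exists (- ga' / (de' - ga')).
    have : ga' < 0 by rewrite lt_neqAle h.
    move=> hh; rewrite divr_gt0 ?ltr_pdivrMr ?mul1r //=; lra.
  rewrite mm (_ : _ + _ = 0) ?interp0 //; field; lra.
have [h'|h'] := eqVneq de' 1; last first.
  case: (e' b); exists ((1 - ga') / (de' - ga')).
    have : 1 < de' by rewrite lt_neqAle eq_sym h'.
    move=> hh; rewrite divr_gt0 ?ltr_pdivrMr ?mul1r //=; lra.
  rewrite mm (_ : _ + _ = 1) ?interp1 //; field; lra.
have -> : a = c' by apply: pI; rewrite ec' h interp0.
by have -> : b = d' by apply: pI; rewrite ed' h' interp1.
Qed.

Lemma collinear_edge a b c d x : a != b -> (forall w, ~ open_seg (p a) (p b) (p w)) -> E c d ->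
  open_seg (p a) (p b) x -> open_seg (p c) (p d) x -> det (p a) (p b) (p c) = 0 -> E a b.
Proof.
move=> ab nP ecd o o' dc.
by case: (collinear_same ab (plane_edge_neq ecd) nP (fun w => pl_pt pl ecd) o o' dc) =>
    -[-> ->] //; apply: Esym.
Qed.

Lemma edge_of_clear_seg a b : a != b -> (forall w, ~ open_seg (p a) (p b) (p w)) ->
  (forall c d x, E c d -> det (p a) (p b) (p c) != 0 -> open_seg (p a) (p b) x ->
      ~ open_seg (p c) (p d) x) -> E a b.
Proof.
move=> ab nP nE; apply: contraT => nab; exfalso; apply: (negP nab); apply: sat => // c d x e o o'.
have [d0|d0] := eqVneq (det (p a) (p b) (p c)) 0; last exact: nE e d0 o o'.
by case/negP: nab; apply: collinear_edge ab nP e o o' d0.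
Qed.

(** The part of an edge from [z] to its end [w] cannot meet the edge [b c], taken without [c], be it
    at [w], at [b] or inside both. Having [z] off the line of [b c] excludes that the two are the
    same edge. *)
Lemma ray_hit b c w w' (z : point R) s0 s be : E b c -> E w w' -> w != b ->
  z = interp (p w') (p w) s0 -> 0 < s0 < 1 -> 0 < s <= 1 -> 0 <= be < 1 ->
  interp z (p w) s = interp (p b) (p c) be -> det (p b) (p c) z != 0 -> False.
Proof.
move=> ebc eww wb ez s01 s1 be1 ey dz.
have ey' : interp z (p w) s = interp (p w') (p w) (s0 + s * (1 - s0)) by rewrite ez interp_interpl.
have eww' := Esym eww.
have [e1|n1] := eqVneq s 1.
  rewrite e1 interp1 in ey; have [b0|b0] := eqVneq be 0.
    by move: ey; rewrite b0 interp0 => /pI/eqP; apply/negP.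
  by apply: (pl_pt pl ebc (w := w)); exists be; [lra|].
have s1' : s < 1 by lra.
have o1 : open_seg (p w') (p w) (interp z (p w) s) by rewrite ey'; exists (s0 + s * (1 - s0)) => //; nra.
have [b0|b0] := eqVneq be 0.
  by move: ey o1 => ->; rewrite b0 interp0; apply: pl_pt pl _ _ _ eww'.
have o2 : open_seg (p b) (p c) (interp z (p w) s) by rewrite ey; exists be; [lra|].
by case: (pl_cr pl ebc eww' o2 o1) => -[e1 e2]; move: dz;
    rewrite ez e1 e2 det_interp ?detaba ?detabb ?mulr0 ?addr0 eqxx.
Qed.

Section Ear.
Variables b a c : P.
Hypotheses (eba : E b a) (ebc : E b c) (D : 0 < det (p b) (p a) (p c)).
Hypothesis H : forall w, E b w -> 0 < det (p b) (p w) (p c) -> 0 < det (p b) (p a) (p w) -> False.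
Local Notation X := (cone_x (p b) (p a) (p c)).
Local Notation Y := (cone_y (p b) (p a) (p c)).
Let Dn : det (p b) (p a) (p c) != 0. Proof. by rewrite gt_eqF. Qed.

Lemma on_right_ray y : X y = 0 -> y = interp (p b) (p c) (Y y).
Proof.
have [h1 h2 h3 h4 [h5 h6]] := cone_coordE Dn.
by move=> e; apply: (cone_coord_inj Dn); rewrite ?cone_x_interp ?cone_y_interp ?h1 ?h2 ?h5 ?h6 ?e; ring.
Qed.

Lemma on_left_ray y : Y y = 0 -> y = interp (p b) (p a) (X y).
Proof.
have [h1 h2 h3 h4 [h5 h6]] := cone_coordE Dn.
by move=> e; apply: (cone_coord_inj Dn); rewrite ?cone_x_interp ?cone_y_interp ?h1 ?h2 ?h3 ?h4 ?e; ring.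
Qed.

(** Followed from [z] towards [w], which is under the line [X + Y = 1] but outside the open cone,
    the edge must cross one of the two sides at [b], against [ray_hit]. Comparing [Y z * X w] with
    [X z * Y w] tells which side. *)
Lemma edge_escapes w w' z : E w w' -> w != b -> open_seg (p w) (p w') z -> 0 < X z -> 0 < Y z ->
    X z + Y z <= 1 ->
  X (p w) + Y (p w) < 1 -> (0 < X (p w) -> 0 < Y (p w) -> False) -> False.
Proof.
move=> eww wb /open_seg_sym[s0 s01 ez] xz yz lz lw nc.
case: (boolP ((X (p w) <= 0) && (Y z * X (p w) <= X z * Y (p w)))) => [/andP[xw le]|no].
  have den : 0 < X z - X (p w) by lra.
  pose s := X z / (X z - X (p w)).
  have sp : 0 < s <= 1 by rewrite /s divr_gt0 //= ler_pdivrMr // mul1r; lra.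
  have x0 : X (interp z (p w) s) = 0 by rewrite cone_x_interp /s; field; lra.
  have y0 : 0 <= Y (interp z (p w) s).
    rewrite cone_y_interp (_ : _ + _ = (X z * Y (p w) - Y z * X (p w)) / (X z - X (p w)));
        last by rewrite /s; field; lra.
    by apply: divr_ge0; lra.
  have y1 : Y (interp z (p w) s) < 1.
    have : X (interp z (p w) s) + Y (interp z (p w) s) < 1 by rewrite cone_x_interp cone_y_interp;
        move: s sp {x0 y0} => s sp; nra.
    by rewrite x0 add0r.
  apply: (ray_hit ebc eww wb ez s01 sp _ (on_right_ray x0)); first by rewrite y0.
  apply/eqP => e; move: xz; rewrite /cone_x det_swap e oppr0 mul0r ltxx //.
have yw : Y (p w) <= 0 by rewrite leNgt; apply/negP => h; move: no;
    rewrite negb_and -!ltNge => /orP[h'|h']; [exact: nc|nra].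
have le : X z * Y (p w) <= Y z * X (p w).
  by move: no; rewrite negb_and -!ltNge => /orP[h'|h']; [nra|lra].
have den : 0 < Y z - Y (p w) by lra.
pose s := Y z / (Y z - Y (p w)).
have sp : 0 < s <= 1 by rewrite /s divr_gt0 //= ler_pdivrMr // mul1r; lra.
have x0 : Y (interp z (p w) s) = 0 by rewrite cone_y_interp /s; field; lra.
have y0 : 0 <= X (interp z (p w) s).
  rewrite cone_x_interp (_ : _ + _ = (Y z * X (p w) - X z * Y (p w)) / (Y z - Y (p w)));
      last by rewrite /s; field; lra.
  by apply: divr_ge0; lra.
have y1 : X (interp z (p w) s) < 1.
  have : X (interp z (p w) s) + Y (interp z (p w) s) < 1 by rewrite cone_x_interp cone_y_interp;
      move: s sp {x0 y0} => s sp; nra.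
  by rewrite x0 addr0.
apply: (ray_hit eba eww wb ez s01 sp _ (on_left_ray x0)); first by rewrite y0.
by apply/eqP => e; move: yz; rewrite /cone_y e mul0r ltxx.
Qed.

Lemma cone_signs w : (0 < X w) = (0 < det (p b) w (p c)) /\ (0 < Y w) = (0 < det (p b) (p a) w).
Proof. by rewrite /cone_x /cone_y !pmulr_lgt0 ?invr_gt0. Qed.

(** A vertex of the triangle with least [X + Y] is visible from [b]: a blocking edge could neither
    end nor escape in the smaller triangle cut off at that level. Saturation makes it a neighbour of
    [b] inside the cone, against [H]. *)
Lemma ear_empty w : 0 < X (p w) -> 0 < Y (p w) -> X (p w) + Y (p w) <= 1 -> False.
Proof.
move=> w1 w2 w3; pose T := [pred w | [&& 0 < X (p w), 0 < Y (p w) & X (p w) + Y (p w) <= 1]].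
have wT : T w by rewrite /= w1 w2 w3.
case: (@Order.TotalTheory.arg_minP _ _ _ w T (fun w => X (p w) + Y (p w)) wT) => u /and3P[u1 u2 u3] um.
have {}um u' : 0 < X (p u') -> 0 < Y (p u') -> X (p u') + Y (p u') < X (p u) + Y (p u) -> False.
  by move=> a1 a2 a3; have := um u'; rewrite /= a1 a2 /= leNgt a3 => h; have := h (ltW (lt_le_trans a3 u3)).
have [h1 h2 h3 h4 [h5 h6]] := cone_coordE Dn.
have [c1 c2] := cone_signs (p u).
suff e : E b u by apply: (H e); rewrite -?c1 -?c2.
have bu : b != u by apply: contraTneq u1 => <-; rewrite h1 ltxx.
have ms s : X (interp (p b) (p u) s) = s * X (p u) /\ Y (interp (p b) (p u) s) = s * Y (p u).
  by rewrite cone_x_interp cone_y_interp h1 h2; split; ring.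
apply: edge_of_clear_seg => // [v [s s01 e]|f g x efg df [s s01 ex] o].
  by have [m1 m2] := ms s; apply: (um v); rewrite e ?m1 ?m2; nra.
have [m1 m2] := ms s; rewrite -ex in m1 m2.
have x1 : 0 < X x by rewrite m1; nra.
have x2 : 0 < Y x by rewrite m2; nra.
have x3 : X x + Y x < X (p u) + Y (p u) by rewrite m1 m2; nra.
have key f' g' : E f' g' -> f' != b -> open_seg (p f') (p g') x ->
    X (p f') + Y (p f') <= X x + Y x -> False.
  move=> e' n' o' le; apply: (edge_escapes e' n' o' x1 x2); [lra|lra|move=> a1 a2;
      apply: (um f') => //; lra].
have fb : f != b by apply: contraNneq df => ->; rewrite detaba.
have gb : g != b.
  apply: contraNneq df => e; have dx : det (p b) (p u) x = 0 by rewrite ex det_interp detaba detabb; ring.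
  have [t t01 ex'] := o; move: dx; rewrite ex' e det_interp detaba mulr0 addr0 => /eqP.
  by rewrite mulf_eq0 => /orP[/eqP|//]; lra.
have [t t01 ex'] := o.
have [l|l] := leP (X (p f) + Y (p f)) (X x + Y x); first exact: (key f g).
apply: (key g f) => //; [exact: Esym | exact: open_seg_sym |].
have ex1 : X x = (1 - t) * X (p f) + t * X (p g) by rewrite ex' cone_x_interp.
have ex2 : Y x = (1 - t) * Y (p f) + t * Y (p g) by rewrite ex' cone_y_interp.
rewrite leNgt; apply/negP => l'; move: l l' ex1 ex2.
move: (X x) (Y x) (X (p f)) (Y (p f)) (X (p g)) (Y (p g)) => a1 a2 a3 a4 a5 a6 l l' ex1 ex2; nra.
Qed.

Lemma ear_edge : E a c.
Proof.
have [h1 h2 h3 h4 [h5 h6]] := cone_coordE Dn.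
have ms s : X (interp (p a) (p c) s) = 1 - s /\ Y (interp (p a) (p c) s) = s.
  by rewrite cone_x_interp cone_y_interp h3 h4 h5 h6; split; ring.
have ac : a != c by apply: contraTneq D => ->; rewrite detabb ltxx.
apply: edge_of_clear_seg => // [w [s s01 e]|f g x efg df [s s01 ex] o].
  by have [m1 m2] := ms s; apply: (@ear_empty w); rewrite e ?m1 ?m2; lra.
have [m1 m2] := ms s; rewrite -ex in m1 m2.
have key f' g' : E f' g' -> open_seg (p f') (p g') x -> X (p f') + Y (p f') < 1 -> False.
  move=> e' o' le; have [fb|fb] := eqVneq f' b.
    rewrite fb in e' o'; have [t t01 ex'] := o'; move: m1 m2;
        rewrite ex' cone_x_interp cone_y_interp h1 h2 !mulr0 !add0r.
    have [c1 c2] := cone_signs (p g') => m1 m2; apply: (H e'); rewrite -?c1 -?c2.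
      by rewrite -(pmulr_rgt0 _ (_ : 0 < t)) ?m1; lra.
    by rewrite -(pmulr_rgt0 _ (_ : 0 < t)) ?m2; lra.
  apply: (edge_escapes e' fb o'); rewrite ?m1 ?m2; try lra.
  by move=> a1 a2; apply: ear_empty a1 a2 (ltW le).
have [t t01 ex'] := o.
have ex1 : 1 - s = (1 - t) * X (p f) + t * X (p g) by rewrite -m1 ex' cone_x_interp.
have ex2 : s = (1 - t) * Y (p f) + t * Y (p g) by rewrite -m2 ex' cone_y_interp.
have l1 : X (p f) + Y (p f) != 1.
  apply: contraNneq df => e;
      rewrite (_ : det _ _ _ = det (p b) (p a) (p c) - det (p b) (p f) (p c) - det (p b) (p a) (p
      f)); last first.
    by rewrite /det /crossp /=; ring.
  move: e; rewrite /cone_x /cone_y -mulrDl => e.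
  have : det (p b) (p f) (p c) + det (p b) (p a) (p f) = det (p b) (p a) (p c).
    by rewrite -[LHS](mulfVK Dn) e mul1r.
  by move=> <-; apply/eqP; ring.
have [l|l|l] := ltgtP (X (p f) + Y (p f)) 1; first exact: (key f g).
  apply: (key g f); [exact: Esym | exact: open_seg_sym |].
  rewrite ltNge; apply/negP => l'; move: l l' ex1 ex2.
  move: (X (p f)) (Y (p f)) (X (p g)) (Y (p g)) => a3 a4 a5 a6 l l' ex1 ex2; nra.
by rewrite l eqxx in l1.
Qed.

Lemma ear_closed w : 0 <= det (p b) (p w) (p c) -> 0 <= det (p b) (p a) (p w) ->
  0 <= det (p a) (p c) (p w) -> [|| w == a, w == b | w == c].
Proof.
move=> w1 w2 w3; have x0 : 0 <= X (p w) by rewrite /cone_x divr_ge0 // ltW.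
have y0 : 0 <= Y (p w) by rewrite /cone_y divr_ge0 // ltW.
have l1 : X (p w) + Y (p w) <= 1.
  rewrite /cone_x /cone_y -mulrDl ler_pdivrMr // mul1r -subr_ge0.
  by rewrite (_ : _ - _ = det (p a) (p c) (p w)) // /det /crossp /=; ring.
have [e|n] := eqVneq (X (p w)) 0.
  have := on_right_ray e; have [e'|n'] := eqVneq (Y (p w)) 0;
      first by rewrite e' interp0 => /pI ->; rewrite eqxx orbT.
  have [e2|n2] := eqVneq (Y (p w)) 1; first by rewrite e2 interp1 => /pI ->; rewrite eqxx !orbT.
  move=> ew; case: (pl_pt pl ebc (w := w)); exists (Y (p w)) => //; lra.
have [e'|n'] := eqVneq (Y (p w)) 0.
  have := on_left_ray e'; have [e2|n2] := eqVneq (X (p w)) 1;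
      first by rewrite e2 interp1 => /pI ->; rewrite eqxx.
  move=> ew; case: (pl_pt pl eba (w := w)); exists (X (p w)) => //; lra.
by case: (@ear_empty w) => //; lra.
Qed.
End Ear.

End Saturated.

(** * Visibility next to a blocking edge *)

Section Saturated.
Variables (R : realType) (P : finType) (p : P -> point R) (E : rel P).
Hypothesis pI : injective p.
Hypothesis pl : plane_graph p E.
Hypothesis sat : saturated p E.

Let Esym a b : E a b -> E b a. Proof. by rewrite (pl_sym pl). Qed.

Section Vis.
Variables (v a b : P) (z : point R).
Hypothesis eab : E a b.
Hypothesis zab : open_seg (p a) (p b) z.
Hypothesis Dn : det (p v) z (p a) != 0.
Hypothesis freeP : forall x w, open_seg (p v) z x -> p w <> x.
Hypothesis freeE : forall x c d, open_seg (p v) z x -> E c d -> ~ open_seg (p c) (p d) x.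
Local Notation X := (cone_x (p v) z (p a)).
Local Notation Y := (cone_y (p v) z (p a)).

(** Followed from [x] towards an end [f] on the side of [z] and outside the triangle, an edge would
    have to leave through the edge [a b] or the free segment [v z], and neither can be crossed. *)
Lemma visible_exit f g x : E f g -> open_seg (p f) (p g) x -> 0 <= X x -> 0 < Y x -> X x + Y x < 1 ->
  X x * Y (p f) < X (p f) * Y x -> (0 <= X (p f) -> 0 < Y (p f) -> X (p f) + Y (p f) <= 1 ->
      False) -> False.
Proof.
move=> efg ofg x1 x2 x3 gf nT.
have [h1 h2 h3 h4 [h5 h6]] := cone_coordE Dn.
have notab : (f, g) = (a, b) \/ (f, g) = (b, a) -> False.
  move=> h; have oab : open_seg (p a) (p b) x by case: h => -[<- <-] //; apply: open_seg_sym.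
  have [s s01 ez] := zab; have [t t01 ex] := oab.
  have l1 : X (p b) + Y (p b) = 1.
    have l2 : (1 - s) * X (p a) + s * X (p b) = 1 by rewrite -cone_x_interp -ez.
    have l3 : (1 - s) * Y (p a) + s * Y (p b) = 0 by rewrite -cone_y_interp -ez.
    apply: (@mulfI _ s); first by rewrite gt_eqF; lra.
    by move: l2 l3; rewrite h5 h6; lra.
  move: x3; rewrite ex cone_x_interp cone_y_interp h5 h6.
  have -> : (1 - t) * 0 + t * X (p b) + ((1 - t) * 1 + t * Y (p b)) = (1 - t) + t * (X (p b) + Y (p
      b)) by ring.
  by rewrite l1; lra.
have [t t01 ex] := open_seg_sym ofg.
have og s : 0 < s < 1 -> open_seg (p f) (p g) (interp x (p f) s).
  by move=> s01; apply: open_seg_sym; rewrite ex interp_interpl; exists (t + s * (1 - t)) => //; nra.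
have exitab s : 0 < s < 1 -> X (interp x (p f) s) + Y (interp x (p f) s) = 1 -> 0 < Y (interp x (p f) s) ->
    0 < X (interp x (p f) s) -> False.
  move=> s01 l1 y0 x0; apply: notab; apply: (pl_cr pl efg eab (og s s01)).
  have -> : interp x (p f) s = interp z (p a) (Y (interp x (p f) s)).
    by apply: (cone_coord_inj Dn);
        rewrite ?(cone_x_interp _ _ _ z) ?(cone_y_interp _ _ _ z) ?h3 ?h4 ?h5 ?h6; lra.
  have [r r01 ez] := open_seg_sym zab; apply: open_seg_sym.
  move: (Y (interp x (p f) s)) (X (interp x (p f) s)) l1 y0 x0 => a1 a2 l1 y0 x0.
  by rewrite ez interp_interpl; exists (r + a1 * (1 - r)) => //; nra.
have xs s : X (interp x (p f) s) = (1 - s) * X x + s * X (p f) by rewrite cone_x_interp.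
have ys s : Y (interp x (p f) s) = (1 - s) * Y x + s * Y (p f) by rewrite cone_y_interp.
have gs s : 0 < s -> 0 <= Y (interp x (p f) s) -> 0 < X (interp x (p f) s).
  move=> s0; rewrite xs ys => y0; rewrite -(pmulr_lgt0 _ x2).
  apply: lt_le_trans (_ : s * (X (p f) * Y x - X x * Y (p f)) <= _); first by rewrite mulr_gt0 // subr_gt0.
  rewrite -subr_ge0 (_ : _ - _ = X x * ((1 - s) * Y x + s * Y (p f))); [exact: mulr_ge0 | ring].
have exit1 : 1 < X (p f) + Y (p f) -> let s := (1 - X x - Y x) / (X (p f) + Y (p f) - X x - Y x) in
    0 < Y (interp x (p f) s) -> False.
  move=> l1 s y0; have s01 : 0 < s < 1 by apply: ratio_in01; lra.
  apply: (exitab s s01) => //; last by apply: gs; lra.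
  by rewrite xs ys /s; field; lra.
have [yf|yf] := ltP 0 (Y (p f)).
  have xf : 0 < X (p f) by rewrite -[p f](interp1 x); apply: gs; rewrite ?ltr01 // interp1 ltW.
  apply: exit1; first by rewrite ltNge; apply/negP => /(nT (ltW xf) yf).
  rewrite ys; set s := _ / _; have s01 : 0 < s < 1.
    have : 1 < X (p f) + Y (p f) by rewrite ltNge; apply/negP => /(nT (ltW xf) yf).
    by move=> ?; apply: ratio_in01; lra.
  by rewrite addr_gt0 // mulr_gt0 //; lra.
pose s1 := Y x / (Y x - Y (p f)).
have yd : 0 < Y x - Y (p f) by move: (Y x) (Y (p f)) x2 yf => a1 a2 *; lra.
have s1p : 0 < s1 <= 1.
  apply/andP; split; first exact: divr_gt0.
  by rewrite /s1 ler_pdivrMr // mul1r; move: (Y x) (Y (p f)) x2 yf => a1 a2 *; lra.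
have y1 : Y (interp x (p f) s1) = 0 by rewrite ys /s1; field; lra.
have x1p : 0 < X (interp x (p f) s1) by apply: gs; [lra | rewrite y1].
have [l1|l1] := leP (X (interp x (p f) s1)) 1; last first.
  have lf : 1 < X (p f) + Y (p f).
    rewrite ltNge; apply/negP => l; move: l1; rewrite ltNge => /negP[].
    have : X (interp x (p f) s1) + Y (interp x (p f) s1) <= 1 by rewrite xs ys;
        move: s1 s1p {y1 x1p} => s *; nra.
    by rewrite y1 addr0.
  apply: exit1 => //; set s := _ / _.
  have s01 : 0 < s < 1 by apply: ratio_in01; lra.
  have ls : (1 - s) * (X x + Y x) + s * (X (p f) + Y (p f)) = 1 by rewrite /s; field; lra.
  have ls1 : 1 < (1 - s1) * (X x + Y x) + s1 * (X (p f) + Y (p f)).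
    have -> : (1 - s1) * (X x + Y x) + s1 * (X (p f) + Y (p f)) = X (interp x (p f) s1) + Y (interp
        x (p f) s1) by rewrite xs ys; ring.
    by rewrite y1 addr0.
  have ss : s < s1 by move: s s1 ls ls1 {s01 s1p y1 x1p l1} => s s' *; nra.
  have d0 : 0 < Y x - Y (p f) by lra.
  move: ss; rewrite /s1 ltr_pdivlMr // ys => ss; lra.
have ey : interp x (p f) s1 = interp (p v) z (X (interp x (p f) s1)).
  by apply: (cone_coord_inj Dn);
      rewrite ?(cone_x_interp _ _ _ (p v)) ?(cone_y_interp _ _ _ (p v)) ?h1 ?h2 ?h3 ?h4; lra.
have [e1|n1] := eqVneq (X (interp x (p f) s1)) 1.
  rewrite e1 interp1 in ey; have [f1|m1] := eqVneq s1 1.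
    by apply: (pl_pt pl eab (w := f)); rewrite -[p f](interp1 x) -f1 ey.
  have s01 : 0 < s1 < 1 by lra.
  by apply: notab; apply: (pl_cr pl efg eab (og s1 s01)); rewrite ey.
have ovz : open_seg (p v) z (interp x (p f) s1).
  by exists (X (interp x (p f) s1)) => //; lra.
have [f1|m1] := eqVneq s1 1.
  by apply: (freeP ovz (w := f)); rewrite f1 interp1.
have s01 : 0 < s1 < 1 by lra.
exact: (freeE ovz efg (og s1 s01)).
Qed.

(** Choose the vertex of the triangle with least angle to the ray [v z], then the nearest to [v]. An
    edge blocking it would, by [visible_exit], have an end in the triangle at a smaller angle. *)
Lemma visible_vertex : exists w, [/\ E v w, 0 <= X (p w), 0 < Y (p w) & X (p w) + Y (p w) <= 1].
Proof.
have [h1 h2 h3 h4 [h5 h6]] := cone_coordE Dn.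
pose T := [pred w | [&& 0 <= X (p w), 0 < Y (p w) & X (p w) + Y (p w) <= 1]].
have aT : T a by rewrite /= h5 h6; apply/and3P; split; lra.
case: (@Order.TotalTheory.arg_maxP _ _ _ a T (fun w => X (p w) / Y (p w)) aT) => w0 w0T max0.
pose T' := [pred w | T w && (X (p w) / Y (p w) == X (p w0) / Y (p w0))].
have w0T' : T' w0 by rewrite /= eqxx andbT; exact: w0T.
case: (@Order.TotalTheory.arg_minP _ _ _ w0 T' (fun w => Y (p w)) w0T') => w /andP[wT /eqP we] min0.
have {w0 max0 T' w0T' w0T min0 we} [max0 min0] :
   (forall w', T w' -> X (p w') * Y (p w) <= X (p w) * Y (p w')) /\
   (forall w', T w' -> X (p w') * Y (p w) = X (p w) * Y (p w') -> Y (p w) <= Y (p w')).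
  have yw : 0 < Y (p w) by case/and3P: wT.
  split=> w' w'T; have yw' : 0 < Y (p w') by case/and3P: w'T.
    by have := max0 _ w'T; rewrite -we /= ler_pdivrMr // mulrAC ler_pdivlMr.
  move=> e; apply: min0; rewrite /= -we; apply/andP; split; first exact: w'T.
  by rewrite (eqr_div _ _ (lt0r_neq0 yw') (lt0r_neq0 yw)) e.
case/and3P: (wT) => w1 w2 w3; exists w; split => //.
have ms s : X (interp (p v) (p w) s) = s * X (p w) /\ Y (interp (p v) (p w) s) = s * Y (p w).
  by rewrite cone_x_interp cone_y_interp h1 h2; split; ring.
apply: (edge_of_clear_seg pI pl sat) => [|w' [s s01 e]|f g x efg df [s s01 ex] o].
- by apply: contraTneq w2 => <-; rewrite h2 ltxx.
- have [m1 m2] := ms s; rewrite -e in m1 m2.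
  have T1 : T w' by rewrite /= m1 m2; apply/and3P; split; nra.
  by have := min0 _ T1; rewrite m1 m2 => h; have := h ltac:(ring); nra.
have [m1 m2] := ms s; rewrite -ex in m1 m2.
have key f' g' : E f' g' -> open_seg (p f') (p g') x -> X x * Y (p f') < X (p f') * Y x -> False.
  move=> e' o' gt; apply: (visible_exit e' o' _ _ _ gt); rewrite ?m1 ?m2; try nra.
  move=> t1 t2 t3; have T1 : T f' by rewrite /= t1 t2 t3.
  have := max0 _ T1; move: gt; rewrite m1 m2.
  move: (X (p f')) (Y (p f')) (X (p w)) (Y (p w)) s01 => a1 a2 a3 a4 s01 l1 l2; nra.
have [t t01 ex'] := o.
have e1 : X x = (1 - t) * X (p f) + t * X (p g) by rewrite ex' cone_x_interp.
have e2 : Y x = (1 - t) * Y (p f) + t * Y (p g) by rewrite ex' cone_y_interp.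
have [l|l|l] := ltgtP (X x * Y (p f)) (X (p f) * Y x); first exact: (key f g).
  apply: (key g f); [exact: Esym | exact: open_seg_sym |].
  rewrite ltNge; apply/negP => l'.
  have h0 : (1 - t) * (X x * Y (p f) - X (p f) * Y x) + t * (X x * Y (p g) - X (p g) * Y x) = 0.
    move: (X x) (Y x) e1 e2 => a1 a2 -> ->; ring.
  have : 0 < (1 - t) * (X x * Y (p f) - X (p f) * Y x) by rewrite mulr_gt0 // subr_gt0 //; lra.
  have : 0 <= t * (X x * Y (p g) - X (p g) * Y x) by rewrite mulr_ge0 // ?subr_ge0 //; lra.
  lra.
case/negP: df; rewrite (_ : det _ _ _ = det (p v) z (p a) * (X (p w) * Y (p f) - Y (p w) * X (p
    f))); last first.
  by move: (Dn); rewrite /cone_x /cone_y /det /crossp /= => D'; field.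
have : s * (X (p w) * Y (p f) - Y (p w) * X (p f)) = 0 by move: l; rewrite m1 m2; lra.
by move/eqP; rewrite !mulf_eq0 => /orP[/eqP|->]; [lra | rewrite orbT].
Qed.
End Vis.
End Saturated.

(** * Faces of a saturated plane graph *)

Section Saturated.
Variables (R : realType) (P : finType) (p : P -> point R) (E : rel P).
Hypothesis pI : injective p.
Hypothesis pl : plane_graph p E.
Hypothesis sat : saturated p E.

Let Esym a b : E a b -> E b a. Proof. by rewrite (pl_sym pl). Qed.

(** [par] is the parameter at which an edge meets the segment to [p c]; the edge minimising it is
    the first obstacle, so the segment is free before [z]. *)
Lemma nbr_along_free_seg v c : v != c -> (forall w, ~ open_seg (p v) (p c) (p w)) ->
  E v c \/ exists a b s, let z := interp (p v) (p c) s in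
    [/\ E a b, 0 < s < 1, open_seg (p a) (p b) z, det (p v) z (p a) != 0 &
      (forall x w, open_seg (p v) z x -> p w <> x) /\
      (forall x f g, open_seg (p v) z x -> E f g -> ~ open_seg (p f) (p g) x)].
Proof.
move=> vc nP; have [|nE] := boolP (E v c); [by left | right].
have pvc := p_ne pI vc.
pose hits (f : P * P) := E f.1 f.2 /\ exists2 s, 0 < s < 1 &
    open_seg (p f.1) (p f.2) (interp (p v) (p c) s).
pose par (f : P * P) := det (p f.1) (p f.2) (p v) / (det (p f.1) (p f.2) (p v) - det (p f.1) (p f.2) (p c)).
have dne a b s : E a b -> 0 < s < 1 -> open_seg (p a) (p b) (interp (p v) (p c) s) ->
    det (p v) (p c) (p a) != 0.
  move=> e s01 o; apply: contraNneq nE => d0; apply: (collinear_edge pI pl vc nP e _ o d0).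
  by exists s.
have parE a b s : E a b -> 0 < s < 1 -> open_seg (p a) (p b) (interp (p v) (p c) s) -> s = par (a, b).
  move=> e s01 o; have dn := dne _ _ _ e s01 o; case: o => t t01 et.
  have : det (p a) (p b) (interp (p v) (p c) s) = 0 by rewrite et det_interp detaba detabb; ring.
  rewrite det_interp /par /=; set D1 := det _ _ (p v); set D2 := det _ _ (p c) => h.
  suff ne : D1 - D2 != 0.
    by apply: (mulIf ne); rewrite divfK //; move: D1 D2 h {ne} => D1 D2 h; lra.
  apply: contraNneq dn => h'; have e12 : D1 = D2 by apply/eqP; rewrite -subr_eq0 h'.
  have h2 : D2 = 0 by rewrite -h e12; ring.
  have h1 : D1 = 0 by rewrite e12.
  have [g1 e1] := det0_line (p_ne pI (plane_edge_neq pl e)) h1;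
      have [g2 e2] := det0_line (p_ne pI (plane_edge_neq pl e)) h2.
  by apply/eqP; rewrite e1 e2 /det /crossp /=; ring.
have [f0 f0h] : exists f, hits f.
  apply: contrapT => nh; apply: (negP nE); apply: (edge_of_clear_seg pI pl sat) =>
      // a b x e _ [s s01 ex] o.
  by apply: nh; exists (a, b); split => //=; exists s => //; rewrite -ex.
have f0h' : `[< hits f0 >] by apply/asboolP.
case: (@Order.TotalTheory.arg_minP _ _ _ f0 (fun f => `[< hits f >]) par f0h') =>
    -[a b] /asboolP[/= e [s s01 o]] mn.
exists a, b, s; split => //.
  have := dne _ _ _ e s01 o; apply: contraNneq.
  rewrite (_ : det _ _ _ = s * det (p v) (p c) (p a)); last by rewrite /det /crossp /=; ring.
  by move/eqP; rewrite mulf_eq0 => /orP[/eqP|/eqP->//]; lra.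
have sub x : open_seg (p v) (interp (p v) (p c) s) x -> exists2 s', 0 < s' < s & x = interp (p v) (p c) s'.
  case=> t t01 ->; exists (t * s); first by apply/andP; split; nra.
  by apply: pair_ext => /=; ring.
split=> [x w /sub[s' s01' ->] ew|x f g /sub[s' s01' ->] e' o'].
  by apply: (nP w); exists s' => //; lra.
have s01'' : 0 < s' < 1 by lra.
have h : hits (f, g) by split => //; exists s'.
have := mn (f, g); rewrite /= -(parE _ _ _ e s01 o) -(parE _ _ _ e' s01'' o') => hh.
by have := hh (introT (asboolP _) h); lra.
Qed.

(** The vertex closest to the line on its left side has no vertex between it and [v]. If an edge
    blocks the view, one of its ends is on the left as well, and [visible_vertex] finds a neighbour
    in a triangle lying on the left. *)
Lemma left_nbr v u : E v u -> (exists c, 0 < det (p v) (p u) (p c)) ->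
  exists2 w, E v w & 0 < det (p v) (p u) (p w).
Proof.
move=> evu [c0 c0l].
case: (@Order.TotalTheory.arg_minP _ _ _ c0 (fun c => 0 < det (p v) (p u) (p c)) (fun c =>
    det (p v) (p u) (p c)) c0l) => c cl mn.
have vc : v != c by apply: contraTneq cl => <-; rewrite detaba ltxx.
have [w [s s01 e]||[a [b [s [/= e s01 o d [fP fE]]]]]] := @nbr_along_free_seg v c vc.
- have dw : det (p v) (p u) (p w) = s * det (p v) (p u) (p c) by rewrite e det_interp detaba; ring.
  by have := mn w; rewrite dw => h; have := h ltac:(nra); nra.
- by exists c.
have zl : 0 < det (p v) (p u) (interp (p v) (p c) s) by rewrite det_interp detaba; nra.
suff key a' b' : E a' b' -> open_seg (p a') (p b') (interp (p v) (p c) s) ->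
    det (p v) (interp (p v) (p c) s) (p a') != 0 ->
    0 < det (p v) (p u) (p a') -> exists2 w, E v w & 0 < det (p v) (p u) (p w).
  have [t t01 et] := o.
  have [l|l] := ltP 0 (det (p v) (p u) (p a)); first exact: (key a b).
  apply: (key b a) => //; [exact: Esym | exact: open_seg_sym | |].
    apply: contraNneq d => h.
    have : det (p v) (interp (p v) (p c) s) (interp (p v) (p c) s) = 0 by rewrite detabb.
    rewrite {2}et det_interp h mulr0 addr0 => /eqP; rewrite mulf_eq0 => /orP[/eqP|/eqP->//]; lra.
  by move: zl; rewrite et det_interp; nra.
move=> e' o' d' al.
have [w [evw x0 y0 _]] := visible_vertex pI pl sat e' o' d' fP fE.
exists w => //; rewrite (cone_coord_affine (p w) d') (_ : det _ _ _ = cone_x (p v) (interp (p v) (p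
    c) s) (p a') (p w) * det (p v) (p u) (interp (p v) (p c) s) + cone_y (p v) (interp (p v) (p c)
    s) (p a') (p w) * det (p v) (p u) (p a')); last first.
  by rewrite [LHS]/det /crossp /= [det (p v) (p u) _]/det [det (p v) (p u) (p a')]/det /crossp /=; ring.
by apply: ltr_wpDl; [apply: mulr_ge0 => //; exact: ltW | apply: mulr_gt0].
Qed.

(** Emptiness is asked of vertices only; [cone_empty] deduces that no edge at a corner enters the
    cone of the face. *)
Definition face a b c := [&& E a b, E b c, E c a, 0 < det (p a) (p b) (p c) &
  [forall w, [&& 0 <= det (p a) (p b) (p w), 0 <= det (p b) (p c) (p w) & 0 <= det (p c) (p a) (p w)]
     ==> [|| w == a, w == b | w == c]]].

(** For the angularly first neighbour [w] on the left, no neighbour of [v] is strictly between, so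
    [ear_edge] and [ear_closed] apply. *)
Lemma face_of_edge v u : E v u -> (exists c, 0 < det (p v) (p u) (p c)) -> exists w, face v u w.
Proof.
move=> evu /(left_nbr evu)[w0 e0 l0].
have [||w] := @angle_first _ P (fun w => vec (p v) (p w)) (vec (p v) (p u)) [set w | E v w &
    0 < det (p v) (p u) (p w)].
- by apply/set0Pn; exists w0; rewrite inE e0.
- by move=> w; rewrite inE => /andP[].
rewrite inE => /andP[evw lw] first; exists w.
have H n : E v n -> 0 < det (p v) (p n) (p w) -> 0 < det (p v) (p u) (p n) -> False.
  move=> e h1 h2; have := first n; rewrite inE e h2 => /(_ isT); rewrite -/(det _ _ _).
  by rewrite det_swap; lra.
have euw := ear_edge pI pl sat evu evw lw H.
rewrite /face evu euw Esym //= lw /=; apply/forallP => n; apply/implyP => /and3P[n1 n2 n3].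
have := ear_closed pI pl sat evu evw lw H (w := n); rewrite orbCA; apply => //.
by rewrite (det_rot (p w)).
Qed.

Lemma face_rot a b c : face a b c -> face b c a.
Proof.
case/and5P=> h1 h2 h3 h4 /forallP h5; apply/and5P; split => //; first by rewrite det_rot.
apply/forallP => w; apply/implyP => /and3P[k1 k2 k3].
by have := h5 w; rewrite k1 k2 k3 => /or3P[] ->; rewrite ?orbT.
Qed.

(** A neighbour [n] inside the closed triangle contradicts its emptiness; one beyond the side [u w]
    makes the edge [v n] cross that side, at coordinates [X / (X + Y)] and [Y / (X + Y)]. *)
Lemma cone_empty v u w n : face v u w -> E v n -> 0 < det (p v) (p u) (p n) ->
    0 < det (p v) (p n) (p w) -> False.
Proof.
case/and5P=> e1 e2 e3 D /forallP em en n1 n2.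
have Dn : det (p v) (p u) (p w) != 0 by rewrite gt_eqF.
have x0 : 0 < cone_x (p v) (p u) (p w) (p n) by apply: divr_gt0.
have y0 : 0 < cone_y (p v) (p u) (p w) (p n) by apply: divr_gt0.
have [h1 h2 h3 h4 [h5 h6]] := cone_coordE Dn.
have [l|l] := leP (cone_x (p v) (p u) (p w) (p n) + cone_y (p v) (p u) (p w) (p n)) 1.
  have := em n; rewrite (ltW n1) /= (_ : 0 <= det (p u) (p w) (p n)); last first.
    rewrite (_ : det _ _ _ = det (p v) (p u) (p w) - det (p v) (p n) (p w) - det (p v) (p u) (p
        n)); last first.
      by rewrite /det /crossp /=; ring.
    by move: l; rewrite /cone_x /cone_y -mulrDl ler_pdivrMr // mul1r; lra.
  rewrite -(det_rot (p w) (p v) (p n)) (ltW n2) /= => /or3P[]/eqP e; move: n1 n2;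
      rewrite e ?detaba ?detabb ltxx //.
set X := cone_x _ _ _ _ in x0 l *; set Y := cone_y _ _ _ _ in y0 l *.
have ey : interp (p v) (p n) (X + Y)^-1 = interp (p u) (p w) (Y / (X + Y)).
  apply: (cone_coord_inj Dn).
    by rewrite !cone_x_interp h1 h3 h5 -/X; field; lra.
  by rewrite !cone_y_interp h2 h4 h6 -/Y; field; lra.
have o1 : open_seg (p v) (p n) (interp (p v) (p n) (X + Y)^-1).
  by exists (X + Y)^-1 => //; rewrite invr_gt0 invf_lt1; lra.
have o2 : open_seg (p u) (p w) (interp (p v) (p n) (X + Y)^-1).
  by rewrite ey; exists (Y / (X + Y)) => //; apply: ratio_in01; lra.
by case: (pl_cr pl en e2 o1 o2) => -[e _]; move: D; rewrite e ?detaa ?detaba ltxx.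
Qed.

Lemma face_cone v u w u' w' d : face v u w -> face v u' w' ->
  0 <= crossp (vec (p v) (p u)) d -> 0 < crossp d (vec (p v) (p w)) ->
  0 <= crossp (vec (p v) (p u')) d -> 0 < crossp d (vec (p v) (p w')) -> u = u'.
Proof.
move=> f f' d1 d2 d1' d2'.
have [e1 _ _ D _] := and5P f; have [e1' _ _ D' _] := and5P f'.
have key a b c : 0 <= crossp a d -> 0 < crossp d c -> 0 < crossp a b -> 0 < crossp a c ->
    0 <= crossp b d -> 0 < crossp b c.
  move=> k1 k2 k3 k4 k5; have := crossp_plucker a b c d.
  have : 0 < crossp a b * crossp d c by apply: mulr_gt0.
  have : 0 <= crossp a c * crossp b d by apply: mulr_ge0; first exact: ltW.
  rewrite (crosspC c d) mulrN => h1 h2 h3.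
  have : 0 < crossp b c * crossp a d by lra.
  move=> h; have : 0 < crossp a d by rewrite lt_neqAle k1 andbT eq_sym; apply: contraTneq h => ->;
      rewrite mulr0 ltxx.
  by move=> k; rewrite -(pmulr_lgt0 _ k).
have [l|l|l] := ltgtP (det (p v) (p u) (p u')) 0.
- have l' : 0 < det (p v) (p u') (p u) by rewrite det_swap; lra.
  by case: (cone_empty f' e1 l'); apply: (key _ _ _ d1' d2' l' D' d1).
- by case: (cone_empty f e1' l); apply: (key _ _ _ d1 d2 l D d1').
have vu := p_ne pI (plane_edge_neq pl e1).
have [s es] := det0_line vu l.
have vs : vec (p v) (p u') = (s * (vec (p v) (p u)).1, s * (vec (p v) (p u)).2).
  by rewrite es; apply: pair_ext => /=; ring.
have cs y : crossp (vec (p v) (p u')) y = s * crossp (vec (p v) (p u)) y by rewrite vs /crossp /=; ring.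
have s0 : 0 < s.
  rewrite ltNge; apply/negP => sle.
  have D1 : 0 < s * crossp (vec (p v) (p u)) (vec (p v) (p w')) by rewrite -cs.
  have sn : s < 0 by rewrite lt_neqAle sle andbT; apply: contraTneq D1 => ->; rewrite mul0r ltxx.
  have ud : crossp (vec (p v) (p u)) d = 0.
    apply/eqP; rewrite eq_le d1 andbT; move: d1'; rewrite cs nmulr_rge0 //.
  have := crossp_plucker (vec (p v) (p u)) d (vec (p v) (p w)) (vec (p v) (p w')).
  rewrite ud mul0r addr0 => h; rewrite nmulr_rgt0 // in D1.
  have h1 : 0 < crossp (vec (p v) (p u)) (vec (p v) (p w)) * crossp d (vec (p v) (p w')) by apply: mulr_gt0.
  by rewrite h pmulr_rgt0 // in h1; lra.
have [s1|s1|s1] := ltgtP s 1.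
- by case: (pl_pt pl e1 (w := u')); exists s; rewrite ?s0.
- case: (pl_pt pl e1' (w := u)); exists s^-1; first by rewrite invr_gt0 s0 invf_lt1.
  by rewrite es; apply: pair_ext => /=; field; lra.
by apply: pI; rewrite es s1 interp1.
Qed.

Variables x y z : P.
Hypothesis outer_pos : 0 < det (p x) (p y) (p z).
Hypothesis outer_edges : [/\ E x y, E y z & E z x].
Hypothesis inner_strict : forall v, [&& v != x, v != y & v != z] ->
    [/\ 0 < det (p x) (p y) (p v), 0 < det (p y) (p z) (p v) & 0 < det (p z) (p x) (p v)].

Theorem sat_triangulation : triangulation E face x y z p.
Proof.
split => //.
- exact: face_rot.
- move=> a b c c' f f'; have g := face_rot f; have g' := face_rot f'.
  have [_ _ _ D _] := and5P f; have [_ _ _ D' _] := and5P f'.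
  rewrite -det_rot in D; rewrite -det_rot in D'.
  have [l|l] := leP 0 (crossp (vec (p b) (p c)) (vec (p b) (p c'))).
    by apply: (face_cone g g' (d := vec (p b) (p c'))) => //; rewrite /crossp mulrC subrr.
  apply: (face_cone g g' (d := vec (p b) (p c))) => //; first by rewrite /crossp mulrC subrr.
  by rewrite crosspC; lra.
- by move=> a b c /and5P[].
- exact: pl_sym pl.
- by move=> a b c /and5P[].
- move=> a b e n1 n2 n3; apply: (face_of_edge e); apply: contrapT => nl.
  have le c : det (p a) (p b) (p c) <= 0 by rewrite leNgt; apply/negP => h; apply: nl; exists c.
  have pab := p_ne pI (plane_edge_neq pl e).
  (* All vertices are on or to the right of the line of [a b]. If [v] on it were strictly inside the
     outer triangle, the positive barycentric weights in [combo] would force all three outer corners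
     onto that line. *)
  have outer v : det (p a) (p b) (p v) = 0 -> [|| v == x, v == y | v == z].
    move=> dv; apply: contraT; rewrite !negb_or => /inner_strict[i1 i2 i3]; exfalso.
    have combo : det (p x) (p y) (p z) * det (p a) (p b) (p v) = det (p y) (p z) (p v) * det (p a)
        (p b) (p x) +
      (det (p z) (p x) (p v) * det (p a) (p b) (p y) + det (p x) (p y) (p v) * det (p a) (p b) (p z)).
      by rewrite /det /crossp /=; ring.
    have c1 : det (p y) (p z) (p v) * det (p a) (p b) (p x) <= 0 by rewrite pmulr_rle0.
    have c2 : det (p z) (p x) (p v) * det (p a) (p b) (p y) <= 0 by rewrite pmulr_rle0.
    have c3 : det (p x) (p y) (p v) * det (p a) (p b) (p z) <= 0 by rewrite pmulr_rle0.
    rewrite dv mulr0 in combo.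
    have z0 (r k : R) : 0 < r -> r * k = 0 -> k = 0.
      by move=> r0 /eqP; rewrite mulf_eq0 gt_eqF //= => /eqP.
    have [s1 e1] : exists s, p x = interp (p a) (p b) s by apply: det0_line => //; apply: z0 i2 _; lra.
    have [s2 e2] : exists s, p y = interp (p a) (p b) s by apply: det0_line => //; apply: z0 i3 _; lra.
    have [s3 e3] : exists s, p z = interp (p a) (p b) s by apply: det0_line => //; apply: z0 i1 _; lra.
    have := outer_pos; rewrite e1 e2 e3 (_ : det _ _ _ = 0) ?ltxx // /det /crossp /=; ring.
  have oa : [|| a == x, a == y | a == z] by apply: outer; rewrite detaba.
  have ob : [|| b == x, b == y | b == z] by apply: outer; rewrite detabb.
  have o2 : 0 < det (p y) (p z) (p x) by rewrite det_rot.
  have o3 : 0 < det (p z) (p x) (p y) by rewrite (det_rot (p y)).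
  have := plane_edge_neq pl e; have := outer_pos; move: o2 o3.
  have := le x; have := le y; have := le z; move: n1 n2 n3.
  by case/or3P: oa => /eqP ->; case/or3P: ob => /eqP ->; rewrite ?eqxx // => _ _ _; lra.
- move=> v iv; have [vx _ _] := and3P iv.
(* The segment to the nearest vertex contains no vertex; it is an edge, or its first obstacle yields
   a visible neighbour. *)
pose dist c := ((p c).1 - (p v).1) ^+ 2 + ((p c).2 - (p v).2) ^+ 2.
have xv : x != v by rewrite eq_sym.
case: (@Order.TotalTheory.arg_minP _ _ _ x (fun c => c != v) dist xv) => c cv mn.
have [|w [s s01 ew]|e|[a [b [s [e s01 o d [fP fE]]]]]] := @nbr_along_free_seg v c;
    [by rewrite eq_sym| |by exists c|].
  have dw : dist w = s ^+ 2 * dist c by rewrite /dist ew /=; ring.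
  have wv : w != v.
    apply: contraTneq s01 => e; move: ew; rewrite e -{1}(interp0 (p v) (p c)) => /(interp_inj _) <-.
      by rewrite ltxx.
    by rewrite p_ne // eq_sym.
  have dc : 0 < dist c.
    apply: (@sqnorm_gt0 _ (vec (p v) (p c))).
    have [e1|] := eqVneq ((p c).1 - (p v).1) 0; last by left.
    right; apply: contraNneq cv => e2; apply/eqP/pI/pair_ext; rewrite /vec /= in e2; lra.
  have := mn w wv; rewrite dw leNgt => /negP[]; rewrite gtr_pMl // expr2; nra.
by have [w [ew _ _ _]] := visible_vertex pI pl sat e o d fP fE; exists w.
exact: face_cone.
Qed.
End Saturated.

(** * The linear system on the walks *)

Section Linear.
Variables (R : realType) (B : finType).

Lemma inj_linear_solve (A : B -> B -> R) :
  (forall x : B -> R, (forall b, \sum_b' A b b' * x b' = 0) -> forall b, x b = 0) ->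
  forall s : B -> R, exists x : B -> R, forall b, \sum_b' A b b' * x b' = s b.
Proof.
move=> inj s.
pose M : 'M[R]_#|B| := \matrix_(i, j) A (enum_val j) (enum_val i).
have mulE (v : 'rV[R]_#|B|) b :
    (v *m M) 0 (enum_rank b) = \sum_b' A b b' * v 0 (enum_rank b').
  rewrite mxE [RHS](reindex _ (onW_bij _ (@enum_val_bij B))) /=.
  by apply: eq_bigr => i _; rewrite mxE enum_rankK enum_valK mulrC.
have Mu : M \in unitmx.
  rewrite -row_free_unit -kermx_eq0; apply/rowV0P => v /sub_kermxP v0.
  apply/rowP => i; rewrite mxE -[i]enum_valK.
  apply: (inj (fun b => v 0 (enum_rank b))) => b.
  by rewrite -mulE v0 mxE.
exists (fun b => ((\row_i s (enum_val i)) *m invmx M) 0 (enum_rank b)) => b.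
by rewrite -mulE mulmxKV // mxE enum_rankK.
Qed.

Variables (W : B -> R) (Pm : B -> B -> R).
Hypothesis P_ge0 : forall b b', 0 <= Pm b b'.
Hypothesis P_le : forall (X : {set B}) b', b' \in X -> \sum_(b in X) Pm b b' <= W b'.
Hypothesis P_lt : forall X : {set B}, X != set0 ->
  exists2 b', b' \in X & \sum_(b in X) Pm b b' < W b'.

(** Sum the inequalities over the set [X] of negative entries and group by columns: columns in [X]
    contribute a negative entry times a nonnegative excess, positive at least once, and the other
    columns contribute nothing positive. *)
Lemma mmatrix_nonneg x : (forall b, 0 <= W b * x b - \sum_b' Pm b b' * x b') -> forall b, 0 <= x b.
Proof.
move=> hx b0; rewrite leNgt; apply/negP => xb0.
pose X := [set b | x b < 0].
have [|b1 b1X lt1] := P_lt (X := X); first by apply/set0Pn; exists b0; rewrite inE.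
have : 0 <= \sum_(b in X) (W b * x b - \sum_b' Pm b b' * x b') by apply: sumr_ge0 => b _.
rewrite leNgt => /negP[].
have -> : \sum_(b in X) (W b * x b - \sum_b' Pm b b' * x b') =
   \sum_(b in X) x b * (W b - \sum_(a in X) Pm a b) - \sum_(b | b \notin X) x b * \sum_(a in X) Pm a b.
  rewrite big_split /= sumrN exchange_big /= [X in _ - X](bigID (mem X)) /= opprD addrA.
  congr (_ - _); last by apply: eq_bigr => b _; rewrite mulr_sumr; apply: eq_bigr => a _; rewrite mulrC.
  rewrite -sumrB; apply: eq_bigr => b _.
  by rewrite mulrBr mulr_sumr [W b * _]mulrC; congr (_ - _); apply: eq_bigr => a _; rewrite mulrC.
rewrite subr_lt0; apply: (@lt_le_trans _ _ 0); last first.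
  apply: sumr_ge0 => b; rewrite inE -leNgt => xb; apply: mulr_ge0 => //; exact: sumr_ge0.
rewrite (bigD1 b1) //= -[ltRHS]addr0; apply: ltr_leD.
  by rewrite nmulr_rlt0 ?subr_gt0 //; move: b1X; rewrite inE.
by apply: sumr_le0 => b /andP[bX _]; rewrite nmulr_rle0 ?subr_ge0 ?P_le //; move: bX; rewrite inE.
Qed.

Lemma mmatrix_solve s : exists x : B -> R, forall b, W b * x b - \sum_b' Pm b b' * x b' = s b.
Proof.
pose A b b' := (if b' == b then W b else 0) - Pm b b'.
have AE x b : \sum_b' A b b' * x b' = W b * x b - \sum_b' Pm b b' * x b'.
  rewrite /A; under eq_bigr do rewrite mulrBl; rewrite sumrB; congr (_ - _).
  rewrite (bigD1 b) //= eqxx big1 ?addr0 // => i /negbTE ->; exact: mul0r.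
have [|x hx] := @inj_linear_solve A _ s; last by exists x => b; rewrite -AE.
move=> x x0 b; apply/eqP; rewrite eq_le; apply/andP; split; last first.
  by apply: mmatrix_nonneg => c; rewrite -AE x0.
rewrite -oppr_ge0; apply: (mmatrix_nonneg (x := fun b => - x b)) => c.
rewrite mulrN; under eq_bigr do rewrite mulrN; rewrite sumrN opprK addrC -opprB -AE x0.
by rewrite oppr0.
Qed.
End Linear.

(** * Walks and their laminar blocks *)

Section Walks.
Variables (R : realType) (V : eqType).
Variables (K : bool -> nat) (u : bool -> nat -> V) (t t0 : bool -> nat -> R).

(* [u s] is the closed walk on side [s]: at each transition either its vertex changes (a step) or the
   axis point it sees moves up (a gap), from old height [t0 s i] and prescribed height [t s i]. *)
Definition is_step s i := u s i != u s i.+1.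

Record walks : Prop := Walks {
  wk_step : forall s i, (i < K s)%N -> is_step s i -> t s i.+1 = t s i /\ t0 s i.+1 = t0 s i;
  wk_gap : forall s i, (i < K s)%N -> ~~ is_step s i -> t s i < t s i.+1 /\ t0 s i < t0 s i.+1;
  wk_nc : forall s i j k l, (i < j)%N -> (j < k)%N -> (k < l)%N -> (l <= K s)%N ->
    u s i = u s k -> u s j = u s l -> u s i = u s j;
  wk_root : forall s, u s 0%N = u s (K s)
}.
Hypothesis Wk : walks.

Definition walk_bound := (maxn (K false) (K true)).+1.
(* A block [(s, lo, hi)] consists of two consecutive visits of one vertex, with another vertex between;
   [wk_nc] makes the blocks laminar. *)
Definition is_blk (b : bool * 'I_walk_bound * 'I_walk_bound) :=
  [&& (b.2 <= K b.1.1)%N, (b.1.2.+1 < b.2)%N, u b.1.1 b.1.2 == u b.1.1 b.2 &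
   [forall k : 'I_walk_bound, (b.1.2 < k < b.2)%N ==> (u b.1.1 k != u b.1.1 b.1.2)]].
Definition blk := {b | is_blk b}.
Definition sd (b : blk) := (val b).1.1.
Definition lo (b : blk) : nat := (val b).1.2.
Definition hi (b : blk) : nat := (val b).2.

Lemma ltKb s i : (i <= K s)%N -> (i < walk_bound)%N.
Proof. by rewrite /walk_bound ltnS leq_max; case: s => ->; rewrite ?orbT. Qed.

Lemma blkP b : [/\ (hi b <= K (sd b))%N, ((lo b).+1 < hi b)%N, u (sd b) (lo b) = u (sd b) (hi b) &
  forall k, (lo b < k < hi b)%N -> u (sd b) k != u (sd b) (lo b)].
Proof.
case: b => b hb; rewrite /hi /lo /sd /=; case/and4P: hb => h1 h2 /eqP h3 /forallP h4; split=> // k hk.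
have kb : (k < walk_bound)%N by apply: (@ltKb b.1.1); lia.
by have := h4 (Ordinal kb); rewrite /= hk.
Qed.

Lemma blk_mk s p q : (q <= K s)%N -> (p.+1 < q)%N -> u s p = u s q ->
  (forall k, (p < k < q)%N -> u s k != u s p) -> exists b : blk, [/\ sd b = s, lo b = p & hi b = q].
Proof.
move=> qK pq e h; have pb : (p < walk_bound)%N by apply: (@ltKb s); lia.
have hb : is_blk (s, Ordinal pb, Ordinal (ltKb qK)).
  by apply/and4P; split => //=; [apply/eqP | apply/forallP => k; apply/implyP => /h].
by exists (Sub (s, Ordinal pb, Ordinal (ltKb qK)) hb : blk).
Qed.

Lemma blk_eq b b' : sd b = sd b' -> lo b = lo b' -> hi b = hi b' -> b = b'.
Proof.
move=> h1 h2 h3; apply: val_inj; move: h1 h2 h3; rewrite /sd /lo /hi.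
by case: (val b) (val b') => [[s p] q] [[s' p'] q'] /= -> /val_inj -> /val_inj ->.
Qed.

Lemma blk_lo_inj b b' : sd b = sd b' -> lo b = lo b' -> b = b'.
Proof.
move=> hs hl; apply: blk_eq => //; have [_ h1 h2 h3] := blkP b; have [_ h1' h2' h3'] := blkP b'.
rewrite -hs -hl in h1' h2' h3'.
case: (ltngtP (hi b) (hi b')) => // h; first by have := h3' (hi b); rewrite h2 eqxx; lia.
by have := h3 (hi b'); rewrite h2' eqxx; lia.
Qed.

Lemma blk_hi_inj b b' : sd b = sd b' -> hi b = hi b' -> b = b'.
Proof.
move=> hs hl; apply: blk_eq => //; have [_ h1 h2 h3] := blkP b; have [_ h1' h2' h3'] := blkP b'.
rewrite -hs -hl in h1' h2' h3'.
case: (ltngtP (lo b) (lo b')) => // h; first by have := h3 (lo b'); rewrite h2' h2 eqxx; lia.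
by have := h3' (lo b); rewrite h2 h2' eqxx; lia.
Qed.

Lemma step_lo b : is_step (sd b) (lo b).
Proof. by have [_ h1 _ h3] := blkP b; rewrite /is_step eq_sym h3 // leqnn. Qed.

Definition inside b s i := (sd b == s) && (lo b < i < hi b)%N.
Definition covers b s i := (sd b == s) && (lo b <= i < hi b)%N.
Definition nested b' b := [&& sd b' == sd b, (lo b <= lo b')%N & (hi b' <= hi b)%N].

Lemma covers_nested b b' s i : covers b' s i -> nested b' b -> covers b s i.
Proof. by rewrite /covers /nested => /andP[/eqP <- h] /and3P[/eqP <- ? ?]; rewrite eqxx; lia. Qed.

Lemma nested_anti b b' : nested b b' -> nested b' b -> b = b'.
Proof. by case/and3P=> /eqP e ? ?; case/and3P=> _ ? ?; apply: blk_lo_inj => //; lia. Qed.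

(** Crossing blocks would make their two vertices alternate along the walk; [wk_nc] identifies them,
    and the vertex of a block would recur strictly inside it. *)
Lemma laminar b b' s i : covers b s i -> covers b' s i -> nested b b' || nested b' b.
Proof.
move=> /andP[/eqP e h] /andP[/eqP e' h']; rewrite /nested e e' eqxx /=.
have [k1 k2 k3 k4] := blkP b; have [k1' k2' k3' k4'] := blkP b'.
rewrite ?e ?e' in k1 k2 k3 k4 k1' k2' k3' k4'.
case: (ltngtP (lo b) (lo b')) => l /=; last 1 first.
- by have -> := blk_lo_inj (etrans e (esym e')) l; rewrite leqnn.
- rewrite leqNgt; apply/negP => hh.
  have := wk_nc Wk (s := s) l (j := lo b') (k := hi b) (l := hi b');
      rewrite k3 k3' => /(_ _ _ k1' erefl erefl).
  have le : (lo b' < hi b)%N by lia.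
  by move=> /(_ le hh) ee; have := k4 (lo b'); rewrite k3 k3' ee eqxx l le => /(_ isT).
rewrite orbF leqNgt; apply/negP => hh.
have := wk_nc Wk (s := s) l (j := lo b) (k := hi b') (l := hi b); rewrite k3 k3' => /(_ _ _ k1 erefl erefl).
have le : (lo b < hi b')%N by lia.
by move=> /(_ le hh) ee; have := k4' (lo b); rewrite k3 k3' ee eqxx l le => /(_ isT).
Qed.

Definition innermost b s i := [&& covers b s i, is_step s i & [forall b', covers b' s i ==> nested b b']].

Lemma innermost_covers b s i : innermost b s i -> covers b s i. Proof. by case/and3P. Qed.

Lemma innermost_nested b b' s i : innermost b s i -> covers b' s i -> nested b b'.
Proof. by case/and3P=> _ _ /forallP/(_ b')/implyP; apply. Qed.

Lemma innermost_uniq b b' s i : innermost b s i -> innermost b' s i -> b = b'.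
Proof. by move=> h h'; apply: nested_anti; [apply: innermost_nested h (innermost_covers h') |
    apply: innermost_nested h' (innermost_covers h)]. Qed.

(** The walk is closed, so the last visit of the root up to [i] and the first one after [i] bound a
    block around the step. *)
Lemma covers_ex s i : (i < K s)%N -> is_step s i -> exists b, covers b s i.
Proof.
move=> iK st.
have ex1 : exists p, (p <= i)%N && (u s p == u s 0%N) by exists 0%N; rewrite eqxx.
have ex2 : exists q, (i < q)%N && (u s q == u s 0%N) by exists (K s); rewrite iK -(wk_root Wk) eqxx.
have ub p : (p <= i)%N && (u s p == u s 0%N) -> (p <= i)%N by case/andP.
case: (ex_maxnP ex1 ub) => p /andP[pi /eqP up] pm; case: (ex_minnP ex2) => q /andP[iq /eqP uq] qm.
have qK : (q <= K s)%N by apply: qm; rewrite iK -(wk_root Wk) eqxx.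
have [|||b [b1 b2 b3]] := @blk_mk s p q qK; last by exists b; rewrite /covers b1 b2 b3 eqxx pi.
- rewrite ltn_neqAle (leq_ltn_trans pi iq) andbT; apply: contraNneq st => e.
  by rewrite (_ : i = p) ?e ?up ?uq //; lia.
- by rewrite up uq.
- move=> k /andP[pk kq]; rewrite up; apply/negP => uk.
  case: (leqP k i) => ki; first by have := pm k; rewrite ki uk => /(_ isT); lia.
  by have := qm k; rewrite ki uk => /(_ isT); lia.
Qed.

Lemma innermost_ex s i : (i < K s)%N -> is_step s i -> exists b, innermost b s i.
Proof.
move=> iK st; have [b0 c0] := covers_ex iK st.
case: (@arg_minnP _ b0 (fun b => covers b s i) (fun b => hi b - lo b)%N c0) => b cb bm.
exists b; apply/and3P; split => //; apply/forallP => b'; apply/implyP => cb'.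
have /orP[//|/and3P[/eqP e h1 h2]] := laminar cb cb'.
by have := bm _ cb'; rewrite /nested e eqxx; have [_ ? _ _] := blkP b'; have [_ ? _ _] := blkP b; lia.
Qed.

(** A visit outside the block would alternate with its two ends. Hence the set of blocks strictly
    around a visit depends only on the vertex, which makes [Ys] a function of the vertex. *)
Lemma inside_vertex b s i j : (i <= K s)%N -> (j <= K s)%N -> u s i = u s j -> inside b s i -> inside b s j.
Proof.
move=> iK jK e /andP[/eqP es h]; have [k1 k2 k3 k4] := blkP b; rewrite es in k1 k2 k3 k4.
rewrite /inside es eqxx /=; have hi' := k4 _ h; rewrite e in hi'.
apply: contraT; rewrite negb_and -!leqNgt => /orP[] hj; exfalso.
  have lj : (j < lo b)%N by rewrite ltn_neqAle hj andbT; apply: contraNneq hi' => ->.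
  have /andP[h1 h2] := h.
  have := wk_nc Wk lj h1 h2 k1; rewrite e => /(_ erefl k3) ej.
  by rewrite ej eqxx in hi'.
have lj : (hi b < j)%N by rewrite ltn_neqAle hj andbT; apply: contraNneq hi' => <-; rewrite k3.
have /andP[h1 h2] := h.
have := wk_nc Wk h1 h2 lj jK k3 e => ej; by rewrite -e -ej eqxx in hi'.
Qed.

Definition wsum (f : bool -> nat -> R) := \sum_s \sum_(0 <= i < K s) f s i.

Lemma eq_wsum f g : (forall s i, (i < K s)%N -> f s i = g s i) -> wsum f = wsum g.
Proof. by move=> h; apply: eq_bigr => s _; apply: eq_big_nat => i /andP[_]; apply: h. Qed.

Lemma le_wsum f g : (forall s i, (i < K s)%N -> f s i <= g s i) -> wsum f <= wsum g.
Proof. by move=> h; apply: ler_sum => s _; apply: ler_sum_nat => i /andP[_]; apply: h. Qed.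

Lemma wsum_add f g : wsum (fun s i => f s i + g s i) = wsum f + wsum g.
Proof. by rewrite -big_split; apply: eq_bigr => s _; rewrite big_split. Qed.

Lemma wsum_opp f : wsum (fun s i => - f s i) = - wsum f.
Proof. by rewrite /wsum -sumrN; apply: eq_bigr => s _; rewrite sumrN. Qed.

Lemma wsum_sub f g : wsum (fun s i => f s i - g s i) = wsum f - wsum g.
Proof. by rewrite wsum_add wsum_opp. Qed.

Lemma wsum_mull c f : wsum (fun s i => c * f s i) = c * wsum f.
Proof. by rewrite /wsum mulr_sumr; apply: eq_bigr => s _; rewrite mulr_sumr. Qed.

Lemma wsum_0 : wsum (fun _ _ => 0) = 0.
Proof. by rewrite /wsum big1 // => s _; rewrite big1. Qed.

Lemma wsum_ge0 f : (forall s i, (i < K s)%N -> 0 <= f s i) -> 0 <= wsum f.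
Proof. by move=> h; rewrite -wsum_0; apply: le_wsum. Qed.

Lemma wsum_sum (I : Type) (r : seq I) (Q : pred I) (f : I -> bool -> nat -> R) :
  wsum (fun s i => \sum_(a <- r | Q a) f a s i) = \sum_(a <- r | Q a) wsum (f a).
Proof.
rewrite /wsum exchange_big; apply: eq_bigr => s _ /=; by rewrite exchange_big.
Qed.

Lemma wsum_itv s p q (f : nat -> R) : (p <= q)%N -> (q <= K s)%N ->
  wsum (fun s' i => if (s == s') && (p <= i < q)%N then f i else 0) = \sum_(p <= i < q) f i.
Proof.
move=> pq qK; rewrite /wsum (bigD1 s) //= eqxx /= [X in _ + X]big1 ?addr0; last first.
  by move=> s' ns; rewrite big1 // => i _; rewrite eq_sym (negbTE ns).
rewrite -big_mkcond /= (big_cat_nat (leq0n p) (leq_trans pq qK)) /=.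
rewrite [X in X + _]big_nat_cond [X in X + _]big1 ?add0r; last by move=> i; lia.
rewrite (big_cat_nat pq qK) /= [X in _ + X]big_nat_cond [X in _ + X]big1 ?addr0; last by move=> i; lia.
by rewrite big_nat_cond [RHS]big_nat_cond; apply: eq_bigl => i; lia.
Qed.

Lemma wsum_covers b f : wsum (fun s i =>
    if covers b s i then f s i else 0) = \sum_(lo b <= i < hi b) f (sd b) i.
Proof.
have [h1 h2 _ _] := blkP b; rewrite -(@wsum_itv (sd b)) //; last lia.
by apply: eq_wsum => s i _; rewrite /covers; case: eqP => //= <-.
Qed.

(** A widest block is maximal; by laminarity the blocks not nested in it are disjoint from it, so
    the union decomposes into disjoint blocks. *)
Lemma union_pos (f : bool -> nat -> R) (X : {set blk}) : X != set0 ->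
  (forall b, b \in X -> 0 < \sum_(lo b <= i < hi b) f (sd b) i) ->
  0 < wsum (fun s i => if [exists b in X, covers b s i] then f s i else 0).
Proof.
have [m] := ubnP #|X|; elim: m X => // m IH X mX X0 hX.
have [b0 b0X] := set0Pn _ X0.
case: (@arg_maxnP _ b0 (mem X) (fun b => hi b - lo b)%N b0X) => b bX' bm.
have bX : b \in X by []; have {}bX' := bX.
pose X' := [set b' in X | ~~ nested b' b].
have -> : wsum (fun s i => if [exists b in X, covers b s i] then f s i else 0) =
  wsum (fun s i => if covers b s i then f s i else 0) +
  wsum (fun s i => if [exists b in X', covers b s i] then f s i else 0).
  rewrite -wsum_add; apply: eq_wsum => s i _.
  case: (boolP (covers b s i)) => cb.
    have -> : [exists b in X, covers b s i] by apply/exists_inP; exists b.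
    suff -> : [exists b in X', covers b s i] = false by rewrite addr0.
    apply/negbTE/exists_inPn => b' /setIdP[b'X nsub]; apply/negP => cb'.
    have := laminar cb cb'; rewrite (negbTE nsub) orbF => sb; case/negP: nsub.
    have := bm _ b'X; have [_ l1 _ _] := blkP b; have [_ l2 _ _] := blkP b'.
    by case/and3P: sb => /eqP e l3 l4 l5; rewrite /nested e eqxx; lia.
  rewrite add0r; suff -> : [exists b in X, covers b s i] = [exists b in X', covers b s i] by [].
  apply/exists_inP/exists_inP => -[b' b'X cb']; exists b' => //; last by case/setIdP: b'X.
  by rewrite inE b'X; apply: contra cb => /(covers_nested cb').
rewrite wsum_covers; have hb := hX _ bX.
have [->|X'0] := eqVneq X' set0.
  rewrite (@eq_wsum _ (fun _ _ => 0)) ?wsum_0 ?addr0 // => s i _.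
  suff -> : [exists b in set0, covers b s i] = false by [].
  by apply/negbTE/exists_inPn => b'; rewrite inE.
apply: addr_gt0 => //; apply: IH => //; last by move=> b' /setIdP[/hX].
apply: leq_trans (_ : #|X| <= m)%N; last by rewrite -ltnS.
apply: proper_card; apply/properP; split; first by apply/subsetP => b' /setIdP[].
by exists b => //; rewrite inE bX /= negbK /nested !leqnn eqxx.
Qed.
End Walks.

(** * Runs between crossings and the transfer matrix *)

Section Runs.
Variables (R : realType) (V : eqType).
Variables (K : bool -> nat) (u : bool -> nat -> V) (t t0 : bool -> nat -> R).
Hypothesis Wk : walks K u t t0.
Variables (n : nat) (x : bool -> nat -> nat).
Hypothesis Hx_le : forall s m, (m < n)%N -> (x s m <= K s)%N.
Hypothesis Hx_mono : forall s m m', (m <= m')%N -> (m' < n)%N -> (x s m <= x s m')%N.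
Variables (Y0 h0 : bool -> V -> R).
(* The value on the walk vertex of the linear form [h - t Y] of the axis point it sees. The positions
   [x s m] are those of the crossing edges; they cut the walks into runs. *)
Definition orig_F s i := h0 s (u s i) - t0 s i * Y0 s (u s i).
Record original : Prop := Original {
  or_pos : forall s i, (i <= K s)%N -> 0 < Y0 s (u s i);
  or_step : forall s i, (i < K s)%N -> is_step u s i -> orig_F s i < orig_F s i.+1;
  or_cross : forall m, (m < n)%N -> orig_F false (x false m) + orig_F true (x true m) = 0;
  or_start : orig_F false 0 + orig_F true 0 < 0
}.
Hypothesis Or : original.
Local Notation S := (@wsum R K).
Local Notation step := (is_step u).
Local Notation blk := (blk K u).

Definition gap s i := t s i.+1 - t s i.
(** The number of crossings passed up to [i]: run [r] lies between the crossings [r - 1] and [r], on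
    both sides together, and run [n] comes after the last one. *)
Definition run_index s i := (\sum_(m < n) (x s m <= i)%N)%N.

Lemma sum_lt m k : (\sum_(i < k) (i < m)%N)%N = minn m k.
Proof. by elim: k => [|k IH]; rewrite ?big_ord0 ?big_ord_recr /= ?IH; lia. Qed.

Lemma run_index_le s i m : (m < n)%N -> (run_index s i <= m)%N = (i < x s m)%N.
Proof.
move=> mn; apply/idP/idP => [|im].
  move=> h; rewrite ltnNge; apply/negP => xi; move: h; rewrite leqNgt => /negP; apply.
  apply: leq_trans (_ : \sum_(k < n) (k < m.+1)%N <= _)%N; first by rewrite sum_lt; lia.
  apply: leq_sum => k _; case: ltnP => //= km; have := @Hx_mono s k m km mn => h.
  by rewrite (leq_trans h xi).
apply: (@leq_trans (\sum_(k < n) (k < m)%N)); last by rewrite sum_lt; lia.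
apply: leq_sum => k _; case: ltnP => km; first exact: leq_b1.
by rewrite (leqNgt (x s k)) (leq_trans im (Hx_mono s km (ltn_ord k))).
Qed.

Lemma run_index_max s i : (run_index s i <= n)%N.
Proof.
apply: (@leq_trans (\sum_(k < n) 1)%N); last by rewrite sum1_card card_ord.
by apply: leq_sum => k _; apply: leq_b1.
Qed.

Lemma wsum_prefix (G : bool -> nat -> R) m : (m < n)%N ->
  S (fun s i => if (run_index s i <= m)%N then G s i.+1 - G s i else 0) =
  (G false (x false m) + G true (x true m)) - (G false 0 + G true 0).
Proof.
move=> mn; rewrite /S (_ : \sum_s _ = \sum_(s : bool) (G s (x s m) - G s 0)).
  by rewrite big_bool /=; ring.
apply: eq_bigr => s _.
rewrite -(telescope_sumr (fun i => G s i) (leq0n (x s m))).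
rewrite (big_cat_nat (leq0n (x s m)) (Hx_le s mn)) /= [X in _ + X]big1_seq ?addr0; last first.
  by move=> i; rewrite mem_index_iota run_index_le // => /andP[_ /andP[h _]]; rewrite ltnNge h.
by apply: eq_big_nat => i /andP[_ h]; rewrite run_index_le // h.
Qed.

Lemma wsum_regroup (f : bool -> nat -> R) (A : nat -> bool) k :
  S (fun s i => if A (run_index s i) && (run_index s i < k)%N then f s i else 0) =
  \sum_(r < k | A r) S (fun s i => if run_index s i == r then f s i else 0).
Proof.
rewrite -wsum_sum; apply: eq_wsum => s i _.
case: ltnP => h; last first.
  rewrite andbF big1 // => r _; case: eqP => // e; have := ltn_ord r; rewrite -e; lia.
rewrite andbT big_mkcond (bigD1 (Ordinal h)) //= eqxx big1 ?addr0 //.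
move=> r; rewrite -val_eqE /= eq_sym => /negbTE ->; by rewrite if_same.
Qed.

Lemma wsum_prefix_run (f : bool -> nat -> R) m :
  S (fun s i => if (run_index s i <= m)%N then f s i else 0) =
  \sum_(r < m.+1) S (fun s i => if run_index s i == r then f s i else 0).
Proof.
by rewrite -(@wsum_regroup f (fun _ => true) m.+1); apply: eq_wsum => s i _; rewrite ltnS.
Qed.

Lemma wsum_run_diff (f : bool -> nat -> R) m :
  S (fun s i => if run_index s i == m.+1 then f s i else 0) =
  S (fun s i => if (run_index s i <= m.+1)%N then f s i else 0) -
  S (fun s i => if (run_index s i <= m)%N then f s i else 0).
Proof. by rewrite (wsum_prefix_run f m.+1) big_ord_recr /= -wsum_prefix_run addrAC subrr add0r. Qed.

(** A signed weight read off the original drawing: positive at gaps and negative at steps, positive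
    in total on every block, and nonpositive in total on every run before the last crossing. *)
Definition drop_F s i := orig_F s i - orig_F s i.+1.

Lemma orig_mono s i j : (i <= j)%N -> (j <= K s)%N -> t0 s i <= t0 s j.
Proof.
elim: j => [|j IH]; first by rewrite leqn0 => /eqP ->.
rewrite leq_eqVlt => /orP[/eqP -> //|ij jK]; apply: le_trans (IH ij (ltnW jK)) _.
have [/(wk_step Wk jK)[_ ->] //|/(wk_gap Wk jK)[_ /ltW]//] := boolP (step s j).
Qed.

Lemma target_mono s i j : (i <= j)%N -> (j <= K s)%N -> t s i <= t s j.
Proof.
elim: j => [|j IH]; first by rewrite leqn0 => /eqP ->.
rewrite leq_eqVlt => /orP[/eqP -> //|ij jK]; apply: le_trans (IH ij (ltnW jK)) _.
have [/(wk_step Wk jK)[-> _] //|/(wk_gap Wk jK)[/ltW]//] := boolP (step s j).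
Qed.

Lemma drop_F_gap s i : (i < K s)%N -> ~~ step s i -> 0 < drop_F s i.
Proof.
move=> iK st; have [_ tt] := wk_gap Wk iK st; move: st; rewrite /is_step negbK => /eqP e.
rewrite /drop_F /orig_F -e (_ : _ - _ = (t0 s i.+1 - t0 s i) * Y0 s (u s i)); last ring.
by rewrite mulr_gt0 ?subr_gt0 // (or_pos Or) // ltnW.
Qed.

Lemma drop_F_step s i : (i < K s)%N -> step s i -> drop_F s i < 0.
Proof. by move=> iK /(or_step Or iK); rewrite /drop_F subr_lt0. Qed.

Lemma blk_gap (b : blk) : exists2 i, (lo b <= i < hi b)%N & ~~ step (sd b) i.
Proof.
have [h1 h2 h3 _] := blkP b.
have [/existsP[i /andP[]]|] := boolP [exists i : 'I_(hi b), (lo b <= i)%N && ~~ step (sd b) i].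
  by exists i => //; rewrite ltn_ord andbT.
rewrite negb_exists => /forallP all; exfalso.
have alls i : (lo b <= i < hi b)%N -> step (sd b) i.
  by case/andP=> a1 a2; have := all (Ordinal a2); rewrite /= a1 negbK.
have key k : (lo b <= k <= hi b)%N -> t0 (sd b) k = t0 (sd b) (lo b).
  elim: k => [|k IH] /andP[a1 a2]; first by move: a1; rewrite leqn0 => /eqP ->.
  move: a1; rewrite leq_eqVlt => /orP[/eqP -> //|a1].
  have kK : (k < K (sd b))%N by lia.
  by have [_ ->] := wk_step Wk kK (alls k ltac:(lia)); apply: IH; lia.
have lt k : (lo b < k <= hi b)%N -> orig_F (sd b) (lo b) < orig_F (sd b) k.
  elim: k => [|k IH] /andP[a1 a2] //.
  have kK : (k < K (sd b))%N by lia.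
  have hk := or_step Or kK (alls k ltac:(lia)).
  have [e|ne] := eqVneq (lo b) k; first by rewrite e.
  by apply: lt_trans hk; apply: IH; lia.
have := lt (hi b); rewrite /orig_F -h3 key ?ltxx; lia.
Qed.

Lemma drop_F_blk (b : blk) : 0 < \sum_(lo b <= i < hi b) drop_F (sd b) i.
Proof.
have [h1 h2 h3 _] := blkP b.
have -> : \sum_(lo b <= i < hi b) drop_F (sd b) i = orig_F (sd b) (lo b) - orig_F (sd b) (hi b).
  rewrite -opprB -(telescope_sumr (fun i => orig_F (sd b) i)); last lia.
  by rewrite -sumrN; apply: eq_bigr => i _; rewrite opprB.
rewrite /orig_F -h3 (_ : _ - _ = (t0 (sd b) (hi b) - t0 (sd b) (lo b)) * Y0 (sd b) (u (sd b) (lo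
    b))); last ring.
rewrite mulr_gt0 ?(or_pos Or) //; last lia.
rewrite subr_gt0; have [i hi' st] := blk_gap b.
have iK : (i < K (sd b))%N by lia.
have [_ tt] := wk_gap Wk iK st.
apply: le_lt_trans (orig_mono (s := sd b) (i := lo b) (j := i) _ _) _; try lia.
by apply: lt_le_trans tt _; apply: orig_mono; lia.
Qed.

Lemma drop_F_prefix m : (m < n)%N ->
  S (fun s i => if (run_index s i <= m)%N then drop_F s i else 0) = orig_F false 0 + orig_F true 0.
Proof.
move=> mn; have := @wsum_prefix orig_F m mn; rewrite (or_cross Or mn) sub0r => e.
apply: oppr_inj; rewrite -e -wsum_opp; apply: eq_wsum => s i _.
by case: ifP; rewrite ?oppr0 // /drop_F opprB.
Qed.

Lemma drop_F_run0 : (0 < n)%N -> S (fun s i => if run_index s i == 0%N then drop_F s i else 0) < 0.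
Proof.
move=> n0; rewrite (@eq_wsum _ _ _ (fun s i => if (run_index s i <= 0)%N then drop_F s i else 0)).
  by rewrite drop_F_prefix // (or_start Or).
by move=> s i _; rewrite leqn0.
Qed.

(** The forms of the two sides cancel at each crossing, so a run between two crossings has total
    zero; the first run carries the negative starting value. *)
Lemma drop_F_run r : (r < n)%N -> S (fun s i => if run_index s i == r then drop_F s i else 0) <= 0.
Proof.
case: r => [/drop_F_run0/ltW //|r] rn.
by rewrite wsum_run_diff !drop_F_prefix ?subrr // ltnW.
Qed.

(** On the union of [X] the total of [drop_F] is positive. Under the closure hypothesis this union
    contains every step of each run whose gaps it touches, so the total is at most that of these
    full runs, which is nonpositive. *)
Lemma not_closed (X : {set blk}) : X != set0 ->
  (forall b s i, b \in X -> (i < K s)%N -> covers b s i -> ~~ step s i -> (run_index s i < n)%N /\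
    (forall s' i', (i' < K s')%N -> step s' i' -> run_index s' i' = run_index s i ->
        [exists b in X, innermost b s' i'])) ->
  False.
Proof.
move=> X0 hX.
pose Rs r := [exists b in X, exists i : 'I_(walk_bound K), [&& (i < K (sd b))%N, covers b (sd b) i,
    ~~ step (sd b) i & run_index (sd b) i == r]].
have RsP r : Rs r -> exists b s i, [/\ b \in X, (i < K s)%N, covers b s i, ~~ step s i & run_index s i = r].
  by case/exists_inP=> b bX /existsP[i /and4P[h1 h2 h3 /eqP h4]]; exists b, (sd b), i.
have mkRs b s i : b \in X -> (i < K s)%N -> covers b s i -> ~~ step s i -> Rs (run_index s i).
  move=> bX iK cb st; apply/exists_inP; exists b => //.
  have ib : (i < walk_bound K)%N by apply: (@ltKb _ s); apply: ltnW.
  have e : sd b = s by case/andP: cb => /eqP.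
  by apply/existsP; exists (Ordinal ib); rewrite /= e iK cb st eqxx.
have U := union_pos Wk X0 (fun b _ => drop_F_blk b).
have : S (fun s i => if [exists b in X, covers b s i] then drop_F s i else 0) <=
       S (fun s i => if Rs (run_index s i) && (run_index s i < n)%N then drop_F s i else 0).
  apply: le_wsum => s i iK; have [st|st] := boolP (step s i).
    have neg := drop_F_step iK st; case: ifP => cu; case: ifP => // ru; try exact: ltW.
    case/andP: ru => /RsP[b [s' [i' [h1 h2 h3 h4 h5]]]] _.
    have [_ /(_ s i iK st)] := hX _ _ _ h1 h2 h3 h4; rewrite h5 =>
        /(_ erefl)/exists_inP[b' b'X /innermost_covers cb'].
    by case/negP: (negbT cu); apply/exists_inP; exists b'.
  have pos := drop_F_gap iK st; case: ifP => cu; case: ifP => // ru; try exact: ltW.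
  case/exists_inP: cu => b bX cb; have [rn _] := hX _ _ _ bX iK cb st.
  by rewrite (mkRs b) // rn in ru.
rewrite leNgt => /negP; apply; apply: le_lt_trans U.
rewrite wsum_regroup; apply: sumr_le0 => r _; exact: drop_F_run.
Qed.

Lemma gap_step s i : (i < K s)%N -> step s i -> gap s i = 0.
Proof. by move=> iK /(wk_step Wk iK)[e _]; rewrite /gap e subrr. Qed.

Lemma gap_gt0 s i : (i < K s)%N -> ~~ step s i -> 0 < gap s i.
Proof. by move=> iK /(wk_gap Wk iK)[e _]; rewrite /gap subr_gt0. Qed.

Lemma gap_ge0 s i : (i < K s)%N -> 0 <= gap s i.
Proof. by move=> iK; rewrite subr_ge0; apply: target_mono. Qed.

Definition blk_width (b : blk) := t (sd b) (hi b) - t (sd b) (lo b).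
Definition run_steps r := S (fun s i => if step s i && (run_index s i == r) then 1 else 0).
Definition run_mass (b : blk) r := S (fun s i =>
    if run_index s i == r then (if inside b s i then gap s i else 0) else 0).
(* [run_steps] and [run_mass] share the mass of a run equally among its steps. Column sums are bounded by
   [blk_width], and strictness on unions of blocks is read off the original drawing. *)
Definition transfer (b b' : blk) :=
  S (fun s i => if innermost b s i && (run_index s i < n)%N then run_mass b' (run_index s i) /
      run_steps (run_index s i) else 0).

Lemma blk_width_gt0 b : 0 < blk_width b.
Proof.
rewrite subr_gt0; have [h1 h2 h3 _] := blkP b; have [i hi' st] := blk_gap b.
have iK : (i < K (sd b))%N by lia.
have [tt _] := wk_gap Wk iK st.
apply: le_lt_trans (target_mono (s := sd b) (i := lo b) (j := i) _ _) _; try lia.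
by apply: lt_le_trans tt _; apply: target_mono; lia.
Qed.

Lemma blk_width_itv b : blk_width b = \sum_(lo b <= i < hi b) gap (sd b) i.
Proof.
have [_ h _ _] := blkP b; have l : (lo b <= hi b)%N by lia.
by rewrite /blk_width -(telescope_sumr (fun i => t (sd b) i) l).
Qed.

Lemma blk_width_wsum b : blk_width b = S (fun s i => if inside b s i then gap s i else 0).
Proof.
rewrite blk_width_itv -wsum_covers; apply: eq_wsum => s i iK; rewrite /covers /inside; case: eqP => //= e.
case: (ltngtP (lo b) i) => //= ei; case: ifP => // _.
by rewrite gap_step // -ei -e; apply: step_lo.
Qed.

Lemma blk_width_runs b : blk_width b = \sum_(r < n.+1) run_mass b r.
Proof.
rewrite blk_width_wsum -(@wsum_regroup _ (fun _ => true) n.+1); apply: eq_wsum => s i _.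
by rewrite ltnS run_index_max.
Qed.

Lemma run_mass_ge0 b r : 0 <= run_mass b r.
Proof. by apply: wsum_ge0 => s i iK; do 2 case: ifP => // _; apply: gap_ge0. Qed.

Lemma run_steps_ge0 r : 0 <= run_steps r.
Proof. by apply: wsum_ge0 => s i iK; case: ifP. Qed.

Lemma transfer_ge0 b b' : 0 <= transfer b b'.
Proof. by apply: wsum_ge0 => s i iK; case: ifP => // _; rewrite divr_ge0 ?run_mass_ge0 ?run_steps_ge0. Qed.

Definition covered_steps (X : {set blk}) r :=
  S (fun s i => if run_index s i == r then (if [exists b in X, innermost b s i] then 1 else 0) else 0).

Lemma transfer_col (X : {set blk}) b' : \sum_(b in X) transfer b b' = \sum_(r < n) covered_steps X
    r * (run_mass b' r / run_steps r).
Proof.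
rewrite -wsum_sum.
rewrite (@eq_wsum _ _ _ (fun s i => if true && (run_index s i < n)%N then
   (if [exists b in X, innermost b s i] then run_mass b' (run_index s i) / run_steps (run_index s
       i) else 0) else 0)).
  rewrite (@wsum_regroup _ (fun _ => true)); apply: eq_bigr => r _.
  rewrite mulrC -wsum_mull; apply: eq_wsum => s i _; case: eqP => [->|_]; last by rewrite mulr0.
  by case: ifP; rewrite ?mulr0 ?mulr1.
move=> s i _ /=; case: ltnP => rn; last by rewrite big1 // => b _; rewrite andbF.
case: ifP => [/exists_inP[b bX bb]|/negbT/exists_inPn hn].
  rewrite (bigD1 b) //= bb /= big1 ?addr0 // => c /andP[_ /eqP cb].
  by case: (boolP (innermost c s i)) => // bc; case: cb; apply: innermost_uniq bc bb.
by rewrite big1 // => b /hn /negbTE ->.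
Qed.

Lemma covered_steps_le (X : {set blk}) r : covered_steps X r <= run_steps r.
Proof.
apply: le_wsum => s i iK; case: eqP => _; rewrite ?andbF // andbT.
case: ifP => [/exists_inP[b _ /and3P[_ -> _]] //|_]; by case: ifP.
Qed.

Lemma covered_mass_le (X : {set blk}) b r : covered_steps X r * (run_mass b r / run_steps r) <=
    run_mass b r.
Proof.
rewrite mulrCA; have [->|n0] := eqVneq (run_steps r) 0; first by rewrite invr0 !mulr0 run_mass_ge0.
rewrite -[leRHS]mulr1 ler_wpM2l ?run_mass_ge0 // ler_pdivrMr ?mul1r ?covered_steps_le //.
by rewrite lt_neqAle eq_sym n0 run_steps_ge0.
Qed.

Lemma transfer_le (X : {set blk}) b' : b' \in X -> \sum_(b in X) transfer b b' <= blk_width b'.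
Proof.
move=> _; rewrite transfer_col blk_width_runs big_ord_recr /= -[leLHS]addr0 lerD ?run_mass_ge0 //.
by apply: ler_sum => r _; apply: covered_mass_le.
Qed.

Lemma lt_wsum (f g : bool -> nat -> R) s0 i0 : (forall s i, (i < K s)%N -> f s i <= g s i) ->
  (i0 < K s0)%N -> f s0 i0 < g s0 i0 -> S f < S g.
Proof.
move=> le i0K lt0; rewrite -subr_gt0 -wsum_sub /S (bigD1 s0) //= ltr_pwDl //.
  rewrite (bigD1_seq i0) ?iota_uniq ?mem_index_iota //= ltr_pwDl ?subr_gt0 //.
  by rewrite big_seq_cond sumr_ge0 // => i /andP[]; rewrite mem_index_iota subr_ge0 => ? _; apply: le.
rewrite sumr_ge0 // => s _; rewrite big_seq_cond sumr_ge0 // => i /andP[];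
    rewrite mem_index_iota subr_ge0 => ? _; exact: le.
Qed.

Lemma run_mass_gap b s i : (i < K s)%N -> covers b s i -> ~~ step s i -> 0 < run_mass b (run_index s i).
Proof.
move=> iK cb st; rewrite -[X in X < _](@wsum_0 R K); apply: (@lt_wsum _ _ s i) => //.
  by move=> s' i' iK'; do 2 case: ifP => // _; apply: gap_ge0.
rewrite eqxx; suff -> : inside b s i by apply: gap_gt0.
case/andP: cb => /eqP e /andP[h1 h2]; rewrite /inside e eqxx h2 andbT /= ltn_neqAle h1 andbT.
by apply: contraNneq st => <-; rewrite -e; apply: step_lo.
Qed.

(** Equality in all columns of [X] would mean that every run with a gap covered by [X] precedes the
    last crossing and has all its steps innermost in blocks of [X], the situation excluded by
    [not_closed]. *)
Lemma transfer_lt (X : {set blk}) : X != set0 -> exists2 b', b' \in X &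
    \sum_(b in X) transfer b b' < blk_width b'.
Proof.
move=> X0; apply/exists_inP; apply: contraT => /exists_inPn hn; exfalso.
apply: (not_closed X0) => b s i bX iK cb st.
have := hn b bX; rewrite -leNgt transfer_col blk_width_runs big_ord_recr /= => hle.
have {}hle : \sum_(r < n) (run_mass b r - covered_steps X r * (run_mass b r / run_steps r)) +
    run_mass b n <= 0.
  by rewrite sumrB; move: hle; lra.
have ge (r : 'I_n) : 0 <= run_mass b r - covered_steps X r * (run_mass b r / run_steps r) by
    rewrite subr_ge0 covered_mass_le.
have s0 : \sum_(r < n) (run_mass b r - covered_steps X r * (run_mass b r / run_steps r)) = 0.
  by apply/eqP; rewrite eq_le sumr_ge0 // andbT; have := run_mass_ge0 b n; lra.
have rn : (run_index s i < n)%N.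
  rewrite ltn_neqAle run_index_max andbT; apply/eqP => e.
  by have := run_mass_gap iK cb st; rewrite e; move: hle; rewrite s0; lra.
split=> // s' i' iK' st' er.
apply: contraT => nex; exfalso.
have gpos := run_mass_gap iK cb st.
move/eqP: s0; rewrite psumr_eq0 // => /allP/(_ (Ordinal rn) (mem_index_enum _)) /=.
rewrite subr_eq0 mulrCA => /eqP e.
have nspos : 0 < run_steps (run_index s i).
  rewrite lt_neqAle run_steps_ge0 andbT eq_sym; apply/eqP => z; move: gpos.
  by rewrite e z invr0 !mulr0 ltxx.
have : covered_steps X (run_index s i) < run_steps (run_index s i).
  apply: (@lt_wsum _ _ s' i') => //; last first.
    by rewrite er eqxx st' (negbTE nex) /= ltr01.
  move=> s1 i1 _; case: eqP => _; rewrite ?andbF // andbT.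
  by case: ifP => [/exists_inP[c _ /and3P[_ -> _]] //|_]; case: ifP.
suff -> : covered_steps X (run_index s i) = run_steps (run_index s i) by rewrite ltxx.
have /(mulfI (lt0r_neq0 gpos)) h1 : run_mass b (run_index s i) * (covered_steps X (run_index s i) /
    run_steps (run_index s i)) = run_mass b (run_index s i) * 1.
  by rewrite mulr1 -e.
by rewrite -[LHS](mulfVK (lt0r_neq0 nspos)) h1 mul1r.
Qed.

Lemma zeta_solve c : exists z : blk -> R, forall b, blk_width b * z b - \sum_b' transfer b b' * z b' = c b.
Proof. exact: mmatrix_solve transfer_ge0 transfer_le transfer_lt c. Qed.

Lemma zeta_nonneg (z : blk -> R) : (forall b,
    0 <= blk_width b * z b - \sum_b' transfer b b' * z b') -> forall b, 0 <= z b.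
Proof. exact: mmatrix_nonneg transfer_ge0 transfer_le transfer_lt z. Qed.
End Runs.

(** * Solutions of the closing conditions *)

Section Solve.
Variables (R : realType) (V : eqType).
Variables (K : bool -> nat) (u : bool -> nat -> V) (t t0 : bool -> nat -> R).
Hypothesis Wk : walks K u t t0.
Variables (n : nat) (x : bool -> nat -> nat).
Hypothesis xK : forall s m, (m < n)%N -> (x s m <= K s)%N.
Hypothesis x_mono : forall s m m', (m <= m')%N -> (m' < n)%N -> (x s m <= x s m')%N.
Variables (Y0 h0 : bool -> V -> R).
Hypothesis Or : original K u t0 n x Y0 h0.
Local Notation S := (@wsum R K).
Local Notation step := (is_step u).
Local Notation blk := (blk K u).
Local Notation run := (run_index n x).
Local Notation w := (gap t).
Local Notation W := (blk_width t).
Local Notation ns := (@run_steps R V K u n x).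
Local Notation mass := (run_mass t n x).
Local Notation Pm := (transfer t n x).

Section Particular.
Variables (Kp : bool -> nat -> R) (c e : R) (eb : blk -> R) (f0 : bool -> R).
Hypothesis Kp_vertex : forall s i j, (i <= K s)%N -> (j <= K s)%N -> u s i = u s j -> Kp s i = Kp s j.
Hypothesis eb_closure : forall b : blk, \sum_(b' | nested b' b) eb b' =
  - \sum_(lo b <= i < hi b) w (sd b) i * (Kp (sd b) i - Kp (sd b) (lo b)).
Hypothesis f0_sum : f0 false + f0 true = - e.

(** A source [Kp] depending on the vertex, raised by [z b] at all vertices strictly inside the block
    [b]. *)
Definition Ys (z : blk -> R) s i := Kp s i + \sum_(b : blk | inside b s i) z b.
(** What the steps of run [r] must add up to in order to balance its gaps; run [0] also compensates
    the starting values, which sum to [- e]. *)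
Definition Qr z r := S (fun s i =>
    if run s i == r then w s i * Ys z s i else 0) + (if r == 0%N then e else 0).
(** The steps of a run share its total equally. After the last crossing nothing has to balance, and
    each step gets the free constant [c]. *)
Definition qs z s i :=
  if step s i then (if (run s i < n)%N then Qr z (run s i) / ns (run s i) else c) else 0.

(* The equation of [b] makes [hs] agree at the two ends of [b]. *)
Definition solves z := forall b : blk, W b * z b = S (fun s i =>
    if innermost b s i then qs z s i else 0) + eb b.

Definition Qr0 r := S (fun s i => if run s i == r then w s i * Kp s i else 0) + (if r == 0%N then e else 0).
Definition rhs b :=
  S (fun s i => if innermost b s i then (if (run s i < n)%N then Qr0 (run s i) / ns (run s i) else
      c) else 0) + eb b.

Lemma Qr_split z r : Qr z r = Qr0 r + \sum_b mass b r * z b.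
Proof.
rewrite /Qr /Qr0 addrAC; congr (_ + _).
have -> : \sum_b mass b r * z b =
  S (fun s i => \sum_b z b * (if run s i == r then (if inside b s i then w s i else 0) else 0)).
  by rewrite wsum_sum; apply: eq_bigr => b _; rewrite wsum_mull mulrC.
rewrite -wsum_add; apply: eq_wsum => s i _; rewrite /Ys; case: eqP => _; last first.
  by rewrite big1 ?addr0 // => b _; rewrite mulr0.
rewrite mulrDr; congr (_ + _); rewrite big_mkcond mulr_sumr /=; apply: eq_bigr => b _.
by case: ifP => _; rewrite ?mulr0 // mulrC.
Qed.

Lemma rhs_split z b : S (fun s i => if innermost b s i then qs z s i else 0) + eb b =
  rhs b + \sum_b' Pm b b' * z b'.
Proof.
rewrite /rhs addrAC; congr (_ + _).
have -> : \sum_b' Pm b b' * z b' = S (fun s i => \sum_b' z b' *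
   (if innermost b s i && (run s i < n)%N then mass b' (run s i) / ns (run s i) else 0)).
  by rewrite wsum_sum; apply: eq_bigr => b' _; rewrite wsum_mull mulrC.
rewrite -wsum_add; apply: eq_wsum => s i _; case: (boolP (innermost b s i)) => /= hb; last first.
  by rewrite big1 ?addr0 // => b' _; rewrite mulr0.
have st : step s i by case/and3P: hb.
rewrite /qs st; case: ifP => rn; last by rewrite big1 ?addr0 // => b' _; rewrite mulr0.
rewrite Qr_split mulrDl; congr (_ + _); rewrite mulr_suml; apply: eq_bigr => b' _.
by rewrite mulrCA mulrA.
Qed.

Lemma solves_ex : exists z, solves z.
Proof.
have [z hz] := zeta_solve Wk xK x_mono Or rhs.
by exists z => b; rewrite rhs_split -hz; ring.
Qed.

Variable z : blk -> R.
Hypothesis Hz : solves z.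
Local Notation Y := (Ys z).
Local Notation q := (qs z).
(** The intended values of [h - t Y]: along a gap [h] and [Y] are fixed while [t] grows by [w], so
    the form falls by [w Y]; along a step it changes by [q]. *)
Definition Fs s i := f0 s + \sum_(0 <= j < i) (q s j - w s j * Y s j).
Definition hs s i := Fs s i + t s i * Y s i.

Lemma Ys_vertex s i j : (i <= K s)%N -> (j <= K s)%N -> u s i = u s j -> Y s i = Y s j.
Proof.
move=> iK jK uij; rewrite /Ys (Kp_vertex iK jK uij); congr (_ + _); apply: eq_bigl => b.
by apply/idP/idP; [apply: (inside_vertex Wk iK jK uij) | apply: (inside_vertex Wk jK iK (esym uij))].
Qed.

Lemma Fs_S s i : Fs s i.+1 = Fs s i + (q s i - w s i * Y s i).
Proof. by rewrite /Fs big_nat_recr //= addrA. Qed.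

Lemma Fs_step s i : (i < K s)%N -> step s i -> Fs s i.+1 = Fs s i + q s i.
Proof. by move=> iK st; rewrite Fs_S (gap_step Wk iK st) mul0r subr0. Qed.

Lemma Ys_gap (b : blk) i : (lo b <= i < hi b)%N -> ~~ step (sd b) i ->
  Y (sd b) i - Y (sd b) (lo b) = Kp (sd b) i - Kp (sd b) (lo b) + \sum_(b' |
      nested b' b && inside b' (sd b) i) z b'.
Proof.
move=> hi' st.
have cb : covers b (sd b) i by rewrite /covers eqxx.
rewrite /Ys (bigID (fun b' : blk => nested b' b)) /= (_ : \sum_(b' |
    inside b' (sd b) i && ~~ nested b' b) z b' = \sum_(b' | inside b' (sd b) (lo b)) z b').
  by rewrite (eq_bigl (fun b' => nested b' b && inside b' (sd b) i)); [ring | move=> b'; rewrite andbC].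
apply: eq_bigl => b'; have [k1 k2 k3 k4] := blkP b; have [k1' k2' k3' k4'] := blkP b'.
apply/idP/idP.
  case/andP=> sb nsub; have cb' : covers b' (sd b) i by move: sb; rewrite /covers /inside; lia.
  have := laminar Wk cb cb'; rewrite (negbTE nsub) orbF => /and3P[/eqP es l1 l2].
  rewrite /inside -es eqxx /=; have : lo b' != lo b.
    apply: contra nsub => /eqP le; rewrite (blk_lo_inj (esym es) le) /nested !leqnn eqxx //.
  by move/andP: hi'; lia.
case/andP=> /eqP es h; have sub' : nested b b'.
  have cl : covers b (sd b) (lo b) by rewrite /covers eqxx; lia.
  have cl' : covers b' (sd b) (lo b) by rewrite /covers es eqxx; lia.
  by have /orP[//|/and3P[_]] := laminar Wk cl cl'; lia.
case/and3P: sub' => _ l1 l2; rewrite /inside es eqxx /nested es eqxx /=.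
have : lo b' != lo b by lia.
by move/andP: hi'; lia.
Qed.

(** Adding the equations of all blocks nested in [b] counts each step once, under its innermost
    block, and each nested unknown with its width; [eb_closure] absorbs the variation of [Kp]. *)
Lemma blk_closes (b : blk) : hs (sd b) (hi b) = hs (sd b) (lo b).
Proof.
have [k1 k2 k3 k4] := blkP b; have lh : (lo b <= hi b)%N by lia.
have eY : Y (sd b) (hi b) = Y (sd b) (lo b) by apply: Ys_vertex => //; lia.
rewrite /hs eY; apply/eqP; rewrite -subr_eq0; apply/eqP.
have -> : Fs (sd b) (hi b) + t (sd b) (hi b) * Y (sd b) (lo b) - (Fs (sd b) (lo b) + t (sd b) (lo
    b) * Y (sd b) (lo b)) =
  (Fs (sd b) (hi b) - Fs (sd b) (lo b)) + W b * Y (sd b) (lo b) by rewrite /blk_width; ring.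
rewrite -(telescope_sumr (fun i => Fs (sd b) i) lh) (blk_width_itv t) mulr_suml -big_split /=.
have -> : \sum_(lo b <= i < hi b) (Fs (sd b) i.+1 - Fs (sd b) i + w (sd b) i * Y (sd b) (lo b)) =
  \sum_(lo b <= i < hi b) q (sd b) i - \sum_(lo b <= i < hi b) w (sd b) i * (Y (sd b) i - Y (sd b) (lo b)).
  by rewrite -sumrB; apply: eq_bigr => i _; rewrite Fs_S; ring.
have -> : \sum_(lo b <= i < hi b) q (sd b) i = \sum_(b' | nested b' b) S (fun s i =>
    if innermost b' s i then q s i else 0).
  rewrite -(wsum_covers b q) -wsum_sum; apply: eq_wsum => s i iK; case: ifP => cb; last first.
    rewrite big1 // => b' sb; case: ifP => // /innermost_covers cb'.
    by rewrite (covers_nested cb' sb) in cb.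
  have [st|nst] := boolP (step s i); last first.
    rewrite /qs (negbTE nst) big1 // => b' _; by case: ifP.
  have [b0 bb] := innermost_ex Wk iK st.
  rewrite (bigD1 b0) /=; last exact: innermost_nested bb cb.
  rewrite bb big1 ?addr0 // => b' /andP[_ /eqP nb]; case: ifP => // bb'.
  by case: nb; apply: innermost_uniq bb' bb.
have -> : \sum_(lo b <= i < hi b) w (sd b) i * (Y (sd b) i - Y (sd b) (lo b)) =
  \sum_(lo b <= i < hi b) w (sd b) i * (Kp (sd b) i - Kp (sd b) (lo b)) + \sum_(b' |
      nested b' b) W b' * z b'.
  have -> : \sum_(b' | nested b' b) W b' * z b' =
     \sum_(lo b <= i < hi b) \sum_(b' | nested b' b) (if inside b' (sd b) i then w (sd b) i * z b' else 0).
    rewrite exchange_big /=; apply: eq_bigr => b' sb.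
    rewrite (blk_width_wsum Wk) -(wsum_covers b (fun s i =>
        if inside b' s i then w s i * z b' else 0)) mulrC -wsum_mull; apply: eq_wsum => s i iK.
    rewrite /covers; have [<-|ns] := eqVneq (sd b) s => /=.
      case: ifP => st; last by rewrite mulr0 if_same.
      have -> : (lo b <= i < hi b)%N by case/andP: st; case/and3P: sb; lia.
      by rewrite mulrC.
    rewrite /inside; case/and3P: sb => /eqP -> _ _; rewrite (negbTE ns) /=; exact: mulr0.
  rewrite -big_split /=; apply: eq_big_nat => i hi'.
  have [st|nst] := boolP (step (sd b) i).
    rewrite (gap_step Wk _ st); last lia.
    by rewrite !mul0r big1 ?addr0 // => b' _; rewrite mul0r if_same.
  rewrite Ys_gap // mulrDr; congr (_ + _); rewrite mulr_sumr big_mkcondr /=; apply: eq_bigr => b' _.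
  by case: ifP.
have hb := eb_closure b.
have -> : \sum_(b' | nested b' b) S (fun s i => if innermost b' s i then q s i else 0) =
  \sum_(b' | nested b' b) W b' * z b' - \sum_(b' | nested b' b) eb b'.
  by rewrite -sumrB; apply: eq_bigr => b' _; rewrite Hz addrK.
rewrite hb; ring.
Qed.

Lemma hs_gap s i : (i < K s)%N -> ~~ step s i -> hs s i.+1 = hs s i.
Proof.
move=> iK st; have e1 : u s i = u s i.+1 by apply/eqP; rewrite -[_ == _]negbK.
rewrite /hs Fs_S /qs (negbTE st) (@Ys_vertex s i.+1 i) //; last exact: ltnW.
by rewrite /gap; ring.
Qed.

(** Induction on the distance between visits: consecutive visits are joined by a gap or are the two
    ends of a block. *)
Lemma hs_vertex s i j : (i <= K s)%N -> (j <= K s)%N -> u s i = u s j -> hs s i = hs s j.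
Proof.
suff H d : forall i j, (j - i <= d)%N -> (i <= j)%N -> (j <= K s)%N -> u s i = u s j -> hs s i = hs s j.
  move=> iK jK e1; case: (leqP i j) => h; first exact: H (leqnn _) h jK e1.
  by apply/esym; apply: H (leqnn _) (ltnW h) iK (esym e1).
elim: d => [|d IH] {}i {}j dij ij jK e1; first by rewrite (_ : i = j) //; lia.
have [->//|ne] := eqVneq i j.
have [/existsP[k /andP[ik /eqP uk]]|none] := boolP [exists k : 'I_j, (i < k)%N && (u s k == u s i)].
  have kj := ltn_ord k; rewrite (IH i k) ?(IH k j) ?uk //; lia.
have [ji|ji] := eqVneq j i.+1.
  by rewrite ji hs_gap //; [lia | rewrite /is_step -ji e1 eqxx].
have [||b [e2 e3 e4]] := @blk_mk V K u s i j jK _ e1 _; first lia; last by rewrite -e2 -e3 -e4 blk_closes.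
move=> k /andP[ik kj]; move: none; rewrite negb_exists => /forallP/(_ (Ordinal kj)).
by rewrite /= ik.
Qed.

(** A run with gaps but no steps would have a positive [drop_F] total, and the first run has a
    negative one. So [ns r = 0] forces an empty run, and the division by zero in [qs] is
    harmless. *)
Lemma no_step_run r : (r < n)%N -> ns r = 0 -> r != 0%N /\ forall s i, (i < K s)%N -> run s i != r.
Proof.
move=> rn n0.
have nstep s i : (i < K s)%N -> run s i = r -> ~~ step s i.
  move=> iK ri; apply/negP => st; suff : 0 < ns r by rewrite n0 ltxx.
  rewrite -[X in X < _](@wsum_0 R K); apply: (@lt_wsum _ _ _ _ s i) => //; last by rewrite st ri eqxx ltr01.
  by move=> s' i' _; case: ifP.
have pos s i : (i < K s)%N -> 0 <= if run s i == r then drop_F u t0 Y0 h0 s i else 0.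
  by move=> iK; case: eqP => // /(nstep s i iK) st; apply/ltW/(drop_F_gap Wk Or iK st).
split.
  apply/eqP => r0; have := drop_F_run0 xK x_mono Or; rewrite -r0 => /(_ rn).
  by rewrite ltNge => /negP; apply; apply: wsum_ge0.
move=> s i iK; apply/eqP => ri; have := drop_F_run xK x_mono Or rn; rewrite leNgt => /negP; apply.
rewrite -[X in X < _](@wsum_0 R K); apply: (@lt_wsum _ _ _ _ s i) => //; rewrite ri eqxx.
exact: (drop_F_gap Wk Or iK (nstep _ _ iK ri)).
Qed.

Lemma run_balance r : (r < n)%N ->
  S (fun s i => if run s i == r then q s i - w s i * Y s i else 0) = if r == 0%N then e else 0.
Proof.
move=> rn; have [n0|n0] := eqVneq (ns r) 0.
  have [/negbTE -> h] := no_step_run rn n0.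
  by rewrite (@eq_wsum _ _ _ (fun _ _ => 0)) ?wsum_0 // => s i iK; rewrite (negbTE (h s i iK)).
rewrite (@eq_wsum _ _ _ (fun s i => Qr z r / ns r * (if step s i && (run s i == r) then 1 else 0) -
   (if run s i == r then w s i * Y s i else 0))).
  rewrite wsum_sub wsum_mull -/(ns r) mulfVK // /Qr addrAC subrr add0r //.
move=> s i iK; case: eqP => [ri|_]; last by rewrite andbF mulr0 subr0.
by rewrite andbT /qs ri rn; case: ifP; rewrite ?mulr1 ?mulr0.
Qed.

Lemma crossing_balance m : (m < n)%N -> Fs false (x false m) + Fs true (x true m) = 0.
Proof.
move=> mn; have := wsum_prefix xK x_mono Fs mn.
have -> : Fs false 0 + Fs true 0 = - e by rewrite /Fs !big_nil !addr0.
rewrite (@eq_wsum _ _ _ (fun s i => if (run s i <= m)%N then q s i - w s i * Y s i else 0)); last first.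
  by move=> s i _; rewrite Fs_S addrAC subrr add0r.
rewrite wsum_prefix_run big_ord_recl /= run_balance ?(leq_ltn_trans _ mn) //= big1 ?addr0.
  by lra.
by move=> r _; rewrite run_balance //; have := ltn_ord r; rewrite /= /bump; lia.
Qed.

Lemma Ys_root s : Y s 0 = Kp s 0.
Proof. by rewrite /Ys big1 ?addr0 // => b /andP[_]; lia. Qed.

Lemma hs_root s : hs s 0 = f0 s + t s 0 * Kp s 0.
Proof. by rewrite /hs Ys_root /Fs big_nil addr0. Qed.
End Particular.
End Solve.

Lemma small_all (R : realType) (I : finType) (Q : I -> R -> Prop) :
  (forall i, exists2 d : R, 0 < d & forall e, 0 < e -> e < d -> Q i e) ->
  exists2 e : R, 0 < e & forall i, Q i e.
Proof.
move=> h; suff [d d0 hd] : exists2 d : R, 0 < d & forall e, 0 < e -> e < d ->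
    forall i, i \in enum I -> Q i e.
  by exists (d / 2); [lra | move=> i; apply: hd; rewrite ?mem_enum //; lra].
elim: (enum I) => [|i r [d d0 hd]]; first by exists 1; rewrite ?ltr01.
have [d' d'0 hd'] := h i; exists (Num.min d d'); first by rewrite lt_min d0.
move=> e e0; rewrite lt_min => /andP[l1 l2] k; rewrite inE => /orP[/eqP -> |]; [exact: hd' | exact: hd].
Qed.

Lemma small_poly (R : realType) (d0 d1 d2 : R) : 0 < d0 \/ d0 = 0 /\ 0 < d1 ->
  exists2 d : R, 0 < d & forall e, 0 < e -> e < d -> 0 < d0 + e * d1 + e ^+ 2 * d2.
Proof.
case=> [p|[-> p]].
  pose M := `|d1| + `|d2| + 1; have M0 : 0 < M by rewrite /M; have := normr_ge0 d1;
      have := normr_ge0 d2; lra.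
  exists (Num.min 1 (d0 / M)); first by rewrite lt_min ltr01 divr_gt0.
  move=> e e0; rewrite lt_min ltr_pdivlMr // => /andP[e1 eM].
  have h1 := ler_norm (- d1); have h2 := ler_norm (- d2); rewrite !normrN in h1 h2.
  have a0 := normr_ge0 d1; have b0 := normr_ge0 d2; rewrite /M in eM.
  move: `|d1| `|d2| h1 h2 a0 b0 eM => a b h1 h2 a0 b0 eM.
  have k1 : 0 <= e * (d1 + a) by rewrite mulr_ge0 //; lra.
  have k2 : 0 <= e * e * (d2 + b) by rewrite !mulr_ge0 //; lra.
  have k3 : 0 <= e * (1 - e) * b by rewrite !mulr_ge0 //; lra.
  rewrite expr2; lra.
pose M := `|d2| + 1; have M0 : 0 < M by rewrite /M; have := normr_ge0 d2; lra.
exists (d1 / M); first by rewrite divr_gt0.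
move=> e e0; rewrite ltr_pdivlMr // => eM.
have h2 := ler_norm (- d2); rewrite !normrN in h2; have b0 := normr_ge0 d2; rewrite /M in eM.
have : 0 < d1 + e * d2.
  move: `|d2| h2 b0 eM => b h2 b0 eM.
  have k2 : 0 <= e * (d2 + b) by rewrite !mulr_ge0 //; lra.
  lra.
by move=> h; rewrite (_ : _ + _ = e * (d1 + e * d2)); [exact: mulr_gt0 | ring].
Qed.

(** * Positive weights in general position *)

Section Core.
Variables (R : realType) (V : eqType).
Variables (K : bool -> nat) (u : bool -> nat -> V) (t t0 : bool -> nat -> R).
Hypothesis Wk : walks K u t t0.
Variables (n : nat) (x : bool -> nat -> nat).
Hypothesis xK : forall s m, (m < n)%N -> (x s m <= K s)%N.
Hypothesis x_mono : forall s m m', (m <= m')%N -> (m' < n)%N -> (x s m <= x s m')%N.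
Variables (Y0 h0 : bool -> V -> R).
Hypothesis Or : original K u t0 n x Y0 h0.
Variable tau : R.
Hypothesis tau_lt : forall s, tau < t s 0%N.
Local Notation S := (@wsum R K).
Local Notation step := (is_step u).
Local Notation blk := (blk K u).
Local Notation run := (run_index n x).
Local Notation w := (gap t).
Local Notation W := (blk_width t).

Definition first_visit s i := forall k, (k < i)%N -> u s k != u s i.
Definition last_visit s j := forall k, (j < k)%N -> (k <= K s)%N -> u s k != u s j.

Lemma innermost_lo (b : blk) : innermost b (sd b) (lo b).
Proof.
have [_ k2 _ _] := blkP b; have c : covers b (sd b) (lo b) by rewrite /covers eqxx; lia.
rewrite /innermost c step_lo; apply/forallP => b'; apply/implyP => c'.
have /orP[//|s1] := laminar Wk c c'; case/and3P: (s1) => /eqP es l1 _.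
have l2 : lo b' = lo b by move: c'; rewrite /covers es eqxx; lia.
by rewrite -(blk_lo_inj es l2) /nested eqxx !leqnn.
Qed.

Lemma blk_prev s i (b : blk) : (0 < i)%N -> first_visit s i ->
  inside b s i = inside b s i.-1 || (sd b == s) && (lo b == i.-1).
Proof.
move=> i0 fv; have [k1 k2 k3 k4] := blkP b; rewrite /inside; case: eqP => //= es.
apply/idP/idP => [|/orP[|/eqP e1]]; [lia| |lia] => h.
have : hi b != i by apply/eqP => e1; have := fv (lo b); rewrite -es -e1 k3 eqxx; lia.
lia.
Qed.

Lemma blk_next s j (b : blk) : (j < K s)%N -> last_visit s j ->
  inside b s j = inside b s j.+1 || (sd b == s) && (hi b == j.+1).
Proof.
move=> jK lv; have [k1 k2 k3 k4] := blkP b; rewrite /inside; case: eqP => //= es.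
apply/idP/idP => [|/orP[|/eqP e1]]; [lia| |lia] => h.
have : lo b != j by apply/eqP => e1; have := lv (hi b); rewrite -es -e1 k3 eqxx; rewrite e1; lia.
lia.
Qed.

(** No block ends at a first visit, so passing from [i.-1] to [i] only adds a block that starts at
    [i.-1]. *)
Lemma Ys_prev Kp (z : blk -> R) s i : (0 < i)%N -> first_visit s i ->
  Ys Kp z s i - Ys Kp z s i.-1 = Kp s i - Kp s i.-1 + \sum_(b : blk | (sd b == s) && (lo b == i.-1)) z b.
Proof.
move=> i0 fv; rewrite /Ys (bigID (fun b : blk => (sd b == s) && (lo b == i.-1))) /=.
rewrite (eq_bigl (fun b : blk => (sd b == s) && (lo b == i.-1))); last first.
  by move=> b /=; rewrite blk_prev //; case: ((sd b == s) && (lo b == i.-1)); rewrite ?orbT ?andbF.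
rewrite [X in _ + (_ + X) - _](eq_bigl (fun b : blk => inside b s i.-1)); first ring.
move=> b /=; rewrite blk_prev //; rewrite /inside; case: eqP => //= _.
by case: eqP => [->|]; rewrite ?ltnn ?orbT ?andbF ?orbF ?andbT.
Qed.

Lemma Ys_next Kp (z : blk -> R) s j : (j < K s)%N -> last_visit s j ->
  Ys Kp z s j - Ys Kp z s j.+1 = Kp s j - Kp s j.+1 + \sum_(b : blk | (sd b == s) && (hi b == j.+1)) z b.
Proof.
move=> jK lv; rewrite /Ys (bigID (fun b : blk => (sd b == s) && (hi b == j.+1))) /=.
rewrite (eq_bigl (fun b : blk => (sd b == s) && (hi b == j.+1))); last first.
  by move=> b /=; rewrite blk_next //; case: ((sd b == s) && (hi b == j.+1)); rewrite ?orbT ?andbF.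
rewrite [X in _ + (_ + X) - _](eq_bigl (fun b : blk => inside b s j.+1)); first ring.
move=> b /=; rewrite blk_next //; rewrite /inside; case: eqP => //= _.
by case: eqP => [->|]; rewrite ?ltnn ?orbT ?andbF ?orbF ?andbT.
Qed.

(** Each block contains all visits of the vertex, so one reaches at least to [j.+1] and the other
    back to at least [i.-1]; being nested, one of them runs exactly from [i.-1] to [j.+1]. *)
Lemma blk_tips s i j (b b' : blk) : (0 < i)%N -> (i <= j)%N -> (j < K s)%N -> u s i = u s j ->
  first_visit s i -> last_visit s j -> sd b = s -> lo b = i.-1 -> sd b' = s -> hi b' = j.+1 ->
  u s i.-1 = u s j.+1.
Proof.
move=> i0 ij jK e1 fv lv s1 l1 s2 l2.
have [k1 k2 k3 k4] := blkP b; have [k1' k2' k3' k4'] := blkP b'.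
have iK : (i <= K s)%N by lia.
have si : inside b s i by rewrite /inside s1 eqxx l1; lia.
have sj : inside b' s j by rewrite /inside s2 eqxx l2; lia.
have := inside_vertex Wk iK (ltnW jK) e1 si; have := inside_vertex Wk (ltnW jK) iK (esym e1) sj.
rewrite /inside s1 s2 eqxx /= => h' h.
have c : covers b s i.-1 by rewrite /covers s1 eqxx; lia.
have c' : covers b' s i.-1 by rewrite /covers s2 eqxx; lia.
rewrite s1 in k3; rewrite s2 in k3'.
case/orP: (laminar Wk c c') => /and3P[_ a1 a2].
  have e2 : hi b = j.+1 by lia.
  by rewrite -l1 k3 e2.
have e2 : lo b' = i.-1 by lia.
by rewrite -e2 k3' l2.
Qed.

(** Moebius inversion: ordered by block length, the nesting matrix is unitriangular. *)
Lemma nested_sum_solve (g : blk -> R) : exists eb : blk -> R, forall b : blk, \sum_(b' |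
    nested b' b) eb b' = g b.
Proof.
have [|eb heb] := @inj_linear_solve R blk (fun b b' => (nested b' b)%:R) _ g; last first.
  exists eb => b; rewrite -heb big_mkcond; apply: eq_bigr => b' _.
  by case: (nested _ _); rewrite ?mul1r ?mul0r.
move=> y y0 b; have [m] := ubnP (hi b - lo b)%N; elim: m b => // m IH b hm.
have := y0 b; rewrite (bigD1 b) //= big1 ?addr0 => [|b' ne].
  by rewrite /nested eqxx !leqnn mul1r.
case: (boolP (nested b' b)) => sb; last by rewrite mul0r.
rewrite IH ?mulr0 //; have [_ ? _ _] := blkP b; have [_ ? _ _] := blkP b'.
case/and3P: sb => /eqP es l1 l2.
suff : (lo b' != lo b) || (hi b' != hi b) by lia.
by apply: contraNT ne; rewrite negb_or !negbK => /andP[/eqP e1 /eqP e2]; apply/eqP; apply: blk_eq.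
Qed.

Section Flat.
Let e := \sum_s (t s 0%N - tau).
Let K1 : bool -> nat -> R := fun _ _ => 1.
Let eb1 : blk -> R := fun _ => 0.
Variable z : blk -> R.
Hypothesis Hz : solves t n x K1 1 e eb1 z.
Local Notation Y := (Ys K1 z).
Local Notation q := (qs t n x K1 1 e z).

Lemma flat_e_gt0 : 0 < e.
Proof. by rewrite /e big_bool addr_gt0 // subr_gt0. Qed.

Lemma flat_Qr0_ge0 r : 0 <= Qr0 K t n x K1 e r.
Proof.
rewrite /Qr0 addr_ge0 //; last by case: ifP => // _; apply/ltW/flat_e_gt0.
by apply: wsum_ge0 => s i iK; case: ifP => // _; rewrite mulr1 (gap_ge0 Wk).
Qed.

Lemma flat_z_ge0 b : 0 <= z b.
Proof.
apply: (zeta_nonneg Wk xK x_mono Or) => {}b; rewrite Hz rhs_split addrK.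
rewrite /rhs /eb1 addr0; apply: wsum_ge0 => s i iK; case: ifP => // _.
by case: ifP => // _; rewrite ?ler01 // divr_ge0 ?flat_Qr0_ge0 ?run_steps_ge0.
Qed.

Lemma flat_Y_gt0 s i : 0 < Y s i.
Proof. by rewrite /Ys ltr_pwDl ?ltr01 // sumr_ge0 // => b _; apply: flat_z_ge0. Qed.

(** If the total were not positive, the run would not be the first and would consist of steps only;
    its [drop_F] total would then be negative, although the crossings at its two ends make it
    zero. *)
Lemma flat_Qr_gt0 r s i : (r < n)%N -> (i < K s)%N -> step s i -> run s i = r -> 0 < Qr t n x K1 e z r.
Proof.
move=> rn iK st ri; rewrite /Qr.
have ge0 s' i' : (i' < K s')%N -> 0 <= if run s' i' == r then w s' i' * Y s' i' else 0.
  by move=> iK'; case: ifP => // _; rewrite mulr_ge0 ?(gap_ge0 Wk) // ltW // flat_Y_gt0.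
case: eqP => r0; first by rewrite ltr_wpDl ?flat_e_gt0 // wsum_ge0.
rewrite addr0 ltNge; apply/negP => le0.
have allst s' i' : (i' < K s')%N -> run s' i' = r -> step s' i'.
  move=> iK' ri'; apply: contraT => st'; move: le0; rewrite leNgt => /negP[].
  rewrite -[X in X < _](@wsum_0 R K); apply: (@lt_wsum _ _ _ _ s' i') => //.
  by rewrite ri' eqxx mulr_gt0 ?flat_Y_gt0 // (gap_gt0 Wk).
have : S (fun s i => if run s i == r then drop_F u t0 Y0 h0 s i else 0) < 0.
  rewrite -[X in _ < X](@wsum_0 R K); apply: (@lt_wsum _ _ _ _ s i) => //; last first.
    by rewrite ri eqxx (drop_F_step Or).
  by move=> s' i' iK'; case: eqP => // /(allst _ _ iK') st'; apply/ltW/(drop_F_step Or).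
case: r rn ri r0 {ge0 le0 allst} => // r rn _ _.
by rewrite wsum_run_diff !(drop_F_prefix xK x_mono Or) ?subrr ?ltxx // ltnW.
Qed.

Lemma flat_q_gt0 s i : (i < K s)%N -> step s i -> 0 < q s i.
Proof.
move=> iK st; rewrite /qs st; case: ifP => rn; last exact: ltr01.
rewrite divr_gt0 ?(flat_Qr_gt0 rn iK st) //.
rewrite -[X in X < _](@wsum_0 R K); apply: (@lt_wsum _ _ _ _ s i) => //; last by rewrite st eqxx ltr01.
by move=> s' i' _; case: ifP.
Qed.

Lemma flat_z_gt0 b : 0 < z b.
Proof.
suff : 0 < W b * z b by rewrite pmulr_rgt0 // (blk_width_gt0 Wk Or).
rewrite Hz addr0 -[X in X < _](@wsum_0 R K).
have lK : (lo b < K (sd b))%N by have [? ? _ _] := blkP b; lia.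
apply: (@lt_wsum _ _ _ _ (sd b) (lo b)) => //; last by rewrite innermost_lo flat_q_gt0 // step_lo.
by move=> s i iK; case: ifP => // /and3P[_ st _]; apply/ltW/flat_q_gt0.
Qed.
End Flat.

(** The last clause makes the walk neighbours before the first and after the last visit turn
    strictly around the vertex in [(h, Y)]. The solution with constant source may leave them aligned
    at equal [Y]; a small multiple of the solution with source [K2] bends them. *)
Theorem walk_weights : exists Y h : bool -> V -> R,
  let F s i := h s (u s i) - t s i * Y s (u s i) in
  [/\ forall s i, (i <= K s)%N -> 0 < Y s (u s i),
      forall s, Y s (u s 0%N) = 1 /\ h s (u s 0%N) = tau,
      forall s i, (i < K s)%N -> step s i -> F s i < F s i.+1,
      forall m, (m < n)%N -> F false (x false m) + F true (x true m) = 0 &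
      forall s i j, (0 < i)%N -> (i <= j)%N -> (j < K s)%N -> u s i = u s j ->
        first_visit s i -> last_visit s j -> u s i.-1 != u s j.+1 ->
        0 < (h s (u s i.-1) - h s (u s i)) * (Y s (u s j.+1) - Y s (u s i)) -
            (Y s (u s i.-1) - Y s (u s i)) * (h s (u s j.+1) - h s (u s i))].
Proof.
pose e := \sum_s (t s 0%N - tau).
pose K1 : bool -> nat -> R := fun _ _ => 1.
pose eb1 : blk -> R := fun _ => 0.
pose f1 s := tau - t s 0%N.
have K1v s i j : (i <= K s)%N -> (j <= K s)%N -> u s i = u s j -> K1 s i = K1 s j by [].
have eb1c (b : blk) : \sum_(b' | nested b' b) eb1 b' =
  - \sum_(lo b <= i < hi b) w (sd b) i * (K1 (sd b) i - K1 (sd b) (lo b)).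
  by rewrite !big1 ?oppr0 // => i _; rewrite subrr mulr0.
have f1s : f1 false + f1 true = - e by rewrite /f1 /e big_bool /=; ring.
have [z1 Hz1] := solves_ex Wk xK x_mono Or K1 1 e eb1.
pose Y1 := Ys K1 z1; pose q1 := qs t n x K1 1 e z1; pose F1 := Fs t n x K1 1 e f1 z1;
    pose h1 := hs t n x K1 1 e f1 z1.
have h1v s i j : (i <= K s)%N -> (j <= K s)%N -> u s i = u s j -> h1 s i = h1 s j.
  exact: (hs_vertex Wk f1 K1v eb1c Hz1).
have Y1v s i j : (i <= K s)%N -> (j <= K s)%N -> u s i = u s j -> Y1 s i = Y1 s j.
  exact: (Ys_vertex Wk K1v).
(* A function of [h1], hence of the vertex; strictly concave, which bends vertices level in [Y1];
   and zero at the root, where [h1] is [tau], so that [Y = 1] survives there. *)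
pose K2 s i := tau ^+ 2 - h1 s i ^+ 2.
have K2v s i j : (i <= K s)%N -> (j <= K s)%N -> u s i = u s j -> K2 s i = K2 s j.
  by move=> iK jK /(h1v _ _ _ iK jK); rewrite /K2 => ->.
have [eb2 eb2c] := nested_sum_solve (fun b : blk =>
    - \sum_(lo b <= i < hi b) w (sd b) i * (K2 (sd b) i - K2 (sd b) (lo b))).
pose f2 (s : bool) : R := 0.
have f2s : f2 false + f2 true = - 0 by rewrite /f2 addr0 oppr0.
have [z2 Hz2] := solves_ex Wk xK x_mono Or K2 0 0 eb2.
pose Y2 := Ys K2 z2; pose q2 := qs t n x K2 0 0 z2; pose F2 := Fs t n x K2 0 0 f2 z2;
    pose h2 := hs t n x K2 0 0 f2 z2.
have h2v s i j : (i <= K s)%N -> (j <= K s)%N -> u s i = u s j -> h2 s i = h2 s j.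
  exact: (hs_vertex Wk f2 K2v eb2c Hz2).
have Y2v s i j : (i <= K s)%N -> (j <= K s)%N -> u s i = u s j -> Y2 s i = Y2 s j.
  exact: (Ys_vertex Wk K2v).
have q1p s i : (i < K s)%N -> step s i -> 0 < q1 s i by apply: (flat_q_gt0 Hz1).
pose D0 s i j := (h1 s i.-1 - h1 s i) * (Y1 s j.+1 - Y1 s j) - (Y1 s i.-1 - Y1 s i) * (h1 s j.+1 - h1 s j).
pose D1 s i j := (h1 s i.-1 - h1 s i) * (Y2 s j.+1 - Y2 s j) + (h2 s i.-1 - h2 s i) * (Y1 s j.+1 - Y1 s j)
   - (Y1 s i.-1 - Y1 s i) * (h2 s j.+1 - h2 s j) - (Y2 s i.-1 - Y2 s i) * (h1 s j.+1 - h1 s j).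
pose D2 s i j := (h2 s i.-1 - h2 s i) * (Y2 s j.+1 - Y2 s j) - (Y2 s i.-1 - Y2 s i) * (h2 s j.+1 - h2 s j).
(* [D0], [D1], [D2] are the coefficients of the determinant as a polynomial in [ep]. A block
   starting at [i.-1] or ending at [j.+1] makes [D0] positive, and [blk_tips] excludes having both;
   with neither, the [Y1] differences vanish and concavity gives [D1]. *)
have Dpos s i j : (0 < i)%N -> (i <= j)%N -> (j < K s)%N -> u s i = u s j ->
   first_visit s i -> last_visit s j -> u s i.-1 != u s j.+1 -> 0 < D0 s i j \/ D0 s i j = 0 /\
       0 < D1 s i j.
  move=> i0 ij jK eij fv lv ne.
  have iK : (i.-1 < K s)%N by lia.
  have sti : step s i.-1 by rewrite /is_step prednK // fv // prednK.
  have stj : step s j by rewrite /is_step eq_sym lv.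
  have ep : h1 s i.-1 - h1 s i = - q1 s i.-1 + t s i * (Y1 s i.-1 - Y1 s i).
    have eF : F1 s i.-1.+1 = F1 s i.-1 + q1 s i.-1 by apply: (Fs_step Wk).
    have [et _] := wk_step Wk iK sti; rewrite prednK // in eF et.
    by rewrite /h1 /hs -/Y1 -/F1 eF et; ring.
  have en : h1 s j.+1 - h1 s j = q1 s j + t s j * (Y1 s j.+1 - Y1 s j).
    have eF : F1 s j.+1 = F1 s j + q1 s j by apply: (Fs_step Wk).
    have [et _] := wk_step Wk jK stj.
    by rewrite /h1 /hs -/Y1 -/F1 eF et; ring.
  have qi := q1p _ _ iK sti; have qj := q1p _ _ jK stj.
  have := Ys_prev K1 z1 i0 fv; have := Ys_next K1 z1 jK lv; rewrite -/Y1.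
  have := Ys_prev K2 z2 i0 fv; have := Ys_next K2 z2 jK lv; rewrite -/Y2.
  have [/existsP[b /andP[/eqP bs /eqP bl]]|nb] := boolP [exists b : blk, (sd b == s) && (lo b == i.-1)].
    have [/existsP[b' /andP[/eqP bs' /eqP bl']]|nb'] := boolP [exists b : blk,
        (sd b == s) && (hi b == j.+1)].
      by rewrite (blk_tips i0 ij jK eij fv lv bs bl bs' bl') eqxx in ne.
    move=> _ _; rewrite [X in _ = _ + X -> _]big_pred0 ?addr0; last first.
      by move=> b'; apply: contraNF nb' => h; apply/existsP; exists b'.
    rewrite (big_pred1 b) => [|b']; last first.
      apply/idP/eqP => [/andP[/eqP c1 /eqP c2]|->]; last by rewrite bs bl !eqxx.
      by apply: blk_lo_inj; congruence.
    rewrite /K1 !subrr ?add0r ?addr0 => e2 e1; left; have zb := flat_z_gt0 Hz1 b.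
    rewrite /D0 ep en (_ : Y1 s j.+1 - Y1 s j = 0); last lra.
    rewrite (_ : Y1 s i.-1 - Y1 s i = - z1 b); last lra.
    by rewrite !mulr0 !addr0 sub0r mulNr opprK mulr_gt0.
  rewrite ![\sum_(b | _ && (lo b == _)) _]big_pred0; try
    by move=> b'; apply: contraNF nb => h; apply/existsP; exists b'.
  have [/existsP[b /andP[/eqP bs /eqP bl]]|nb'] := boolP [exists b : blk, (sd b == s) && (hi b == j.+1)].
    move=> _ _; rewrite (big_pred1 b) => [|b']; last first.
      apply/idP/eqP => [/andP[/eqP c1 /eqP c2]|->]; last by rewrite bs bl !eqxx.
      by apply: blk_hi_inj; congruence.
    rewrite /K1 !subrr ?add0r ?addr0 => e2 e1; left; have zb := flat_z_gt0 Hz1 b.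
    rewrite /D0 ep en (_ : Y1 s i.-1 - Y1 s i = 0); last lra.
    rewrite (_ : Y1 s j.+1 - Y1 s j = - z1 b); last lra.
    by rewrite !mulr0 !addr0 mul0r subr0 mulrNN mulr_gt0.
  rewrite ![\sum_(b | _ && (hi b == _)) _]big_pred0; try
    by move=> b'; apply: contraNF nb' => h; apply/existsP; exists b'.
  rewrite /K1 !subrr ?addr0 => e4 e3 e2 e1; right.
  have y1 : Y1 s i.-1 - Y1 s i = 0 by lra.
  have y2 : Y1 s j.+1 - Y1 s j = 0 by lra.
  rewrite /D0 /D1 ep en y1 y2 !(mulr0, mul0r, addr0, subr0); split => //.
  rewrite y1 mulr0 addr0 in ep; rewrite y2 mulr0 addr0 in en.
  have hij : h1 s i = h1 s j by apply: h1v => //; lia.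
  have -> : Y2 s j.+1 - Y2 s j = - q1 s j * (2 * h1 s i + q1 s j).
    rewrite (_ : _ - _ = - (Y2 s j - Y2 s j.+1)); last by ring.
    rewrite e4 /K2 (_ : h1 s j.+1 = h1 s j + q1 s j); last lra.
    by rewrite hij; ring.
  have -> : Y2 s i.-1 - Y2 s i = q1 s i.-1 * (2 * h1 s i - q1 s i.-1).
    rewrite (_ : _ - _ = - (Y2 s i - Y2 s i.-1)); last by ring.
    rewrite e3 /K2 (_ : h1 s i.-1 = h1 s i - q1 s i.-1); last lra.
    by ring.
  move: (q1 s j) (q1 s i.-1) (h1 s i) qi qj => a b c b0 a0.
  have -> : - b * (- a * (2 * c + a)) - b * (2 * c - b) * a = a * b * (a + b) by ring.
  by rewrite !mulr_gt0 ?addr_gt0.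
(* The strict conditions are indexed by a side and two positions, hence finitely many, and one [ep]
   serves them all. *)
pose Ie : finType := (bool * 'I_(walk_bound K) * 'I_(walk_bound K))%type.
pose Q (a : Ie) (ep : R) : Prop := let: (s, i, j) := a in
  [/\ (i <= K s)%N -> 0 < Y1 s i + ep * Y2 s i,
      (i < K s)%N -> step s i -> 0 < q1 s i + ep * q2 s i &
      (0 < i)%N -> (i <= j)%N -> (j < K s)%N -> u s i = u s j ->
      first_visit s i -> last_visit s j -> u s i.-1 != u s j.+1 ->
      0 < D0 s i j + ep * D1 s i j + ep ^+ 2 * D2 s i j].
have [|ep ep0 hep] := @small_all R Ie Q.
  move=> [[s i] j].
  have [d1 d1p h_1] := @small_poly R (Y1 s i) (Y2 s i) 0 (or_introl (flat_Y_gt0 Hz1 s i)).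
  have [d2 d2p h_2] : exists2 d, 0 < d & forall ep, 0 < ep -> ep < d -> (i < K s)%N -> step s i ->
      0 < q1 s i + ep * q2 s i.
    have [/andP[iK st]|no] := boolP ((i < K s)%N && step s i); last first.
      by exists 1; rewrite ?ltr01 // => ep _ _ iK st; rewrite iK st in no.
    have [d dp hd] := @small_poly R (q1 s i) (q2 s i) 0 (or_introl (q1p _ _ iK st)).
    by exists d => // ep l1 l2 _ _; have := hd ep l1 l2; rewrite mulr0 addr0.
  have [d3 d3p h_3] : exists2 d, 0 < d & forall ep, 0 < ep -> ep < d -> (0 < i)%N -> (i <= j)%N ->
      (j < K s)%N -> u s i = u s j ->
      first_visit s i -> last_visit s j -> u s i.-1 != u s j.+1 ->
      0 < D0 s i j + ep * D1 s i j + ep ^+ 2 * D2 s i j.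
    have [yes|no] := boolP [&& (0 < i)%N, (i <= j)%N, (j < K s)%N, u s i == u s j,
       [forall k : 'I_(walk_bound K), (k < i)%N ==> (u s k != u s i)],
       [forall k : 'I_(walk_bound K), (j < k)%N ==> (k <= K s)%N ==> (u s k != u s j)] &
           u s i.-1 != u s j.+1].
      case/and5P: yes => c1 c2 c3 /eqP c4 /and3P[c5 c6 c7].
      have fv : first_visit s i.
        move=> k ki; have kb := ltn_trans ki (ltn_ord i).
        by move/forallP/(_ (Ordinal kb))/implyP: c5; apply.
      have lv : last_visit s j.
        move=> k ki kK; have kb := ltKb kK.
        by move/forallP/(_ (Ordinal kb))/implyP: c6 => /(_ ki)/implyP; apply.
      have [d dp hd] := @small_poly R (D0 s i j) (D1 s i j) (D2 s i j) (Dpos _ _ _ c1 c2 c3 c4 fv lv c7).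
      by exists d => // ep l1 l2 *; apply: hd.
    exists 1; rewrite ?ltr01 // => ep _ _ c1 c2 c3 c4 fv lv c7.
    case/negP: no; rewrite c1 c2 c3 c7 /= andbT; apply/and3P; split; first exact/eqP.
      by apply/forallP => k; apply/implyP => ki; exact: (fv k ki).
    by apply/forallP => k; apply/implyP => k1; apply/implyP => k2; exact: (lv k k1 k2).
  exists (Num.min d1 (Num.min d2 d3)); first by rewrite !lt_min d1p d2p d3p.
  move=> ep l1; rewrite !lt_min => /and3P[l2 l3 l4]; split; [|exact: h_2|exact: h_3].
  by move=> _; have := h_1 ep l1 l2; rewrite mulr0 addr0.
pose idx s v := index v [seq u s i | i <- iota 0 (K s).+1].
have idxP s i : (i <= K s)%N -> (idx s (u s i) <= K s)%N /\ u s (idx s (u s i)) = u s i.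
  move=> iK; have vin : u s i \in [seq u s i | i <- iota 0 (K s).+1].
    by apply/mapP; exists i => //; rewrite mem_iota.
  have l : (idx s (u s i) < (K s).+1)%N by have := vin; rewrite -index_mem size_map size_iota.
  split=> //; have := nth_index (u s i) vin.
  by rewrite (nth_map 0%N) ?size_iota // nth_iota.
exists (fun s v => Y1 s (idx s v) + ep * Y2 s (idx s v)), (fun s v => h1 s (idx s v) + ep * h2 s (idx s v)).
have EY1 s i : (i <= K s)%N -> Y1 s (idx s (u s i)) = Y1 s i by move=> iK;
    have [l1 l2] := idxP s i iK; apply: Y1v.
have EY2 s i : (i <= K s)%N -> Y2 s (idx s (u s i)) = Y2 s i by move=> iK;
    have [l1 l2] := idxP s i iK; apply: Y2v.
have Eh1 s i : (i <= K s)%N -> h1 s (idx s (u s i)) = h1 s i by move=> iK;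
    have [l1 l2] := idxP s i iK; apply: h1v.
have Eh2 s i : (i <= K s)%N -> h2 s (idx s (u s i)) = h2 s i by move=> iK;
    have [l1 l2] := idxP s i iK; apply: h2v.
have b0 : (0 < walk_bound K)%N by [].
have EF s i : (i <= K s)%N -> h1 s (idx s (u s i)) + ep * h2 s (idx s (u s i)) -
   t s i * (Y1 s (idx s (u s i)) + ep * Y2 s (idx s (u s i))) = F1 s i + ep * F2 s i.
  by move=> iK; rewrite EY1 ?EY2 ?Eh1 ?Eh2 // /h1 /h2 /hs -/F1 -/F2 -/Y1 -/Y2; ring.
split => /=.
- move=> s i iK; rewrite EY1 ?EY2 //.
  by have [/(_ iK)] := hep (s, Ordinal (ltKb iK), Ordinal b0).
- move=> s; rewrite EY1 // EY2 // Eh1 // Eh2 //.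
  have hr : h1 s 0%N = tau by rewrite /h1 (hs_root) /f1 /K1; ring.
  rewrite /Y1 /Y2 /h2 !Ys_root hr hs_root /f2 /K1 /K2 hr; split; ring.
- move=> s i iK st; rewrite !EF //; last exact: ltnW.
  have [_ /(_ iK st) + _] := hep (s, Ordinal (ltKb (ltnW iK)), Ordinal b0).
  have e1 : F1 s i.+1 = F1 s i + q1 s i by apply: (Fs_step Wk).
  have e2 : F2 s i.+1 = F2 s i + q2 s i by apply: (Fs_step Wk).
  rewrite e1 e2 /= => hq; rewrite -subr_gt0; apply: lt_le_trans hq _; rewrite le_eqVlt; apply/orP;
      left; apply/eqP; ring.
- move=> m mn; rewrite !EF ?xK //.
  have c1 : F1 false (x false m) + F1 true (x true m) = 0 by apply: (crossing_balance Wk xK x_mono Or).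
  have c2 : F2 false (x false m) + F2 true (x true m) = 0 by apply: (crossing_balance Wk xK x_mono Or).
  rewrite (_ : _ + _ = (F1 false (x false m) + F1 true (x true m)) + ep * (F2 false (x false m) +
      F2 true (x true m))); last ring.
  by rewrite c1 c2 mulr0 addr0.
move=> s i j i0 ij jK eij fv lv ne; have iK : (i <= K s)%N by lia.
have [_ _ /(_ i0 ij jK eij fv lv ne)] := hep (s, Ordinal (ltKb iK), Ordinal (ltKb (ltnW jK))).
rewrite eij !EY1 ?EY2 ?Eh1 ?Eh2 /=; try lia.
have a1 : h1 s i = h1 s j by apply: h1v => //; lia.
have a2 : h2 s i = h2 s j by apply: h2v => //; lia.
have a3 : Y1 s i = Y1 s j by apply: Y1v => //; lia.
have a4 : Y2 s i = Y2 s j by apply: Y2v => //; lia.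
rewrite /D0 /D1 /D2 a1 a2 a3 a4 => hq; apply: lt_le_trans hq _; rewrite le_eqVlt; apply/orP; left;
    apply/eqP; ring.
Qed.
End Core.

(** * Positively oriented triangulations are plane *)

Section Chain.
Variables (T : finType) (C fin : pred T) (s : T -> T) (lt : rel T).
Hypothesis ltI : irreflexive lt.
Hypothesis ltT : transitive lt.
Hypothesis s_in : forall d, C d -> ~~ fin d -> C (s d) && lt d (s d).
Hypothesis s_inj : forall d d', C d -> C d' -> ~~ fin d -> ~~ fin d' -> s d = s d' -> d = d'.
Hypothesis fin1 : forall d d', C d -> C d' -> fin d -> fin d' -> d = d'.

Definition chained d m := forall k, (k < m)%N -> C (iter k s d) && ~~ fin (iter k s d).

Lemma chain_end d : C d -> exists m, [/\ chained d m, C (iter m s d) & fin (iter m s d)].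
Proof.
have [m] := ubnP #|[pred d' | C d' && lt d d']|; elim: m d => // m IH d hm Cd.
have [fd|nfd] := boolP (fin d); first by exists 0%N.
have /andP[Cs ls] := s_in Cd nfd.
have [|k [h1 h2 h3]] := IH (s d) _ Cs.
  rewrite -ltnS; apply: leq_trans hm; rewrite ltnS; apply: proper_card; apply/properP; split.
    by apply/subsetP => d' /andP[c l]; rewrite inE c (ltT ls l).
  by exists (s d); rewrite inE Cs ?ls // ltI.
exists k.+1; rewrite iterSr; split => // -[|j] jk; first by rewrite /= Cd.
by rewrite iterSr; apply: h1.
Qed.

Lemma chained_lt d m k : chained d m -> (k < m)%N -> lt d (iter k.+1 s d).
Proof.
move=> h; elim: k => [|k IH] km; first by have /andP[a b] := h 0%N km; have /andP[] := s_in a b.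
apply: ltT (IH (ltnW km)) _; have /andP[a b] := h _ km.
by have /andP[] := s_in a b.
Qed.

(** Both chains end at the unique final element; by injectivity they can be followed back in
    parallel, so the shorter is a tail of the longer. *)
Lemma chain_total d d' : C d -> C d' ->
  (exists2 m, chained d m & d' = iter m s d) \/ (exists2 m, chained d' m & d = iter m s d').
Proof.
move=> Cd Cd'; have [m [h1 h2 h3]] := chain_end Cd; have [m' [h1' h2' h3']] := chain_end Cd'.
suff key e e' n n' : chained e n -> chained e' n' -> C (iter n s e) -> C (iter n' s e') ->
    fin (iter n s e) -> fin (iter n' s e') -> (n <= n')%N ->
    exists2 m, chained e' m & e = iter m s e'.
  by have [l|l] := leqP m m'; [right; apply: (key d d' m m')|left; apply: (key d' d m' m) => //;
      exact: ltnW].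
move=> k1 k2 k3 k4 k5 k6 nn; exists (n' - n)%N; first by move=> k kn; apply: k2;
    apply: leq_trans kn (leq_subr _ _).
have back k : (k <= n)%N -> iter (n - k) s e = iter (n' - k) s e'.
  elim: k => [_|k IH kn]; first by rewrite !subn0; apply: fin1.
  have kn' : (k < n')%N := leq_trans kn nn.
  have l1 : (n - k.+1 < n)%N by rewrite ltn_subrL (leq_ltn_trans (leq0n k) kn).
  have l2 : (n' - k.+1 < n')%N by rewrite ltn_subrL (leq_ltn_trans (leq0n k) kn').
  have /andP[a1 a2] := k1 _ l1; have /andP[b1 b2] := k2 _ l2.
  by apply: s_inj => //; rewrite -!iterS !subnSK // IH // ltnW.
by have := back n (leqnn n); rewrite subnn.
Qed.

Lemma chain_next d d' : C d -> C d' -> d <> d' ->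
  ~~ fin d /\ (s d = d' \/ lt (s d) d') \/ ~~ fin d' /\ (s d' = d \/ lt (s d') d).
Proof.
have key e m : chained e m -> e <> iter m s e -> ~~ fin e /\ (s e = iter m s e \/ lt (s e) (iter m s e)).
  case: m => [|m] // h _; have /andP[_ f] := h 0%N isT; split => //.
  case: m h => [|m] h; first by left.
  right; rewrite iterSr; apply: (@chained_lt (s e) m.+1); last exact: leqnn.
  by move=> k km; rewrite -iterSr; apply: h.
move=> Cd Cd' ne; have [[m h e]|[m h e]] := chain_total Cd Cd'; [left|right].
  by have := key d m h; rewrite -e; apply.
by have := key d' m h; rewrite -e; apply; apply: nesym.
Qed.
End Chain.

Lemma no_out_tri (R : realType) (P : finType) (E : rel P) (tri : P -> P -> P ->
    bool) (x y z w : P) (p : P -> point R) :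
  triangulation E tri x y z p -> tri y x w -> False.
Proof.
move=> T /(tg_pos T); have out := tg_out T; rewrite (_ : det _ _ _ = - det (p x) (p y) (p w)); last first.
  by rewrite /det /crossp /=; ring.
have [->|nx] := eqVneq w x; first by rewrite detaba oppr0 ltxx.
have [->|ny] := eqVneq w y; first by rewrite detabb oppr0 ltxx.
have [->|nz] := eqVneq w z; first by lra.
by have [|i1 i2 i3] := tg_in T (v := w); [exact/and3P | lra].
Qed.

Lemma avoid_slope (R : realType) (P : finType) (q : P -> point R) (z : point R) : (forall v, q v <> z) ->
  exists s, forall v, (q v).2 - s * (q v).1 != z.2 - s * z.1.
Proof.
move=> nz; pose L := z :: map q (enum P).
have [s hs] := @generic_slope R (seq_sub L) val val_inj.
exists s => v; apply/eqP => e; apply: (nz v).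
have vL : q v \in L by rewrite inE map_f ?orbT ?mem_enum.
have zL : z \in L by rewrite inE eqxx.
by have := hs (SeqSub vL) (SeqSub zL) e; move/(congr1 val).
Qed.

(** * Edges crossed by a level line *)

Section Planarity.
Variables (R : realType) (P : finType) (E : rel P) (tri : P -> P -> P -> bool)
  (x y z : P) (p q : P -> point R).
Hypothesis T : triangulation E tri x y z p.
Hypothesis q_out : 0 < det (q x) (q y) (q z).
Hypothesis pos : forall a b c, tri a b c -> 0 < det (q a) (q b) (q c).
Local Notation inner := (inner_vertex x y z).
Local Notation nx := (next_nbr tri).

Lemma edge_image_neq a b : E a b -> q a <> q b.
Proof.
have h c d : E c d -> q c = q d -> [|| (c, d) == (y, x), (c, d) == (z, y) | (c, d) == (x, z)].
  move=> e ecd; apply: contraT; rewrite !negb_or => /and3P[n1 n2 n3].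
  by have [w /pos] := tg_next T e n1 n2 n3; rewrite ecd detaa ltxx.
move=> e eq; have := h _ _ e eq; rewrite !xpair_eqE.
case/or3P=> /andP[/eqP e1 /eqP e2]; move: q_out eq; rewrite e1 e2 => + e3; rewrite e3.
- by rewrite detaa ltxx.
- by rewrite detabb ltxx.
- by rewrite detaba ltxx.
Qed.

Section Level.
Variables (sl c : R).
Definition level (u : point R) := u.2 - sl * u.1.
Definition colevel (u : point R) := u.1 + sl * u.2.
Hypothesis generic : forall v, level (q v) != c.
Definition up_edge (d : P * P) := [&& E d.1 d.2, level (q d.1) < c & c < level (q d.2)].
Definition end_edge (d : P * P) := [|| d == (x, y), d == (y, z) | d == (z, x)].
(** The line leaves the face to the right of [d] through one of its two other sides, according to
    the side of the line on which the third vertex lies. *)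
Definition next_up (d : P * P) := let w := nx d.2 d.1 in
  if c < level (q w) then (d.1, w) else (w, d.2).
Definition cross_par (d : P * P) := (c - level (q d.1)) / (level (q d.2) - level (q d.1)).
Definition cross_pt (d : P * P) := interp (q d.1) (q d.2) (cross_par d).
Definition left_of (d d' : P * P) := colevel (cross_pt d) < colevel (cross_pt d').

Lemma level_interp a b t : level (interp a b t) = (1 - t) * level a + t * level b.
Proof. by rewrite /level /=; ring. Qed.

Lemma cross_par01 d : up_edge d -> 0 < cross_par d < 1.
Proof. by case/and3P=> _ h1 h2; apply: ratio_in01; lra. Qed.

Lemma level_cross_pt d : up_edge d -> level (cross_pt d) = c.
Proof. by case/and3P=> _ h1 h2; rewrite level_interp /cross_par; field; lra. Qed.

Lemma cross_side d u : up_edge d -> level u = c ->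
  (level (q d.2) - level (q d.1)) * (colevel (cross_pt d) - colevel u) = (1 + sl ^+ 2) * det (q
      d.1) (q d.2) u.
Proof.
move=> ud gu; have := level_cross_pt ud; have : det (q d.1) (q d.2) (cross_pt d) = 0.
  by rewrite det_interp detaba detabb; ring.
move: (cross_pt d) gu; case=> u1 u2; case: u => v1 v2; rewrite /det /crossp /level /colevel /=.
move=> gu h1 gc; have e2 : u2 = v2 + sl * (u1 - v1) by lra.
rewrite e2 in h1 *; move: h1; case: (q d.1) (q d.2) => [a1 a2] [b1 b2] /= h1.
rewrite -[RHS]subr0 -[X in _ = _ - X](mulr0 (1 + sl ^+ 2)) -[X in _ = _ - _ * X]h1; ring.
Qed.

Lemma cross_sideP d u : up_edge d -> level u = c ->
    (colevel u < colevel (cross_pt d)) = (0 < det (q d.1) (q d.2) u) /\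
  (colevel (cross_pt d) < colevel u) = (det (q d.1) (q d.2) u < 0).
Proof.
move=> ud gu; have := cross_side ud gu; have /and3P[_ h1 h2] := ud.
have gp : 0 < level (q d.2) - level (q d.1) by lra.
have np : 0 < 1 + sl ^+ 2 by have := sqr_ge0 sl; lra.
move=> e; split.
  by rewrite -subr_gt0 -(pmulr_rgt0 _ gp) e pmulr_rgt0.
by rewrite -subr_lt0 -(pmulr_rlt0 _ gp) e pmulr_rlt0.
Qed.

Lemma up_edge_tri d : up_edge d -> ~~ end_edge d -> tri d.2 d.1 (nx d.2 d.1).
Proof.
case: d => a b; case/and3P=> /= e _ _; rewrite /end_edge !xpair_eqE !negb_or => /and3P[n1 n2 n3].
rewrite (tg_sym T) in e.
have [||| w h] := tg_next T e; rewrite ?xpair_eqE ?[(b == _) && _]andbC //.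
by rewrite (next_nbrP T h).
Qed.

Lemma next_up_edge d : up_edge d -> ~~ end_edge d -> up_edge (next_up d) && left_of d (next_up d).
Proof.
move=> ud nd; have t := up_edge_tri ud nd; have D := pos t; have /andP[p0 p1] := cross_par01 ud.
have t' := tg_rot T t.
have e1 := tg_edge T t'; have e2 := tg_edge T (tg_rot T t').
have gc := level_cross_pt ud; have /and3P[_ g1 g2] := ud.
rewrite /next_up; case: ltP => gw.
  have ud' : up_edge (d.1, nx d.2 d.1) by rewrite /up_edge /= e1 g1 gw.
  rewrite ud' /left_of; have [-> _] := cross_sideP ud' gc;
      rewrite det_interp detaba mulr0 add0r mulr_gt0 //=.
  by rewrite det_rot.
have gw' : level (q (nx d.2 d.1)) < c by rewrite lt_neqAle generic.
have ud' : up_edge (nx d.2 d.1, d.2) by rewrite /up_edge /= e2 g2 gw'.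
rewrite ud' /left_of; have [-> _] := cross_sideP ud' gc;
    rewrite det_interp detabb mulr0 addr0 mulr_gt0 //=; first by rewrite subr_gt0.
by rewrite -det_rot.
Qed.

Lemma next_up_inj d d' : up_edge d -> up_edge d' -> ~~ end_edge d -> ~~ end_edge d' ->
    next_up d = next_up d' -> d = d'.
Proof.
move=> ud ud' nd nd'; have := up_edge_tri ud nd; have := up_edge_tri ud' nd'.
move: ud ud'; case: d nd => a b nd; case: d' nd' => a' b' nd'; rewrite /next_up /up_edge /=.
move=> /and3P[_ g1 g2] /and3P[_ g1' g2']; move: (nx b a) (nx b' a') => w w' t' t.
have r1 := tg_rot T t; have r2 := tg_rot T r1; have r1' := tg_rot T t'; have r2' := tg_rot T r1'.
case: ifP => h; case: ifP => h' [e1 e2]; subst.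
- by rewrite (tg_uniq T r1 r1').
- by rewrite -(tg_uniq T r1 r2') in g1'; have := lt_trans g1' g2; rewrite ltxx.
- by rewrite (tg_uniq T r1' r2) in g2'; have := lt_trans g1 g2'; rewrite ltxx.
- by rewrite (tg_uniq T r2 r2').
Qed.

Lemma end_edge_uniq d d' : up_edge d -> up_edge d' -> end_edge d -> end_edge d' -> d = d'.
Proof.
case/and3P=> _ g1 g2 /and3P[_ g1' g2'] /or3P[] /eqP e /or3P[] /eqP e'; subst d d' => //; exfalso;
    move: g1 g2 g1' g2' => /=; lra.
Qed.

(** Positive faces move the crossing point strictly to the right, and at most one outer edge rises
    through the level in the terminal orientation; so all up-edges form a single chain. *)
Lemma up_edge_consecutive d d' : up_edge d -> up_edge d' -> d <> d' ->
  ~~ end_edge d /\ colevel (cross_pt (next_up d)) <= colevel (cross_pt d') \/ ~~ end_edge d' /\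
      colevel (cross_pt (next_up d')) <= colevel (cross_pt d).
Proof.
move=> ud ud' ne.
have lI : irreflexive left_of by move=> ?; rewrite /left_of ltxx.
have lT : transitive left_of by move=> ? ? ?; apply: lt_trans.
have [[nr [->|/ltW h]]|[nr [->|/ltW h]]] :=
    chain_next lI lT next_up_edge next_up_inj end_edge_uniq ud ud' ne.
- by left.
- by left.
- by right.
- by right.
Qed.

Lemma up_edge_inj d d' : up_edge d -> up_edge d' -> colevel (cross_pt d) = colevel (cross_pt d') -> d = d'.
Proof.
move=> ud ud' e; apply: contrapT => /(up_edge_consecutive ud ud') [[nr h]|[nr h]].
  by have /andP[_] := next_up_edge ud nr; rewrite /left_of ltNge e h.
by have /andP[_] := next_up_edge ud' nr; rewrite /left_of ltNge -e h.
Qed.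

Lemma cross_pt_on a b u : E a b -> level u = c -> open_seg (q a) (q b) u ->
    exists d, [/\ up_edge d, d = (a, b) \/ d = (b, a) & cross_pt d = u].
Proof.
move=> e gu o; have key a' b' : E a' b' -> open_seg (q a') (q b') u -> level (q a') < c ->
    up_edge (a', b') /\ cross_pt (a', b') = u.
  move=> e' [t t01 et] ga;
      have gt : (1 - t) * level (q a') + t * level (q b') = c by rewrite -level_interp -et.
  have gb : c < level (q b').
    rewrite ltNge; apply/negP => gb;
        suff : (1 - t) * level (q a') + t * level (q b') < c by rewrite gt ltxx.
    have : 0 < (1 - t) * (c - level (q a')) by apply: mulr_gt0; lra.
    have : 0 <= t * (c - level (q b')) by apply: mulr_ge0; lra.
    lra.
  split; first by rewrite /up_edge /= e' ga gb.
  by rewrite et /cross_pt /cross_par /= -gt; congr interp; field; lra.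
have [l|l] := ltP (level (q a)) c.
  by have [h1 h2] := key _ _ e o l; exists (a, b); split => //; left.
have l' : level (q b) < c.
  have [t t01 et] := o; have gt : (1 - t) * level (q a) + t * level (q b) = c by rewrite -level_interp -et.
  have l2 : c < level (q a) by rewrite lt_neqAle eq_sym generic.
  rewrite ltNge; apply/negP => gb.
  have : 0 < (1 - t) * (level (q a) - c) by apply: mulr_gt0; lra.
  have : 0 <= t * (level (q b) - c) by apply: mulr_ge0; lra.
  lra.
rewrite (tg_sym T) in e; have [h1 h2] := key _ _ e (open_seg_sym o) l'; exists (b, a); split => //;
    by right.
Qed.

(** The level line enters and leaves the face through two consecutive up-edges, with [u] strictly
    between the crossings. *)
Lemma strictly_in A B D u : tri A B D -> level u = c ->
  0 < det (q A) (q B) u -> 0 < det (q B) (q D) u -> 0 < det (q D) (q A) u ->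
  exists d, [/\ up_edge d, ~~ end_edge d, colevel (cross_pt d) < colevel u &
      colevel u < colevel (cross_pt (next_up d))].
Proof.
move=> t gu d1 d2 d3.
have key A' B' D' : tri A' B' D' -> c < level (q A') -> level (q B') < c ->
    0 < det (q A') (q B') u -> 0 < det (q B') (q D') u -> 0 < det (q D') (q A') u ->
    exists d, [/\ up_edge d, ~~ end_edge d, colevel (cross_pt d) < colevel u &
        colevel u < colevel (cross_pt (next_up d))].
  move=> t' gA gB h1 h2 h3; have e' := tg_edge T t'; have e := e'; rewrite (tg_sym T) in e.
  have ud : up_edge (B', A') by rewrite /up_edge /= e gA gB.
  have nr : ~~ end_edge (B', A').
    by apply/negP => /or3P[] /eqP[eB eA]; move: t'; rewrite eB eA => t';
        [case: (no_out_tri T t')|case: (no_out_tri (tg_turn T) t')|case: (no_out_tri (tg_turn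
        (tg_turn T)) t')].
  exists (B', A'); split => //.
    by have [_ ->] := cross_sideP ud gu;
        rewrite /= (_ : det _ _ _ = - det (q A') (q B') u) ?oppr_lt0 // /det /crossp /=; ring.
  have n : nx A' B' = D' by apply: (next_nbrP T t').
  have /andP[us _] := next_up_edge ud nr.
  have [-> _] := cross_sideP us gu; rewrite /next_up /= n; case: ifP => //= _.
have gc : det (q A) (q B) (q D) * c = det (q B) (q D) u * level (q A) + det (q D) (q A) u * level
    (q B) + det (q A) (q B) u * level (q D).
  by rewrite -gu /level /det /crossp /=; ring.
have sm : det (q A) (q B) (q D) = det (q B) (q D) u + det (q D) (q A) u + det (q A) (q B) u.
  by rewrite /det /crossp /=; ring.
have t1 := tg_rot T t; have t2 := tg_rot T t1.
have nA := generic A; have nB := generic B; have nD := generic D.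
have gt v : level (q v) != c -> c <= level (q v) -> c < level (q v) by rewrite lt_neqAle eq_sym => -> ->.
have [lA|lA] := ltP (level (q A)) c; have [lB|lB] := ltP (level (q B)) c;
    have [lD|lD] := ltP (level (q D)) c.
- exfalso; rewrite sm in gc.
  have k1 : 0 < det (q B) (q D) u * (c - level (q A)) by apply: mulr_gt0; lra.
  have k2 : 0 < det (q D) (q A) u * (c - level (q B)) by apply: mulr_gt0; lra.
  have k3 : 0 < det (q A) (q B) u * (c - level (q D)) by apply: mulr_gt0; lra.
  lra.
- exact: (key D A B t2 (gt _ nD lD) lA).
- exact: (key B D A t1 (gt _ nB lB) lD).
- exact: (key D A B t2 (gt _ nD lD) lA).
- exact: (key A B D t (gt _ nA lA) lB).
- exact: (key A B D t (gt _ nA lA) lB).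
- exact: (key B D A t1 (gt _ nB lB) lD).
exfalso; rewrite sm in gc; move: (gt _ nA lA) (gt _ nB lB) (gt _ nD lD) => {}lA {}lB {}lD.
have k1 : 0 < det (q B) (q D) u * (level (q A) - c) by apply: mulr_gt0; lra.
have k2 : 0 < det (q D) (q A) u * (level (q B) - c) by apply: mulr_gt0; lra.
have k3 : 0 < det (q A) (q B) u * (level (q D) - c) by apply: mulr_gt0; lra.
lra.
Qed.
End Level.

(** On a generic line through the common point no vertex lies, and both edges become up-edges with
    the same crossing point. *)
Lemma edges_meet a b a' b' u : E a b -> E a' b' -> (forall v, q v <> u) ->
  open_seg (q a) (q b) u -> open_seg (q a') (q b') u -> (a, b) = (a', b') \/ (a, b) = (b', a').
Proof.
move=> e e' nv o o'; have [sl gen] := avoid_slope nv.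
have [d [ud ed cd]] := cross_pt_on (sl := sl) (c := level sl u) gen e erefl o.
have [d' [ud' ed' cd']] := cross_pt_on (sl := sl) (c := level sl u) gen e' erefl o'.
have edd : d = d' by apply: (up_edge_inj gen ud ud'); rewrite cd cd'.
by rewrite -edd in ed'; case: ed ed' => -> [] [-> ->]; tauto.
Qed.

Lemma inner_nbr v al be : inner v -> al != 0 \/ be != 0 -> exists2 u, E v u &
    linform al be (q v) < linform al be (q u).
Proof.
move=> iv ab; pose D : point R := (be, - al).
have D0 : D.1 != 0 \/ D.2 != 0 by rewrite /= oppr_eq0; case: ab; [right|left].
have [u|u|u uN h] := @cycle_meets_halfplane R P (fun u =>
    vec (q v) (q u)) (nx v) (nbrs E v) (nbrs0 T iv) _ _ D D0.
- exact: (next_nbr_in T).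
- by rewrite inE => e; apply: pos; apply: (next_nbr_tri T).
exists u; first by move: uN; rewrite inE.
by move: h; rewrite /linform /crossp /=; lra.
Qed.

Lemma outer_max v : v != x -> det (q y) (q z) (q v) < det (q y) (q z) (q x).
Proof.
move=> vx; pose f v := det (q y) (q z) (q v).
have fl u : f u = linform (- ((q z).2 - (q y).2)) ((q z).1 - (q y).1) (q u) + ((q z).2 - (q y).2) *
    (q y).1 - ((q z).1 - (q y).1) * (q y).2.
  by rewrite /f /linform /det /crossp /=; ring.
have fx : 0 < f x by rewrite /f det_rot.
have nz : - ((q z).2 - (q y).2) != 0 \/ (q z).1 - (q y).1 != 0.
  have [h|] := eqVneq ((q z).1 - (q y).1) 0; [left | by right].
  apply/eqP => h'; move: fx;
      rewrite /f /det /crossp /= h (_ : (q z).2 - (q y).2 = 0) ?mul0r ?subrr ?ltxx //; lra.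
have notin u : inner u -> exists w, f u < f w.
  by move=> iu; have [w _ h] := inner_nbr iu nz; exists w; rewrite !fl; lra.
have big u : f u <= f x.
  case: (@Order.TotalTheory.arg_maxP _ _ _ x predT f isT) => m _ mx; apply: le_trans (mx u isT) _.
  have [/notin[w]|] := boolP (inner m); first by rewrite ltNge => /negP; case; exact: (mx w isT).
  rewrite /inner_vertex !negb_and !negbK => /or3P[] /eqP -> //; apply: ltW; rewrite /f ?detabb ?detaba //.
rewrite -/(f v) -/(f x) lt_neqAle big andbT; apply/eqP => e.
have [/notin[w]|] := boolP (inner v); first by rewrite e ltNge big.
rewrite /inner_vertex !negb_and !negbK (negbTE vx) /= => /orP[] /eqP ev; move: fx;
    rewrite -e ev /f ?detabb ?detaba ltxx //.
Qed.

Lemma outer_off a b t : E a b -> x != a -> x != b -> 0 <= t < 1 -> q x <> interp (q a) (q b) t.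
Proof.
move=> e xa xb t01 h; have := outer_max (v := a); have := outer_max (v := b).
rewrite eq_sym xb eq_sym xa => /(_ isT) h1 /(_ isT) h2.
have : det (q y) (q z) (q x) < det (q y) (q z) (q x); last by rewrite ltxx.
rewrite {1}h det_interp.
have k1 : 0 < (1 - t) * (det (q y) (q z) (q x) - det (q y) (q z) (q a)) by apply: mulr_gt0; lra.
have k2 : 0 <= t * (det (q y) (q z) (q x) - det (q y) (q z) (q b)) by apply: mulr_ge0; lra.
lra.
Qed.

(** If [q w] were on the edge, the point [ze ep] slightly further along it would be on an edge at
    [w], against [edges_meet], or strictly inside a face at [w], between consecutive up-edges where
    no other edge can cross. *)
Lemma inner_off w a b t : inner w -> E a b -> w != a -> w != b -> 0 <= t < 1 -> q w <> interp (q a) (q b) t.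
Proof.
move=> iw e wa wb t01 h; pose D := vec (q a) (q b).
have qab : q a != q b by apply/eqP; apply: edge_image_neq.
have D0 : D.1 != 0 \/ D.2 != 0.
  have [e1|e1] := eqVneq D.1 0; last by left.
  right; apply: contraNneq qab => e2; apply/eqP/pair_ext; move: e1 e2; rewrite /D /vec /=; lra.
have [u|u|u uN /andP[c1 c2]] := @cycle_covers R P (fun u =>
    vec (q w) (q u)) (nx w) (nbrs E w) D (nbrs0 T iw) _ _ D0.
- exact: (next_nbr_in T).
- by rewrite inE => ewu; apply: pos; apply: (next_nbr_tri T).
rewrite inE in uN; have tr := next_nbr_tri T iw uN; move: (nx w u) tr c2 => u' tr c2.
have dt := pos tr.
pose ze ep : point R := ((q w).1 + ep * D.1, (q w).2 + ep * D.2).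
have D2 := sqnorm_gt0 D0.
pose Q (v : P) ep := [/\ q v <> ze ep, ep < 1 - t &
    ep * (crossp D (vec (q w) (q u')) + crossp (vec (q w) (q u)) D) < det (q w) (q u) (q u')].
have [|ep ep0 hQ] := @small_all R P Q.
  move=> v; have S0 : 0 < crossp D (vec (q w) (q u')) + crossp (vec (q w) (q u)) D by lra.
  pose d0 := Num.min (1 - t) (det (q w) (q u) (q u') / (crossp D (vec (q w) (q u')) + crossp (vec
      (q w) (q u)) D)).
  have d00 : 0 < d0 by rewrite lt_min divr_gt0 // andbT; lra.
  have ok ep : 0 < ep -> ep < d0 -> ep < 1 - t /\
      ep * (crossp D (vec (q w) (q u')) + crossp (vec (q w) (q u)) D) < det (q w) (q u) (q u').
    by move=> h1; rewrite lt_min ltr_pdivlMr // => /andP[].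
  have [[ev [ev0 hv]]|no] := pselect (exists ev, 0 < ev /\ q v = ze ev); last first.
    exists d0 => // ep h1 h2; have [o1 o2] := ok _ h1 h2; split=> // h3; apply: no; by exists ep.
  exists (Num.min d0 ev); first by rewrite lt_min d00.
  move=> ep h1; rewrite lt_min => /andP[h2 h3]; have [o1 o2] := ok _ h1 h2; split => //.
  rewrite hv => hh; have e1 : (q w).1 + ev * D.1 = (q w).1 + ep * D.1 := congr1 fst hh.
  have e2 : (q w).2 + ev * D.2 = (q w).2 + ep * D.2 := congr1 snd hh.
  case: D0 => D0; move/eqP: D0 => D0; apply: D0.
    by apply: (@mulfI _ (ev - ep)); [rewrite subr_eq0 gt_eqF | rewrite mulr0; lra].
  by apply: (@mulfI _ (ev - ep)); [rewrite subr_eq0 gt_eqF | rewrite mulr0; lra].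
have nv v : q v <> ze ep by have [] := hQ v.
have [_ ep1 ep2] := hQ w.
have oab : open_seg (q a) (q b) (ze ep).
  exists (t + ep); first lra.
  by rewrite /ze h /D /vec; apply: pair_ext => /=; ring.
have ewu' := tri_edge2 T tr.
have dwu : det (q w) (q u) (ze ep) = ep * crossp (vec (q w) (q u)) D by rewrite /ze /det /crossp /=; ring.
have duw : det (q u') (q w) (ze ep) = ep * crossp D (vec (q w) (q u')) by rewrite /ze /det /crossp /=; ring.
have [c0|c0] := eqVneq (crossp (vec (q w) (q u)) D) 0.
  have qwu : q w != q u by apply/eqP; apply: edge_image_neq.
  have [s es] : exists s, ze ep = interp (q w) (q u) s by apply: det0_line => //; rewrite dwu c0 mulr0.
  have ds : s * det (q w) (q u) (q u') = ep * crossp D (vec (q w) (q u')).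
    by rewrite -duw es /det /crossp /=; ring.
  have s0 : 0 < s by rewrite -(pmulr_lgt0 _ dt) ds mulr_gt0.
  have s1 : s < 1 by rewrite -(ltr_pM2r dt) mul1r ds; move: ep2; rewrite c0 addr0.
  have o2 : open_seg (q w) (q u) (ze ep) by exists s; rewrite ?s0.
  by case: (edges_meet e uN nv oab o2) => -[h1 h2]; move: wa wb; rewrite h1 h2 eqxx.
have cp0 : 0 < crossp (vec (q w) (q u)) D by rewrite lt_neqAle eq_sym c0.
have [sl gen0] := avoid_slope nv.
have gen v : level sl (q v) != level sl (ze ep) := gen0 v.
have d1 : 0 < det (q w) (q u) (ze ep) by rewrite dwu mulr_gt0.
have d3 : 0 < det (q u') (q w) (ze ep) by rewrite duw mulr_gt0.
have d2 : 0 < det (q u) (q u') (ze ep).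
  have -> : det (q u) (q u') (ze ep) = det (q w) (q u) (q u') - det (q w) (q u) (ze ep) - det (q
      u') (q w) (ze ep).
    by rewrite /det /crossp /=; ring.
  by rewrite dwu duw; move: ep2; rewrite mulrDr; lra.
have [d [ud nr l1 l2]] := strictly_in (sl := sl) (c := level sl (ze ep)) gen tr erefl d1 d2 d3.
have [d' [ud' _ cd']] := cross_pt_on (sl := sl) (c := level sl (ze ep)) gen e erefl oab.
have ne : d <> d' by move=> e'; move: l1; rewrite e' cd' ltxx.
case: (up_edge_consecutive gen ud ud' ne) => -[nr' h'].
  by have := lt_le_trans l2 h'; rewrite cd' ltxx.
have /andP[_ h3] := next_up_edge gen ud' nr'; have := lt_le_trans h3 h'; rewrite cd' => h4.
by have := lt_trans h4 l1; rewrite ltxx.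
Qed.
End Planarity.

Theorem positive_plane (R : realType) (P : finType) (E : rel P) (tri : P -> P -> P -> bool)
  (x y z : P) (p q : P -> point R) :
  triangulation E tri x y z p -> 0 < det (q x) (q y) (q z) ->
  (forall a b c, tri a b c -> 0 < det (q a) (q b) (q c)) -> injective q /\ plane_graph q E.
Proof.
move=> T out pos; have T1 := tg_turn T; have T2 := tg_turn T1.
have out1 : 0 < det (q y) (q z) (q x) by rewrite det_rot.
have out2 : 0 < det (q z) (q x) (q y) by rewrite det_rot.
have off w a b t : E a b -> w != a -> w != b -> 0 <= t < 1 -> q w <> interp (q a) (q b) t.
  have [iw|] := boolP (inner_vertex x y z w); first exact: (inner_off T out pos).
  rewrite /inner_vertex !negb_and !negbK => /or3P[] /eqP ->.
  - exact: (outer_off T out pos).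
  - exact: (outer_off T1 out1 pos).
  - exact: (outer_off T2 out2 pos).
have Eq a b : E a b -> q a <> q b by apply: (edge_image_neq T out pos).
have Es a b : E a b -> E b a by rewrite (tg_sym T).
have pt a b w : E a b -> ~ open_seg (q a) (q b) (q w).
  move=> e [t t01 h]; have qab : q a != q b by apply/eqP; apply: Eq.
  have [wa|wa] := eqVneq w a.
    have t0 : 0 = t by apply: (interp_inj qab); rewrite interp0 -h wa.
    by move: t01; rewrite -t0 ltxx.
  have [wb|wb] := eqVneq w b.
    have t0 : 1 = t by apply: (interp_inj qab); rewrite interp1 -h wb.
    by move: t01; rewrite -t0 ltxx andbF.
  by apply: (off w a b t) => //; lra.
split.
  move=> w w' h; apply: contrapT => /eqP ne.
  have [u e] : exists u, E w' u.
    have [iw|] := boolP (inner_vertex x y z w'); first exact: (tg_deg T).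
    have [e1 e2 e3] := tg_outE T.
    by rewrite /inner_vertex !negb_and !negbK => /or3P[] /eqP ->; [exists y|exists z|exists x].
  have [wu|wu] := eqVneq w u; first by apply: (Eq _ _ e); rewrite -wu h.
  by apply: (off w w' u 0 e ne wu); rewrite ?lexx ?ltr01 // interp0.
split => //.
- exact: (tg_sym T).
- by move=> a; apply/negbTE/negP => /Eq.
- move=> a b c d u e e' o o'; apply: (edges_meet T pos e e' _ o o') => v h.
  by apply: (pt a b v e); rewrite h.
Qed.

(** * The walks along the axis *)

(** [l] and [r] are the outer corners on the two sides, [z] and [o1] the top and the bottom vertex
    on the axis. Crossings have become vertices, so [ax_cross] leaves only the edge [l r] joining
    the two sides. *)
Record axis_setup (R : realType) (P : finType) (E : rel P) (tri : P -> P -> P -> bool)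
    (l r z o1 : P) (p : P -> point R) : Prop := AxisSetup {
  ax_tri : triangulation E tri l r z p;
  ax_plane : plane_graph p E;
  ax_l : (p l).1 < 0;
  ax_r : 0 < (p r).1;
  ax_z : (p z).1 = 0;
  ax_o : (p o1).1 = 0;
  ax_oz : o1 != z;
  ax_cross : forall u v, E u v -> (p u).1 < 0 -> 0 < (p v).1 -> u = l /\ v = r;
  ax_lo : E l o1;
  ax_ro : E r o1;
  ax_abl : forall v, v != l -> v != r -> v != o1 -> 0 < det (p l) (p o1) (p v);
  ax_abr : forall v, v != l -> v != r -> v != o1 -> 0 < det (p o1) (p r) (p v);
  ax_bl : (p l).2 < (p o1).2;
  ax_br : (p r).2 < (p o1).2
}.

Definition mirror (R : realType) (P : finType) (p : P -> point R) v : point R := (- (p v).1, (p v).2).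

Lemma det_mirror (R : realType) (P : finType) (p : P -> point R) a b c :
  det (mirror p a) (mirror p b) (mirror p c) = - det (p a) (p b) (p c).
Proof. by rewrite /det /crossp /mirror /=; ring. Qed.

Lemma mirror_mid (R : realType) (P : finType) (p : P -> point R) a b v s :
  mirror p v = interp (mirror p a) (mirror p b) s -> p v = interp (p a) (p b) s.
Proof. by case=> e1 e2; apply: pair_ext => //=; apply: oppr_inj; rewrite e1; ring. Qed.

(** [tg_cone] uses cones closed at their first side, while reflection produces cones closed at the
    last one. Turning [d] slightly towards [w] reduces the second form to the first. *)
Lemma cone_left (R : realType) (P : finType) (E : rel P) (tri : P -> P -> P ->
    bool) (x y z : P) (p : P -> point R) v u w u' w' d :
  triangulation E tri x y z p -> tri v w u -> tri v w' u' ->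
  0 < crossp (vec (p v) (p w)) d -> 0 <= crossp d (vec (p v) (p u)) ->
  0 < crossp (vec (p v) (p w')) d -> 0 <= crossp d (vec (p v) (p u')) -> u = u'.
Proof.
move=> T t t' h1 h2 h3 h4; have D := tg_pos T t; have D' := tg_pos T t'.
rewrite /det in D D'; move: h1 h2 h3 h4 D D'.
set W := vec _ (p w); set W' := vec _ (p w'); set U := vec _ (p u);
    set U' := vec _ (p u') => h1 h2 h3 h4 D D'.
have [ep [ep0 eA eB]] : exists ep, [/\ 0 < ep, ep * (`|crossp W' W| + 1) <= crossp W' d &
    0 < crossp d U' -> ep * (`|crossp W U'| + 1) <= crossp d U'].
  have M1 : 0 < `|crossp W' W| + 1 by have := normr_ge0 (crossp W' W); lra.
  have M2 : 0 < `|crossp W U'| + 1 by have := normr_ge0 (crossp W U'); lra.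
  have [B|B] := ltP 0 (crossp d U').
    exists (Num.min (crossp W' d / (`|crossp W' W| + 1)) (crossp d U' / (`|crossp W U'| + 1))); split.
    - by rewrite lt_min !divr_gt0.
    - by rewrite -ler_pdivlMr // ge_min lexx.
    - by move=> _; rewrite -ler_pdivlMr // ge_min lexx orbT.
  by exists (crossp W' d / (`|crossp W' W| + 1)); rewrite divr_gt0 // divfK ?gt_eqF.
pose d' : point R := (d.1 + ep * W.1, d.2 + ep * W.2).
have c1 : crossp W d' = crossp W d by rewrite /crossp /=; ring.
have c2 X : crossp d' X = crossp d X + ep * crossp W X by rewrite /crossp /=; ring.
have c3 : 0 < crossp W' d'.
  have -> : crossp W' d' = crossp W' d + ep * crossp W' W by rewrite /crossp /=; ring.
  have : 0 < ep * (`|crossp W' W| + 1 + crossp W' W) by rewrite mulr_gt0 //;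
      have := ler_norm (- crossp W' W); rewrite normrN; lra.
  lra.
have c4 : 0 < crossp d' U by rewrite c2; have := mulr_gt0 ep0 D; lra.
have c5 : 0 < crossp d' U'.
  rewrite c2; have [e|n] := eqVneq (crossp d U') 0; last first.
    have eB' : ep * (`|crossp W U'| + 1) <= crossp d U' by apply: eB; rewrite lt_neqAle eq_sym n.
    have : 0 < ep * (`|crossp W U'| + 1 + crossp W U') by rewrite mulr_gt0 //;
        have := ler_norm (- crossp W U'); rewrite normrN; lra.
    lra.
  have := crossp_plucker W W' d U'; rewrite e mulr0 addr0 => h.
  have : 0 < crossp W d * crossp W' U' by apply: mulr_gt0.
  by rewrite h pmulr_rgt0 // => hh; rewrite add0r mulr_gt0.
have ww : w = w'.
  by apply: (tg_cone T t t' (d := d')) => //; [rewrite c1; exact: ltW | exact: ltW].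
by rewrite ww in t; apply: (tg_uniq T t t').
Qed.

Lemma axis_mirror (R : realType) (P : finType) (E : rel P) (tri : P -> P -> P -> bool)
    (l r z o1 : P) (p : P -> point R) :
  axis_setup E tri l r z o1 p -> axis_setup E (fun a b c => tri b a c) r l z o1 (mirror p).
Proof.
case=> T pl hl hr hz ho oz cr lo ro abl abr bl br.
have rot := tg_rot T.
split => //.
- split.
  + by move=> a b c h; apply/rot/rot.
  + move=> a b c c'; exact: (tg_uniq T).
  + by move=> a b c h; rewrite (tg_sym T); apply: (tg_edge T h).
  + exact: tg_sym T.
  + by move=> a b c h; rewrite det_mirror -det_swap det_rot; apply: (tg_pos T).
  + by rewrite det_mirror -det_swap det_rot; apply: tg_out T.
  + move=> v /and3P[n1 n2 n3]; have [|i1 i2 i3] := tg_in T (v := v); first by rewrite n1 n2 n3.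
    by rewrite !det_mirror -!det_swap; split; rewrite det_rot.
  + move=> a b e n1 n2 n3; rewrite (tg_sym T) in e.
    by have [||| w h] := tg_next T e; rewrite ?xpair_eqE ?[(b == _) && _]andbC //; exists w.
  + move=> v /and3P[n1 n2 n3]; apply: (tg_deg T); by rewrite n1 n2 n3.
  + by have [e1 e2 e3] := tg_outE T; split; rewrite (tg_sym T).
  + move=> v u w u' w' d t t' d1 d2 d3 d4.
    by apply: (cone_left T (rot _ _ _ (t : tri u v w)) (rot _ _ _ (t' : tri u' v w')) (d := (- d.1, d.2)));
      move: d1 d2 d3 d4; rewrite /crossp /vec /mirror /=; lra.
  + by move=> v w [/oppr_inj h1 h2]; apply: (tg_inj T); apply: pair_ext.
- split; [exact: pl_sym pl | exact: pl_irr pl | |].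
    by move=> a b w e [s s01 h]; apply: (pl_pt pl e (w := w)); exists s => //; apply: mirror_mid h.
  move=> a b c d u e e' [s s01 h] [s' s01' h'].
  apply: (pl_cr pl e e' (x := (- u.1, u.2))); [exists s => // | exists s' => //].
    by rewrite h; apply: pair_ext => /=; ring.
  by rewrite h'; apply: pair_ext => /=; ring.
- by rewrite /= oppr_lt0.
- by rewrite /= oppr_gt0.
- by rewrite /= hz oppr0.
- by rewrite /= ho oppr0.
- move=> u v e; rewrite /= oppr_lt0 oppr_gt0 => h1 h2; rewrite (tg_sym T) in e.
  by have [-> ->] := cr _ _ e h2 h1.
- by move=> v n1 n2 n3; rewrite det_mirror -det_swap det_rot; apply: abr.
- by move=> v n1 n2 n3; rewrite det_mirror -det_swap det_rot; apply: abl.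
Qed.

(** * The walk on one side of the axis *)

Section LeftWalk.
Variables (R : realType) (P : finType) (E : rel P) (tri : P -> P -> P -> bool)
    (l r z o1 : P) (p : P -> point R).
Hypothesis A : axis_setup E tri l r z o1 p.
Let T := ax_tri A.
Let pl := ax_plane A.
Local Notation nx := (next_nbr tri).
Let Esym a b : E a b -> E b a. Proof. by rewrite (tg_sym T). Qed.

(* In the coordinates (h, Y) the axis point [o] is a linear form; its values [slope_at u o] order the
   left vertices [u] around [o]. *)
Definition projY v : R := (- (p v).1)^-1.
Definition projH v : R := (p v).2 / - (p v).1.
Definition slope_at u o : R := projH u - (p o).2 * projY u.
Definition axis_dart (d : P * P) := [&& E d.1 d.2, (p d.1).1 < 0 & (p d.2).1 == 0].
Definition last_dart (d : P * P) := d == (l, z).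
(** In the face to the left of the dart, another side again joins a left vertex to the axis: a gap
    moves the axis end, a step moves the left end. *)
Definition next_dart (d : P * P) := let w := nx d.1 d.2 in if (p w).1 == 0 then (d.1, w) else (w, d.2).
Definition dart_lt (d d' : P * P) :=
    ((p d.2).2 < (p d'.2).2) || (d.2 == d'.2) && (slope_at d.1 d.2 < slope_at d'.1 d'.2).

Lemma dart_ltI : irreflexive dart_lt.
Proof. by move=> d; rewrite /dart_lt !ltxx andbF. Qed.

Lemma dart_ltT : transitive dart_lt.
Proof.
move=> d d' d''; rewrite /dart_lt => /orP[h|/andP[/eqP e h]] /orP[h'|/andP[/eqP e' h']].
- by rewrite (lt_trans h h').
- by rewrite -e' h.
- by rewrite e h'.
- by rewrite e e' eqxx; rewrite e e' in h h'; rewrite (lt_trans h h') orbT.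
Qed.

Lemma axis_low v : (p v).1 = 0 -> v != o1 -> (p o1).2 < (p v).2.
Proof.
move=> v0 vo; have vl : v != l by apply: contraTneq (ax_l A) => <-; rewrite v0 ltxx.
have vr : v != r by apply: contraTneq (ax_r A) => <-; rewrite v0 ltxx.
have := ax_abl A vl vr vo; rewrite /det /crossp /= v0 (ax_o A) => h.
have l0 := ax_l A; rewrite -subr_gt0 -(pmulr_rgt0 _ (_ : 0 < - (p l).1)); lra.
Qed.

Lemma axis_dart_tri d : axis_dart d -> ~~ last_dart d -> tri d.1 d.2 (nx d.1 d.2).
Proof.
case: d => u o /and3P[/= e u0 /eqP o0]; rewrite /last_dart => nl.
have [||| w h] := tg_next T e => //; last by rewrite (next_nbrP T h).
- by rewrite xpair_eqE; apply: contraTN u0 => /andP[/eqP -> _]; rewrite -leNgt ltW // (ax_r A).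
- by rewrite xpair_eqE; apply: contraTN u0 => /andP[/eqP -> _]; rewrite (ax_z A) ltxx.
Qed.

Lemma tri_gap u o w : (p u).1 < 0 -> (p o).1 = 0 -> (p w).1 = 0 -> tri u o w -> (p o).2 < (p w).2.
Proof.
move=> u0 o0 w0 /(tg_pos T); rewrite /det /crossp /= o0 w0 => h.
by rewrite -subr_gt0 -(pmulr_rgt0 _ (_ : 0 < - (p u).1)); lra.
Qed.

Lemma slope_at_lt u o w : (p u).1 < 0 -> (p o).1 = 0 -> (p w).1 < 0 ->
    (slope_at u o < slope_at w o) = (0 < det (p u) (p o) (p w)).
Proof.
move=> u0 o0 w0; rewrite -subr_gt0 -(pmulr_rgt0 _ (_ : 0 < (p u).1 * (p w).1)); last by rewrite nmulr_rgt0.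
congr (0 < _); rewrite /slope_at /projH /projY /det /crossp /= o0; field; lra.
Qed.

Lemma axis_side u o : axis_dart (u, o) -> 0 < det (p l) (p r) (p o).
Proof.
case/and3P=> /= e u0 /eqP o0; have [->|oz] := eqVneq o z; first exact: tg_out T.
have ol : o != l by apply: contraTneq (ax_l A) => <-; rewrite o0 ltxx.
have or : o != r by apply: contraTneq (ax_r A) => <-; rewrite o0 ltxx.
by have [|i1 _ _] := tg_in T (v := o); first exact/and3P.
Qed.

Lemma tri_third u o w : axis_dart (u, o) -> tri u o w -> (p w).1 <= 0.
Proof.
move=> du t; rewrite leNgt; apply/negP => w0; have [/= e u0 /eqP o0] := and3P du.
have [eu ew] := ax_cross A (tri_edge2 T t) u0 w0; have := tg_pos T t; have := axis_side du.
by rewrite eu ew (det_swap (p l)); lra.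
Qed.

Lemma next_dart_in d : axis_dart d -> ~~ last_dart d -> axis_dart (next_dart d) && dart_lt d (next_dart d).
Proof.
case: d => u o dd nl; have t := axis_dart_tri dd nl; have w0 := tri_third dd t.
have [/= e u0 /eqP o0] := and3P dd; rewrite /= in t w0; rewrite /next_dart /=.
case: eqP => h.
  by rewrite /axis_dart /= (tri_edge2 T t) u0 h eqxx /dart_lt /= (tri_gap u0 o0 h t).
have {}w0 : (p (nx u o)).1 < 0 by rewrite lt_neqAle w0 andbT; apply/eqP.
by rewrite /axis_dart /= Esym ?(tg_edge T (tg_rot T t)) // w0 o0 eqxx /dart_lt /= ltxx eqxx
    slope_at_lt // (tg_pos T t).
Qed.

Lemma next_dart_inj d d' : axis_dart d -> axis_dart d' -> ~~ last_dart d -> ~~ last_dart d' ->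
    next_dart d = next_dart d' -> d = d'.
Proof.
case: d => u o; case: d' => u' o' dd dd' nl nl'; have := axis_dart_tri dd nl; have := axis_dart_tri dd' nl'.
have [/= _ u0 /eqP o0] := and3P dd; have [/= _ u0' /eqP o0'] := and3P dd'.
rewrite /next_dart /=; move: (nx u o) (nx u' o') => w w' t' t.
have r1 := tg_rot T t; have r2 := tg_rot T r1; have r1' := tg_rot T t'; have r2' := tg_rot T r1'.
case: ifP => h; case: ifP => h' [e1 e2]; subst.
- by rewrite (tg_uniq T r2 r2').
- by move: u0'; rewrite (tg_uniq T r1' r2) o0 ltxx.
- by move: u0; rewrite (tg_uniq T r1 r2') o0' ltxx.
- by rewrite (tg_uniq T r1 r1').
Qed.

Lemma last_dart_uniq d d' : axis_dart d -> axis_dart d' -> last_dart d -> last_dart d' -> d = d'.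
Proof. by move=> _ _ /eqP -> /eqP ->. Qed.

Lemma first_dart_no_pred d : axis_dart d -> ~~ last_dart d -> next_dart d <> (l, o1).
Proof.
case: d => u o dd nl; have t := axis_dart_tri dd nl; have [/= e u0 /eqP o0] := and3P dd.
rewrite /next_dart /=; rewrite /= in t; case: eqP => h [e1 e2].
  have := tri_gap u0 o0 h t; rewrite e2; have [->|no] := eqVneq o o1; first by rewrite ltxx.
  by have := axis_low o0 no; lra.
rewrite e1 e2 in t.
have nl' : u != l.
  by apply/eqP => e'; move: (tg_pos T t); rewrite e' detaba ltxx.
have ur : u != r by apply: contraTneq (ax_r A) => <-; lra.
have uo : u != o1 by apply: contraTneq u0 => ->; rewrite (ax_o A) ltxx.
by have := ax_abl A nl' ur uo; have := tg_pos T t; rewrite /det /crossp /=; lra.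
Qed.

(** With the axis at infinity, the edge of a dart is a ray over [Y] of slope [(p o).2]. The steeper
    ray is eventually above, so a violation at [Y] would make the two edges cross at [Y1]. *)
Lemma rays_ordered u o v o' Y : axis_dart (u, o) -> axis_dart (v, o') -> dart_lt (u, o) (v, o') ->
    projY u <= Y -> projY v <= Y ->
  projH u + (p o).2 * (Y - projY u) <= projH v + (p o').2 * (Y - projY v).
Proof.
move=> /and3P[/= e u0 /eqP o0] /and3P[/= e' v0 /eqP o0'] /orP[/= yy|/andP[/eqP/= oo]]; last first.
  by rewrite /slope_at oo; move: (projH u) (projH v) (projY u) (projY v) (p o').2 => a b c d g; nra.
move=> uY vY; rewrite leNgt; apply/negP => viol.
pose Y1 := (slope_at u o - slope_at v o') / ((p o').2 - (p o).2).
have dp : 0 < (p o').2 - (p o).2 by lra.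
have Y1Y : Y < Y1.
  by rewrite /Y1 ltr_pdivlMr // /slope_at; move: viol;
      move: (projH u) (projH v) (projY u) (projY v) (p o).2 (p o').2 => *; lra.
have sY0 w : (p w).1 < 0 -> 0 < projY w by move=> w0; rewrite /projY invr_gt0; lra.
have on w a : (p w).1 < 0 -> (p a).1 = 0 -> projY w < Y1 -> open_seg (p w) (p a) (- Y1^-1,
    (slope_at w a + (p a).2 * Y1) / Y1).
  move=> w0 a0 wY; have Yp : 0 < Y1 := lt_trans (sY0 _ w0) wY.
  exists (1 - projY w / Y1).
    have := ratio_in01 (sY0 _ w0) wY; lra.
  apply: pair_ext => /=; first by rewrite a0 /projY; field; lra.
  by rewrite /slope_at /projH /projY; field; lra.
have o1' := on _ _ u0 o0 (le_lt_trans uY Y1Y); have o2 := on _ _ v0 o0' (le_lt_trans vY Y1Y).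
have same : slope_at u o + (p o).2 * Y1 = slope_at v o' + (p o').2 * Y1 by rewrite /Y1; field; lra.
rewrite -same in o2.
case: (pl_cr pl e e' o1' o2) => -[h1 h2]; first by move: yy; rewrite h2 ltxx.
by move: u0; rewrite h1 o0' ltxx.
Qed.

Lemma rays_aligned u o v : axis_dart (u, o) -> (p v).1 < 0 -> projY u <= projY v ->
    projH u + (p o).2 * (projY v - projY u) = projH v -> u = v.
Proof.
move=> /and3P[/= e u0 /eqP o0] v0 uv eh.
have vp : 0 < projY v by rewrite /projY invr_gt0; lra.
have up : 0 < projY u by rewrite /projY invr_gt0; lra.
have [e1|ne] := eqVneq (projY u) (projY v).
  have x1 : (p u).1 = (p v).1 by apply: oppr_inj; apply: invr_inj.
  apply: (tg_inj T); apply: pair_ext => //; move: eh; rewrite e1 subrr mulr0 addr0 /projH x1.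
  by move/mulIf; apply; rewrite invr_eq0; lra.
have lt : projY u < projY v by rewrite lt_neqAle ne.
case: (pl_pt pl e (w := v)); exists (1 - projY u / projY v).
  have := ratio_in01 up lt; lra.
apply: pair_ext => /=; first by rewrite o0 /projY; field; lra.
have -> : (p v).2 = projH v / projY v by rewrite /projH /projY; field; lra.
by rewrite -eh /projH /projY; field; lra.
Qed.

Record left_walk (K : nat) (u o : nat -> P) : Prop := LeftWalk {
  lw_dart : forall i, (i <= K)%N -> axis_dart (u i, o i);
  lw_0 : (u 0, o 0) = (l, o1);
  lw_K : (u K, o K) = (l, z);
  lw_next : forall i, (i < K)%N ->
    (u i.+1 = u i /\ tri (u i) (o i) (o i.+1)) \/ (o i.+1 = o i /\ tri (u i) (o i) (u i.+1) /\
        u i != u i.+1);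
  lw_all : forall a b, axis_dart (a, b) -> exists2 i, (i <= K)%N & (a, b) = (u i, o i);
  lw_lt : forall i j, (i < j)%N -> (j <= K)%N -> dart_lt (u i, o i) (u j, o j);
  lw_nc : forall i j k m, (i < j)%N -> (j < k)%N -> (k < m)%N -> (m <= K)%N ->
    u i = u k -> u j = u m -> u i = u j
}.

(** All axis darts lie on one chain: [(l, z)] is its only end, and [(l, o1)], having no predecessor,
    is its start. *)
Lemma left_walk_ex : exists K u o, left_walk K u o.
Proof.
have d0 : axis_dart (l, o1) by rewrite /axis_dart /= (ax_lo A) (ax_l A) (ax_o A) eqxx.
have [K [ch Cl fl]] := chain_end dart_ltI dart_ltT next_dart_in d0.
pose d i := iter i next_dart (l, o1).
have dd i : (i <= K)%N -> axis_dart (d i).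
  by rewrite leq_eqVlt => /orP[/eqP -> //|/ch/andP[]].
have dlti i j : (i < j)%N -> (j <= K)%N -> dart_lt (d i) (d j).
  move=> ij jK; rewrite /d -(subnK ij) addnS -addSn iterD.
  apply: (chained_lt dart_ltT next_dart_in (m := (j - i)%N)); last by rewrite subnSK.
  by move=> k kj; rewrite -iterD; apply: ch; rewrite ltn_subRL addnC in kj; apply: leq_trans kj jK.
(* When two vertices alternate, the one with larger [projY] is squeezed between rays onto an edge of
   the other, and [rays_aligned] identifies them. *)
have nc i j k m : (i < j)%N -> (j < k)%N -> (k < m)%N -> (m <= K)%N ->
    (d i).1 = (d k).1 -> (d j).1 = (d m).1 -> (d i).1 = (d j).1.
  move=> ij jk km mK e1 e2.
  have kK := leq_trans (ltnW km) mK; have jK := leq_trans (ltnW jk) kK; have iK := leq_trans (ltnW ij) jK.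
  have h1 := dlti _ _ ij jK; have h2 := dlti _ _ jk kK; have h3 := dlti _ _ km mK.
  move: e1 e2 h1 h2 h3 (dd _ iK) (dd _ jK) (dd _ kK) (dd _ mK).
  case: (d i) => u oi; case: (d j) => v oj; case: (d k) => u' ok;
      case: (d m) => v' om /= <- <- h1 h2 h3 di dj dk dm.
  have [uv|vu] := leP (projY u) (projY v).
    apply: (rays_aligned dk _ uv); first by case/and3P: dj.
    have r1 := rays_ordered dj dk h2 (lexx _) uv; have r2 := rays_ordered dk dm h3 uv (lexx _).
    by move: r1 r2; rewrite !subrr !mulr0 !addr0 => r1 r2; apply/eqP; rewrite eq_le r1 r2.
  have {}vu := ltW vu; apply/esym.
  apply: (rays_aligned dj _ vu); first by case/and3P: di.
  have r1 := rays_ordered di dj h1 (lexx _) vu; have r2 := rays_ordered dj dk h2 vu (lexx _).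
  by move: r1 r2; rewrite !subrr !mulr0 !addr0 => r1 r2; apply/eqP; rewrite eq_le r1 r2.
exists K, (fun i => (d i).1), (fun i => (d i).2); split.
- by move=> i /dd; case: (d i).
- by [].
- by rewrite -surjective_pairing; apply/eqP.
- move=> i iK; have /andP[di nl] := ch i iK; have t := axis_dart_tri di nl.
  rewrite /d iterS -/(d i); move: t; rewrite -/(d i) /next_dart; case: eqP => h t /=;
      [by left | right; split => //; split => //].
  apply/eqP => e; have := tg_pos T t; rewrite -e detaba ltxx //.
- move=> a b dab; have [[m cm e]|[m cm e]] :=
    chain_total dart_ltI dart_ltT next_dart_in next_dart_inj last_dart_uniq d0 dab.
    exists m; last by rewrite e -surjective_pairing.
    by rewrite leqNgt; apply/negP => /cm/andP[_]; rewrite fl.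
  case: m cm e => [|m] cm e; first by exists 0%N => //; rewrite -e.
  by have /andP[c1 c2] := cm m (leqnn _); case: (first_dart_no_pred c1 c2); rewrite -iterS -e.
- by move=> i j ij jK; rewrite -!surjective_pairing; apply: dlti.
- exact: nc.
Qed.
End LeftWalk.

(** * Redrawing a triangulation with prescribed axis points *)

Lemma nonneg_sum0 (R : realType) (a b c : R) : 0 <= a -> 0 <= b -> 0 <= c -> a + b + c = 0 ->
    a = 0 /\ b = 0 /\ c = 0.
Proof. by move=> *; split; [|split]; lra. Qed.

(** In [(h, Y)] the directions [(ti, 1)], [(A1, al)], [(B1, be)], [(tj, 1)] lead from a walk vertex
    to an axis point of its first visit, to its two walk neighbours and to an axis point of its last
    visit. They positively span the plane, so a form nonnegative on all of them vanishes; [e1],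
    [e2], [e3] are the relations used in the three cases. *)
Lemma walk_hull (R : realType) (b c0 A1 al B1 be ti tj : R) :
  0 < ti * al - A1 -> 0 < B1 - tj * be -> ti <= tj ->
  0 <= b * A1 - c0 * al -> 0 <= b * B1 - c0 * be -> 0 <= b * ti - c0 -> 0 <= b * tj - c0 ->
  (A1 = B1 /\ al = be) \/ 0 < A1 * be - al * B1 -> b = 0 /\ c0 = 0.
Proof.
move=> dTA dBT tij g2 g3 g1 g4.
have fin : b * ti - c0 = 0 -> b * A1 - c0 * al = 0 -> b = 0 /\ c0 = 0.
  move=> h1 h2; have b0 : b = 0.
    apply: (mulIf (lt0r_neq0 dTA)); rewrite mul0r.
    have -> : b * (ti * al - A1) = al * (b * ti - c0) - (b * A1 - c0 * al) by ring.
    by rewrite h1 h2 mulr0 subr0.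
  by split => //; move: h1; rewrite b0; lra.
have M0 (u v : R) : 0 < u -> u * v = 0 -> v = 0.
  by move=> u0 /eqP; rewrite mulf_eq0 gt_eqF //= => /eqP.
case=> [[e1 e2]|D].
  rewrite -e1 -e2 in dBT g3.
  have aneg : 0 < - al * (tj - ti) by lra.
  have al0 : al < 0.
    by rewrite ltNge; apply/negP => h; have : 0 <= al * (tj - ti) by [apply: mulr_ge0 => //; lra]; lra.
  have k1 : 0 <= - al * (b * ti - c0) by apply: mulr_ge0 => //; lra.
  have k2 : 0 <= - al * (b * tj - c0) by apply: mulr_ge0 => //; lra.
  have b1 : b * (ti * al - A1) <= 0 by lra.
  have b2 : 0 <= b * (A1 - tj * al) by lra.
  have b0 : b = 0.
    by apply/eqP; rewrite eq_le -(pmulr_lle0 _ dTA) b1 -(pmulr_lge0 _ dBT) b2.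
  apply: fin; move: g1 g2 g3 g4 k1 k2; rewrite b0 !mul0r !sub0r => g1 g2 g3 g4 k1 k2.
    have : c0 * al = 0 by lra.
    by move/eqP; rewrite mulf_eq0 (lt_eqF al0) orbF => /eqP ->; rewrite oppr0.
  by lra.
have e1 : (A1 * be - al * B1) * (b * ti - c0) + (B1 - be * ti) * (b * A1 - c0 * al) + (ti * al -
    A1) * (b * B1 - c0 * be) = 0 by ring.
have e2 : (B1 - tj * be) * (b * A1 - c0 * al) + (tj * al - A1) * (b * B1 - c0 * be) + (A1 * be - al
    * B1) * (b * tj - c0) = 0 by ring.
have e3 : (A1 - al * tj) * (b * ti - c0) + (tj - ti) * (b * A1 - c0 * al) + (ti * al - A1) * (b *
    tj - c0) = 0 by ring.
have [c1|c1] := leP 0 (B1 - be * ti).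
  have [z1 [_ z3]] := nonneg_sum0 (mulr_ge0 (ltW D) g1) (mulr_ge0 c1 g2) (mulr_ge0 (ltW dTA) g3) e1.
  have h3 := M0 _ _ dTA z3; rewrite h3 mulr0 addr0 in e2.
  have z2 : (B1 - tj * be) * (b * A1 - c0 * al) = 0.
    by have := mulr_ge0 (ltW dBT) g2; have := mulr_ge0 (ltW D) g4; lra.
  by apply: fin; [exact: M0 D z1 | exact: M0 dBT z2].
have [c2|c2] := leP 0 (tj * al - A1).
  have [z2 [_ z4]] := nonneg_sum0 (mulr_ge0 (ltW dBT) g2) (mulr_ge0 c2 g3) (mulr_ge0 (ltW D) g4) e2.
  have h2 := M0 _ _ dBT z2; rewrite h2 mulr0 addr0 in e1.
  have z1 : (A1 * be - al * B1) * (b * ti - c0) = 0.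
    by have := mulr_ge0 (ltW dTA) g3; have := mulr_ge0 (ltW D) g1; lra.
  by apply: fin => //; exact: M0 D z1.
have c2' : 0 < A1 - al * tj by lra.
have tt : 0 <= tj - ti by lra.
have [z1 [z2 _]] := nonneg_sum0 (mulr_ge0 (ltW c2') g1) (mulr_ge0 tt g2) (mulr_ge0 (ltW dTA) g4) e3.
have tp : 0 < tj - ti.
  by rewrite lt_neqAle tt andbT; apply/eqP => e; rewrite (_ : ti = tj) in c1; lra.
by apply: fin; [exact: M0 c2' z1 | exact: M0 tp z2].
Qed.

(** * The discrete Dirichlet problem *)

Section Dirichlet.
Variables (R : realType) (P : finType) (E : rel P) (tri : P -> P -> P -> bool)
  (x y z : P) (p : P -> point R).
Hypothesis T : triangulation E tri x y z p.
Variable deep : pred P.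
Hypothesis deep_in : forall v, deep v -> inner_vertex x y z v.

(** At a deep minimum all neighbours are minimal. The rightmost minimal deep vertex of the old
    drawing has a neighbour further right, which is minimal and so not deep. *)
Lemma harmonic_min (f : P -> R) : (forall v, deep v -> \sum_(u | E v u) (f u - f v) = 0) ->
  exists2 w, ~~ deep w & forall v, f w <= f v.
Proof.
move=> har; case: (@Order.TotalTheory.arg_minP _ _ _ x predT f isT) => m _ mn.
have {}mn v : f m <= f v by apply: mn.
have [dm|] := boolP (deep m); last by exists m.
pose F := [set v | deep v && (f v == f m)].
have mF : m \in F by rewrite inE dm eqxx.
case: (@Order.TotalTheory.arg_maxP _ _ _ m (mem F) (fun v => linform 1 0 (p v)) mF) => v vF vmx.
have /andP[dv /eqP fv] : deep v && (f v == f m) by move: (vF : v \in F); rewrite inE.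
have [|u e lu] := tri_span T (v := v) (al := 1) (be := 0) (deep_in dv); first by left; rewrite oner_eq0.
have fu : f u = f m.
  have /eqP := har v dv; rewrite psumr_eq0 => [/allP/(_ u (mem_index_enum _))|w _].
    by rewrite e subr_eq0 fv => /eqP.
  by rewrite fv subr_ge0.
exists u; last by rewrite fu.
apply/negP => du; have uF : u \in F by rewrite inE du fu eqxx.
by have /= := vmx u uF; rewrite leNgt lu.
Qed.

Lemma dirichlet (g : P -> R) : exists f : P -> R, [/\ forall v, ~~ deep v -> f v = g v,
  forall v, deep v -> \sum_(u | E v u) (f u - f v) = 0 &
  forall c, (forall v, ~~ deep v -> c < g v) -> forall v, c < f v].
Proof.
pose A v u : R := if deep v then (E v u)%:R - (if u == v then \sum_(w | E v w) 1 else 0) else (u == v)%:R.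
have AE (f : P -> R) v : \sum_u A v u * f u = if deep v then \sum_(u | E v u) (f u - f v) else f v.
  rewrite /A; case: ifP => dv; last first.
    by rewrite (bigD1 v) //= eqxx mul1r big1 ?addr0 // => u /negbTE ->; rewrite mul0r.
  under eq_bigr do rewrite mulrBl;
      rewrite sumrB [X in _ - X](bigD1 v) //= eqxx [X in _ - (_ + X)]big1 ?addr0; last first.
    by move=> u /negbTE ->; rewrite mul0r.
  rewrite sumrB mulr_suml; congr (_ - _); last by apply: eq_bigr => u _; rewrite mul1r.
  by rewrite [RHS]big_mkcond /=; apply: eq_bigr => u _; case: (E v u); rewrite ?mul1r ?mul0r.
have [|f hf] := @inj_linear_solve R P A _ (fun v => if deep v then 0 else g v).
  move=> f f0; have h v : deep v -> \sum_(u | E v u) (f u - f v) = 0 by move=> dv; have := f0 v;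
      rewrite AE dv.
  have b v : ~~ deep v -> f v = 0 by move=> dv; have := f0 v; rewrite AE (negbTE dv).
  have [w nw mw] := harmonic_min h; rewrite (b w nw) in mw.
  have [|w' nw' mw'] := @harmonic_min (fun v => - f v).
    move=> v dv; rewrite (eq_bigr (fun u => - (f u - f v))) ?sumrN ?h ?oppr0 // => u _; ring.
  rewrite (b w' nw') oppr0 in mw'.
  by move=> v; apply/eqP; rewrite eq_le mw -oppr_ge0 mw'.
have h v : deep v -> \sum_(u | E v u) (f u - f v) = 0 by move=> dv; have := hf v; rewrite AE dv.
have b v : ~~ deep v -> f v = g v by move=> dv; have := hf v; rewrite AE (negbTE dv).
exists f; split => // c hc v; have [w nw mw] := harmonic_min h.
by apply: lt_le_trans (mw v); rewrite b // hc.
Qed.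
End Dirichlet.

(** * Neighbours of axis vertices *)

Section AxisNeighbours.
Variables (R : realType) (P : finType) (E : rel P) (tri : P -> P -> P -> bool)
    (l r z o1 : P) (p : P -> point R).
Hypothesis A : axis_setup E tri l r z o1 p.
Let T := ax_tri A.
Let pl := ax_plane A.
Variables (K : nat) (u o : nat -> P).
Hypothesis W : left_walk E tri l z o1 p K u o.

Lemma axis_high v : (p v).1 = 0 -> v != z -> (p v).2 < (p z).2.
Proof.
move=> v0 vz; have vl : v != l by apply: contraTneq (ax_l A) => <-; rewrite v0 ltxx.
have vr : v != r by apply: contraTneq (ax_r A) => <-; rewrite v0 ltxx.
have [|_ + _] := tg_in T (v := v); first exact/and3P.
rewrite /det /crossp /= v0 (ax_z A) => h.
by rewrite -subr_gt0 -(pmulr_rgt0 _ (ax_r A)); lra.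
Qed.

Lemma left_walk_axis i : (i <= K)%N -> (p (o i)).1 = 0.
Proof. by move=> iK; have /and3P[_ _ /eqP] := lw_dart W iK. Qed.

Lemma left_walk_gap i : (i < K)%N -> o i != o i.+1 -> u i.+1 = u i /\ tri (u i) (o i) (o i.+1).
Proof. by move=> iK ne; case: (lw_next W iK) => // -[e _]; rewrite e eqxx in ne. Qed.

Lemma no_axis_between a b v : E a b -> (p a).1 = 0 -> (p b).1 = 0 -> (p v).1 = 0 ->
    (p a).2 < (p v).2 -> (p v).2 < (p b).2 -> False.
Proof.
move=> e a0 b0 v0 h1 h2; apply: (pl_pt pl e (w := v)).
exists (((p v).2 - (p a).2) / ((p b).2 - (p a).2)); first by apply: ratio_in01; lra.
apply: pair_ext => /=; first by rewrite a0 b0 v0; ring.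
by field; lra.
Qed.

Lemma axis_eq a b : (p a).1 = 0 -> (p b).1 = 0 -> (p a).2 = (p b).2 -> a = b.
Proof. by move=> a0 b0 h; apply: (tg_inj T); apply: pair_ext => //; rewrite a0 b0. Qed.

(** The last walk position with axis point not above [v] is followed by a gap. The axis edge of that
    gap passes no vertex, so the position is at [v] itself. *)
Lemma axis_next v : (p v).1 = 0 -> v != z ->
  exists w s, [/\ E v w, (p w).1 = 0, (p v).2 < (p w).2, E v s & (p s).1 < 0].
Proof.
move=> v0 vz.
have [e0u e0o] := lw_0 W; have [eKu eKo] := lw_K W.
have ex : exists i, (i <= K)%N && ((p (o i)).2 <= (p v).2).
  exists 0%N => /=; rewrite e0o; have [->//|n] := eqVneq v o1.
  by apply/ltW/(axis_low A).
have ub i : (i <= K)%N && ((p (o i)).2 <= (p v).2) -> (i <= K)%N by case/andP.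
case: (ex_maxnP ex ub) => i /andP[iK hi] mx.
have {}iK : (i < K)%N.
  rewrite ltn_neqAle iK andbT; apply/eqP => e; move: hi; rewrite e eKo.
  by rewrite leNgt axis_high.
have hi1 : (p v).2 < (p (o i.+1)).2.
  by rewrite ltNge; apply/negP => h; have := mx i.+1; rewrite iK h ltnn => /(_ isT).
have ne : o i != o i.+1 by apply: contraTneq hi1 => <-; rewrite -leNgt.
have [eu t] := left_walk_gap iK ne; have eoo := tg_edge T (tg_rot T t).
have ov : o i = v.
  apply: axis_eq => //; first exact/left_walk_axis/ltnW.
  apply/eqP; rewrite eq_le hi leNgt /=; apply/negP => h.
  by apply: (no_axis_between eoo _ _ v0 h hi1); apply: left_walk_axis; rewrite // ltnW.
have /and3P[/= e us _] := lw_dart W (ltnW iK).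
exists (o i.+1), (u i); rewrite -ov; split => //; last by rewrite (tg_sym T).
  exact: left_walk_axis.
by rewrite ov.
Qed.

Lemma axis_prev v : (p v).1 = 0 -> v != o1 -> exists w, [/\ E v w, (p w).1 = 0 & (p w).2 < (p v).2].
Proof.
move=> v0 vo; have [e0u e0o] := lw_0 W; have [eKu eKo] := lw_K W.
have ex : exists i, (i <= K)%N && ((p v).2 <= (p (o i)).2).
  exists K; rewrite leqnn eKo /=; have [->//|n] := eqVneq v z.
  by apply/ltW/axis_high.
case: (ex_minnP ex) => i /andP[iK hi] mn.
case: i iK hi mn => [|i] iK hi mn; first by move: hi; rewrite e0o leNgt (axis_low A).
have hi1 : (p (o i)).2 < (p v).2.
  by rewrite ltNge; apply/negP => h; have := mn i; rewrite h ltnn (ltnW iK) => /(_ isT).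
have ne : o i != o i.+1 by apply: contraTneq hi1 => ->; rewrite -leNgt.
have [eu t] := left_walk_gap iK ne; have eoo := tg_edge T (tg_rot T t).
have ov : o i.+1 = v.
  apply: axis_eq => //; first exact: left_walk_axis.
  apply/eqP; rewrite eq_le hi andbT leNgt /=; apply/negP => h.
  by apply: (no_axis_between eoo _ _ v0 hi1 h); apply: left_walk_axis; rewrite // ltnW.
exists (o i); rewrite -{1}ov (tg_sym T); split => //; exact/left_walk_axis/ltnW.
Qed.
End AxisNeighbours.

(** * Joining the two sides *)

Section Assemble.
Variables (R : realType) (P : finType) (E : rel P) (tri : P -> P -> P -> bool)
    (l r z o1 : P) (p : P -> point R).
Hypothesis A0 : axis_setup E tri l r z o1 p.
Let T := ax_tri A0.
Variable t : P -> R.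
Hypothesis t_mono : forall a b, (p a).1 = 0 -> (p b).1 = 0 -> (p a).2 < (p b).2 -> t a < t b.

Definition side_map (s : bool) := if s then mirror p else p.
Definition side_root (s : bool) := if s then r else l.
Definition side_tri (s : bool) := if s then fun a b c => tri b a c else tri.

Lemma side_setup s : axis_setup E (side_tri s) (side_root s) (side_root (~~ s)) z o1 (side_map s).
Proof. by case: s => //; apply: axis_mirror. Qed.

Lemma side_map2 s v : (side_map s v).2 = (p v).2. Proof. by case: s. Qed.
Lemma side_map_axis s v : (side_map s v).1 = 0 -> (p v).1 = 0.
Proof. by case: s => //=; rewrite /mirror /= => /eqP; rewrite oppr_eq0 => /eqP. Qed.
Lemma axis_side_map s v : (p v).1 = 0 -> (side_map s v).1 = 0.
Proof. by case: s => //=; rewrite /mirror /= => ->; rewrite oppr0. Qed.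

Variables (cr : pred P) (cc : bool -> P -> P).
Hypothesis cr_ax : forall c, cr c -> (p c).1 = 0.
Hypothesis cr_side : forall s c, cr c -> E (cc s c) c /\ (side_map s (cc s c)).1 < 0.
Hypothesis cr_straight : forall c, cr c ->
  slope_at (side_map false) (cc false c) c + slope_at (side_map true) (cc true c) c = 0.

Section Walked.
Variables (K : bool -> nat) (u o : bool -> nat -> P).
Hypothesis W : forall s, left_walk E (side_tri s) (side_root s) z o1 (side_map s) (K s) (u s) (o s).
Definition new_at s i := t (o s i).
Definition old_at s i := (side_map s (o s i)).2.

Lemma walk_axis s i : (i <= K s)%N -> (p (o s i)).1 = 0.
Proof. by move=> iK; apply: (side_map_axis (s := s)); apply: (left_walk_axis (W s) iK). Qed.

Lemma side_walks : walks K u new_at old_at.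
Proof.
split.
- move=> s i iK; rewrite /is_step => st; have [[e _]|[e _]] := lw_next (W s) iK;
    first by rewrite e eqxx in st.
  by rewrite /new_at /old_at e.
- move=> s i iK; rewrite /is_step negbK => /eqP st; have [[e tt1]|[_ [_ ne]]] := lw_next (W s) iK;
    last by rewrite st eqxx in ne.
  have a0 := walk_axis (ltnW iK); have a1 := walk_axis iK.
  have /and3P[_ /= un _] := lw_dart (W s) (ltnW iK).
  have yy := tri_gap (side_setup s) un (axis_side_map s a0) (axis_side_map s a1) tt1.
  by split => //; apply: t_mono => //; rewrite -!(side_map2 s).
- by move=> s i j k m *; apply: (lw_nc (W s)); eauto.
- by move=> s; have [-> _] := lw_0 (W s); have [-> _] := lw_K (W s).
Qed.

Definition crossings := sort (fun a b => (p a).2 <= (p b).2) (enum cr).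
Definition visit s c := index (cc s c, c) [seq (u s i, o s i) | i <- iota 0 (K s).+1].
Definition visit_nth s m := visit s (nth z crossings m).

Lemma visitP s c : cr c -> (visit s c <= K s)%N /\ u s (visit s c) = cc s c /\ o s (visit s c) = c.
Proof.
move=> cc'; have [e n] := cr_side s cc'.
have d : axis_dart E (side_map s) (cc s c, c) by rewrite /axis_dart /= e n axis_side_map ?eqxx // cr_ax.
have [i iK ei] := lw_all (W s) d.
have vin : (cc s c, c) \in [seq (u s i, o s i) | i <- iota 0 (K s).+1].
  by apply/mapP; exists i => //; rewrite mem_iota.
have lt : (visit s c < (K s).+1)%N by have := vin; rewrite -index_mem size_map size_iota.
have := nth_index (z, z) vin;
    rewrite (nth_map 0%N) ?size_iota // nth_iota // add0n -/(visit s c) => -[e1 e2].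
by split.
Qed.

Lemma crossingsP m : (m < size crossings)%N -> cr (nth z crossings m).
Proof. by move=> h; have := mem_nth z h; rewrite mem_sort mem_enum. Qed.

Lemma visit_nth_le s m : (m < size crossings)%N -> (visit_nth s m <= K s)%N.
Proof. by move=> /crossingsP /(visitP s)[]. Qed.

Lemma visit_nth_mono s m m' : (m <= m')%N -> (m' < size crossings)%N -> (visit_nth s m <= visit_nth s m')%N.
Proof.
move=> mm m'n; have mn := leq_ltn_trans mm m'n.
have [k1 [e1 f1]] := visitP s (crossingsP mn); have [k2 [e2 f2]] := visitP s (crossingsP m'n).
have yy : (p (nth z crossings m)).2 <= (p (nth z crossings m')).2.
  apply: (sorted_leq_nth _ _ z (s := crossings) (leT := fun a b => (p a).2 <= (p b).2)) => //.
  - by move=> a b c; apply: le_trans.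
  - by apply: sort_sorted => a b; apply: le_total.
rewrite leqNgt; apply/negP => lt; have := lw_lt (W s) lt k1.
rewrite /dart_lt /= -/(visit_nth s m) -/(visit_nth s m') [o s (visit_nth s m)]f1 [o s (visit_nth s
    m')]f2 !side_map2 ltNge yy /= => /andP[/eqP e _].
by move: lt; rewrite /visit_nth e ltnn.
Qed.

Definition orig_Y s v := projY (side_map s) v.
Definition orig_h s v := projH (side_map s) v.

(** The old drawing satisfies the balance conditions for the old heights because its crossing edges
    are straight; it starts negative because both roots are lower than [o1]. *)
Lemma original_walks : original K u old_at (size crossings) visit_nth orig_Y orig_h.
Proof.
split.
- by move=> s i iK; have /and3P[_ /= un _] := lw_dart (W s) iK; rewrite /orig_Y /projY invr_gt0 oppr_gt0.
- move=> s i iK; rewrite /is_step => st; have [[e _]|[e [tt1 _]]] := lw_next (W s) iK;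
    first by rewrite e eqxx in st.
  have /and3P[_ /= un _] := lw_dart (W s) (ltnW iK); have /and3P[_ /= un' _] := lw_dart (W s) iK.
  rewrite /orig_F /old_at e; have := slope_at_lt un (axis_side_map s (walk_axis (ltnW iK))) un';
      rewrite (tg_pos (ax_tri (side_setup s)) tt1).
  by rewrite /slope_at.
- move=> m mn; have c := crossingsP mn; rewrite -(cr_straight c) /orig_F /old_at.
  by have [_ [-> ->]] := visitP false c; have [_ [-> ->]] := visitP true c.
have neg s : orig_F u old_at orig_Y orig_h s 0 < 0.
  have [e1 e2] := lw_0 (W s); rewrite /orig_F /old_at e1 e2 /orig_h /orig_Y /projH /projY.
  have n := ax_l (side_setup s); have b := ax_bl (side_setup s).
  have -> : (side_map s (side_root s)).2 / - (side_map s (side_root s)).1 - (side_map s o1).2 * (-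
      (side_map s (side_root s)).1)^-1 = ((side_map s (side_root s)).2 - (side_map s o1).2) / -
      (side_map s (side_root s)).1 by ring.
  by rewrite pmulr_llt0 ?invr_gt0 ?oppr_gt0 // subr_lt0.
by have := neg false; have := neg true; lra.
Qed.

(** The [tau] of the walk system; it only has to be below [t o1]. *)
Definition root_height := t o1 - 1.

Lemma root_height_lt s : root_height < new_at s 0.
Proof. by have [_ e] := lw_0 (W s); rewrite /new_at e /root_height; lra. Qed.

Definition on_walk s v := has (fun i => u s i == v) (iota 0 (K s).+1).
Lemma on_walkP s v : reflect (exists2 i, (i <= K s)%N & u s i = v) (on_walk s v).
Proof.
apply: (iffP hasP) => [[i]|[i iK <-]]; first by rewrite mem_iota add0n ltnS => /andP[_ iK] /eqP <-;
    exists i.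
by exists i => //; rewrite mem_iota add0n ltnS iK.
Qed.

Definition right_side v := 0 < (p v).1.
(** The vertices placed harmonically; all their neighbours are strictly on their own side of the
    axis. *)
Definition off_walk v := ((p v).1 != 0) && ~~ on_walk (right_side v) v.

Lemma root_on_walk s : on_walk s (side_root s).
Proof. by apply/on_walkP; exists 0%N => //; have [-> _] := lw_0 (W s). Qed.

Lemma left_root_side : right_side l = false.
Proof. by rewrite /right_side; apply/negbTE; rewrite -leNgt ltW // (ax_l A0). Qed.

Lemma right_root_side : right_side r.
Proof. exact: (ax_r A0). Qed.

Lemma off_walk_inner v : off_walk v -> inner_vertex l r z v.
Proof.
case/andP=> v0 nw; apply/and3P; split; apply: contraNneq nw => e;
    rewrite ?e ?left_root_side ?right_root_side.
- exact: (root_on_walk false).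
- exact: (root_on_walk true).
- by rewrite e (ax_z A0) eqxx in v0.
Qed.

Lemma pp_side v : (p v).1 != 0 -> (side_map (right_side v) v).1 < 0.
Proof.
rewrite /right_side => n; have [h|h] := boolP (0 < (p v).1); first by rewrite /side_map /mirror /= oppr_lt0.
by rewrite /side_map lt_neqAle n leNgt.
Qed.

Lemma side_pp s v : (side_map s v).1 < 0 -> (p v).1 != 0 /\ right_side v = s.
Proof.
rewrite /right_side; case: s; rewrite /side_map /mirror /= ?oppr_lt0 => h; first by rewrite gt_eqF.
by rewrite lt_eqF // lt_gtF.
Qed.

Lemma nbr_side v w : E v w -> (p v).1 != 0 -> v != side_root (right_side v) -> (p w).1 = 0 \/
    (p w).1 != 0 /\ right_side w = right_side v.
Proof.
move=> e v0 vr; have [->|w0] := eqVneq (p w).1 0; [by left | right; split => //].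
apply: contraNeq vr => ne.
have h1 := pp_side v0; have h2 := pp_side w0.
have h3 : 0 < (side_map (right_side v) w).1.
  by move: h2 ne; case: (right_side w); case: (right_side v) => //;
      rewrite /side_map /mirror /= ?oppr_lt0 ?oppr_gt0.
by have [e1 _] := ax_cross (side_setup (right_side v)) e h1 h3; apply/eqP.
Qed.

Variables (Y h : bool -> P -> R).
Let F s i := h s (u s i) - new_at s i * Y s (u s i).
Hypothesis Ypos : forall s i, (i <= K s)%N -> 0 < Y s (u s i).
Hypothesis Yroot : forall s, Y s (u s 0%N) = 1 /\ h s (u s 0%N) = root_height.
Hypothesis Fstep : forall s i, (i < K s)%N -> is_step u s i -> F s i < F s i.+1.
Hypothesis Fcross : forall m, (m < size crossings)%N ->
    F false (visit_nth false m) + F true (visit_nth true m) = 0.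
Hypothesis Fdet : forall s i j, (0 < i)%N -> (i <= j)%N -> (j < K s)%N -> u s i = u s j ->
        first_visit u s i -> last_visit K u s j -> u s i.-1 != u s j.+1 ->
        0 < (h s (u s i.-1) - h s (u s i)) * (Y s (u s j.+1) - Y s (u s i)) -
            (Y s (u s i.-1) - Y s (u s i)) * (h s (u s j.+1) - h s (u s i)).

Variables (Yf hf : P -> R).
Hypothesis Yfp : forall v, 0 < Yf v.
Hypothesis Yfw : forall v, (p v).1 != 0 -> on_walk (right_side v) v -> Yf v = Y (right_side v) v /\
    hf v = h (right_side v) v.
Hypothesis Ydeep : forall v, off_walk v -> \sum_(w | E v w) (Yf w - Yf v) = 0 /\
    \sum_(w | E v w) (hf w - hf v) = 0.

(** The inverse of [projH] and [projY], with the sign of the side restored. *)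
Definition redrawn v : point R := if (p v).1 == 0 then (0,
    t v) else ((if right_side v then 1 else -1) / Yf v, hf v / Yf v).

Lemma redrawn_axis v : (p v).1 = 0 -> redrawn v = (0, t v).
Proof. by rewrite /redrawn => ->; rewrite eqxx. Qed.

Lemma redrawn_walk s i : (i <= K s)%N -> redrawn (u s i) = ((if s then 1 else -1) / Y s (u s i),
    h s (u s i) / Y s (u s i)) /\
  Yf (u s i) = Y s (u s i) /\ hf (u s i) = h s (u s i) /\ (p (u s i)).1 != 0 /\ right_side (u s i) = s.
Proof.
move=> iK; have /and3P[_ /= un _] := lw_dart (W s) iK; have [n0 es] := side_pp un.
have [|e1 e2] := Yfw n0; first by rewrite es; apply/on_walkP; exists i.
by rewrite /redrawn (negbTE n0) e1 e2 es.
Qed.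

Lemma redrawn_root s : redrawn (side_root s) = (if s then 1 else -1, root_height).
Proof.
have [e _] := lw_0 (W s); have [y1 y2] := Yroot s.
by rewrite -e; have [-> _] := @redrawn_walk s 0%N isT; rewrite y1 y2 !divr1.
Qed.

(** Up to the positive factor [1 / Yf w], the difference is linear in [(hf, Yf)], so hull conditions
    can be checked in the linear coordinates. *)
Lemma redrawn_diff al be v w : (p v).1 != 0 -> (p w).1 != 0 -> right_side w = right_side v ->
  linform al be (redrawn w) - linform al be (redrawn v) = (be * (hf w - hf v) - linform al be
      (redrawn v) * (Yf w - Yf v)) / Yf w.
Proof.
move=> v0 w0 es; rewrite /redrawn (negbTE v0) (negbTE w0) es /linform /=.
have := Yfp v; have := Yfp w => y1 y2; field; lra.
Qed.

Lemma redrawn_le al be v w : (p v).1 != 0 -> (p w).1 != 0 -> right_side w = right_side v ->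
  linform al be (redrawn v) <= linform al be (redrawn w) ->
      0 <= be * (hf w - hf v) - linform al be (redrawn v) * (Yf w - Yf v).
Proof.
by move=> v0 w0 es le; rewrite -(pmulr_lge0 _ (_ : 0 < (Yf w)^-1)) ?invr_gt0 // -redrawn_diff // subr_ge0.
Qed.

(** Axis neighbours above and below force [be = 0], then a left and a right neighbour force
    [al = 0]. At the bottom vertex [o1] the two roots replace the lower axis neighbour. *)
Lemma redrawn_hull_axis v al be : inner_vertex l r z v -> (p v).1 = 0 ->
  (forall w, E v w -> linform al be (redrawn v) <= linform al be (redrawn w)) -> al = 0 /\ be = 0.
Proof.
move=> /and3P[_ _ vz] v0 H.
have [w [s [ew w0 yw es s0]]] := axis_next A0 (W false) v0 vz.
have [w' [s' [_ _ _ es' s0']]] := axis_next (side_setup true) (W true) (axis_side_map true v0) vz.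
have tw := t_mono v0 w0 yw.
have side a : (p a).1 != 0 -> linform al be (redrawn v) <= linform al be (redrawn a) -> be = 0 ->
    0 <= (if right_side a then 1 else -1) * al.
  move=> a0 le b0; move: le;
      rewrite (redrawn_axis v0) /redrawn (negbTE a0) /linform /= b0 !mul0r mulr0 !addr0 mulrCA mulrA => le'.
  have yi : 0 < (Yf a)^-1 by rewrite invr_gt0.
  by move: le'; rewrite (pmulr_lge0 _ yi).
have done : be = 0 -> al = 0 /\ be = 0.
  move=> b0; split => //; have [n1 e1] := @side_pp false s s0; have [n2 e2] := side_pp s0'.
  have := side _ n1 (H _ es) b0; have := side _ n2 (H _ es') b0; rewrite e1 e2 => k1 k2; lra.
have h1 := H _ ew; rewrite (redrawn_axis v0) (redrawn_axis w0) /linform /= !mulr0 !add0r in h1.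
have bge : 0 <= be.
  by rewrite -(pmulr_lge0 _ (_ : 0 < t w - t v)) ?subr_gt0 //; lra.
apply: done.
have [vo|vo] := eqVneq v o1; last first.
  have [a [ea a0 ya]] := axis_prev A0 (W false) v0 vo.
  have ta := t_mono a0 v0 ya; have h2 := H _ ea;
      rewrite (redrawn_axis v0) (redrawn_axis a0) /linform /= !mulr0 !add0r in h2.
  apply/eqP; rewrite eq_le bge andbT -oppr_ge0 -(pmulr_lge0 _ (_ : 0 < t v - t a)) ?subr_gt0 //; lra.
subst v; have eol : E o1 l by rewrite (tg_sym T) (ax_lo A0).
have eor : E o1 r by rewrite (tg_sym T) (ax_ro A0).
have := H l eol; have := H r eor.
by rewrite (redrawn_root false) (redrawn_root true) (redrawn_axis v0) /linform /root_height /=; lra.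
Qed.

Lemma visits s v : on_walk s v -> v != side_root s -> exists i j, [/\ (0 < i)%N, (i <= j)%N, (j < K s)%N &
  u s i = v /\ u s j = v /\ first_visit u s i /\ last_visit K u s j].
Proof.
case/on_walkP=> k kK ek vr.
have ex1 : exists i, (i <= K s)%N && (u s i == v) by exists k; rewrite kK ek eqxx.
have ub i : (i <= K s)%N && (u s i == v) -> (i <= K s)%N by case/andP.
case: (ex_minnP ex1) => i /andP[iK /eqP ui] mn; case: (ex_maxnP ex1 ub) => j /andP[jK /eqP uj] mx.
have [e0 _] := lw_0 (W s); have [eK _] := lw_K (W s).
exists i, j; split.
- by rewrite lt0n; apply: contraNneq vr => ei; rewrite -ui ei e0.
- by apply: mn; rewrite jK uj eqxx.
- by rewrite ltn_neqAle jK andbT; apply: contraNneq vr => ej; rewrite -uj ej eK.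
split => //; split => //; split.
  move=> m mi; apply/eqP => e; have := mn m;
      rewrite e ui eqxx andbT (leq_trans (ltnW mi) iK) leqNgt mi => /(_ isT) //.
move=> m jm mK; apply/eqP => e; have := mx m; rewrite e uj eqxx mK leqNgt jm => /(_ isT) //.
Qed.

Lemma step_edge s i : (i < K s)%N -> is_step u s i -> E (u s i) (u s i.+1).
Proof.
move=> iK; rewrite /is_step => st; have [[e _]|[_ [tt1 _]]] := lw_next (W s) iK;
    first by rewrite e eqxx in st.
exact: (tri_edge2 (ax_tri (side_setup s)) tt1).
Qed.

Lemma redrawn_hull_walk v al be : (p v).1 != 0 -> on_walk (right_side v) v ->
    v != side_root (right_side v) ->
  (forall w, E v w -> linform al be (redrawn v) <= linform al be (redrawn w)) -> be = 0 /\
      linform al be (redrawn v) = 0.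
Proof.
move=> v0; move es : (right_side v) => s wv vr H.
have [i [j [i0 ij jK [ui [uj [fv lv]]]]]] := visits wv vr.
have iK' : (i <= K s)%N := leq_trans ij (ltnW jK).
have iK : (i.-1 < K s)%N by rewrite prednK.
have ip : i.-1.+1 = i by rewrite prednK.
have sti : is_step u s i.-1 by rewrite /is_step ip fv // ip.
have stj : is_step u s j by rewrite /is_step eq_sym lv.
have Ei := step_edge iK sti; have Ej := step_edge jK stj; rewrite ip ui (tg_sym T) in Ei; rewrite uj in Ej.
have tie : new_at s i = new_at s i.-1 by have [] := wk_step side_walks iK sti; rewrite ip.
have tje : new_at s j.+1 = new_at s j by have [] := wk_step side_walks jK stj.
have Fi := Fstep iK sti; have Fj := Fstep jK stj; rewrite /F ip ui tie in Fi; rewrite /F uj tje in Fj.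
have [qi [yi [hi [ni si]]]] := redrawn_walk (ltnW iK); have [qj [yj [hj [nj sj]]]] := redrawn_walk jK.
have [qv [yv [hv _]]] := redrawn_walk iK'; rewrite ui in qv yv hv.
have g2 := redrawn_le v0 ni (etrans si (esym es)) (H _ Ei); have g3 :=
    redrawn_le v0 nj (etrans sj (esym es)) (H _ Ej).
rewrite yi hi yv hv in g2; rewrite yj hj yv hv in g3.
have ax k : (k <= K s)%N -> u s k = v -> 0 <= be * new_at s k - linform al be (redrawn v).
  move=> kK uk; have /and3P[/= e _ _] := lw_dart (W s) kK; rewrite uk in e.
  by have := H _ e; rewrite (redrawn_axis (walk_axis kK)) {2}/linform /= mulr0 add0r /new_at subr_ge0.
have g1 := ax _ iK' ui; have g4 := ax _ (ltnW jK) uj; rewrite tie in g1.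
apply: (walk_hull (A1 := h s (u s i.-1) - h s v) (al := Y s (u s i.-1) - Y s v)
   (B1 := h s (u s j.+1) - h s v) (be := Y s (u s j.+1) - Y s v) (ti := new_at s i.-1) (tj :=
       new_at s j)) => //; try lra.
  by rewrite -tie; exact: (target_mono side_walks ij (ltnW jK)).
have [e|ne] := eqVneq (u s i.-1) (u s j.+1); first by left; rewrite e.
by right; have := Fdet i0 ij jK (etrans ui (esym uj)) fv lv ne; rewrite ui.
Qed.

Lemma redrawn_hull v : inner_vertex l r z v -> forall al be,
  (forall w, E v w -> linform al be (redrawn v) <= linform al be (redrawn w)) ->
  forall w, E v w -> linform al be (redrawn w) = linform al be (redrawn v).
Proof.
move=> iv al be H w ew.
have [v0|v0] := eqVneq (p v).1 0; first by have [-> ->] := redrawn_hull_axis iv v0 H;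
    rewrite /linform !mul0r.
have vr : v != side_root (right_side v) by case/and3P: iv; case: (right_side v).
have [wv|nw] := boolP (on_walk (right_side v) v).
  have [b0 c0] := redrawn_hull_walk v0 wv vr H.
  have [w0|[w0 es]] := nbr_side ew v0 vr.
    by rewrite c0 (redrawn_axis w0) /linform /= b0 !mul0r mulr0 addr0.
  by apply/eqP; rewrite -subr_eq0 redrawn_diff // c0 b0 !mul0r subrr mul0r.
have dv : off_walk v by rewrite /off_walk v0.
have same a : E v a -> (p a).1 != 0 /\ right_side a = right_side v.
  move=> ea; have [a0|//] := nbr_side ea v0 vr; case/negP: nw.
  have d : axis_dart E (side_map (right_side v)) (v,
      a) by rewrite /axis_dart /= ea pp_side // axis_side_map // eqxx.
  by have [i iK [ev _]] := lw_all (W (right_side v)) d; apply/on_walkP; exists i.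
have [s1 s2] := Ydeep dv.
have : \sum_(a | E v a) (be * (hf a - hf v) - linform al be (redrawn v) * (Yf a - Yf v)) = 0.
  by rewrite sumrB -!mulr_sumr s1 s2 !mulr0 subrr.
move/eqP; rewrite psumr_eq0 => [/allP/(_ w (mem_index_enum _))|a ea]; last first.
  by have [a0 es] := same _ ea; apply: redrawn_le => //; apply: H.
rewrite ew /= => /eqP e0; have [w0 es] := same _ ew.
by apply/eqP; rewrite -subr_eq0 redrawn_diff // e0 mul0r.
Qed.

Lemma redrawn_outer : 0 < det (redrawn l) (redrawn r) (redrawn z).
Proof.
rewrite (redrawn_root false) (redrawn_root true) (redrawn_axis (ax_z A0)) /det /crossp /=.
have : t o1 < t z.
  by apply: t_mono; rewrite ?(ax_o A0) ?(ax_z A0) //; apply: (axis_low A0);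
      rewrite ?(ax_z A0) // eq_sym (ax_oz A0).
rewrite /root_height; lra.
Qed.

Lemma redrawn_cross c : cr c -> [/\ (redrawn (cc false c)).1 < 0, 0 < (redrawn (cc true c)).1 &
    det (redrawn (cc false c)) (redrawn c) (redrawn (cc true c)) = 0].
Proof.
move=> c0; have [k1 [e1 f1]] := visitP false c0; have [k2 [e2 f2]] := visitP true c0.
have [qa _] := redrawn_walk k1; have [qb _] := redrawn_walk k2; have y1 := Ypos k1; have y2 := Ypos k2.
have mc : (index c crossings < size crossings)%N by rewrite index_mem mem_sort mem_enum.
have := Fcross mc; rewrite /F /visit_nth nth_index; last by rewrite mem_sort mem_enum.
rewrite /new_at f1 f2; rewrite e1 in qa y1 *; rewrite e2 in qb y2 *.
rewrite qa qb (redrawn_axis (cr_ax c0)); move: (Y _ _) (Y _ _) (h _ _) (h _ _) (t c) y1 y2 =>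
    a b g k tc a0 b0 eq0 /=.
split; first by rewrite mulN1r oppr_lt0 invr_gt0.
  by rewrite mul1r invr_gt0.
have ek : k = tc * a + tc * b - g by lra.
by rewrite ek /det /crossp /=; field; rewrite !gt_eqF.
Qed.
End Walked.

Theorem axis_redraw : exists q, [/\ injective q, plane_graph q E, forall v, (p v).1 = 0 -> q v = (0, t v) &
  forall c, cr c -> [/\ (q (cc false c)).1 < 0, 0 < (q (cc true c)).1 &
      det (q (cc false c)) (q c) (q (cc true c)) = 0]].
Proof.
have [K0 [u0 [oo0 W0]]] := left_walk_ex (side_setup false); have [K1 [u1 [oo1 W1]]] :=
    left_walk_ex (side_setup true).
pose K s := if s then K1 else K0; pose u s := if s then u1 else u0; pose o s := if s then oo1 else oo0.
have W s : left_walk E (side_tri s) (side_root s) z o1 (side_map s) (K s) (u s) (o s) by case: s.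
have [Y [h /= [Ypos Yroot Fstep Fcross Fdet]]] :=
    walk_weights (side_walks W) (visit_nth_le W) (visit_nth_mono W) (original_walks W) (root_height_lt W).
(* On the axis the data only need [gY] positive, for the minimum principle to make [Yf] positive:
   vertices off the walks have no axis neighbours. *)
pose gY v := if (p v).1 == 0 then 1 else Y (right_side v) v.
pose gh v := if (p v).1 == 0 then 0 else h (right_side v) v.
have di v : off_walk K u v -> inner_vertex l r z v by apply: (off_walk_inner W).
have [Yf [Yg Yd Yp]] := dirichlet T di gY; have [hf [hg hd _]] := dirichlet T di gh.
have Yfp v : 0 < Yf v.
  apply: Yp => {}v; rewrite /off_walk negb_and negbK /gY; case: eqP => [_ _|_ /=]; first exact: ltr01.
  by rewrite negbK; move: (right_side v) => s /on_walkP[i iK <-]; apply: Ypos.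
have Yfw v : (p v).1 != 0 -> on_walk K u (right_side v) v -> Yf v = Y (right_side v) v /\
    hf v = h (right_side v) v.
  move=> v0 wv; have nd : ~~ off_walk K u v by rewrite /off_walk wv andbF.
  by rewrite Yg // hg // /gY /gh (negbTE v0).
have Ydeep v : off_walk K u v -> \sum_(w | E v w) (Yf w - Yf v) = 0 /\ \sum_(w | E v w) (hf w - hf v) = 0.
  by move=> dv; split; [apply: Yd | apply: hd].
have qo : 0 < det (redrawn Yf hf l) (redrawn Yf hf r) (redrawn Yf hf z) by eapply (redrawn_outer
    W); eassumption.
have hu v : inner_vertex l r z v -> forall al be, (forall w, E v w ->
    linform al be (redrawn Yf hf v) <= linform al be (redrawn Yf hf w)) ->
  forall w, E v w -> linform al be (redrawn Yf hf w) = linform al be (redrawn Yf hf v).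
  by eapply (redrawn_hull W); eassumption.
have pos := tutte_floater T qo hu; have [qi qp] := positive_plane T qo pos.
exists (redrawn Yf hf); split => //; first exact: redrawn_axis.
by move=> c; eapply (redrawn_cross W); eassumption.
Qed.
End Assemble.

(** * The triangulation of a drawing *)

Lemma saturated_hull_edge (R : realType) (P : finType) (p : P -> point R) (E : rel P) a b :
  injective p -> plane_graph p E -> saturated p E -> a != b ->
  (forall v, v != a -> v != b -> 0 < det (p a) (p b) (p v)) -> E a b.
Proof.
move=> pI pl sat ab pos; have pab := p_ne pI ab.
have det0 v : det (p a) (p b) (p v) = 0 -> v = a \/ v = b.
  move=> h; have [->|va] := eqVneq v a; first by left.
  by right; apply: contrapT => /eqP vb; have := pos v va vb; rewrite h ltxx.
have ge0 v : 0 <= det (p a) (p b) (p v).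
  have [->|va] := eqVneq v a; first by rewrite detaba.
  have [->|vb] := eqVneq v b; first by rewrite detabb.
  exact/ltW/pos.
have [//|nE] := boolP (E a b); exfalso; apply: (negP nE); apply: (sat _ _ ab) =>
    [w [s s01 e]|c d x e [s s01 ex] [t t01 et]].
  have : det (p a) (p b) (p w) = 0 by rewrite e det_interp detaba detabb; ring.
  case/det0 => ew; move: e s01; rewrite ew.
    by rewrite -{1}(interp0 (p a) (p b)) => /(interp_inj pab) <-; rewrite ltxx.
  by rewrite -{1}(interp1 (p a) (p b)) => /(interp_inj pab) <-; rewrite ltxx andbF.
have dx : det (p a) (p b) x = 0 by rewrite ex det_interp detaba detabb; ring.
have : (1 - t) * det (p a) (p b) (p c) + t * det (p a) (p b) (p d) = 0 by rewrite -det_interp -et.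
have g1 := ge0 c; have g2 := ge0 d => h.
have k1 : 0 <= (1 - t) * det (p a) (p b) (p c) by apply: mulr_ge0 => //; lra.
have k2 : 0 <= t * det (p a) (p b) (p d) by apply: mulr_ge0 => //; lra.
have z1 : (1 - t) * det (p a) (p b) (p c) = 0 by lra.
have z2 : t * det (p a) (p b) (p d) = 0 by lra.
have cd := plane_edge_neq pl e.
have nE' : ~~ E b a by rewrite (pl_sym pl).
move/eqP: z1; rewrite mulf_eq0 => /orP[/eqP ?|/eqP/det0 hc]; first lra.
move/eqP: z2; rewrite mulf_eq0 => /orP[/eqP ?|/eqP/det0 hd]; first lra.
by case: hc hd cd e nE nE' => -> [] ->; rewrite ?eqxx // => _ ->.
Qed.

(** * The auxiliary points and segments *)

Section Setup.
Variables (R : realType) (V : finType) (e : rel V) (p : V -> point R).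
Hypothesis Gs : simple_graph e.
Hypothesis D : plane_sl_drawing e p.

Definition radius : R := 1 + \sum_v (`|(p v).1| + `|(p v).2|).
Lemma vertex_box v : [/\ - radius < (p v).1, (p v).1 < radius, - radius < (p v).2 & (p v).2 < radius].
Proof.
have h : `|(p v).1| + `|(p v).2| < radius.
  rewrite /radius (bigD1 v) //=; have : 0 <= \sum_(i | i != v) (`|(p i).1| + `|(p i).2|).
    by apply: sumr_ge0 => i _; rewrite addr_ge0.
  lra.
have n1 := ler_norm (p v).1; have n2 := ler_norm (p v).2; have n3 := ler_norm (- (p v).1);
    have n4 := ler_norm (- (p v).2).
rewrite !normrN in n3 n4; have := normr_ge0 (p v).1; have := normr_ge0 (p v).2.
by split; lra.
Qed.
Lemma radius_gt0 : 0 < radius.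
Proof.
rewrite /radius; have : 0 <= \sum_v (`|(p v).1| + `|(p v).2|) by apply: sumr_ge0 => i _; rewrite addr_ge0.
lra.
Qed.

(** All vertices and crossings lie in the open box of half-width [radius]. The constants put the box
    inside the triangle of the first three points and above the flat segments joining [low_pt] to
    the lower corners. *)
Definition left_pt : point R := (- (10 * radius), - (3 * radius)).
Definition right_pt : point R := (10 * radius, - (3 * radius)).
Definition top_pt : point R := (0, 10 * radius).
Definition low_pt : point R := (0, - (2 * radius)).
Definition crosses_axis u v := [&& e u v, (p u).1 < 0 & 0 < (p v).1].
Definition crossing_pt u v : point R := (0, ((p v).1 * (p u).2 - (p u).1 * (p v).2) / ((p v).1 - (p u).1)).
Definition in_box (x : point R) := [/\ - radius < x.1, x.1 < radius, - radius < x.2 & x.2 < radius].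

Lemma crossing_ptE u v : crosses_axis u v ->
    crossing_pt u v = interp (p u) (p v) (- (p u).1 / ((p v).1 - (p u).1)) /\
  0 < - (p u).1 / ((p v).1 - (p u).1) < 1.
Proof.
case/and3P=> _ h1 h2; split; last by apply: ratio_in01; lra.
by apply: pair_ext => /=; field; lra.
Qed.

Lemma in_box_interp a b s : in_box a -> in_box b -> 0 <= s <= 1 -> in_box (interp a b s).
Proof.
case=> a1 a2 a3 a4 [b1 b2 b3 b4] /andP[s0 s1]; rewrite /in_box /=.
have c (u v m : R) : u < m -> v < m -> (1 - s) * u + s * v < m.
  move=> um vm; have k1 : 0 <= s * (m - v) by apply: mulr_ge0 => //; lra.
  have k2 : 0 <= (1 - s) * (m - u) by apply: mulr_ge0 => //; lra.
  rewrite lt_neqAle; apply/andP; split; last by lra.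
  apply/eqP => h; have z1 : s * (m - v) = 0 by lra.
  have z2 : (1 - s) * (m - u) = 0 by lra.
  move/eqP: z1; rewrite mulf_eq0 => /orP[/eqP z1|/eqP]; last by lra.
  by move: z2; rewrite z1; lra.
have c' (u v m : R) : m < u -> m < v -> m < (1 - s) * u + s * v.
  move=> um vm; have := c (- u) (- v) (- m); rewrite !ltrN2 => /(_ um vm); lra.
by split; [apply: c' | apply: c | apply: c' | apply: c].
Qed.

Definition pts : seq (point R) := [:: left_pt; right_pt; top_pt; low_pt] ++ [seq p v | v <- enum V] ++
  [seq crossing_pt uv.1 uv.2 | uv <- enum {: V * V} & crosses_axis uv.1 uv.2].
Local Notation P := (seq_sub pts).
Local Notation pt := (val : P -> point R).

Lemma pts_inj : injective pt. Proof. exact: val_inj. Qed.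

Lemma vertex_pts v : p v \in pts.
Proof. by rewrite !mem_cat map_f ?orbT // mem_enum. Qed.
Lemma crossing_pts u v : crosses_axis u v -> crossing_pt u v \in pts.
Proof.
move=> h; rewrite !mem_cat; apply/orP; right; apply/orP; right.
by apply/mapP; exists (u, v) => //; rewrite mem_filter mem_enum h.
Qed.
Lemma left_pts : left_pt \in pts. Proof. by rewrite inE eqxx. Qed.
Lemma right_pts : right_pt \in pts. Proof. by rewrite !inE eqxx orbT. Qed.
Lemma top_pts : top_pt \in pts. Proof. by rewrite !inE eqxx !orbT. Qed.
Lemma low_pts : low_pt \in pts. Proof. by rewrite !inE eqxx !orbT. Qed.
Definition vertex_of v : P := SeqSub (vertex_pts v).
Definition lP : P := SeqSub left_pts.
Definition rP : P := SeqSub right_pts.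
Definition zP : P := SeqSub top_pts.
Definition oP : P := SeqSub low_pts.

Inductive kind (a : P) : Prop :=
 | Kv v of pt a = p v
 | Kx u v of crosses_axis u v & pt a = crossing_pt u v
 | Kl of a = lP | Kr of a = rP | Kz of a = zP | Ko of a = oP.

Lemma kindP a : kind a.
Proof.
have := valP a; rewrite /= !mem_cat => /orP[|/orP[|]].
- rewrite !inE => /or4P[] /eqP h; [apply: Kl|apply: Kr|apply: Kz|apply: Ko]; exact: val_inj.
- by case/mapP=> v _ h; apply: (Kv h).
by case/mapP=> -[u v]; rewrite mem_filter => /andP[c _] h; apply: (Kx c h).
Qed.

Lemma pts_in_box a : in_box (pt a) \/ [\/ a = lP, a = rP, a = zP | a = oP].
Proof.
case: (kindP a) => [v ->|u v c ->|->|->|->|->].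
- by left; apply: vertex_box.
- left; have [-> h] := crossing_ptE c; apply: in_box_interp; try exact: vertex_box; lra.
- by right; constructor 1.
- by right; constructor 2.
- by right; constructor 3.
- by right; constructor 4.
Qed.

Definition on_axis_edge u v := ((p u).1 == 0) && ((p v).1 == 0).
(* Edges lying on the axis are covered by the segment from [low_pt] to [top_pt]. *)
Definition base_seg (a b : point R) : Prop :=
  [\/ exists u v, [/\ e u v, ~~ on_axis_edge u v, a = p u & b = p v], (a, b) = (low_pt, top_pt),
      (a, b) = (left_pt, low_pt) | (a, b) = (right_pt, low_pt)].

Definition region (k : nat) (x : point R) : Prop := match k with
  | 0 => in_box x
  | 1 => [/\ x.1 = 0, - (2 * radius) <= x.2 & x.2 <= 10 * radius]
  | 2 => [/\ 10 * x.2 = x.1 - 20 * radius, - (10 * radius) <= x.1 & x.1 <= 0]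
  | _ => [/\ 10 * x.2 = - x.1 - 20 * radius, 0 <= x.1 & x.1 <= 10 * radius]
  end.

Lemma seg_region x :
  [/\ forall u v, on_seg (p u) (p v) x -> in_box x,
      on_seg low_pt top_pt x -> region 1 x, on_seg left_pt low_pt x -> region 2 x &
          on_seg right_pt low_pt x -> region 3 x].
Proof.
have M0 := radius_gt0; split; first by move=> u v [s [s01 ->]]; apply: in_box_interp => //;
    apply: vertex_box.
- case=> s [/andP[s0 s1] ->] /=; have := mulr_ge0 s0 (ltW M0);
    have : 0 <= (1 - s) * radius by apply: mulr_ge0; lra.
  by split; lra.
- case=> s [/andP[s0 s1] ->] /=; have := mulr_ge0 s0 (ltW M0);
    have : 0 <= (1 - s) * radius by apply: mulr_ge0; lra.
  by split; lra.
- case=> s [/andP[s0 s1] ->] /=; have := mulr_ge0 s0 (ltW M0);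
    have : 0 <= (1 - s) * radius by apply: mulr_ge0; lra.
  by split; lra.
Qed.

Lemma same_edge u v u' v' x : e u v -> e u' v' -> on_seg (p u) (p v) x -> on_seg (p u') (p v') x ->
  (exists w, x = p w) \/ (u, v) = (u', v') \/ (u, v) = (v', u').
Proof.
move=> e1 e2 o1 o2; have [eq|ne] := eqVneq [set u; v] [set u'; v']; last first.
  by left; have [w _ ->] := D.2.2 _ _ _ _ e1 e2 ne x o1 o2; exists w.
right; have uv : u != v by apply: contraTneq e1 => ->; rewrite (Gs.2 v).
have /set2P hu : u \in [set u'; v'] by rewrite -eq set21.
have /set2P hv : v \in [set u'; v'] by rewrite -eq set22.
by case: hu hv uv => -> [] ->; rewrite ?eqxx //; [left | right].
Qed.

Lemma axis_cross u v x : e u v -> ~~ on_axis_edge u v -> on_seg (p u) (p v) x -> x.1 = 0 -> x \in pts.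
Proof.
move=> euv na [s [s01 ex]] x0.
have h : (1 - s) * (p u).1 + s * (p v).1 = 0 by rewrite -x0 ex.
have key u' v' s' : e u' v' -> 0 <= s' <= 1 -> x = interp (p u') (p v') s' -> (p u').1 < 0 ->
    0 < (p v').1 -> x \in pts.
  move=> e' s01' ex' n1 n2; have c : crosses_axis u' v' by rewrite /crosses_axis e' n1 n2.
  have -> : x = crossing_pt u' v'; last exact: crossing_pts.
  rewrite ex' (crossing_ptE c).1; congr interp; apply: (mulIf (_ : (p v').1 - (p u').1 != 0));
      first by rewrite gt_eqF; lra.
  have : (1 - s') * (p u').1 + s' * (p v').1 = 0 by rewrite -x0 ex'.
  rewrite divfK; last by rewrite gt_eqF; lra.
  lra.
have [l|l|l] := ltgtP (p u).1 0; have [l'|l'|l'] := ltgtP (p v).1 0.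
- exfalso; have k1 : 0 <= (1 - s) * - (p u).1 by apply: mulr_ge0; lra.
  have k2 : 0 <= s * - (p v).1 by apply: mulr_ge0; lra.
  have z1 : (1 - s) * (p u).1 = 0 by lra.
  have z2 : s * (p v).1 = 0 by lra.
  move/eqP: z1; rewrite mulf_eq0 (lt_eqF l) orbF => /eqP z1; move/eqP: z2;
      rewrite mulf_eq0 (lt_eqF l') orbF => /eqP z2; lra.
- exact: (key u v s).
- have -> : x = p v; last exact: vertex_pts.
  move: h; rewrite l' mulr0 addr0 => /eqP; rewrite mulf_eq0 (lt_eqF l) orbF => /eqP s1.
  have e1 : s = 1 by lra.
  by rewrite ex -/(interp (p u) (p v) s) e1 interp1.
- apply: (key v u (1 - s)) => //; rewrite ?(Gs.1 v) //; first lra.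
  by rewrite -interp_sym.
- exfalso; have k1 : 0 <= (1 - s) * (p u).1 by apply: mulr_ge0; lra.
  have k2 : 0 <= s * (p v).1 by apply: mulr_ge0; lra.
  have z1 : (1 - s) * (p u).1 = 0 by lra.
  have z2 : s * (p v).1 = 0 by lra.
  move/eqP: z1; rewrite mulf_eq0 (gt_eqF l) orbF => /eqP z1; move/eqP: z2;
      rewrite mulf_eq0 (gt_eqF l') orbF => /eqP z2; lra.
- have -> : x = p v; last exact: vertex_pts.
  move: h; rewrite l' mulr0 addr0 => /eqP; rewrite mulf_eq0 (gt_eqF l) orbF => /eqP s1.
  have e1 : s = 1 by lra.
  by rewrite ex -/(interp (p u) (p v) s) e1 interp1.
- have -> : x = p u; last exact: vertex_pts.
  move: h; rewrite l mulr0 add0r => /eqP; rewrite mulf_eq0 (lt_eqF l') orbF => /eqP s1.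
  by rewrite ex -/(interp (p u) (p v) s) s1 interp0.
- have -> : x = p u; last exact: vertex_pts.
  move: h; rewrite l mulr0 add0r => /eqP; rewrite mulf_eq0 (gt_eqF l') orbF => /eqP s1.
  by rewrite ex -/(interp (p u) (p v) s) s1 interp0.
by move: na; rewrite /on_axis_edge l l' eqxx.
Qed.

Lemma base_meet a b a' b' x : base_seg a b -> base_seg a' b' -> on_seg a b x -> on_seg a' b' x ->
  x \in pts \/ (a, b) = (a', b') \/ (a, b) = (b', a').
Proof.
have M0 := radius_gt0; have [sG s1 s2 s3] := seg_region x.
have inL y : x.1 = y.1 -> x.2 = y.2 -> y \in pts -> x \in pts by move=> h1 h2; rewrite (pair_ext h1 h2).
have half u v a2 b2 : e u v -> ~~ on_axis_edge u v -> on_seg (p u) (p v) x ->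
    [\/ (a2, b2) = (low_pt, top_pt), (a2, b2) = (left_pt, low_pt) | (a2, b2) = (right_pt,
        low_pt)] -> on_seg a2 b2 x -> x \in pts.
  move=> euv na o1 h o2; have [b1 b2' b3 b4] := sG _ _ o1.
  case: h => -[h1 h2]; rewrite h1 h2 in o2.
  - by have [x0 _ _] := s1 o2; apply: axis_cross o1 x0.
  - by have [? ? ?] := s2 o2; exfalso; lra.
  - by have [? ? ?] := s3 o2; exfalso; lra.
case=> [[u [v [euv na -> ->]]]|h|h|h]; case=> [[u' [v' [euv' na' -> ->]]]|h'|h'|h'] o o'.
- by case: (same_edge euv euv' o o') => [[w ->]|[[-> ->]|[-> ->]]]; [left; apply: vertex_pts|right;
    left|right; right].
- by left; apply: (half u v _ _ euv na o _ o'); constructor 1.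
- by left; apply: (half u v _ _ euv na o _ o'); constructor 2.
- by left; apply: (half u v _ _ euv na o _ o'); constructor 3.
- by left; apply: (half u' v' _ _ euv' na' o' _ o); constructor 1.
- by right; left; rewrite h h'.
- left; case: h o => -> -> /s1[? ? ?]; case: h' o' => -> -> /s2[? ? ?];
    apply: (inL low_pt _ _ low_pts) => /=; lra.
- left; case: h o => -> -> /s1[? ? ?]; case: h' o' => -> -> /s3[? ? ?];
    apply: (inL low_pt _ _ low_pts) => /=; lra.
- by left; apply: (half u' v' _ _ euv' na' o' _ o); constructor 2.
- left; case: h o => -> -> /s2[? ? ?]; case: h' o' => -> -> /s1[? ? ?];
    apply: (inL low_pt _ _ low_pts) => /=; lra.
- by right; left; rewrite h h'.
- left; case: h o => -> -> /s2[? ? ?]; case: h' o' => -> -> /s3[? ? ?];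
    apply: (inL low_pt _ _ low_pts) => /=; lra.
- by left; apply: (half u' v' _ _ euv' na' o' _ o); constructor 3.
- left; case: h o => -> -> /s3[? ? ?]; case: h' o' => -> -> /s1[? ? ?];
    apply: (inL low_pt _ _ low_pts) => /=; lra.
- left; case: h o => -> -> /s3[? ? ?]; case: h' o' => -> -> /s2[? ? ?];
    apply: (inL low_pt _ _ low_pts) => /=; lra.
by right; left; rewrite h h'.
Qed.

Definition empty_seg (a b : P) := forall w : P, ~ open_seg (pt a) (pt b) (pt w).
Definition base_edges : rel P := fun a b => `[< a != b /\ empty_seg a b /\
    exists s1 s2, [/\ base_seg s1 s2, on_seg s1 s2 (pt a) & on_seg s1 s2 (pt b)] >].

Lemma on_seg_mid (s1 s2 a b x : point R) : on_seg s1 s2 a -> on_seg s1 s2 b -> open_seg a b x ->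
    on_seg s1 s2 x.
Proof.
move=> [s [s01 ->]] [s' [s01' ->]] [r r01 ->]; exists ((1 - r) * s + r * s'); split;
    last exact: interp_interp.
have k1 : 0 <= (1 - r) * s by apply: mulr_ge0; lra.
have k2 : 0 <= r * s' by apply: mulr_ge0; lra.
have k3 : 0 <= (1 - r) * (1 - s) by apply: mulr_ge0; lra.
have k4 : 0 <= r * (1 - s') by apply: mulr_ge0; lra.
lra.
Qed.

(** Different base segments meet only at points of [pts]; on a single one, overlapping pieces
    without points inside coincide by [collinear_same]. *)
Lemma base_edges_plane : plane_graph pt base_edges.
Proof.
split.
- move=> a b; apply/asboolP/asboolP => -[n [h [s1 [s2 [h1 h2 h3]]]]]; rewrite eq_sym; split => //;
    by split; [move=> w /open_seg_sym; apply: h | exists s1, s2].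
- by move=> a; apply/negbTE/asboolP => -[]; rewrite eqxx.
- by move=> a b w /asboolP[_ [h _]]; apply: h.
move=> a b c d x /asboolP[ab [h [s1 [s2 [h1 h2 h3]]]]] /asboolP[cd [h' [s1' [s2' [h1' h2' h3']]]]] o o'.
case: (base_meet h1 h1' (on_seg_mid h2 h3 o) (on_seg_mid h2' h3' o')) => [xL|same].
  by case: (h (SeqSub xL)).
apply: (collinear_same pts_inj ab cd h h' o o').
have [t2 [_ e2]] := h2; have [t3 [_ e3]] := h3.
have [t2' e2'] : exists t, pt c = interp s1 s2 t.
  by case: h2' => t [_ ec]; case: same => -[-> ->]; [exists t | exists (1 - t); rewrite -interp_sym].
by rewrite e2 e3 e2' /det /crossp /=; ring.
Qed.
End Setup.

(** [a] and [b] are proportional to the distances of the two ends from the line through the lower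
    corner and [low_pt], so the crossing divides the segment in the ratio [a] to [b]. *)
Lemma low_cut (R : realType) (sg M X Y c : R) : 0 < M -> 0 < X < M -> - M < Y -> c < - (2 * M) ->
  exists2 r, 0 < r < 1 & open_seg (sg * (10 * M), - (3 * M)) (0, - (2 * M)) (interp (sg * X, Y) (0, c) r).
Proof.
move=> M0 /andP[X0 XM] YM cM; pose a := 10 * Y + 20 * M + X; pose b := - (10 * c + 20 * M).
have a0 : 0 < a by rewrite /a; lra.
have b0 : 0 < b by rewrite /b; lra.
have ab0 : 0 < a + b := addr_gt0 a0 b0.
exists (a / (a + b)); first by apply: ratio_in01; rewrite ?ltrDl.
have r0 : 0 < a / (a + b) by exact: divr_gt0 a0 ab0.
have r1 : a / (a + b) < 1 by rewrite (ltr_pdivrMr _ _ ab0) mul1r ltrDl.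
have er : a / (a + b) * (a + b) = a by rewrite divfK // (gt_eqF ab0).
move: (a / (a + b)) r0 r1 er => r r0 r1; rewrite /a /b {a b a0 b0 ab0} => er.
have k1 : 0 < (1 - r) * X by apply: mulr_gt0; lra.
have k2 : 0 < r * X by apply: mulr_gt0; lra.
have f01 : 0 < (1 - r) * X / (10 * M) < 1 by apply: ratio_in01; lra.
exists (1 - (1 - r) * X / (10 * M)); first by move: (_ / _) f01 => f f01; lra.
apply: pair_ext => /=; first by field; lra.
by transitivity (- (2 * M) - (1 - r) * X / 10); [lra | field; lra].
Qed.

Lemma open_seg_sub (R : realType) (a b c : point R) r : 0 < r < 1 -> open_seg a b c ->
    open_seg a b (interp a c r).
Proof.
move=> /andP[r0 r1] [s /andP[s0 s1] ->]; exists (r * s); last by apply: pair_ext => /=; ring.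
by rewrite mulr_gt0 //= (lt_trans _ s1) // gtr_pMl.
Qed.

(** * The saturated graph of a drawing *)

Section Draw.
Variables (R : realType) (V : finType) (e : rel V) (p : V -> point R).
Hypothesis Gs : simple_graph e.
Hypothesis D : plane_sl_drawing e p.
Local Notation L := (pts e p).
Local Notation P := (seq_sub L).
Local Notation pt := (val : P -> point R).
Local Notation M := (radius p).
Local Notation lP := (lP e p).
Local Notation rP := (rP e p).
Local Notation zP := (zP e p).
Local Notation oP := (oP e p).
Local Notation iv := (vertex_of e p).
Local Notation crosses := (crosses_axis e p).
Local Notation xpt := (crossing_pt p).

Lemma vertex_of_inj u v : iv u = iv v -> u = v.
Proof. by move/(congr1 val) => /= /D.1. Qed.

Lemma crossing_pt_vertex u v w : crosses u v -> xpt u v <> p w.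
Proof.
move=> c h; have [ex x01] := crossing_ptE c; have /and3P[euv h1 h2] := c.
have wu : w != u by apply: contraTneq h1 => <-; rewrite -h /= ltxx.
have wv : w != v by apply: contraTneq h2 => <-; rewrite -h /= ltxx.
apply: (D.2.1 u v w euv wu wv); exists (- (p u).1 / ((p v).1 - (p u).1)); split; first lra.
by rewrite -h.
Qed.

Lemma crossing_pt_same u v u' v' : crosses u v -> e u' v' -> on_seg (p u') (p v') (xpt u v) ->
    (u, v) = (u', v') \/ (u, v) = (v', u').
Proof.
move=> c e' o; have [ex x01] := crossing_ptE c; have /and3P[euv _ _] := c.
have o1 : on_seg (p u) (p v) (xpt u v) by exists (- (p u).1 / ((p v).1 - (p u).1)); split; first lra.
by case: (same_edge Gs D euv e' o1 o) => [[w /(crossing_pt_vertex c)]|].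
Qed.

Lemma edge_pts u v (a : P) : e u v -> open_seg (p u) (p v) (pt a) -> (crosses u v /\
    pt a = xpt u v) \/ (crosses v u /\ pt a = xpt v u).
Proof.
move=> euv o; have M0 := radius_gt0 p.
have oc : on_seg (p u) (p v) (pt a) by case: o => s s01 ->; exists s; split => //; lra.
have [bx _ _ _] := @seg_region R V p (pt a); have {bx} [b1 b2 b3 b4] := bx _ _ oc.
have pne u' v' : e u' v' -> p u' != p v'.
  by move=> e'; apply: contraTneq e' => /D.1 ->; rewrite (Gs.2 v').
case: (kindP a) => [w h|u' v' c h|h|h|h|h]; [ | |by exfalso; move: b1 b2 b3 b4; rewrite h /=;
    lra|by exfalso; move: b1 b2 b3 b4; rewrite h /=; lra|by exfalso; move: b1 b2 b3 b4;
    rewrite h /=; lra|by exfalso; move: b1 b2 b3 b4; rewrite h /=; lra].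
- exfalso; have [wu|wu] := eqVneq w u.
    case: o => s s01; rewrite h wu -{1}(interp0 (p u) (p v)) => /(interp_inj (pne _ _ euv)) s0.
    by move: s01; rewrite -s0 ltxx.
  have [wv|wv] := eqVneq w v.
    case: o => s s01; rewrite h wv -{1}(interp1 (p u) (p v)) => /(interp_inj (pne _ _ euv)) s0.
    by move: s01; rewrite -s0 ltxx andbF.
  by apply: (D.2.1 u v w euv wu wv); rewrite -h.
rewrite h in oc; case: (crossing_pt_same c euv oc) => -[h1 h2]; rewrite h1 h2 in c h; by [left | right].
Qed.

Variable E : rel P.
Hypothesis pl : plane_graph pt E.
Hypothesis sat : saturated pt E.
Hypothesis base_sub : subrel (@base_edges R V e p) E.

Lemma outer_tri_pos : 0 < det (pt lP) (pt rP) (pt zP).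
Proof. by have M0 := radius_gt0 p; rewrite /det /crossp /=; have := mulr_gt0 M0 M0; lra. Qed.

Lemma outer_tri_inner (v : P) : [&& v != lP, v != rP & v != zP] ->
  [/\ 0 < det (pt lP) (pt rP) (pt v), 0 < det (pt rP) (pt zP) (pt v) & 0 < det (pt zP) (pt lP) (pt v)].
Proof.
move=> /and3P[n1 n2 n3]; have M0 := radius_gt0 p; have MM := mulr_gt0 M0 M0.
case: (pts_in_box v) => [[b1 b2 b3 b4]|[] h]; try by move: n1 n2 n3; rewrite h ?eqxx.
  have k1 : 0 < M * (M - (pt v).1) by apply: mulr_gt0 => //; lra.
  have k2 : 0 < M * (M + (pt v).1) by apply: mulr_gt0 => //; lra.
  have k3 : 0 < M * (M - (pt v).2) by apply: mulr_gt0 => //; lra.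
  have k4 : 0 < M * (M + (pt v).2) by apply: mulr_gt0 => //; lra.
  by rewrite /det /crossp /=; split; lra.
by rewrite h /det /crossp /=; split; lra.
Qed.

Lemma outer_tri_neq : [/\ lP != rP, rP != zP & zP != lP].
Proof.
have h := outer_tri_pos; split; apply: contraTneq h => ->; by rewrite ?detaa ?detabb ?detaba ltxx.
Qed.

Lemma outer_tri_edges : [/\ E lP rP, E rP zP & E zP lP].
Proof.
have [n1 n2 n3] := outer_tri_neq; have h := outer_tri_pos.
split; apply: (saturated_hull_edge (@pts_inj R V e p) pl sat) => // v va vb.
- by have [->//|vc] := eqVneq v zP; have [|k _ _] := @outer_tri_inner v; first exact/and3P.
- have [->|vc] := eqVneq v lP; first by rewrite det_rot.
  by have [|_ k _] := @outer_tri_inner v; first exact/and3P.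
have [->|vc] := eqVneq v rP; first by rewrite -det_rot.
by have [|_ _ k] := @outer_tri_inner v; first exact/and3P.
Qed.

Lemma base_edge (a b : P) s1 s2 : a != b -> base_seg e p s1 s2 -> on_seg s1 s2 (pt a) ->
    on_seg s1 s2 (pt b) -> empty_seg a b -> E a b.
Proof. by move=> ab h1 h2 h3 h4; apply: base_sub; apply/asboolP; split => //; split => //;
    exists s1, s2. Qed.

Lemma on_seg0 (a b : point R) : on_seg a b a.
Proof. by exists 0; rewrite lexx ler01 -/(interp a b 0) interp0. Qed.
Lemma on_seg1 (a b : point R) : on_seg a b b.
Proof. by exists 1; rewrite lexx ler01 -/(interp a b 1) interp1. Qed.

Lemma left_low_edge : E lP oP.
Proof.
have M0 := radius_gt0 p.
have ne : lP != oP by apply/eqP => /(congr1 val)/(congr1 fst) /=; lra.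
apply: (base_edge ne (s1 := left_pt p) (s2 := low_pt p)); [by constructor 3 | exact: on_seg0 |
    exact: on_seg1 |].
move=> w [s s01 ew]; have x1 : (pt w).1 = - (10 * M) * (1 - s) by rewrite ew /=; ring.
have x2 : (pt w).2 = - (2 * M) - M * (1 - s) by rewrite ew /=; ring.
have k1 : 0 < M * (1 - s) by apply: mulr_gt0; lra.
have k2 : 0 < M * s by apply: mulr_gt0; lra.
by case: (pts_in_box w) => [[b1 b2 b3 b4]|[] h]; rewrite ?h /= in x1 x2; lra.
Qed.

Lemma right_low_edge : E rP oP.
Proof.
have M0 := radius_gt0 p.
have ne : rP != oP by apply/eqP => /(congr1 val)/(congr1 fst) /=; lra.
apply: (base_edge ne (s1 := right_pt p) (s2 := low_pt p)); [by constructor 4 | exact: on_seg0 |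
    exact: on_seg1 |].
move=> w [s s01 ew]; have x1 : (pt w).1 = (10 * M) * (1 - s) by rewrite ew /=; ring.
have x2 : (pt w).2 = - (2 * M) - M * (1 - s) by rewrite ew /=; ring.
have k1 : 0 < M * (1 - s) by apply: mulr_gt0; lra.
have k2 : 0 < M * s by apply: mulr_gt0; lra.
by case: (pts_in_box w) => [[b1 b2 b3 b4]|[] h]; rewrite ?h /= in x1 x2; lra.
Qed.

Lemma on_axis (a : point R) : a.1 = 0 -> - (2 * M) <= a.2 -> a.2 <= 10 * M ->
    on_seg (low_pt p) (top_pt p) a.
Proof.
move=> a0 h1 h2; have M0 := radius_gt0 p.
exists ((a.2 + 2 * M) / (12 * M)); split.
  rewrite divr_ge0 ?ler_pdivrMr; lra.
by apply: pair_ext => /=; rewrite ?a0; field; lra.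
Qed.

Lemma axis_edge (a b : P) : a != b -> (pt a).1 = 0 -> (pt b).1 = 0 -> empty_seg a b -> E a b.
Proof.
have M0 := radius_gt0 p; move=> ab a0 b0 h.
have ax (c : P) : (pt c).1 = 0 -> on_seg (low_pt p) (top_pt p) (pt c).
  move=> c0; apply: on_axis => //; case: (pts_in_box c) => [[b1 b2 b3 b4]|[] hc]; rewrite ?hc /=; try lra.
    by move: c0; rewrite hc /=; lra.
  by move: c0; rewrite hc /=; lra.
by apply: (base_edge ab (s1 := low_pt p) (s2 := top_pt p)) => //; [constructor 2 | exact: ax | exact: ax].
Qed.

(** Look where the edge meets the axis. Below [low_pt] it would cross an edge from [low_pt] to a
    lower corner unless it ends in both corners; higher up it would cross the axis edge between the
    two vertices next to that point. *)
Lemma cross_edge (u v : P) : E u v -> (pt u).1 < 0 -> 0 < (pt v).1 -> u = lP /\ v = rP.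
Proof.
move=> euv u0 v0; have M0 := radius_gt0 p.
have hb (a : P) : (pt a).2 <= 10 * M.
  by case: (pts_in_box a) => [[b1 b2 b3 b4]|[] h]; rewrite ?h /=; lra.
have [c [oc c1 c2b]] : exists c, [/\ open_seg (pt u) (pt v) c, c.1 = 0 & c.2 <= 10 * M].
  exists (interp (pt u) (pt v) (- (pt u).1 / ((pt v).1 - (pt u).1))).
  have s01 : 0 < - (pt u).1 / ((pt v).1 - (pt u).1) < 1 by apply: ratio_in01; lra.
  split; [by exists (- (pt u).1 / ((pt v).1 - (pt u).1)) | by move=> /=; field; lra |].
  move: (_ / _) s01 (hb u) (hb v) => s /andP[s0 s1] /= hu hv.
  have k1 : 0 <= s * (10 * M - (pt v).2) by rewrite mulr_ge0 ?subr_ge0 // ltW.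
  have k2 : 0 <= (1 - s) * (10 * M - (pt u).2) by rewrite mulr_ge0 ?subr_ge0 // ltW.
  by move: ((pt u).2) ((pt v).2) k1 k2 => a1 a2 k1 k2; lra.
have eE : E oP lP by rewrite (pl_sym pl) left_low_edge.
have eE' : E oP rP by rewrite (pl_sym pl) right_low_edge.
have [l|l] := ltP c.2 (- (2 * M)).
  split; apply/eqP; apply: contraT => ne; exfalso.
    have [b1 b2 b3 b4] : in_box p (pt u).
      by case: (pts_in_box u) => [//|[] h]; exfalso; move: u0 ne; rewrite h ?eqxx //=; lra.
    have xl : 0 < - (pt u).1 < M by rewrite oppr_gt0 u0 ltrNl.
    have [r r01] := low_cut (-1) M0 xl b3 l; rewrite !mulN1r opprK => o2.
    have od : open_seg (pt u) (pt v) (interp ((pt u).1, (pt u).2) (0, c.2) r).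
      rewrite -c1 -!surjective_pairing; apply: open_seg_sub r01 _; exact: oc.
    by case: (pl_cr pl euv left_low_edge od o2) => -[e1 e2]; [move: v0;
        rewrite e2 /= ltxx | move: u0; rewrite e1 /= ltxx].
  have [b1 b2 b3 b4] : in_box p (pt v).
    by case: (pts_in_box v) => [//|[] h]; exfalso; move: v0 ne; rewrite h ?eqxx //=; lra.
  have xl : 0 < (pt v).1 < M by rewrite v0.
  have [r r01] := low_cut 1 M0 xl b3 l; rewrite !mul1r => o2.
  have od : open_seg (pt u) (pt v) (interp ((pt v).1, (pt v).2) (0, c.2) r).
    rewrite -c1 -!surjective_pairing; apply: open_seg_sym; apply: open_seg_sub r01 _; exact: open_seg_sym.
  case: (pl_cr pl euv right_low_edge od o2) => -[e1 e2]; first by move: v0; rewrite e2 /= ltxx.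
  by move: u0; rewrite e1 /= ltxx.
exfalso.
have notL (w : P) : pt w <> c by move=> h; apply: (pl_pt pl euv (w := w)); rewrite h.
have c2z : c.2 < 10 * M.
  rewrite lt_neqAle; apply/andP; split.
    by apply/eqP => h; apply: (notL zP); apply: pair_ext; rewrite ?c1 ?h.
  exact: c2b.
have c2o : - (2 * M) < c.2.
  by rewrite lt_neqAle l andbT; apply/eqP => h; apply: (notL oP); apply: pair_ext; rewrite ?c1 -?h.
pose below (a : P) := ((pt a).1 == 0) && ((pt a).2 < c.2).
pose above (a : P) := ((pt a).1 == 0) && (c.2 < (pt a).2).
have ob : below oP by rewrite /below /= eqxx.
have za : above zP by rewrite /above /= eqxx.
case: (@Order.TotalTheory.arg_maxP _ _ _ oP below (fun a => (pt a).2) ob) => a /andP[/eqP a0 ac] amx.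
case: (@Order.TotalTheory.arg_minP _ _ _ zP above (fun a => (pt a).2) za) => b /andP[/eqP b0 cb] bmn.
have ab : a != b by apply: contraTneq (lt_trans ac cb) => ->; rewrite ltxx.
have eab : E a b.
  apply: axis_edge => // w [r r01 ew].
  have w0 : (pt w).1 = 0 by rewrite ew /= a0 b0; ring.
  have w2 : (pt w).2 = (1 - r) * (pt a).2 + r * (pt b).2 by rewrite ew.
  have [aw wb] : (pt a).2 < (pt w).2 /\ (pt w).2 < (pt b).2.
    have lab := lt_trans ac cb; case/andP: r01 => r0 r1; rewrite w2.
    by move: ((pt a).2) ((pt b).2) lab {amx bmn w0 w2 ew a0 b0 ac cb hb} => a2 b2 lab; split; nra.
  have [lw|lw|ww] := ltgtP (pt w).2 c.2.
  - by have /= := amx w; rewrite /below w0 eqxx lw => /(_ isT); rewrite leNgt aw.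
  - by have /= := bmn w; rewrite /above w0 eqxx lw => /(_ isT); rewrite leNgt wb.
  - by apply: (notL w); apply: pair_ext; rewrite ?c1.
have o2 : open_seg (pt a) (pt b) c.
  have dab : (pt b).2 - (pt a).2 != 0 by rewrite subr_eq0 gt_eqF // (lt_trans ac cb).
  exists ((c.2 - (pt a).2) / ((pt b).2 - (pt a).2)).
    by apply: ratio_in01; rewrite ?subr_gt0 // ltrD2r.
  by apply: pair_ext; rewrite /= ?a0 ?b0 ?c1; [ring | field].
by case: (pl_cr pl euv eab oc o2) => -[e1 e2]; [move: u0; rewrite e1 a0 ltxx | move: u0;
    rewrite e1 b0 ltxx].
Qed.

Lemma axis_setup_ex : axis_setup E (face pt E) lP rP zP oP pt.
Proof.
have M0 := radius_gt0 p; have MM := mulr_gt0 M0 M0.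
split => //=; try by [rewrite oppr_lt0 mulr_gt0 | rewrite mulr_gt0 | rewrite ltrN2 ltr_pM2r // ltr_nat].
- by apply: (sat_triangulation (@pts_inj R V e p) pl sat outer_tri_pos outer_tri_edges outer_tri_inner).
- by apply/eqP => /(congr1 val)/(congr1 snd) /=; lra.
- exact: cross_edge.
- exact: left_low_edge.
- exact: right_low_edge.
- move=> v n1 n2 n3; case: (pts_in_box v) => [[b1 b2 b3 b4]|[] h]; try by move: n1 n2 n3; rewrite h ?eqxx.
    have k2 : 0 < M * (10 * (pt v).2 + 20 * M - (pt v).1) by apply: mulr_gt0 => //; lra.
    by rewrite /det /crossp /=; lra.
  by rewrite h /det /crossp /=; lra.
- move=> v n1 n2 n3; case: (pts_in_box v) => [[b1 b2 b3 b4]|[] h]; try by move: n1 n2 n3; rewrite h ?eqxx.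
    have k2 : 0 < M * (10 * (pt v).2 + 20 * M + (pt v).1) by apply: mulr_gt0 => //; lra.
    by rewrite /det /crossp /=; lra.
  by rewrite h /det /crossp /=; lra.
Qed.
End Draw.

(** * Collinear sets are free *)

Section Redraw.
Variables (R : realType) (V : finType) (e : rel V) (p : V -> point R).
Hypothesis Gs : simple_graph e.
Hypothesis D : plane_sl_drawing e p.
Local Notation L := (pts e p).
Local Notation P := (seq_sub L).
Local Notation pt := (val : P -> point R).
Local Notation iv := (vertex_of e p).
Local Notation crosses := (crosses_axis e p).
Local Notation xpt := (crossing_pt p).

Let esym u v : e u v -> e v u. Proof. by rewrite (Gs.1 u). Qed.

Section Edges.
Variable E : rel P.
Hypothesis pl : plane_graph pt E.
Hypothesis base_sub : subrel (@base_edges R V e p) E.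

Lemma edge_pt_neq u v : e u v -> p u != p v.
Proof. by apply: contraTneq => /D.1 ->; rewrite (Gs.2 v). Qed.

Lemma direct_edge u v : e u v -> ~~ crosses u v -> ~~ crosses v u -> E (iv u) (iv v).
Proof.
move=> euv nc nc'.
have ne : iv u != iv v by apply: contraNneq (edge_pt_neq euv) => /(congr1 val) /= ->.
have nP : empty_seg (iv u) (iv v).
  by move=> w /(edge_pts Gs D euv)[[c _]|[c _]]; [rewrite c in nc | rewrite c in nc'].
have [/andP[/eqP u0 /eqP v0]|na] := boolP (on_axis_edge p u v);
    first exact: (axis_edge base_sub ne u0 v0 nP).
apply: (base_edge base_sub ne (s1 := p u) (s2 := p v)) => //; [|exact: on_seg0|exact: on_seg1].
by constructor 1; exists u, v.
Qed.

Lemma crosses_not_on_axis u v : crosses u v -> ~~ on_axis_edge p u v.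
Proof. by case/and3P=> _ h1 _; rewrite /on_axis_edge (lt_eqF h1). Qed.

Lemma half_edges u v (c : P) : crosses u v -> pt c = xpt u v -> E (iv u) c /\ E c (iv v).
Proof.
move=> cuv ec; have [ex x01] := crossing_ptE cuv; have /and3P[euv h1 h2] := cuv.
move: (- (p u).1 / ((p v).1 - (p u).1)) ex x01 => s ex /andP[s0 s1].
have b : base_seg e p (p u) (p v) by constructor 1; exists u, v; split => //; apply: crosses_not_on_axis.
have on : on_seg (p u) (p v) (pt c) by rewrite ec ex; exists s; split => //; rewrite !ltW.
have nu : iv u != c by apply/eqP => h; case: (crossing_pt_vertex D (w := u) cuv); rewrite -ec -h.
have nv : c != iv v by apply/eqP => h; case: (crossing_pt_vertex D (w := v) cuv); rewrite -ec h.
have noPc w : open_seg (p u) (p v) (pt w) -> w = c.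
  case/(edge_pts Gs D euv) => -[cc h]; first by apply: val_inj; rewrite h ec.
  by case/and3P: cc => _ h3 _; have := lt_trans h2 h3; rewrite ltxx.
have pcu : p u != pt c by apply: contraNneq nu => h; apply/eqP/val_inj.
have pcv : pt c != p v by apply: contraNneq nv => h; apply/eqP/val_inj.
split; apply: (base_edge base_sub _ b) => //; try exact: on_seg0; try exact: on_seg1.
- move=> w o; have wc : w = c.
    by apply: noPc; case: o => r r01 ->; rewrite /= ec ex; apply: open_seg_sub r01 _; exists s; rewrite ?s0.
  case: o => r /andP[_ r1]; rewrite wc -{1}(interp1 (pt (iv u)) (pt c)) => /(interp_inj pcu) h.
  by rewrite -h ltxx in r1.
move=> w o; have wc : w = c.
  apply: noPc; apply: open_seg_sym; case: (open_seg_sym o) => r r01 ->; rewrite /= ec ex;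
      apply: open_seg_sub r01 _.
  by apply: open_seg_sym; exists s; rewrite ?s0.
case: o => r /andP[r0 _]; rewrite wc -{1}(interp0 (pt c) (pt (iv v))) => /(interp_inj pcv) h.
by rewrite -h ltxx in r0.
Qed.

Definition crossing_vertex (a : P) := [exists uv : V * V, crosses uv.1 uv.2 && (pt a == xpt uv.1 uv.2)].
Definition crossing_end (s : bool) (a : P) :=
  if [pick uv : V * V | crosses uv.1 uv.2 && (pt a == xpt uv.1 uv.2)] is Some uv then iv (if s then
      uv.2 else uv.1) else a.

Lemma crossing_vertexP a : crossing_vertex a -> exists u v, [/\ crosses u v, pt a = xpt u v,
    crossing_end false a = iv u & crossing_end true a = iv v].
Proof.
case/existsP=> uv h; rewrite /crossing_end; case: pickP => [[u v] /andP[/= c /eqP ha]|/(_ uv)];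
    last by rewrite h.
by exists u, v.
Qed.

Variable q : P -> point R.
Hypothesis qI : injective q.
Hypothesis qE : plane_graph q E.
Hypothesis q_axis : forall a, (pt a).1 = 0 -> (q a).1 = 0.
Hypothesis q_cross : forall c, crossing_vertex c ->
  [/\ (q (crossing_end false c)).1 < 0, 0 < (q (crossing_end true c)).1 &
      det (q (crossing_end false c)) (q c) (q (crossing_end true c)) = 0].
Definition new_pos v := q (iv v).

(** The image of the crossing is on the axis and collinear with two ends strictly on opposite sides
    of it, hence strictly between them. *)
Lemma new_pos_cross u v (c : P) : crosses u v -> pt c = xpt u v -> open_seg (new_pos u) (new_pos v) (q c).
Proof.
move=> cuv ec; have cr : crossing_vertex c by apply/existsP; exists (u, v); rewrite /= cuv ec eqxx.
have [u' [v' [cuv' ec' e1 e2]]] := crossing_vertexP cr.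
have /and3P[euv h1 h2] := cuv; have /and3P[euv' h1' h2'] := cuv'.
have [eu ev] : u' = u /\ v' = v.
  have [ex x01] := crossing_ptE cuv; have o : on_seg (p u) (p v) (xpt u' v').
    by rewrite -ec' ec ex; exists (- (p u).1 / ((p v).1 - (p u).1)); split => //;
        case/andP: x01 => *; rewrite !ltW.
  case: (crossing_pt_same Gs D cuv' euv o) => -[a1 a2]; first by [].
  by move: h1'; rewrite a1 => h; have := lt_trans h2 h; rewrite ltxx.
have := q_cross cr; rewrite e1 e2 eu ev => -[n1 n2 dz]; rewrite -/(new_pos u) -/(new_pos v) in n1 n2 dz.
have ne : new_pos u != new_pos v by apply: contraTneq n1 => ->; rewrite -leNgt ltW.
have [s es] : exists s, q c = interp (new_pos u) (new_pos v) s.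
  by apply: det0_line => //; apply: oppr_inj; rewrite -det_swap dz oppr0.
exists s => //; have : (1 - s) * (new_pos u).1 + s * (new_pos v).1 = 0.
  by rewrite -(q_axis (a := c)) ?es // ec.
move: (new_pos u).1 (new_pos v).1 n1 n2 => a b n1 n2 h.
have e0 : s * (b - a) = - a by lra.
have ba : 0 < b - a by lra.
by apply/andP; split; [rewrite -(pmulr_lgt0 _ ba) e0 | rewrite -(ltr_pM2r ba) e0]; lra.
Qed.

Lemma new_pos_vertex u v w : e u v -> w != u -> w != v -> ~ open_seg (new_pos u) (new_pos v) (new_pos w).
Proof.
suff key u' v' w' c : crosses u' v' -> pt c = xpt u' v' ->
    open_seg (new_pos u') (new_pos v') (new_pos w') -> False.
  move=> euv wu wv o; have [c|nc] := boolP (crosses u v);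
      first exact: (key u v w (SeqSub (crossing_pts c)) c).
  have [c'|nc'] := boolP (crosses v u);
      first exact: (key v u w (SeqSub (crossing_pts c')) c' erefl (open_seg_sym o)).
  exact: (pl_pt qE (direct_edge euv nc nc') o).
move=> c0 ec [s s01 es]; have [e1 e2] := half_edges c0 ec; have [k /andP[k0 k1] ek] := new_pos_cross c0 ec.
case/andP: s01 => s0 s1.
have [l|l|l] := ltgtP s k.
- apply: (pl_pt qE e1 (w := iv w')); exists (s / k); first by rewrite divr_gt0 // ltr_pdivrMr // mul1r.
  by rewrite -/(new_pos w') es ek -/(new_pos u'); apply: pair_ext => /=; field; rewrite gt_eqF.
- apply: (pl_pt qE e2 (w := iv w')); exists ((s - k) / (1 - k)).
    by rewrite divr_gt0 ?subr_gt0 // ltr_pdivrMr ?subr_gt0 // mul1r ltrD2r.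
  by rewrite -/(new_pos w') es ek -/(new_pos v'); apply: pair_ext => /=; field; rewrite subr_eq0 gt_eqF.
have /qI h : q (iv w') = q c by rewrite -/(new_pos w') es ek l.
by case: (crossing_pt_vertex D (w := w') c0); rewrite -ec -h.
Qed.

Lemma new_pos_inj : injective new_pos.
Proof. by move=> u v /qI /(vertex_of_inj D). Qed.

Lemma new_pos_end u v w : e u v -> on_seg (new_pos u) (new_pos v) (new_pos w) -> w = u \/ w = v.
Proof.
move=> euv [s [/andP[s0 s1] es]]; have [->|wu] := eqVneq w u; first by left.
have [->|wv] := eqVneq w v; first by right.
exfalso; apply: (new_pos_vertex euv wu wv); exists s => //; rewrite !lt_neqAle s0 s1 !andbT;
    apply/andP; split.
  by apply: contraNneq wu => h; apply/eqP/new_pos_inj;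
      rewrite es -h -/(interp (new_pos u) (new_pos v) 0) interp0.
by apply: contraNneq wv => h; apply/eqP/new_pos_inj;
    rewrite es h -/(interp (new_pos u) (new_pos v) 1) interp1.
Qed.

(* A point of the redrawn edge [uv] is an end, interior to an edge of [E] lying along the old [uv],
    or the image of its crossing. *)
Lemma new_pos_cover u v z : e u v -> on_seg (new_pos u) (new_pos v) z ->
  [\/ z = new_pos u \/ z = new_pos v,
      exists a b, [/\ E a b, on_seg (p u) (p v) (pt a), on_seg (p u) (p v) (pt b) &
          open_seg (q a) (q b) z] |
      exists c, [/\ on_seg (p u) (p v) (pt c), forall w, pt c <> p w & z = q c]].
Proof.
move=> euv [s [/andP[s0 s1] ez]]; rewrite -/(interp (new_pos u) (new_pos v) s) in ez.
have [h0|n0] := eqVneq s 0; first by constructor 1; left; rewrite ez h0 interp0.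
have [h1|n1] := eqVneq s 1; first by constructor 1; right; rewrite ez h1 interp1.
have {}s0 : 0 < s by rewrite lt_neqAle eq_sym n0.
have {}s1 : s < 1 by rewrite lt_neqAle n1.
have {n0 n1} o : open_seg (new_pos u) (new_pos v) z by exists s; rewrite ?s0.
have key u' v' : crosses u' v' -> open_seg (new_pos u') (new_pos v') z ->
    (exists a b, [/\ E a b, on_seg (p u') (p v') (pt a), on_seg (p u') (p v') (pt b) &
        open_seg (q a) (q b) z]) \/
    (exists c, [/\ on_seg (p u') (p v') (pt c), forall w, pt c <> p w & z = q c]).
  move=> cc [{}s /andP[{}s0 {}s1] {}ez]; pose c : P := SeqSub (crossing_pts cc).
  have [e1 e2] := half_edges (c := c) cc erefl; have [k /andP[k0 k1] ek] := new_pos_cross (c := c) cc erefl.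
  have oc : on_seg (p u') (p v') (pt c).
    have [ex /andP[x0 x1]] := crossing_ptE cc; rewrite /= ex; exists (- (p u').1 / ((p v').1 - (p u').1)).
    by rewrite !ltW.
  have [l|l|l] := ltgtP s k.
  - left; exists (iv u'), c; split => //; first exact: on_seg0.
    exists (s / k); first by rewrite divr_gt0 // ltr_pdivrMr // mul1r.
    by rewrite ez ek -/(new_pos u'); apply: pair_ext => /=; field; rewrite gt_eqF.
  - left; exists c, (iv v'); split => //; first exact: on_seg1.
    exists ((s - k) / (1 - k)).
      by rewrite divr_gt0 ?subr_gt0 // ltr_pdivrMr ?subr_gt0 // mul1r ltrD2r.
    by rewrite ez ek -/(new_pos v'); apply: pair_ext => /=; field; rewrite subr_eq0 gt_eqF.
  right; exists c; split => //; first by move=> w; apply: (crossing_pt_vertex D cc).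
  by rewrite ez ek l.
have flip a : on_seg (p v) (p u) a -> on_seg (p u) (p v) a.
  case=> r [/andP[r0 r1] ->]; exists (1 - r); rewrite subr_ge0 r1 gerBl r0; split => //.
  by rewrite -/(interp (p v) (p u) r) interp_sym.
have [c|nc] := boolP (crosses u v); first by case: (key _ _ c o) => h; [constructor 2 | constructor 3].
have [c'|nc'] := boolP (crosses v u).
  case: (key _ _ c' (open_seg_sym o)) => [[a [b [h1 h2 h3 h4]]]|[c [h1 h2 h3]]].
    by constructor 2; exists a, b; split => //; apply: flip.
  by constructor 3; exists c; split => //; apply: flip.
constructor 2; exists (iv u), (iv v); split => //; [exact: direct_edge | exact: on_seg0 | exact: on_seg1].
Qed.

(** [new_pos_cover] traces a common point back to edges of [E] or crossing vertices on both old
    edges, where the old drawing allows only a common end. *)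
Lemma new_pos_drawing : plane_sl_drawing e new_pos.
Proof.
split; first exact: new_pos_inj.
split.
  by move=> u v w euv wu wv /(new_pos_end euv)[h|h]; [rewrite h eqxx in wu | rewrite h eqxx in wv].
move=> u v x y euv exy ne z o o'.
have vert w : z = new_pos w -> exists2 w, w \in [set u; v] :&: [set x; y] & z = new_pos w.
  move=> h; exists w => //; rewrite h in o o'.
  have h1 := new_pos_end euv o; have h2 := new_pos_end exy o'.
  by rewrite inE; apply/andP; split; apply/set2P.
have common a : on_seg (p u) (p v) a -> on_seg (p x) (p y) a -> exists2 w, w \in [set u;
    v] :&: [set x; y] & a = p w.
  exact: D.2.2 euv exy ne a.
have nocommon c : on_seg (p u) (p v) (pt c) -> on_seg (p x) (p y) (pt c) ->
    (forall w, pt c <> p w) -> False.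
  by move=> h1 h2 h3; have [w _ /h3] := common _ h1 h2.
case: (new_pos_cover euv o) => [[h|h]|[a [b [eab ha hb oab]]]|[c [hc nc zc]]]; try exact: vert h.
  case: (new_pos_cover exy o') => [[h|h]|[a' [b' [eab' ha' hb' oab']]]|[c' [hc' nc' zc']]];
      try exact: vert h.
    exfalso.
    (* Here one edge of [E] lies on both old edges; its two ends are then two common vertices, so
       the two vertex pairs coincide. *)
    have [ka kb] : on_seg (p x) (p y) (pt a) /\ on_seg (p x) (p y) (pt b).
      by case: (pl_cr qE eab eab' oab oab') => -[-> ->].
    have [w wi aw] := common _ ha ka; have [w' wi' bw] := common _ hb kb.
    have ww : w != w'.
      apply: contraTneq eab => h; rewrite (_ : a = b) ?(pl_irr qE) //; apply: val_inj.
      by rewrite /= aw bw h.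
    have two : [set u; v] :&: [set x; y] = [set u; v] /\ [set u; v] :&: [set x; y] = [set x; y].
      have c2 : (1 < #|[set u; v] :&: [set x; y]|)%N.
        by apply/card_gt1P; exists w, w'.
      split; apply/eqP; rewrite eqEcard ?subsetIl ?subsetIr /=; apply: leq_trans c2;
          rewrite cards2; by case: (_ != _).
    by case: two => h1 h2; move: ne; rewrite -h1 {1}h2 eqxx.
  by exfalso; apply: (pl_pt qE eab (w := c')); rewrite -zc'.
case: (new_pos_cover exy o') => [[h|h]|[a' [b' [eab' ha' hb' oab']]]|[c' [hc' nc' zc']]]; try exact: vert h.
  by exfalso; apply: (pl_pt qE eab' (w := c)); rewrite -zc.
exfalso; apply: (nocommon c hc _ nc); rewrite (_ : c = c') //; apply: qI.
by rewrite -zc -zc'.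
Qed.
End Edges.

Theorem axis_free (f : R -> R) : (forall a b, a < b -> f a < f b) ->
  exists p', plane_sl_drawing e p' /\ forall v, (p v).1 = 0 -> p' v = (0, f (p v).2).
Proof.
move=> fm; have [E [pl sat E0E]] := saturate (base_edges_plane Gs D).
have A := axis_setup_ex pl sat E0E.
pose t (a : P) := f (pt a).2.
have tm a b : (pt a).1 = 0 -> (pt b).1 = 0 -> (pt a).2 < (pt b).2 -> t a < t b by move=> _ _; apply: fm.
have cr0 c : crossing_vertex c -> (pt c).1 = 0 by case/crossing_vertexP=> u [v [_ -> _ _]].
have crs s c : crossing_vertex c -> E (crossing_end s c) c /\ (side_map pt s (crossing_end s c)).1 < 0.
  case/crossing_vertexP=> u [v [cuv ec e1 e2]]; have [h1 h2] := half_edges E0E cuv ec;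
      have /and3P[_ k1 k2] := cuv.
  by case: s; rewrite ?e1 ?e2 /side_map /mirror /= ?oppr_lt0; split => //; rewrite (pl_sym pl).
have crst c : crossing_vertex c ->
    slope_at (side_map pt false) (crossing_end false c) c + slope_at (side_map pt true)
    (crossing_end true c) c = 0.
  case/crossing_vertexP=> u [v [cuv ec -> ->]]; have /and3P[_ k1 k2] := cuv.
  rewrite /slope_at /projH /projY /side_map /mirror /= ec /=;
      move: (p u) (p v) k1 k2 => [a1 a2] [b1 b2] /= k1 k2.
  by clear ec; field; lra.
have [q [qI qE qa qc]] := axis_redraw A tm cr0 crs crst.
exists (new_pos q); split; last by move=> v v0; rewrite /new_pos qa.
have qa' a : (pt a).1 = 0 -> (q a).1 = 0 by move/qa ->.
by eapply new_pos_drawing; eassumption.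
Qed.
End Redraw.

(** Below the second node use the line through the first two nodes, from there on the interpolation
    of the tail. *)
Lemma increasing_interpolation (R : realType) (ys ks : seq R) : size ys = size ks ->
  sorted <%R ys -> sorted <%R ks ->
  exists f : R -> R, (forall a b, a < b -> f a < f b) /\ map f ys = ks.
Proof.
elim: ys ks => [|y ys IH] [|k ks] //=; first by exists id.
case=> sz py pk.
have [f [fm fe]] := IH ks sz (path_sorted py) (path_sorted pk).
case: ys ks sz py pk fe {IH} => [|y2 ys] [|k2 ks] //= sz.
  by move=> _ _ _; exists (fun x => x - y + k); split; [move=> a b ab; lra | rewrite subrr add0r].
move=> /andP[y12 py] /andP[k12 pk] [fe2 fe].
pose sl := (k2 - k) / (y2 - y).
have sl0 : 0 < sl by rewrite divr_gt0 // subr_gt0.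
exists (fun x => if x < y2 then k2 + (x - y2) * sl else f x); split.
  move=> a b ab; case: (ltP a y2) => ha; case: (ltP b y2) => hb.
  - by rewrite ltrD2l ltr_pM2r // ltrD2r.
  - apply: (@lt_le_trans _ _ k2); first by rewrite gtrDl pmulr_llt0 // subr_lt0.
    rewrite -fe2; move: hb; rewrite le_eqVlt => /orP[/eqP -> //|/fm/ltW//].
  - by have := lt_le_trans ab (ltW (lt_le_trans hb ha)); rewrite ltxx.
  - exact: fm.
rewrite y12 ltxx fe2; congr (_ :: _ :: _).
  by rewrite /sl -[y - y2]opprB mulNr mulrC divfK ?subr_eq0 ?gt_eqF // opprB addrCA subrr addr0.
rewrite -fe; apply/eq_in_map => x xin.
have /allP/(_ x xin) l := order_path_min lt_trans py.
by rewrite ltNge (ltW l).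
Qed.

Lemma drawing_comp (R : realType) (V : finType) (e : rel V) (p : V -> point R) (A : point R -> point R) :
  injective A -> (forall a b s, A (interp a b s) = interp (A a) (A b) s) ->
  plane_sl_drawing e p -> plane_sl_drawing e (A \o p).
Proof.
move=> AI Am [pI [h1 h2]].
have os a b z : on_seg (A a) (A b) z -> exists2 z', z = A z' & on_seg a b z'.
  case=> s [s01 ez]; exists (interp a b s); last by exists s.
  by rewrite Am ez.
split; first exact: inj_comp.
split.
  by move=> u v w euv wu wv /os[z' /AI <-]; apply: h1.
move=> u v x y euv exy ne z /os[z1 -> o1] /os[z2 /AI e12 o2].
rewrite -e12 in o2; have [w wi ->] := h2 _ _ _ _ euv exy ne z1 o1 o2.
by exists w.
Qed.

Section Straighten.
Variables (R : realType) (a b c : R).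
Hypothesis ab : a != 0 \/ b != 0.
(** A rotation and scaling given by the normal [(a, b)], followed by a translation; it takes the
    line [a x + b y = c] to the vertical axis. *)
Definition to_axis (q : point R) : point R := (a * q.1 + b * q.2 - c, a * q.2 - b * q.1).
Definition of_axis (q : point R) : point R :=
  ((a * (q.1 + c) - b * q.2) / (a ^+ 2 + b ^+ 2), (b * (q.1 + c) + a * q.2) / (a ^+ 2 + b ^+ 2)).

Let N0 : a ^+ 2 + b ^+ 2 != 0.
Proof. by rewrite gt_eqF // (@sqnorm_gt0 R (a, b)). Qed.

Lemma to_axisK : cancel to_axis of_axis.
Proof. by move=> q; apply: pair_ext; rewrite /of_axis /to_axis /=; field. Qed.
Lemma of_axisK : cancel of_axis to_axis.
Proof. by move=> q; apply: pair_ext; rewrite /of_axis /to_axis /=; field. Qed.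
Lemma to_axis_interp x y s : to_axis (interp x y s) = interp (to_axis x) (to_axis y) s.
Proof. by apply: pair_ext; rewrite /to_axis /=; ring. Qed.
Lemma of_axis_interp x y s : of_axis (interp x y s) = interp (of_axis x) (of_axis y) s.
Proof. by apply: pair_ext; rewrite /of_axis /=; ring. Qed.
End Straighten.

Theorem theorem1 (R : realType) (V : finType) (e : rel V) (S : {set V}) :
  simple_graph e -> planar R e -> collinear_set R e S ->
  free_collinear_set R e S.
Proof.
move=> Gs _ [p [D [a [b [c [ab hS]]]]]] X uX sX [a' [b' [c' [ab' hX]]]].
pose p1 := to_axis a b c \o p.
have D1 : plane_sl_drawing e p1.
  by apply: drawing_comp D; [apply: can_inj (to_axisK c ab) | apply: to_axis_interp].
have S0 s : s \in S -> (p1 s).1 = 0.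
  by move=> sS; rewrite /p1 /= hS ?subrr //; exists s.
have X0 q : q \in X -> (to_axis a' b' c' q).1 = 0 by move=> qX; rewrite /= hX ?subrr.
(* The vertices of [S] are matched with the points of [X] in increasing order along the two
   lines. *)
pose ys := sort <=%R [seq (p1 s).2 | s <- enum S].
pose ks := sort <=%R [seq (to_axis a' b' c' q).2 | q <- X].
have ltsort (s : seq R) : uniq s -> sorted <%R (sort <=%R s).
  by move=> us; rewrite lt_sorted_uniq_le sort_uniq us sort_le_sorted.
have [|||f [fm fe]] := @increasing_interpolation R ys ks.
- by rewrite !size_sort !size_map -cardE sX.
- apply: ltsort; rewrite map_inj_in_uniq ?enum_uniq // => s s'.
  by rewrite !mem_enum => sS s'S h; apply: D1.1; apply: pair_ext => //; rewrite !S0.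
- apply: ltsort; rewrite map_inj_in_uniq // => q q' qX q'X h.
  by apply: (can_inj (to_axisK c' ab')); apply: pair_ext => //; rewrite !X0.
have [p2 [D2 hp2]] := axis_free Gs D1 fm.
exists (of_axis a' b' c' \o p2); split.
  by apply: drawing_comp D2; [apply: can_inj (of_axisK c' ab') | apply: of_axis_interp].
move=> s sS; rewrite /= (hp2 _ (S0 s sS)).
have : f (p1 s).2 \in ks.
  by rewrite -fe map_f // mem_sort; apply/mapP; exists s; rewrite ?mem_enum.
rewrite mem_sort => /mapP[q qX ->].
by rewrite (_ : (0, _) = to_axis a' b' c' q) ?to_axisK //; apply: pair_ext; rewrite ?X0.
Qed.
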